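(* Let $\Gamma\subseteq \mathrm{SL}_2(\mathbb R)$ be a commensurable subgroup, and let $\widehat\Gamma$ be a maximal commensurable subgroup containing $\Gamma$. Let $k\in\frac12\mathbb Z$, and let $\nu$ be any consistent finite weight $k$ multiplier for $\Gamma$. Let $\alpha,\beta,\gamma\in\widehat\Gamma$. For $m\in I^{(\nu^\alpha,\alpha^{-1}\beta,\alpha^{-1}\gamma)}_k$ and $n\in J^{(\overline\nu^\beta,\beta^{-1}\alpha,\beta^{-1}\gamma)}_{2-k}$, let $a^{(\nu^\alpha,\alpha^{-1}\beta,\alpha^{-1}\gamma)}_k(m,n)$ be the coefficient of $q^n$ in the Fourier expansion at $\infty$ of $f^{(\nu^\alpha,\alpha^{-1}\beta,\alpha^{-1}\gamma)}_{k,m}$, and let $b^{(\overline\nu^\beta,\beta^{-1}\alpha,\beta^{-1}\gamma)}_{2-k}(n,m)$ be the coefficient of $q^m$ in the Fourier expansion at $\infty$ of $g^{(\overline\nu^\beta,\beta^{-1}\alpha,\beta^{-1}\gamma)}_{2-k,n}$. Then $$w_{\alpha\infty}\,a^{(\nu^\alpha,\alpha^{-1}\beta,\alpha^{-1}\gamma)}_k(m,n)=-\,w_{\beta\infty}\,b^{(\overline\nu^\beta,\beta^{-1}\alpha,\beta^{-1}\gamma)}_{2-k}(n,m).$$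
   Context: **Groups and multipliers.** $\mathbb H$ is the upper half-plane and $q^r=e^{2\pi i r z}$. A *commensurable subgroup* is a subgroup $\Gamma\subseteq \mathrm{SL}_2(\mathbb R)$ such that $\Gamma\cap \mathrm{SL}_2(\mathbb Z)$ has finite index in both $\Gamma$ and $\mathrm{SL}_2(\mathbb Z)$; it is contained in a maximal one $\widehat\Gamma$. The cusps of $\Gamma$ are the elements of $\Gamma\backslash(\mathbb Q\cup\{\infty\})$; each has the form $\lambda\infty$ with $\lambda\in\widehat\Gamma$, and equalities such as $\alpha\infty=\gamma\infty$ are equalities of cusps of the group under consideration. For $\gamma=\begin{pmatrix}a&b\\c&d\end{pmatrix}\in \mathrm{GL}_2^+(\mathbb R)$ put $j(\gamma,z)=\det(\gamma)^{-1/2}(cz+d)$, using the principal branch of the square root in $j^k$ when $k\in\frac12+\mathbb Z$, and $(f|_k\gamma)(z)=j(\gamma,z)^{-k}f(\gamma z)$. Let $\mathfrak G_k$ be the group of pairs $(\gamma,\phi)$, with $\gamma=\begin{pmatrix}a&b\\c&d\end{pmatrix}\in \mathrm{GL}_2^+(\mathbb R)$ and $\phi$ holomorphic on $\mathbb H$ with $|\phi(z)|=\det(\gamma)^{-k/2}|cz+d|^k$, with product $(\gamma,\phi(z))(\mu,\psi(z))=(\gamma\mu,\phi(\mu z)\psi(z))$. A *consistent weight $k$ multiplier* for $\Gamma$ is a function $\nu:\Gamma\to\mathbb C^\times$ such that $\{(\gamma,\nu(\gamma)j(\gamma,z)^k):\gamma\in\Gamma\}$ is a subgroup of $\mathfrak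 G_k$ and $\nu(\gamma)j(\gamma,z)^k=1$ for all scalar $\gamma\in\Gamma$; it is *finite* if its image is finite. Then $\overline\nu$ is a consistent weight $2-k$ multiplier. A function $f$ is modular of weight $k$ for $\Gamma$ with multiplier $\nu$ if $\nu(\gamma)^{-1}j(\gamma,z)^{-k}f(\gamma z)=f(z)$ for all $\gamma\in\Gamma$. $M^!_k(\Gamma,\nu)$, $M_k(\Gamma,\nu)$, $S_k(\Gamma,\nu)$ are the spaces of weakly holomorphic modular forms (holomorphic on $\mathbb H$, poles allowed at cusps), holomorphic modular forms, and cusp forms. For $\alpha\in\widehat\Gamma$ put $\Gamma^\alpha=\alpha^{-1}\Gamma\alpha$, and let $\nu^\alpha$ be the multiplier on $\Gamma^\alpha$ with $\nu^\alpha(\alpha^{-1}\gamma\alpha)=\nu(\gamma)$; for $f$ modular for $\Gamma$ and $\nu$, $f|_k\alpha$ is modular for $\Gamma^\alpha$ with multiplier $\nu^\alpha$. One has $(\nu^\alpha)^\beta=\nu^{\alpha\beta}$. All notation below attached to $\nu^\alpha$ refers to the group $\Gamma^\alpha$ (contained in the same $\widehat\Gamma$). The width $w_{\lambda\infty}$ of the cusp $\lambda\infty$ of $\Gamma$ ($\lambda\in\widehat\Gamma$) is the positive rational $w$ such that $\{r:\begin{pmatrix}1&r\\0&1\end{pmatrix}\in\Gamma^\lambda\text{ or }-\begin{pmatrix}1&r\\0&1\end{pmatrix}\in\Gamma^\lambda\}=w\mathbb Z$. In the identity of the theorem, $w_{\alpha\infty}$ and $w_{\beta\infty}$ are widths of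 cusps of $\Gamma$. **Exponents.** With $w$ the width of $\infty$ for $\Gamma$, let $\varsigma\in[0,1)$ be the rational number such that $f(z+w)=e^{2\pi i\varsigma}f(z)$ for every $f$ holomorphic on $\mathbb H$ and modular of weight $k$ for $\Gamma$ and $\nu$ (so $e^{2\pi i\varsigma}=\nu(T)$ if $T=\begin{pmatrix}1&w\\0&1\end{pmatrix}\in\Gamma$, and otherwise $e^{2\pi i\varsigma}=i^{2k}\nu(T)$ with $T=-\begin{pmatrix}1&w\\0&1\end{pmatrix}\in\Gamma$). Put $\mathbb Z^{(\nu)}=\{(n+\varsigma)/w:n\in\mathbb Z\}$. Then $\mathbb Z^{(\overline\nu)}=-\mathbb Z^{(\nu)}$ (with weight $2-k$ for $\overline\nu$), and for $f\in M^!_k(\Gamma,\nu)$ the function $f|_k\lambda$ has a Fourier expansion with exponents in $\mathbb Z^{(\nu^\lambda)}$. **Holomorphic bases.** Let $F^{(\nu)}_{k,m}=q^m+\cdots$ ($m\in\widetilde I^{(\nu)}_k$) and $G^{(\nu)}_{k,n}=q^n+\cdots$ ($n\in\widetilde J^{(\nu)}_k$) be the bases of $M_k(\Gamma,\nu)$ and $S_k(\Gamma,\nu)$ whose expansions at $\infty$ are in reduced echelon form, so that $\widetilde I^{(\nu)}_k$, $\widetilde J^{(\nu)}_k$ are the sets of leading exponents and, in each basis element, the coefficient of $q^\ell$ vanishes for every other index $\ell$ of that basis. For $\gamma\in\widehat\Gamma$ put $\widetilde I^{(\nu,\gamma)}_k=\widetilde I^{(\nu^\gamma)}_k$, $\widetilde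 J^{(\nu,\gamma)}_k=\widetilde J^{(\nu^\gamma)}_k$, $F^{(\nu,\gamma)}_{k,m}=F^{(\nu^\gamma)}_{k,m}|_k\gamma^{-1}$ and $G^{(\nu,\gamma)}_{k,n}=G^{(\nu^\gamma)}_{k,n}|_k\gamma^{-1}$. Define coefficients $A^{(\nu,\gamma)}_k(m,n)$ and $B^{(\nu,\gamma)}_k(n,m)$ by $$F^{(\nu,\gamma)}_{k,m}=\sum_{n\in\mathbb Z^{(\nu)}_{\ge0}}A^{(\nu,\gamma)}_k(m,n)q^n+\delta_m,\qquad G^{(\nu,\gamma)}_{k,n}=\sum_{m\in\mathbb Z^{(\nu)}_{>0}}B^{(\nu,\gamma)}_k(n,m)q^m+\delta_n,$$ where $\delta_\ell=\nu(\mu)e^{2\pi i r\ell}q^\ell$ (the leading term, set apart) if $\gamma=\pm\mu\begin{pmatrix}1&r\\0&1\end{pmatrix}$ with $\mu\in\Gamma$, $r\in\mathbb Q$, and $\delta_\ell=0$ otherwise. **Index sets.** Define $I^{(\nu)}_k,J^{(\nu)}_k$ by the disjoint unions $I^{(\nu)}_k\sqcup\widetilde J^{(\overline\nu)}_{2-k}=\mathbb Z^{(\overline\nu)}_{>0}\sqcup(-\widetilde I^{(\nu)}_k)$ and $J^{(\nu)}_k\sqcup\widetilde I^{(\overline\nu)}_{2-k}=\mathbb Z^{(\overline\nu)}_{\ge0}\sqcup(-\widetilde J^{(\nu)}_k)$. For $\alpha,\gamma\in\widehat\Gamma$: if $\alpha\infty=\gamma\infty$, put $I^{(\nu,\alpha,\gamma)}_k=I^{(\nu^\alpha)}_k$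 and $J^{(\nu,\alpha,\gamma)}_k=J^{(\nu^\alpha)}_k$; if $\alpha\infty\ne\gamma\infty$, put $I^{(\nu,\alpha,\gamma)}_k=\mathbb Z^{(\overline\nu^\alpha)}_{>0}$ and $J^{(\nu,\alpha,\gamma)}_k=\mathbb Z^{(\overline\nu^\alpha)}_{\ge0}$. **The forms $f^{(\nu,\alpha,\gamma)}_{k,m}$ and $g^{(\nu,\alpha,\gamma)}_{k,n}$** (defined for any commensurable $\Gamma\subseteq\widehat\Gamma$, multiplier $\nu$ and $\alpha,\gamma\in\widehat\Gamma$; in the theorem they are taken for the group $\Gamma^\alpha$, multiplier $\nu^\alpha$ and matrices $\alpha^{-1}\beta,\alpha^{-1}\gamma$, respectively for $\Gamma^\beta$, $\overline\nu^\beta$, weight $2-k$ and $\beta^{-1}\alpha,\beta^{-1}\gamma$). Let $\mathbb C((q))_{\widehat\Gamma,\nu}$ be the space of families $(h^\lambda)_{\lambda\in\widehat\Gamma}$ of formal series $h^\lambda=\sum_n a^\lambda(n)q^n$ with exponents in $\mathbb Z^{(\nu^\lambda)}$ bounded below, such that $a^\lambda(n)=\nu(\mu)e^{2\pi i r n}a^{\lambda'}(n)$ whenever $\lambda=\pm\mu\lambda'\begin{pmatrix}1&r\\0&1\end{pmatrix}$ with $\mu\in\Gamma$, $r\in\mathbb Q$. For $m\in-\mathbb Z^{(\nu^\alpha)}$ let $\mathbf q^{(\nu,\alpha)}_{k,m}$ be the family in this space whose $\lambda$-component is $\nu(\mu)e^{-2\pi i r m}q^{-m}$ if $\lambda=\pm\mu\alpha\begin{pmatrix}1&r\\0&1\end{pmatrix}$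 with $\mu\in\Gamma$, $r\in\mathbb Q$, and $0$ otherwise. For $m>0$ in $I^{(\nu,\alpha,\gamma)}_k$ let $\mathbf f^{(\nu,\alpha,\gamma)}_{k,m}=\mathbf q^{(\nu,\alpha)}_{k,m}-\mathcal F$, where $\mathcal F=(\mathcal F^\lambda)_\lambda$ is given by $$\mathcal F^\gamma(q)=\frac{w_{\alpha\infty}}{w_{\gamma\infty}}\sum_{n\in\widetilde J^{(\overline\nu,\gamma)}_{2-k}}B^{(\overline\nu^\alpha,\alpha^{-1}\gamma)}_{2-k}(n,m)\,q^{-n},$$ $\mathcal F^\lambda(q)=\nu(\mu)\mathcal F^\gamma(e^{2\pi i r}q)$ if $\lambda=\pm\mu\gamma\begin{pmatrix}1&r\\0&1\end{pmatrix}$ with $\mu\in\Gamma$, $r\in\mathbb Q$, and $\mathcal F^\lambda=0$ otherwise (replacing $q$ by $e^{2\pi i r}q$ means $q^\ell\mapsto e^{2\pi i r\ell}q^\ell$). For $n\ge0$ in $J^{(\nu,\alpha,\gamma)}_k$ let $\mathbf g^{(\nu,\alpha,\gamma)}_{k,n}=\mathbf q^{(\nu,\alpha)}_{k,n}-\mathcal G$, where $\mathcal G$ is defined in the same way from $$\mathcal G^\gamma(q)=\frac{w_{\alpha\infty}}{w_{\gamma\infty}}\sum_{m\in\widetilde I^{(\overline\nu,\gamma)}_{2-k}}A^{(\overline\nu^\alpha,\alpha^{-1}\gamma)}_{2-k}(m,n)\,q^{-m}.$$ For $h\in M^!_k(\Gamma,\nu)$ with $h|_k\gamma=\sum_n a^\gamma(n)q^n$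 put $$\widetilde\pi_\gamma(h)=h-\sum_{m\in\widetilde I^{(\nu,\gamma)}_k}a^\gamma(m)F^{(\nu,\gamma)}_{k,m},\qquad \widehat\pi_\gamma(h)=h-\sum_{n\in\widetilde J^{(\nu,\gamma)}_k}a^\gamma(n)G^{(\nu,\gamma)}_{k,n}.$$ For $m>0$ in $I^{(\nu,\alpha,\gamma)}_k$, $f=f^{(\nu,\alpha,\gamma)}_{k,m}$ is the unique form in $M^!_k(\Gamma,\nu)$ such that $f|_k\lambda=(\mathbf f^{(\nu,\alpha,\gamma)}_{k,m})^\lambda+O(1)$ for each $\lambda\in\widehat\Gamma$ and $\widetilde\pi_\gamma(f)=f$; if $\alpha\infty=\gamma\infty$ and $m\le0$ in $I^{(\nu,\alpha,\gamma)}_k$, then $f^{(\nu,\alpha,\gamma)}_{k,m}=F^{(\nu,\alpha)}_{k,-m}$. For $n\ge0$ in $J^{(\nu,\alpha,\gamma)}_k$, $g=g^{(\nu,\alpha,\gamma)}_{k,n}$ is the unique form in $M^!_k(\Gamma,\nu)$ such that $g|_k\lambda=(\mathbf g^{(\nu,\alpha,\gamma)}_{k,n})^\lambda+o(1)$ for each $\lambda\in\widehat\Gamma$ and $\widehat\pi_\gamma(g)=g$; if $\alpha\infty=\gamma\infty$ and $n<0$ in $J^{(\nu,\alpha,\gamma)}_k$, then $g^{(\nu,\alpha,\gamma)}_{k,n}=G^{(\nu,\alpha)}_{k,-n}$.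
   Formalization: If k is not an even integer, ν(μ) in the families and δ is replaced by the constant c with h|λ(z)=c·(h|λ')(z+r); for half-integral k, ν^α and products such as α^{-1}β are taken in the group of pairs (matrix, root of j), as the literal formulas conflict at λ and −λ. *)

(* Defs.v *)
From Stdlib Require Import Reals ZArith QArith Qreals List ClassicalEpsilon.
From Coquelicot Require Import Coquelicot.

Open Scope R_scope.

(** A weight [k] in (1/2)Z is given by the integer [K = 2k], so the dual weight
    [2 - k] is given by [4 - K].  Functions on the upper half-plane are
    functions [C -> C] of which only the values on the half-plane matter. *)

Definition upper (z : C) : Prop := 0 < Im z.

Definition Cpowz (z : C) (n : Z) : C :=
  match n with
  | Z0 => RtoC 1
  | Zpos p => Cpow z (Pos.to_nat p)
  | Zneg p => Cinv (Cpow z (Pos.to_nat p))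
  end.

(** Principal square root, with argument in (-pi/2, pi/2]. *)
Definition Csqrt (z : C) : C :=
  (sqrt ((Cmod z + Re z) / 2),
   if Rlt_dec (Im z) 0
   then - sqrt ((Cmod z - Re z) / 2)
   else sqrt ((Cmod z - Re z) / 2)).

Definition Csum (l : list C) : C := fold_right Cplus (RtoC 0) l.

(** [ee x] is exp(2 pi i x), and [qpow r z] is q^r = exp(2 pi i r z). *)
Definition ee (x : R) : C := (cos (2 * PI * x), sin (2 * PI * x)).

Definition qpow (r : R) (z : C) : C :=
  Cmult (RtoC (exp (- (2 * PI * r * Im z)))) (ee (r * Re z)).

Definition holomorphic (f : C -> C) : Prop :=
  forall z, upper z -> @ex_derive C_AbsRing C_NormedModule f z.

Record M2 : Type := mkM2 { ma : R; mb : R; mc : R; md : R }.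

Definition det2 (g : M2) : R := ma g * md g - mb g * mc g.
Definition M2one : M2 := mkM2 1 0 0 1.
Definition M2opp (g : M2) : M2 := mkM2 (- ma g) (- mb g) (- mc g) (- md g).
Definition M2mul (g h : M2) : M2 :=
  mkM2 (ma g * ma h + mb g * mc h) (ma g * mb h + mb g * md h)
       (mc g * ma h + md g * mc h) (mc g * mb h + md g * md h).
Definition M2inv (g : M2) : M2 :=
  mkM2 (md g / det2 g) (- mb g / det2 g) (- mc g / det2 g) (ma g / det2 g).
Definition Tmat (r : R) : M2 := mkM2 1 r 0 1.

Definition moebius (g : M2) (z : C) : C :=
  Cdiv (Cplus (Cmult (RtoC (ma g)) z) (RtoC (mb g)))
       (Cplus (Cmult (RtoC (mc g)) z) (RtoC (md g))).

Definition is_int (x : R) : Prop := exists n : Z, x = IZR n.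

Definition SL2Z (g : M2) : Prop :=
  det2 g = 1 /\ is_int (ma g) /\ is_int (mb g) /\ is_int (mc g) /\ is_int (md g).

Definition SL2R_subgroup (G : M2 -> Prop) : Prop :=
  (forall g, G g -> det2 g = 1) /\
  G M2one /\
  (forall g h, G g -> G h -> G (M2mul g h)) /\
  (forall g, G g -> G (M2inv g)).

Definition finite_index (H G : M2 -> Prop) : Prop :=
  exists l : list M2, forall g, G g -> exists h x, H h /\ In x l /\ g = M2mul h x.

Definition commensurable (G : M2 -> Prop) : Prop :=
  SL2R_subgroup G /\
  finite_index (fun g => G g /\ SL2Z g) G /\
  finite_index (fun g => G g /\ SL2Z g) SL2Z.

Definition maximal_commensurable (G : M2 -> Prop) : Prop :=
  commensurable G /\
  forall G', commensurable G' -> (forall g, G g -> G' g) -> forall g, G' g -> G g.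

(** [Gmul] is the product of the group of pairs.  The pairs play two roles: to
    define consistent multipliers, and, with [phi^2 = j], to define the weight
    [K/2] slash operators for all [K] at once. *)

Definition Gelt : Type := (M2 * (C -> C))%type.

Definition Gone : Gelt := (M2one, fun _ => RtoC 1).
Definition Gmul (x y : Gelt) : Gelt :=
  (M2mul (fst x) (fst y), fun z => Cmult (snd x (moebius (fst y) z)) (snd y z)).
Definition Ginv (x : Gelt) : Gelt :=
  (M2inv (fst x), fun z => Cinv (snd x (moebius (M2inv (fst x)) z))).

Definition jfac (g : M2) (z : C) : C :=
  Cmult (RtoC (/ sqrt (det2 g))) (Cplus (Cmult (RtoC (mc g)) z) (RtoC (md g))).

(** j(gamma, z)^k with the principal branch of j^(1/2). *)
Definition jpow (K : Z) (g : M2) (z : C) : C := Cpowz (Csqrt (jfac g z)) K.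

Definition in_Gk (K : Z) (x : Gelt) : Prop :=
  0 < det2 (fst x) /\ holomorphic (snd x) /\
  forall z, upper z ->
    Cmod (snd x z) =
      Rpower (det2 (fst x)) (- (IZR K / 2) / 2) *
      Rpower (Cmod (Cplus (Cmult (RtoC (mc (fst x))) z) (RtoC (md (fst x)))))
             (IZR K / 2).

Definition Gk_subgroup (K : Z) (P : Gelt -> Prop) : Prop :=
  (forall x, P x -> in_Gk K x) /\
  P Gone /\
  (forall x y, P x -> P y -> P (Gmul x y)) /\
  (forall x, P x -> P (Ginv x)).

Definition consistent_multiplier (G : M2 -> Prop) (K : Z) (nu : M2 -> C) : Prop :=
  (forall g, G g -> nu g <> RtoC 0) /\
  Gk_subgroup K (fun x =>
    G (fst x) /\
    forall z, upper z -> snd x z = Cmult (nu (fst x)) (jpow K (fst x) z)) /\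
  (forall g, G g -> mb g = 0 -> mc g = 0 -> ma g = md g ->
     forall z, upper z -> Cmult (nu g) (jpow K g z) = RtoC 1).

Definition finite_multiplier (G : M2 -> Prop) (nu : M2 -> C) : Prop :=
  exists l : list C, forall g, G g -> In (nu g) l.

Definition cbar (nu : M2 -> C) : M2 -> C := fun g => Cconj (nu g).

(** [lift a] is the matrix [a] with the principal branch of j(a,z)^(1/2), so
    [slash K f (lift a)] is f|_k a = j(a,z)^(-k) f(az).  For integral weight
    [slash K f x] only depends on the matrix of [x].  For half-integral weight
    f|_k a|_k b and f|_k ab may differ by a sign; products and inverses such as
    a^-1 b are therefore taken with [Gmul] and [Ginv], for which [slash] is an
    action. *)
Definition lift (a : M2) : Gelt := (a, fun z => Csqrt (jfac a z)).

Definition slash (K : Z) (f : C -> C) (x : Gelt) : C -> C :=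
  fun z => Cmult (Cinv (Cpowz (snd x z) K)) (f (moebius (fst x) z)).

Definition conj_group (G : M2 -> Prop) (x : Gelt) : M2 -> Prop :=
  fun d => G (M2mul (M2mul (fst x) d) (M2inv (fst x))).

(** nu^alpha is the multiplier of f|_k alpha for f modular with multiplier nu,
    that is, the one obtained by conjugation in the group of pairs.  With
    gamma = alpha delta alpha^-1,
      nu^alpha(delta) = nu(gamma) j(gamma,alpha z)^k j(alpha,z)^k
                          / (j(alpha,delta z)^k j(delta,z)^k),
    which is independent of z; it is evaluated at z = i.  The quotient is 1 for
    integral k, and a sign coming from the branches for half-integral k. *)
Definition conj_mult (K : Z) (nu : M2 -> C) (x : Gelt) : M2 -> C :=
  fun d =>
    let g := M2mul (M2mul (fst x) d) (M2inv (fst x)) in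
    Cdiv (Cmult (nu g)
                (Cmult (jpow K g (moebius (fst x) Ci)) (Cpowz (snd x Ci) K)))
         (Cmult (Cpowz (snd x (moebius d Ci)) K) (jpow K d Ci)).

(** mu(alpha oo) = gamma oo in P^1(R) for some mu in the group. *)
Definition same_cusp (G : M2 -> Prop) (x y : Gelt) : Prop :=
  exists mu, G mu /\
    ma (M2mul mu (fst x)) * mc (fst y) = ma (fst y) * mc (M2mul mu (fst x)).

(** Width of the cusp oo; the width of [x oo] is [width (conj_group G x)]. *)
Definition width (G : M2 -> Prop) : R :=
  epsilon (inhabits 0) (fun w =>
    0 < w /\
    forall r, (G (Tmat r) \/ G (M2opp (Tmat r))) <-> exists n : Z, r = IZR n * w).

Definition sigma (G : M2 -> Prop) (K : Z) (nu : M2 -> C) : R :=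
  epsilon (inhabits 0) (fun s =>
    0 <= s < 1 /\
    (G (Tmat (width G)) -> ee s = nu (Tmat (width G))) /\
    (~ G (Tmat (width G)) ->
       ee s = Cmult (Cpowz Ci K) (nu (M2opp (Tmat (width G)))))).

Definition expo (G : M2 -> Prop) (K : Z) (nu : M2 -> C) (n : Z) : R :=
  (IZR n + sigma G K nu) / width G.

Definition exponent (G : M2 -> Prop) (K : Z) (nu : M2 -> C) (x : R) : Prop :=
  exists n : Z, x = expo G K nu n.

(** A formal series sum_x a(x) q^x is the function [a : R -> C]; the
    expansion of [f] at oo has exponents in [exponent G K nu], bounded below. *)
Definition has_expansion (G : M2 -> Prop) (K : Z) (nu : M2 -> C)
    (f : C -> C) (a : R -> C) : Prop :=
  exists n0 : Z,
    (forall x, a x <> RtoC 0 -> exists n : Z, (n0 <= n)%Z /\ x = expo G K nu n) /\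
    forall z, upper z ->
      @is_series C_AbsRing C_NormedModule
        (fun i : nat =>
           let x := expo G K nu (n0 + Z.of_nat i) in Cmult (a x) (qpow x z))
        (f z).

Definition coef (G : M2 -> Prop) (K : Z) (nu : M2 -> C) (f : C -> C) : R -> C :=
  epsilon (inhabits (fun _ => RtoC 0)) (has_expansion G K nu f).

(** Coefficients of f|_k x, with respect to the conjugate group and multiplier. *)
Definition coef_at (G : M2 -> Prop) (K : Z) (nu : M2 -> C) (x : Gelt)
    (f : C -> C) : R -> C :=
  coef (conj_group G x) K (conj_mult K nu x) (slash K f x).

(** [Gh] is the maximal group: the cusps of [G] are the l oo with [l] in [Gh]. *)

Definition modular (G : M2 -> Prop) (K : Z) (nu : M2 -> C) (f : C -> C) : Prop :=
  forall g z, G g -> upper z ->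
    Cmult (Cmult (Cinv (nu g)) (Cinv (jpow K g z))) (f (moebius g z)) = f z.

Definition weakly_holomorphic_form (Gh G : M2 -> Prop) (K : Z) (nu : M2 -> C)
    (f : C -> C) : Prop :=
  holomorphic f /\ modular G K nu f /\
  forall l, Gh l -> exists a,
    has_expansion (conj_group G (lift l)) K (conj_mult K nu (lift l))
                  (slash K f (lift l)) a.

Definition holomorphic_form (Gh G : M2 -> Prop) (K : Z) (nu : M2 -> C)
    (f : C -> C) : Prop :=
  weakly_holomorphic_form Gh G K nu f /\
  forall l, Gh l -> forall x, x < 0 -> coef_at G K nu (lift l) f x = RtoC 0.

Definition cusp_form (Gh G : M2 -> Prop) (K : Z) (nu : M2 -> C)
    (f : C -> C) : Prop :=
  weakly_holomorphic_form Gh G K nu f /\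
  forall l, Gh l -> forall x, x <= 0 -> coef_at G K nu (lift l) f x = RtoC 0.

Record echelon : Type := mkEchelon { idx : list R; form : R -> C -> C }.

Definition lin_comb (l : list R) (c : R -> C) (F : R -> C -> C) : C -> C :=
  fun z => Csum (map (fun m => Cmult (c m) (F m z)) l).

Definition reduced_echelon_basis (V : (C -> C) -> Prop)
    (G : M2 -> Prop) (K : Z) (nu : M2 -> C) (B : echelon) : Prop :=
  NoDup (idx B) /\
  (forall m, In m (idx B) ->
     V (form B m) /\
     coef G K nu (form B m) m = RtoC 1 /\
     (forall x, x < m -> coef G K nu (form B m) x = RtoC 0) /\
     (forall l, In l (idx B) -> l <> m -> coef G K nu (form B m) l = RtoC 0)) /\
  (forall h, V h ->
     exists c, forall z, upper z -> h z = lin_comb (idx B) c (form B) z) /\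
  (forall c, (forall z, upper z -> lin_comb (idx B) c (form B) z = RtoC 0) ->
     forall m, In m (idx B) -> c m = RtoC 0).

(** [Fb E G K nu] and [Gb E G K nu] are the bases of M_k(G, nu) and S_k(G, nu). *)
Record bases : Type := mkBases
  { Fb : (M2 -> Prop) -> Z -> (M2 -> C) -> echelon;
    Gb : (M2 -> Prop) -> Z -> (M2 -> C) -> echelon }.

Definition echelon_bases (Gh : M2 -> Prop) (E : bases) : Prop :=
  forall G K nu,
    commensurable G -> (forall g, G g -> Gh g) ->
    consistent_multiplier G K nu -> finite_multiplier G nu ->
    reduced_echelon_basis (holomorphic_form Gh G K nu) G K nu (Fb E G K nu) /\
    reduced_echelon_basis (cusp_form Gh G K nu) G K nu (Gb E G K nu).

Section Forms.

Context (E : bases).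

(** Ĩ^(nu,g)_k, J̃^(nu,g)_k, F^(nu,g)_{k,m}, G^(nu,g)_{k,n}. *)
Definition tI (G : M2 -> Prop) (K : Z) (nu : M2 -> C) (g : Gelt) : list R :=
  idx (Fb E (conj_group G g) K (conj_mult K nu g)).
Definition tJ (G : M2 -> Prop) (K : Z) (nu : M2 -> C) (g : Gelt) : list R :=
  idx (Gb E (conj_group G g) K (conj_mult K nu g)).
Definition Fform (G : M2 -> Prop) (K : Z) (nu : M2 -> C) (g : Gelt) (m : R) :=
  slash K (form (Fb E (conj_group G g) K (conj_mult K nu g)) m) (Ginv g).
Definition Gform (G : M2 -> Prop) (K : Z) (nu : M2 -> C) (g : Gelt) (n : R) :=
  slash K (form (Gb E (conj_group G g) K (conj_mult K nu g)) n) (Ginv g).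

Definition mono (l : R) : R -> C :=
  fun x => if Req_EM_T x l then RtoC 1 else RtoC 0.

(** lambda = ± mu alpha T^r with mu in the group, and [c] is the constant for
    which h|_k lambda (z) = c (h|_k alpha)(z + r) for all modular h, i.e.
      c = nu(mu) j(mu, alpha(z+r))^k j(alpha, z+r)^k / j(lambda, z)^k.
    It equals nu(mu) up to the root of unity caused by the sign ± (when k is
    not an even integer) and by the branches (when k is half-integral). *)
Definition cusp_factor (G : M2 -> Prop) (K : Z) (nu : M2 -> C)
    (lam al : Gelt) (r : R) (c : C) : Prop :=
  exists mu, G mu /\
    (fst lam = M2mul (M2mul mu (fst al)) (Tmat r) \/
     fst lam = M2opp (M2mul (M2mul mu (fst al)) (Tmat r))) /\
    forall z, upper z ->
      let z' := Cplus z (RtoC r) in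
      Cmult c (Cpowz (snd lam z) K) =
      Cmult (Cmult (nu mu) (jpow K mu (moebius (fst al) z'))) (Cpowz (snd al z') K).

(** The family with alpha-component [s]: its lambda-component is
    c s(e^{2 pi i r} q) if lambda = ± mu alpha T^r with r rational, and 0 if
    there is no such expression.  The value does not depend on the
    expression when the exponents of [s] are exponents for alpha. *)
Definition cusp_family (G : M2 -> Prop) (K : Z) (nu : M2 -> C)
    (al : Gelt) (s : R -> C) (lam : Gelt) : R -> C :=
  fun x => epsilon (inhabits (RtoC 0)) (fun v =>
    (exists (r : Q) (c : C), cusp_factor G K nu lam al (Q2R r) c /\
       v = Cmult (Cmult c (ee (Q2R r * x))) (s x)) \/
    ((forall (r : Q) (c : C), ~ cusp_factor G K nu lam al (Q2R r) c) /\
       v = RtoC 0)).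

Definition qfam (G : M2 -> Prop) (K : Z) (nu : M2 -> C) (al : Gelt) (m : R) :=
  cusp_family G K nu al (mono (- m)).

(** delta_l for the matrix [g]: c e^{2 pi i r l} q^l if g = ± mu T^r. *)
Definition delta (G : M2 -> Prop) (K : Z) (nu : M2 -> C) (g : Gelt) (l : R) :=
  cusp_family G K nu Gone (mono l) g.

(** A^(nu,g)_k(m,n) and B^(nu,g)_k(n,m). *)
Definition Acoef (G : M2 -> Prop) (K : Z) (nu : M2 -> C) (g : Gelt) (m n : R) : C :=
  Cminus (coef G K nu (Fform G K nu g m) n) (delta G K nu g m n).
Definition Bcoef (G : M2 -> Prop) (K : Z) (nu : M2 -> C) (g : Gelt) (n m : R) : C :=
  Cminus (coef G K nu (Gform G K nu g n) m) (delta G K nu g n m).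

Definition Iset (G : M2 -> Prop) (K : Z) (nu : M2 -> C) (x : R) : Prop :=
  ((exponent G (4 - K) (cbar nu) x /\ 0 < x) \/ In (- x) (idx (Fb E G K nu))) /\
  ~ In x (idx (Gb E G (4 - K) (cbar nu))).

Definition Jset (G : M2 -> Prop) (K : Z) (nu : M2 -> C) (x : R) : Prop :=
  ((exponent G (4 - K) (cbar nu) x /\ 0 <= x) \/ In (- x) (idx (Gb E G K nu))) /\
  ~ In x (idx (Fb E G (4 - K) (cbar nu))).

Definition Iset3 (G : M2 -> Prop) (K : Z) (nu : M2 -> C) (al ga : Gelt) (x : R) :=
  (same_cusp G al ga -> Iset (conj_group G al) K (conj_mult K nu al) x) /\
  (~ same_cusp G al ga ->
     exponent (conj_group G al) (4 - K) (conj_mult (4 - K) (cbar nu) al) x /\ 0 < x).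

Definition Jset3 (G : M2 -> Prop) (K : Z) (nu : M2 -> C) (al ga : Gelt) (x : R) :=
  (same_cusp G al ga -> Jset (conj_group G al) K (conj_mult K nu al) x) /\
  (~ same_cusp G al ga ->
     exponent (conj_group G al) (4 - K) (conj_mult (4 - K) (cbar nu) al) x /\ 0 <= x).

Definition width_ratio (G : M2 -> Prop) (al ga : Gelt) : C :=
  RtoC (width (conj_group G al) / width (conj_group G ga)).

Definition calF (G : M2 -> Prop) (K : Z) (nu : M2 -> C) (al ga : Gelt) (m : R) :=
  cusp_family G K nu ga (fun x =>
    Cmult (width_ratio G al ga)
      (Csum (map (fun n =>
         Cmult (Bcoef (conj_group G al) (4 - K) (conj_mult (4 - K) (cbar nu) al)
                      (Gmul (Ginv al) ga) n m)
               (mono (- n) x))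
         (tJ G (4 - K) (cbar nu) ga)))).

Definition calG (G : M2 -> Prop) (K : Z) (nu : M2 -> C) (al ga : Gelt) (n : R) :=
  cusp_family G K nu ga (fun x =>
    Cmult (width_ratio G al ga)
      (Csum (map (fun m =>
         Cmult (Acoef (conj_group G al) (4 - K) (conj_mult (4 - K) (cbar nu) al)
                      (Gmul (Ginv al) ga) m n)
               (mono (- m) x))
         (tI G (4 - K) (cbar nu) ga)))).

Definition pi_tilde (G : M2 -> Prop) (K : Z) (nu : M2 -> C) (ga : Gelt)
    (h : C -> C) : C -> C :=
  fun z => Cminus (h z)
    (lin_comb (tI G K nu ga) (coef_at G K nu ga h) (Fform G K nu ga) z).

Definition pi_hat (G : M2 -> Prop) (K : Z) (nu : M2 -> C) (ga : Gelt)
    (h : C -> C) : C -> C :=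
  fun z => Cminus (h z)
    (lin_comb (tJ G K nu ga) (coef_at G K nu ga h) (Gform G K nu ga) z).

(** [is_f Gh G K nu al ga m f]: [f] is the form f^(nu,al,ga)_{k,m}, for [m] in
    [Iset3 G K nu al ga]; the O(1) condition says that f|_k lambda and the
    prescribed family have the same coefficients at negative exponents. *)
Definition is_f (Gh G : M2 -> Prop) (K : Z) (nu : M2 -> C) (al ga : Gelt)
    (m : R) (f : C -> C) : Prop :=
  (0 < m ->
     weakly_holomorphic_form Gh G K nu f /\
     (forall l, Gh l -> forall x, x < 0 ->
        coef_at G K nu (lift l) f x =
        Cminus (qfam G K nu al m (lift l) x) (calF G K nu al ga m (lift l) x)) /\
     (forall z, upper z -> pi_tilde G K nu ga f z = f z)) /\
  (m <= 0 -> forall z, upper z -> f z = Fform G K nu al (- m) z).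

(** Likewise for g^(nu,al,ga)_{k,n}, [n] in [Jset3 G K nu al ga], with o(1). *)
Definition is_g (Gh G : M2 -> Prop) (K : Z) (nu : M2 -> C) (al ga : Gelt)
    (n : R) (g : C -> C) : Prop :=
  (0 <= n ->
     weakly_holomorphic_form Gh G K nu g /\
     (forall l, Gh l -> forall x, x <= 0 ->
        coef_at G K nu (lift l) g x =
        Cminus (qfam G K nu al n (lift l) x) (calG G K nu al ga n (lift l) x)) /\
     (forall z, upper z -> pi_hat G K nu ga g z = g z)) /\
  (n < 0 -> forall z, upper z -> g z = Gform G K nu al (- n) z).

End Forms.

(* Main.v *)
Require Import Defs.
From Stdlib Require Import Reals ZArith Lra Lia Psatz List FunctionalExtensionality PropExtensionality Classical ClassicalEpsilon Permutation.
From Stdlib Require QArith_base Qreals Znumtheory.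
From Coquelicot Require Import Coquelicot.
Open Scope R_scope.

(** The theorem is a residue theorem.  Let F = f|alpha^-1 and F' = g|beta^-1.
    These are forms for Gamma itself, of dual weights and with dual multipliers,
    so the product phi = F F' has weight 2 and trivial multiplier.  The sum over
    the cusps xi of Gamma of the width times the constant term of phi|xi vanishes
    ([residue_sum], [residue_two_cusps]).  The constant term at xi is the sum over
    x of the coefficient of F|xi at x times that of F'|xi at -x, and in every
    summand one factor is prescribed by a principal part: the first for x < 0, the
    second for x >= 0.  The monomial in the principal part of F lives at beta and
    picks the coefficient b(n,m) of g; that of F' lives at alpha and picks the
    coefficient a(m,n) of f.  The corrections in the principal parts live at gamma
    and are supported on the indices of an echelon basis there.  By the
    normalisation of the other form its coefficients at these indices vanish, so
    the corrections contribute nothing ([pairing]).  What remains is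
    w_beta b(n,m) + w_alpha a(m,n) = 0 ([residue_pairing]).

    This argument is for m > 0 and n >= 0.  If one of these fails, one of the two
    forms is a member of an echelon basis at gamma; the coefficient of the other
    one is read off the correction in its principal part, which is made of the
    coefficients of the same basis ([duality_echelon]).  If both fail, both
    coefficients vanish.

    The residue theorem is obtained without a fundamental domain.  Integrating
    expansions termwise gives a primitive of phi whose increment over a period is
    the width times the constant term ([product_primitive]).  Invariance of phi
    makes the primitive invariant up to additive constants.  Summing over cosets
    preserves this property ([transfer]) and leads to the maximal group, then to
    SL2(Z), where translations act without additive constant because S^2 and
    (S T)^3 are scalar ([SL2Z_qinv_T]).  The additive constant is also a positive
    multiple of the sum of all constant terms over the cosets of the maximal
    group, provided that this group has only one cusp.

    That a maximal commensurable group has one cusp is a theorem of Helling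
    ([maximal_transitive]).  Its elements are integer matrices up to scalars.  In
    a suitable basis their determinants are squarefree ([squarefree_basis]), and
    after another change of basis they are Atkin-Lehner matrices of a squarefree
    level N ([level_structure], [atkin_lehner_basis]).  By maximality the group is
    the full group of these, which acts transitively on the cusps.

    The branches of half-integral powers enter through pairs of a matrix and a
    square root of its factor j ([sqrt_pair]).  Two holomorphic square roots of
    one function differ by a constant sign ([square_rigid]), so that all identities
    between slash operators, multipliers and conjugates hold up to constants that
    do not depend on the point.  The same group and multiplier reached through
    different conjugations are compared by [trel]. *)

(** * Complex numbers *)

Lemma C_eq : forall x y : C, Re x = Re y -> Im x = Im y -> x = y.
Proof. intros [a b] [c d]; simpl; intros; subst; reflexivity. Qed.

Lemma Cmod_sqr : forall z : C, Cmod z * Cmod z = Re z * Re z + Im z * Im z.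
Proof.
  intros z; pose proof (Cmod2_alt z); nra.
Qed.

Lemma Cmod_sub_ge : forall x y : C, Cmod x - Cmod y <= Cmod (x - y)%C.
Proof.
  intros x y; pose proof (Cmod_triangle (x - y) y) as H.
  replace (x - y + y)%C with x in H by ring; lra.
Qed.

Lemma Csqrt_sqr : forall w : C, (Csqrt w * Csqrt w)%C = w.
Proof.
  intros [a b]. unfold Csqrt.
  pose proof (Cmod_sqr (a, b)) as H. pose proof (re_le_Cmod (a, b)) as Hr.
  pose proof (Cmod_ge_0 (a, b)).
  simpl in *. set (m := Cmod (a, b)) in *.
  assert (- m <= a <= m) by (apply Rabs_le_between; exact Hr).
  assert (Hp : sqrt ((m + a) / 2) * sqrt ((m + a) / 2) = (m + a) / 2)
    by (apply sqrt_sqrt; lra).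
  assert (Hq : sqrt ((m - a) / 2) * sqrt ((m - a) / 2) = (m - a) / 2)
    by (apply sqrt_sqrt; lra).
  assert (Hpq : sqrt ((m + a) / 2) * sqrt ((m - a) / 2) = Rabs b / 2).
  { rewrite <- sqrt_mult by lra.
    replace ((m + a) / 2 * ((m - a) / 2)) with (Rsqr (b / 2)) by (unfold Rsqr; nra).
    rewrite sqrt_Rsqr_abs. unfold Rdiv. rewrite Rabs_mult.
    rewrite (Rabs_right (/ 2)) by lra. reflexivity. }
  destruct (Rlt_dec b 0) as [Hb|Hb].
  - rewrite Rabs_left in Hpq by lra. apply C_eq; simpl; nra.
  - rewrite Rabs_right in Hpq by lra. apply C_eq; simpl; nra.
Qed.

Lemma Csqrt_nz : forall w : C, w <> RtoC 0 -> Csqrt w <> RtoC 0.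
Proof.
  intros w H E; apply H; rewrite <- (Csqrt_sqr w), E; ring.
Qed.

Lemma Csqrt_1 : Csqrt (RtoC 1) = RtoC 1.
Proof.
  unfold Csqrt. rewrite Cmod_1. simpl.
  destruct (Rlt_dec 0 0); [lra|].
  replace ((1 + 1) / 2) with 1 by lra. replace ((1 - 1) / 2) with 0 by lra.
  rewrite sqrt_1, sqrt_0. reflexivity.
Qed.

Lemma Csqrt_m1 : Csqrt (RtoC (-1)) = Ci.
Proof.
  unfold Csqrt. rewrite Cmod_R. rewrite Rabs_left by lra. simpl.
  destruct (Rlt_dec 0 0); [lra|].
  replace ((- -1 + -1) / 2) with 0 by lra. replace ((- -1 - -1) / 2) with 1 by lra.
  rewrite sqrt_1, sqrt_0. reflexivity.
Qed.

Lemma Cmod_Csqrt_sqr : forall w : C, Cmod (Csqrt w) * Cmod (Csqrt w) = Cmod w.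
Proof. intros w. rewrite <- Cmod_mult, Csqrt_sqr. reflexivity. Qed.

(** Two square roots whose radicands lie in the same open half-plane above or
    below the real axis lie in the same quadrant, so their sum cannot be short. *)
Lemma Csqrt_sum_ge : forall w w' : C,
  0 < Im w * Im w' -> Cmod (Csqrt w) <= Cmod (Csqrt w' + Csqrt w)%C.
Proof.
  intros w w' H.
  apply Rsqr_incr_0_var; [|apply Cmod_ge_0]. unfold Rsqr. rewrite !Cmod_sqr.
  assert (Hs : forall x, 0 <= sqrt x) by apply sqrt_pos.
  unfold Csqrt; simpl.
  pose proof (Hs ((Cmod w + Re w) / 2)). pose proof (Hs ((Cmod w' + Re w') / 2)).
  pose proof (Hs ((Cmod w - Re w) / 2)). pose proof (Hs ((Cmod w' - Re w') / 2)).
  destruct (Rlt_dec (Im w) 0); destruct (Rlt_dec (Im w') 0); try nra.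
Qed.

Lemma Cmult_integral : forall x y : C, (x * y)%C = RtoC 0 -> x = RtoC 0 \/ y = RtoC 0.
Proof.
  intros x y E. apply (f_equal Cmod) in E. rewrite Cmod_mult, Cmod_0 in E.
  apply Rmult_integral in E. destruct E as [E|E]; [left|right]; apply Cmod_eq_0; exact E.
Qed.

Lemma Cmult_cancel_r : forall a b m : C, m <> RtoC 0 -> (a * m)%C = (b * m)%C -> a = b.
Proof.
  intros a b m Hm E. transitivity (a * m * / m)%C; [field; exact Hm|]. rewrite E. field. exact Hm.
Qed.

(** ** Integer powers *)

Lemma Cpowz_spec : forall (z : C) (p q : nat),
  z <> RtoC 0 -> Cpowz z (Z.of_nat p - Z.of_nat q) = (Cpow z p / Cpow z q)%C.
Proof.
  intros z p q Hz.
  pose proof (Cpow_nz z p Hz) as Hp. pose proof (Cpow_nz z q Hz) as Hq.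
  destruct (Z.of_nat p - Z.of_nat q)%Z as [|r|r] eqn:E; simpl.
  - assert (p = q) by lia. subst. field. exact Hq.
  - assert (p = q + Pos.to_nat r)%nat by lia. subst. rewrite Cpow_add_r. field. exact Hq.
  - assert (q = p + Pos.to_nat r)%nat by lia. subst. rewrite Cpow_add_r.
    assert (Cpow z (Pos.to_nat r) <> RtoC 0) by (apply Cpow_nz; exact Hz).
    field. split; assumption.
Qed.

Lemma Z_split_nat : forall n : Z, exists p q : nat, n = (Z.of_nat p - Z.of_nat q)%Z.
Proof. intros n. exists (Z.to_nat n), (Z.to_nat (- n)). lia. Qed.

Lemma Cpowz_nz : forall (z : C) n, z <> RtoC 0 -> Cpowz z n <> RtoC 0.
Proof.
  intros z n Hz. destruct (Z_split_nat n) as [p [q ->]]. rewrite Cpowz_spec by exact Hz.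
  unfold Cdiv. intros E. apply Cmult_integral in E. destruct E as [E|E].
  - revert E; apply Cpow_nz; exact Hz.
  - apply (C1_nz). rewrite <- (Cinv_r (Cpow z q)) by (apply Cpow_nz; exact Hz).
    rewrite E. ring.
Qed.

Lemma Cpowz_mult : forall (x y : C) n, x <> RtoC 0 -> y <> RtoC 0 ->
  Cpowz (x * y)%C n = (Cpowz x n * Cpowz y n)%C.
Proof.
  intros x y n Hx Hy. destruct (Z_split_nat n) as [p [q ->]].
  rewrite !Cpowz_spec by (assumption || (apply Cmult_neq_0; assumption)).
  rewrite !Cpow_mult_l. field. repeat split; apply Cpow_nz; assumption.
Qed.

Lemma Cpowz_add : forall (x : C) n m, x <> RtoC 0 ->
  Cpowz x (n + m) = (Cpowz x n * Cpowz x m)%C.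
Proof.
  intros x n m Hx. destruct (Z_split_nat n) as [p [q ->]]. destruct (Z_split_nat m) as [p' [q' ->]].
  replace (Z.of_nat p - Z.of_nat q + (Z.of_nat p' - Z.of_nat q'))%Z
    with (Z.of_nat (p + p') - Z.of_nat (q + q'))%Z by lia.
  rewrite !Cpowz_spec by assumption. rewrite !Cpow_add_r.
  field. split; apply Cpow_nz; assumption.
Qed.

Lemma Cpowz_1 : forall n, Cpowz (RtoC 1) n = RtoC 1.
Proof. intros [|p|p]; simpl; rewrite ?Cpow_1_l; try reflexivity; field. Qed.

Lemma Cpowz_4 : forall z : C, Cpowz z 4 = ((z * z) * (z * z))%C.
Proof.
  intros z. unfold Cpowz. change (Pos.to_nat 4) with 4%nat. simpl. ring.
Qed.

Lemma Cpowz_dual : forall (z : C) K, z <> RtoC 0 ->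
  (Cpowz z K * Cpowz z (4 - K))%C = ((z * z) * (z * z))%C.
Proof.
  intros z K Hz. rewrite <- Cpowz_add by exact Hz.
  replace (K + (4 - K))%Z with 4%Z by lia. apply Cpowz_4.
Qed.

Lemma Cpowz_sign : forall (x : C) n, x = RtoC 1 \/ x = RtoC (-1) ->
  Cpowz x n = RtoC 1 \/ Cpowz x n = RtoC (-1).
Proof.
  intros x n [->| ->].
  - left; apply Cpowz_1.
  - assert (H : forall k, (RtoC (-1) ^ k)%C = RtoC 1 \/ (RtoC (-1) ^ k)%C = RtoC (-1)).
    { induction k as [|k [IH|IH]]; [left; reflexivity| |]; rewrite Cpow_S, IH;
        [right|left]; apply C_eq; simpl; lra. }
    destruct n as [|p|p]; simpl; [left; reflexivity|apply H|].
    destruct (H (Pos.to_nat p)) as [E|E]; rewrite E; [left|right];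
      apply C_eq; simpl; field.
Qed.

(** * The half-plane *)

Lemma upper_nz : forall z c d, upper z -> (c <> 0 \/ d <> 0) ->
  (RtoC c * z + RtoC d)%C <> RtoC 0.
Proof.
  intros [x y] c d Hz Hcd E. unfold upper in Hz; simpl in Hz.
  injection E as E1 E2. assert (c = 0) by nra. subst. lra.
Qed.

Lemma upper_Ci : upper Ci.
Proof. unfold upper; simpl; lra. Qed.

Lemma upper_shift : forall z r, upper z -> upper (z + RtoC r)%C.
Proof. intros [x y] r H; unfold upper in *; simpl in *; lra. Qed.

Lemma det_cd : forall g, det2 g = 1 -> mc g <> 0 \/ md g <> 0.
Proof.
  intros g H. unfold det2 in H. destruct (Req_dec (mc g) 0); [right|left; assumption].
  intros E. rewrite H0, E in H. lra.
Qed.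

Lemma jden_nz : forall g z, det2 g = 1 -> upper z ->
  (RtoC (mc g) * z + RtoC (md g))%C <> RtoC 0.
Proof. intros; apply upper_nz; [assumption|apply det_cd; assumption]. Qed.

Lemma jfac_det1 : forall g z, det2 g = 1 ->
  jfac g z = (RtoC (mc g) * z + RtoC (md g))%C.
Proof.
  intros g z H. unfold jfac. rewrite H, sqrt_1, Rinv_1. ring.
Qed.

Lemma jfac_nz : forall g z, det2 g = 1 -> upper z -> jfac g z <> RtoC 0.
Proof. intros. rewrite jfac_det1 by assumption. apply jden_nz; assumption. Qed.

Lemma jfac_Im : forall g z, det2 g = 1 -> Im (jfac g z) = mc g * Im z.
Proof. intros g [x y] H. rewrite jfac_det1 by assumption. simpl. ring. Qed.

Lemma Im_div : forall a b : C, b <> RtoC 0 ->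
  Im (a / b)%C = (Im a * Re b - Re a * Im b) / (Re b * Re b + Im b * Im b).
Proof.
  intros [a1 a2] [b1 b2] H. simpl.
  assert (b1 * b1 + b2 * b2 <> 0).
  { intros E. apply H. assert (b1 = 0) by nra. assert (b2 = 0) by nra. subst; reflexivity. }
  simpl. field. intros E; apply H0; nra.
Qed.

Lemma moebius_upper : forall g z, det2 g = 1 -> upper z -> upper (moebius g z).
Proof.
  intros g z H Hz. unfold upper, moebius.
  pose proof (jden_nz g z H Hz) as Hn.
  rewrite Im_div by exact Hn. destruct z as [x y]. unfold upper in Hz. simpl in *.
  unfold det2 in H.
  assert (Hp : 0 < (mc g * x - 0 * y + md g) * (mc g * x - 0 * y + md g) +
                   (mc g * y + 0 * x + 0) * (mc g * y + 0 * x + 0)).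
  { assert (Hs : forall u v : R, u <> 0 \/ v <> 0 -> 0 < u * u + v * v).
    { intros u v [Hu|Hv]; [pose proof (Rsqr_pos_lt u Hu)|pose proof (Rsqr_pos_lt v Hv)];
        unfold Rsqr in *; nra. }
    apply Hs. destruct (Req_dec (mc g) 0) as [E|E].
    - left. rewrite E. intros E'. rewrite E in H. nra.
    - right. intros E'. apply E. nra. }
  apply Rdiv_lt_0_compat; [|exact Hp]. nra.
Qed.

Lemma moebius_mul : forall g h z, det2 g = 1 -> det2 h = 1 -> upper z ->
  moebius (M2mul g h) z = moebius g (moebius h z).
Proof.
  intros g h z Hg Hh Hz.
  pose proof (jden_nz h z Hh Hz) as H1.
  pose proof (jden_nz g (moebius h z) Hg (moebius_upper h z Hh Hz)) as H2.
  unfold moebius in *. simpl.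
  set (D := (RtoC (mc h) * z + RtoC (md h))%C) in *.
  set (Nu := (RtoC (ma h) * z + RtoC (mb h))%C) in *.
  assert (H3 : (RtoC (mc g) * Nu + RtoC (md g) * D)%C <> RtoC 0).
  { intros E. apply H2. replace (RtoC (mc g) * (Nu / D) + RtoC (md g))%C
      with ((RtoC (mc g) * Nu + RtoC (md g) * D) / D)%C by (field; exact H1).
    rewrite E. field. exact H1. }
  rewrite !RtoC_plus, !RtoC_mult.
  replace ((RtoC (ma g) * RtoC (ma h) + RtoC (mb g) * RtoC (mc h)) * z +
    (RtoC (ma g) * RtoC (mb h) + RtoC (mb g) * RtoC (md h)))%C
    with (RtoC (ma g) * Nu + RtoC (mb g) * D)%C by (unfold Nu, D; ring).
  replace ((RtoC (mc g) * RtoC (ma h) + RtoC (md g) * RtoC (mc h)) * z +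
    (RtoC (mc g) * RtoC (mb h) + RtoC (md g) * RtoC (md h)))%C
    with (RtoC (mc g) * Nu + RtoC (md g) * D)%C by (unfold Nu, D; ring).
  field. split; [exact H1|]. exact H3.
Qed.

Lemma det_mul : forall g h, det2 (M2mul g h) = det2 g * det2 h.
Proof. intros; unfold det2, M2mul; simpl; ring. Qed.

Lemma det_mul1 : forall g h, det2 g = 1 -> det2 h = 1 -> det2 (M2mul g h) = 1.
Proof. intros; rewrite det_mul; nra. Qed.

Lemma jfac_mul : forall g h z, det2 g = 1 -> det2 h = 1 -> upper z ->
  jfac (M2mul g h) z = (jfac g (moebius h z) * jfac h z)%C.
Proof.
  intros g h z Hg Hh Hz.
  rewrite !jfac_det1 by (assumption || apply det_mul1; assumption).
  pose proof (jden_nz h z Hh Hz) as H1. unfold moebius. simpl.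
  rewrite !RtoC_plus, !RtoC_mult. field. exact H1.
Qed.

(** * Complex derivatives *)

Definition near (P : C -> Prop) : Prop :=
  exists d, 0 < d /\ forall h, Cmod h < d -> P h.

Lemma near_and : forall P Q, near P -> near Q -> near (fun h => P h /\ Q h).
Proof.
  intros P Q [d [Hd HP]] [e [He HQ]]. exists (Rmin d e). split.
  - apply Rmin_pos; assumption.
  - intros h Hh. split; [apply HP|apply HQ]; eapply Rlt_le_trans; try exact Hh;
      [apply Rmin_l|apply Rmin_r].
Qed.

Lemma near_mono : forall (P Q : C -> Prop), (forall h, P h -> Q h) -> near P -> near Q.
Proof. intros P Q H [d [Hd HP]]. exists d; auto. Qed.

Lemma near_all : forall (P : C -> Prop), (forall h, P h) -> near P.
Proof. intros P H. exists 1; split; [lra|auto]. Qed.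

Definition tends (u : C -> C) (l : C) : Prop :=
  forall eps, 0 < eps -> near (fun h => Cmod (u h - l) < eps).

Lemma tends_const : forall l, tends (fun _ => l) l.
Proof.
  intros l eps He. apply near_all. intros _. replace (l - l)%C with (RtoC 0) by ring.
  rewrite Cmod_0. exact He.
Qed.

Lemma tends_id : tends (fun h => h) (RtoC 0).
Proof.
  intros eps He. exists eps. split; [exact He|]. intros h Hh.
  replace (h - 0)%C with h by ring. exact Hh.
Qed.

Lemma tends_plus : forall u v a b, tends u a -> tends v b ->
  tends (fun h => u h + v h)%C (a + b)%C.
Proof.
  intros u v a b Hu Hv eps He.
  eapply near_mono; [|apply near_and; [apply (Hu (eps / 2))|apply (Hv (eps / 2))]; lra].
  intros h [H1 H2]. replace (u h + v h - (a + b))%C with ((u h - a) + (v h - b))%C by ring.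
  pose proof (Cmod_triangle (u h - a) (v h - b)). simpl in *. lra.
Qed.

Lemma tends_mult : forall u v a b, tends u a -> tends v b ->
  tends (fun h => u h * v h)%C (a * b)%C.
Proof.
  intros u v a b Hu Hv eps He.
  pose proof (Cmod_ge_0 a) as Ha. pose proof (Cmod_ge_0 b) as Hb.
  set (M := 1 + Cmod a + Cmod b).
  set (e := Rmin 1 (eps / (2 * M))).
  assert (HM : 0 < M) by (unfold M; lra).
  assert (He' : 0 < eps / (2 * M)) by (apply Rdiv_lt_0_compat; lra).
  assert (Hee : 0 < e) by (unfold e; apply Rmin_pos; lra).
  eapply near_mono; [|apply near_and; [apply (Hu e)|apply (Hv e)]; exact Hee].
  intros h [H1 H2].
  replace (u h * v h - a * b)%C
    with ((u h - a) * (v h - b) + ((u h - a) * b + a * (v h - b)))%C by ring.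
  pose proof (Cmod_triangle ((u h - a) * (v h - b)) ((u h - a) * b + a * (v h - b))) as T1.
  pose proof (Cmod_triangle ((u h - a) * b) (a * (v h - b))) as T2.
  rewrite !Cmod_mult in *.
  pose proof (Cmod_ge_0 (u h - a)). pose proof (Cmod_ge_0 (v h - b)).
  assert (e <= 1) by apply Rmin_l. assert (e <= eps / (2 * M)) by apply Rmin_r.
  assert (e * (2 * M) <= eps).
  { replace eps with (eps / (2 * M) * (2 * M)) by (field; lra).
    apply Rmult_le_compat_r; lra. }
  set (p := Cmod (u h - a)) in *. set (q := Cmod (v h - b)) in *.
  assert (p * q <= e * 1) by (apply Rmult_le_compat; lra).
  assert (p * Cmod b <= e * Cmod b) by (apply Rmult_le_compat_r; lra).
  assert (Cmod a * q <= Cmod a * e) by (apply Rmult_le_compat_l; lra).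
  assert (e * M = e + e * Cmod b + Cmod a * e) by (unfold M; ring).
  nra.
Qed.

Lemma tends_comp : forall u k l, tends u l -> tends k (RtoC 0) ->
  tends (fun h => u (k h)) l.
Proof.
  intros u k l Hu Hk eps He. destruct (Hu eps He) as [d [Hd H]].
  eapply near_mono; [|apply (Hk d Hd)]. intros h Hh. apply H.
  replace (k h) with (k h - 0)%C by ring. exact Hh.
Qed.

Lemma tends_nz : forall u l, tends u l -> l <> RtoC 0 -> near (fun h => Cmod l / 2 < Cmod (u h)).
Proof.
  intros u l Hu Hl. apply Cmod_gt_0 in Hl.
  eapply near_mono; [|apply (Hu (Cmod l / 2)); lra].
  intros h Hh. pose proof (Cmod_sub_ge l (l - u h)) as H.
  replace (l - (l - u h))%C with (u h) in H by ring.
  replace (l - u h)%C with (- (u h - l))%C in H by ring. rewrite Cmod_opp in H. lra.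
Qed.

Lemma tends_inv : forall u l, tends u l -> l <> RtoC 0 -> tends (fun h => / u h)%C (/ l)%C.
Proof.
  intros u l Hu Hl eps He. pose proof Hl as Hl'. apply Cmod_gt_0 in Hl'.
  set (m := Cmod l) in *.
  assert (He2 : 0 < eps * (m * m / 2)) by (apply Rmult_lt_0_compat; nra).
  eapply near_mono;
    [|apply near_and; [apply (tends_nz u l Hu Hl)|apply (Hu _ He2)]].
  intros h [H1 H2]. fold m in H1.
  assert (Hn : u h <> RtoC 0) by (apply Cmod_gt_0; lra).
  replace (/ u h - / l)%C with (- (u h - l) * / (u h * l))%C by (field; split; assumption).
  rewrite Cmod_mult, Cmod_opp, Cmod_inv by (apply Cmult_neq_0; assumption).
  rewrite Cmod_mult. fold m.
  apply (Rmult_lt_reg_r (Cmod (u h) * m)); [apply Rmult_lt_0_compat; lra|].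
  rewrite Rmult_assoc, Rinv_l by (apply Rgt_not_eq, Rmult_lt_0_compat; lra).
  assert (m * (m / 2) < m * Cmod (u h)) by (apply Rmult_lt_compat_l; lra). nra.
Qed.

Lemma tends_ext : forall u v l, near (fun h => u h = v h) -> tends u l -> tends v l.
Proof.
  intros u v l E H eps He. eapply near_mono; [|apply near_and; [exact E|apply (H eps He)]].
  intros h [<- Hh]. exact Hh.
Qed.

(** The quotient form of the derivative (Carathéodory): it turns the product
    and chain rules into identities between quotients. *)
Definition cderiv (f : C -> C) (z l : C) : Prop :=
  exists q, near (fun h => f (z + h)%C = (f z + h * q h)%C) /\ tends q l.

Lemma cderiv_cont : forall f z l, cderiv f z l -> tends (fun h => f (z + h)%C) (f z).
Proof.
  intros f z l [q [E H]].
  apply (tends_ext (fun h => f z + h * q h)%C).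
  - eapply near_mono; [|exact E]. intros h ->. reflexivity.
  - replace (f z) with (f z + 0 * l)%C by ring.
    apply tends_plus; [replace (f z + 0 * l)%C with (f z) by ring; apply tends_const|].
    apply tends_mult; [apply tends_id|exact H].
Qed.

Lemma cderiv_const : forall c z, cderiv (fun _ => c) z (RtoC 0).
Proof.
  intros c z. exists (fun _ => RtoC 0). split; [apply near_all; intros; ring|apply tends_const].
Qed.

Lemma cderiv_id : forall z, cderiv (fun x => x) z (RtoC 1).
Proof.
  intros z. exists (fun _ => RtoC 1). split; [apply near_all; intros; ring|apply tends_const].
Qed.

Lemma cderiv_eq : forall f z l l', cderiv f z l -> l = l' -> cderiv f z l'.
Proof. intros; subst; assumption. Qed.

Lemma cderiv_plus : forall f g z a b, cderiv f z a -> cderiv g z b ->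
  cderiv (fun x => f x + g x)%C z (a + b)%C.
Proof.
  intros f g z a b [p [E Hp]] [q [F Hq]]. exists (fun h => p h + q h)%C. split.
  - eapply near_mono; [|apply near_and; [exact E|exact F]].
    intros h [-> ->]. ring.
  - apply tends_plus; assumption.
Qed.

Lemma cderiv_mult : forall f g z a b, cderiv f z a -> cderiv g z b ->
  cderiv (fun x => f x * g x)%C z (a * g z + f z * b)%C.
Proof.
  intros f g z a b Hf Hg. pose proof (cderiv_cont g z b Hg) as Cg.
  destruct Hf as [p [E Hp]]. destruct Hg as [q [F Hq]].
  exists (fun h => p h * g (z + h) + f z * q h)%C. split.
  - eapply near_mono; [|apply near_and; [exact E|exact F]].
    intros h [-> Hh]. rewrite Hh. ring.
  - apply tends_plus; apply tends_mult; try assumption. apply tends_const.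
Qed.

Lemma cderiv_scal : forall c f z a, cderiv f z a -> cderiv (fun x => c * f x)%C z (c * a)%C.
Proof.
  intros c f z a H. eapply cderiv_eq;
    [apply (cderiv_mult (fun _ => c)); [apply cderiv_const|exact H]|]. simpl; ring.
Qed.

Lemma cderiv_comp : forall f g z a b, cderiv f (g z) a -> cderiv g z b ->
  cderiv (fun x => f (g x)) z (a * b)%C.
Proof.
  intros f g z a b [p [[d [Hd E]] Hp]] [q [F Hq]].
  assert (Hk : tends (fun h => h * q h)%C (RtoC 0)).
  { replace (RtoC 0) with (RtoC 0 * b)%C by ring. apply tends_mult; [apply tends_id|exact Hq]. }
  exists (fun h => p (h * q h) * q h)%C. split.
  - eapply near_mono; [|apply near_and; [exact F|apply (Hk d Hd)]].
    intros h [-> Hh]. replace (h * q h - 0)%C with (h * q h)%C in Hh by ring.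
    rewrite E by exact Hh. ring.
  - apply tends_mult; [|exact Hq]. apply (tends_comp p); assumption.
Qed.

Lemma cderiv_inv : forall f z a, cderiv f z a -> f z <> RtoC 0 ->
  cderiv (fun x => / f x)%C z (- a / (f z * f z))%C.
Proof.
  intros f z a Hf Hn. pose proof (cderiv_cont f z a Hf) as Cf.
  destruct Hf as [p [E Hp]].
  exists (fun h => - p h * / (f (z + h) * f z))%C. split.
  - eapply near_mono; [|apply near_and; [exact E|apply (tends_nz _ _ Cf Hn)]].
    intros h [Eh Hh]. assert (f (z + h)%C <> RtoC 0).
    { apply Cmod_gt_0. pose proof (Cmod_ge_0 (f z)). lra. }
    assert (Hd : (h * p h)%C = (f (z + h) - f z)%C) by (rewrite Eh; ring).
    replace (/ f z + h * (- p h * / (f (z + h) * f z)))%C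
      with (/ f z - (h * p h) / (f (z + h) * f z))%C by (field; split; assumption).
    rewrite Hd. field. split; assumption.
  - unfold Cdiv. apply tends_mult.
    + replace (- a)%C with (- (1) * a)%C by ring.
      apply (tends_ext (fun h => - (1) * p h)%C); [apply near_all; intros; ring|].
      apply tends_mult; [apply tends_const|exact Hp].
    + apply tends_inv; [|apply Cmult_neq_0; exact Hn].
      apply tends_mult; [exact Cf|apply tends_const].
Qed.

Lemma near_upper : forall z, upper z -> near (fun h => upper (z + h)%C).
Proof.
  intros z Hz. exists (Im z). split; [exact Hz|]. intros h Hh. unfold upper.
  assert (Rabs (Im h) <= Cmod h).
  { apply Rsqr_incr_0_var; [|apply Cmod_ge_0]. rewrite <- Rsqr_abs. unfold Rsqr.
    rewrite Cmod_sqr. nra. }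
  pose proof (Rabs_def2 (Im h) (Im z)) as [H1 H2]; [lra|].
  replace (Im (z + h)%C) with (Im z + Im h) by (destruct z, h; reflexivity). lra.
Qed.

Lemma cderiv_ext_upper : forall f g z l, upper z -> (forall x, upper x -> f x = g x) ->
  cderiv f z l -> cderiv g z l.
Proof.
  intros f g z l Hz E [q [F Hq]]. exists q. split; [|exact Hq].
  eapply near_mono; [|apply near_and; [exact F|apply (near_upper z Hz)]].
  intros h [H1 H2]. rewrite <- !E by assumption. exact H1.
Qed.

Lemma cderiv_is_derive : forall f z l,
  cderiv f z l -> @is_derive C_AbsRing C_NormedModule f z l.
Proof.
  intros f z l [q [E Hq]]. split; [apply is_linear_scal_l|].
  intros x Hx. apply (is_filter_lim_locally_unique (K := C_AbsRing) (V := AbsRing_NormedModule C_AbsRing)) in Hx. subst x.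
  intros eps. destruct (near_and _ _ E (Hq eps (cond_pos eps))) as [d [Hd H]].
  exists (mkposreal d Hd). intros y' Hy. pose (y := y' : C). change y' with y.
  change (Cmod (y - z)%C < d) in Hy. clearbody y. clear y'. destruct (H _ Hy) as [H1 H2].
  replace (z + (y - z))%C with y in H1 by ring.
  change (Cmod (f y - f z - (y - z) * l)%C <= eps * Cmod (y - z)%C).
  rewrite H1. replace (f z + (y - z) * q (y - z) - f z - (y - z) * l)%C
    with ((q (y - z) - l) * (y - z))%C by ring.
  rewrite Cmod_mult. apply Rmult_le_compat_r; [apply Cmod_ge_0|lra].
Qed.

Lemma is_derive_cderiv : forall (f : C -> C) (z l : C),
  @is_derive C_AbsRing C_NormedModule f z l -> cderiv f z l.
Proof.
  intros f z l [_ H].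
  specialize (H z (fun P HP => HP)).
  exists (fun h => if Req_EM_T (Cmod h) 0 then l else (f (z + h) - f z) / h)%C. split.
  - apply near_all. intros h. destruct (Req_EM_T (Cmod h) 0) as [E|E].
    + apply Cmod_eq_0 in E. subst. replace (z + 0)%C with z by ring. ring.
    + field. intros ->. apply E, Cmod_0.
  - intros eps He. assert (He2 : 0 < eps / 2) by lra.
    specialize (H (mkposreal _ He2)).
    destruct H as [[d Hd] H]. exists d. split; [exact Hd|]. intros h Hh.
    destruct (Req_EM_T (Cmod h) 0) as [E|E].
    + replace (l - l)%C with (RtoC 0) by ring. rewrite Cmod_0. exact He.
    + assert (Hn : h <> RtoC 0) by (intros ->; apply E, Cmod_0).
      specialize (H (z + h)%C).
      assert (B : @ball (AbsRing_UniformSpace C_AbsRing) z d (z + h)%C).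
      { change (Cmod (z + h - z)%C < d). replace (z + h - z)%C with h by ring. exact Hh. }
      specialize (H B).
      change (Cmod (f (z + h) - f z - (z + h - z) * l)%C <= eps / 2 * Cmod (z + h - z)%C) in H.
      replace (z + h - z)%C with h in H by ring.
      replace ((f (z + h) - f z) / h - l)%C
        with ((f (z + h) - f z - h * l) * / h)%C by (field; exact Hn).
      rewrite Cmod_mult, Cmod_inv by exact Hn.
      assert (0 < Cmod h) by (apply Cmod_gt_0; exact Hn).
      apply (Rmult_lt_reg_r (Cmod h)); [assumption|].
      rewrite Rmult_assoc, Rinv_l by lra. nra.
Qed.

Lemma holomorphic_iff : forall f,
  holomorphic f <-> forall z, upper z -> exists l, cderiv f z l.
Proof.
  intros f. split; intros H z Hz; destruct (H z Hz) as [l Hl]; exists l.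
  - apply is_derive_cderiv; exact Hl.
  - apply cderiv_is_derive; exact Hl.
Qed.

(** ** Vanishing derivative on the half-plane *)

Lemma Rabs_Im_le : forall z : C, Rabs (Im z) <= Cmod z.
Proof.
  intros z. apply Rsqr_incr_0_var; [|apply Cmod_ge_0]. rewrite <- Rsqr_abs. unfold Rsqr.
  rewrite Cmod_sqr. nra.
Qed.

(** Along a segment both coordinates have real derivative zero. *)
Lemma cderiv_line : forall (part : C -> R) f z v,
  (forall x y : C, part (x - y)%C = part x - part y) ->
  (forall x, Rabs (part x) <= Cmod x) ->
  forall t : R, cderiv f (z + RtoC t * v)%C (RtoC 0) ->
  is_derive (fun s : R => part (f (z + RtoC s * v)%C)) t 0.
Proof.
  intros part f z v Hm Hb t [q [E Hq]].
  apply is_derive_Reals. intros eps He.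
  pose proof (Cmod_ge_0 v) as Hv.
  assert (He' : 0 < eps / (1 + Cmod v)) by (apply Rdiv_lt_0_compat; lra).
  destruct (near_and _ _ E (Hq _ He')) as [d [Hd H]].
  assert (Hd' : 0 < d / (1 + Cmod v)) by (apply Rdiv_lt_0_compat; lra).
  exists (mkposreal _ Hd'). intros h Hh Hhd. simpl in Hhd.
  assert (Hs : Cmod (RtoC h * v)%C < d).
  { rewrite Cmod_mult, Cmod_R.
    apply (Rmult_lt_compat_r (1 + Cmod v)) in Hhd; [|lra].
    unfold Rdiv in Hhd. rewrite Rmult_assoc, Rinv_l, Rmult_1_r in Hhd by lra.
    pose proof (Rabs_pos h). nra. }
  destruct (H _ Hs) as [H1 H2].
  replace (z + RtoC (t + h) * v)%C with (z + RtoC t * v + RtoC h * v)%C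
    by (rewrite RtoC_plus; ring).
  rewrite H1. rewrite <- Hm.
  set (w := (f (z + RtoC t * v) + RtoC h * v * q (RtoC h * v) - f (z + RtoC t * v))%C).
  assert (Hw : Rabs (part w) <= Rabs h * (Cmod v * (eps / (1 + Cmod v)))).
  { eapply Rle_trans; [apply Hb|]. unfold w.
    replace (f (z + RtoC t * v) + RtoC h * v * q (RtoC h * v) - f (z + RtoC t * v))%C
      with (RtoC h * (v * (q (RtoC h * v) - 0)))%C by ring.
    rewrite !Cmod_mult, Cmod_R. apply Rmult_le_compat_l; [apply Rabs_pos|].
    apply Rmult_le_compat_l; lra. }
  rewrite Rminus_0_r. unfold Rdiv. rewrite Rabs_mult, Rabs_inv.
  pose proof (Rabs_pos_lt h Hh) as Hp.
  apply (Rmult_lt_reg_r (Rabs h)); [exact Hp|].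
  rewrite Rmult_assoc, Rinv_l by lra. rewrite Rmult_1_r.
  eapply Rle_lt_trans; [exact Hw|]. rewrite Rmult_comm. apply Rmult_lt_compat_r; [exact Hp|].
  apply (Rmult_lt_reg_r (1 + Cmod v)); [lra|].
  replace (Cmod v * (eps / (1 + Cmod v)) * (1 + Cmod v)) with (Cmod v * eps) by (field; lra).
  nra.
Qed.

Lemma cderiv_zero_const : forall F, (forall z, upper z -> cderiv F z (RtoC 0)) ->
  forall z w, upper z -> upper w -> F z = F w.
Proof.
  intros F H z w Hz Hw.
  assert (Hl : forall t, 0 <= t <= 1 -> upper (z + RtoC t * (w - z))%C).
  { intros t Ht. unfold upper in *. destruct z as [a b], w as [c d]. simpl in *. nra. }
  assert (G : forall part : C -> R, (forall x y : C, part (x - y)%C = part x - part y) ->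
    (forall x, Rabs (part x) <= Cmod x) -> part (F z) = part (F w)).
  { intros part H1 H2.
    pose proof (eq_is_derive (fun s : R => part (F (z + RtoC s * (w - z))%C)) 0 1) as G.
    cbv beta in G.
    replace (z + RtoC 0 * (w - z))%C with z in G by ring.
    replace (z + RtoC 1 * (w - z))%C with w in G by ring.
    apply G; [|lra]. intros t Ht. apply cderiv_line; auto. }
  apply C_eq; apply G.
  - intros [a b] [c d]; reflexivity.
  - apply re_le_Cmod.
  - intros [a b] [c d]; reflexivity.
  - apply Rabs_Im_le.
Qed.

(** ** Branches of the square root of the automorphy factor *)

Lemma cderiv_affine : forall a b z, cderiv (fun x => RtoC a * x + RtoC b)%C z (RtoC a).
Proof.
  intros a b z. eapply cderiv_eq;
    [apply cderiv_plus; [apply cderiv_scal, cderiv_id|apply cderiv_const]|]. ring.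
Qed.

Lemma cderiv_moebius : forall g z, det2 g = 1 -> upper z ->
  cderiv (moebius g) z (/ (jfac g z * jfac g z))%C.
Proof.
  intros g z Hg Hz. pose proof (jden_nz g z Hg Hz) as Hn.
  unfold moebius, Cdiv. eapply cderiv_eq.
  - apply cderiv_mult; [apply cderiv_affine|].
    apply cderiv_inv; [apply cderiv_affine|exact Hn].
  - rewrite jfac_det1 by exact Hg.
    assert (E : (RtoC (ma g) * RtoC (md g) - RtoC (mb g) * RtoC (mc g))%C = RtoC 1).
    { rewrite <- !RtoC_mult, <- RtoC_minus. f_equal. exact Hg. }
    replace (/ ((RtoC (mc g) * z + RtoC (md g)) * (RtoC (mc g) * z + RtoC (md g))))%C
      with ((RtoC (ma g) * RtoC (md g) - RtoC (mb g) * RtoC (mc g)) /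
        ((RtoC (mc g) * z + RtoC (md g)) * (RtoC (mc g) * z + RtoC (md g))))%C
      by (rewrite E; field; exact Hn).
    field. exact Hn.
Qed.

(** The principal branch is holomorphic along [jfac g], whose values stay in
    one open half-plane unless they are constant. *)
Lemma cderiv_sqrt_jfac : forall g z, det2 g = 1 -> upper z ->
  cderiv (fun x => Csqrt (jfac g x)) z (RtoC (mc g) / (2 * Csqrt (jfac g z)))%C.
Proof.
  intros g z Hg Hz.
  pose proof (Csqrt_nz _ (jfac_nz g z Hg Hz)) as Hs.
  assert (H2 : RtoC 2 <> RtoC 0) by (intros E; apply RtoC_inj in E; lra).
  destruct (Req_dec (mc g) 0) as [E|E].
  - apply (cderiv_ext_upper (fun _ => Csqrt (jfac g z))); [exact Hz| |].
    + intros x Hx. rewrite !jfac_det1 by exact Hg. rewrite E. f_equal. ring.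
    + eapply cderiv_eq; [apply cderiv_const|]. rewrite E. field. exact Hs.
  - set (s := fun x => Csqrt (jfac g x)).
    exists (fun h => RtoC (mc g) / (s (z + h) + s z))%C.
    assert (Hge : near (fun h => Cmod (s z) <= Cmod (s (z + h) + s z)%C)).
    { eapply near_mono; [|apply (near_upper z Hz)]. intros h Hh. apply Csqrt_sum_ge.
      rewrite !jfac_Im by exact Hg. unfold upper in *.
      pose proof (Rsqr_pos_lt _ E). unfold Rsqr in *.
      replace (mc g * Im z * (mc g * Im (z + h)))
        with (mc g * mc g * (Im z * Im (z + h)%C)) by ring.
      apply Rmult_lt_0_compat; [assumption|apply Rmult_lt_0_compat; assumption]. }
    assert (Hsz : 0 < Cmod (s z)) by (apply Cmod_gt_0; exact Hs).
    assert (Heq : near (fun h => s (z + h)%C = (s z + h * (RtoC (mc g) / (s (z + h) + s z)))%C)).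
    { eapply near_mono; [|exact Hge]. intros h Hh.
      assert (Hn : (s (z + h) + s z)%C <> RtoC 0) by (apply Cmod_gt_0; simpl in *; lra).
      assert (Hd : (h * RtoC (mc g))%C = (s (z + h) * s (z + h) - s z * s z)%C).
      { unfold s. rewrite !Csqrt_sqr, !jfac_det1 by exact Hg. ring. }
      replace (h * (RtoC (mc g) / (s (z + h) + s z)))%C
        with (h * RtoC (mc g) / (s (z + h) + s z))%C by (field; exact Hn).
      rewrite Hd. field. exact Hn. }
    split; [exact Heq|].
    assert (Hc : tends (fun h => s (z + h)%C) (s z)).
    { intros eps He.
      set (m := 1 + Rabs (mc g)). assert (Hm : 0 < m) by (unfold m; pose proof (Rabs_pos (mc g)); lra).
      eapply near_mono; [|apply near_and; [apply near_and; [exact Hge|exact Heq]|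
        apply (tends_id (eps * Cmod (s z) / m))]].
      2: { apply Rdiv_lt_0_compat; [apply Rmult_lt_0_compat; assumption|exact Hm]. }
      intros h [[G1 G2] G3]. replace (h - 0)%C with h in G3 by ring.
      assert (Hn : (s (z + h) + s z)%C <> RtoC 0) by (apply Cmod_gt_0; simpl in *; lra).
      rewrite G2 at 1.
      replace (s z + h * (RtoC (mc g) / (s (z + h) + s z)) - s z)%C
        with (h * RtoC (mc g) * / (s (z + h) + s z))%C by (field; exact Hn).
      rewrite !Cmod_mult, Cmod_inv, Cmod_R by exact Hn.
      apply (Rmult_lt_reg_r (Cmod (s (z + h) + s z)%C)); [simpl in *; lra|].
      rewrite Rmult_assoc, Rinv_l, Rmult_1_r by (simpl in *; lra).
      apply (Rmult_lt_compat_r m) in G3; [|exact Hm].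
      unfold Rdiv in G3. rewrite (Rmult_assoc (eps * _)), Rinv_l, Rmult_1_r in G3 by lra.
      pose proof (Cmod_ge_0 h).
      assert (Cmod h * Rabs (mc g) <= Cmod h * m) by (apply Rmult_le_compat_l; unfold m; lra).
      assert (eps * Cmod (s z) <= eps * Cmod (s (z + h) + s z)%C)
        by (apply Rmult_le_compat_l; simpl in *; lra).
      simpl in *; lra. }
    unfold Cdiv. apply tends_mult; [apply tends_const|].
    change (Csqrt (jfac g z)) with (s z).
    replace (2 * s z)%C with (s z + s z)%C by ring.
    apply tends_inv.
    + apply tends_plus; [exact Hc|apply tends_const].
    + replace (s z + s z)%C with (2 * s z)%C by ring. apply Cmult_neq_0; assumption.
Qed.

(** The quotient has a constant square, so its derivative vanishes. *)
Lemma square_rigid : forall (p q : C -> C) (k : C),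
  (forall z, upper z -> exists l, cderiv p z l) ->
  (forall z, upper z -> exists l, cderiv q z l) ->
  (forall z, upper z -> q z <> RtoC 0) -> k <> RtoC 0 ->
  (forall z, upper z -> (p z * p z)%C = (k * (q z * q z))%C) ->
  exists c, (c * c)%C = k /\ forall z, upper z -> p z = (c * q z)%C.
Proof.
  intros p q k Hp Hq Hn Hk E.
  set (u := fun z => (p z * / q z)%C).
  assert (Hu2 : forall z, upper z -> (u z * u z)%C = k).
  { intros z Hz. unfold u. replace (p z * / q z * (p z * / q z))%C
      with ((p z * p z) / (q z * q z))%C by (field; auto). rewrite E by exact Hz. field. auto. }
  assert (Hu : forall z, upper z -> cderiv u z (RtoC 0)).
  { intros z Hz. destruct (Hp z Hz) as [a Ha]. destruct (Hq z Hz) as [b Hb].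
    assert (D : exists l, cderiv u z l).
    { eexists. apply cderiv_mult; [exact Ha|]. apply cderiv_inv; [exact Hb|auto]. }
    destruct D as [l Hl].
    assert (D2 : cderiv (fun x => u x * u x)%C z (l * u z + u z * l)%C)
      by (apply cderiv_mult; exact Hl).
    assert (D3 : cderiv (fun _ => k) z (l * u z + u z * l)%C)
      by (eapply cderiv_ext_upper; [exact Hz| |exact D2]; intros; apply Hu2; assumption).
    pose proof (is_C_derive_unique _ _ _ (cderiv_is_derive _ _ _ D3)) as U1.
    pose proof (is_C_derive_unique _ _ _ (cderiv_is_derive _ _ _ (cderiv_const k z))) as U2.
    assert (U : (2 * (u z * l))%C = RtoC 0) by (transitivity (l * u z + u z * l)%C; [ring|]; congruence).
    assert (Huz : u z <> RtoC 0).
    { intros Ez. apply Hk. rewrite <- (Hu2 z Hz), Ez. ring. }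
    apply Cmult_integral in U. destruct U as [U|U]; [apply RtoC_inj in U; lra|].
    apply Cmult_integral in U. destruct U as [U|U]; [contradiction|]. subst l. exact Hl. }
  exists (u Ci). split; [apply Hu2, upper_Ci|].
  intros z Hz. rewrite <- (cderiv_zero_const u Hu z Ci Hz upper_Ci).
  unfold u. field. auto.
Qed.

Lemma Csqr_1 : forall c : C, (c * c)%C = RtoC 1 -> c = RtoC 1 \/ c = RtoC (-1).
Proof.
  intros c H. assert (E : ((c - 1) * (c + 1))%C = RtoC 0).
  { replace ((c - 1) * (c + 1))%C with (c * c - 1)%C by ring. rewrite H. ring. }
  apply Cmult_integral in E. destruct E as [E|E]; [left|right].
  - replace c with (c - 1 + 1)%C by ring. rewrite E. ring.
  - replace c with (c + 1 - 1)%C by ring. rewrite E. apply C_eq; simpl; lra.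
Qed.

(** The two sides have equal squares, hence a constant quotient: the branch cut
    of the square root causes no jump along the half-plane. *)
Lemma sqrt_cocycle : forall g h, det2 g = 1 -> det2 h = 1 ->
  exists e, (e = RtoC 1 \/ e = RtoC (-1)) /\ forall z, upper z ->
    Csqrt (jfac (M2mul g h) z) =
    (e * (Csqrt (jfac g (moebius h z)) * Csqrt (jfac h z)))%C.
Proof.
  intros g h Hg Hh.
  destruct (square_rigid (fun z => Csqrt (jfac (M2mul g h) z))
    (fun z => Csqrt (jfac g (moebius h z)) * Csqrt (jfac h z))%C (RtoC 1)) as [c [Hc H]].
  - intros z Hz. eexists. apply cderiv_sqrt_jfac; [apply det_mul1; assumption|exact Hz].
  - intros z Hz. eexists. apply cderiv_mult; [|apply cderiv_sqrt_jfac; assumption].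
    apply (cderiv_comp (fun x => Csqrt (jfac g x)) (moebius h)).
    + apply cderiv_sqrt_jfac; [exact Hg|apply moebius_upper; assumption].
    + apply cderiv_moebius; assumption.
  - intros z Hz. apply Cmult_neq_0; apply Csqrt_nz, jfac_nz; try assumption.
    apply moebius_upper; assumption.
  - exact C1_nz.
  - intros z Hz. rewrite Csqrt_sqr, jfac_mul by assumption.
    rewrite <- (Csqrt_sqr (jfac g (moebius h z))) at 1.
    rewrite <- (Csqrt_sqr (jfac h z)) at 1. ring.
  - exists c. split; [apply Csqr_1; exact Hc|exact H].
Qed.

Lemma det_opp : forall g, det2 (M2opp g) = det2 g.
Proof. intros; unfold det2, M2opp; simpl; ring. Qed.

Lemma jfac_opp : forall g z, det2 g = 1 -> jfac (M2opp g) z = (- jfac g z)%C.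
Proof.
  intros g z H. rewrite !jfac_det1 by (rewrite ?det_opp; exact H). simpl.
  rewrite !RtoC_opp. ring.
Qed.

Lemma sqrt_opp : forall g, det2 g = 1 ->
  exists e, e <> RtoC 0 /\ forall z, upper z ->
    Csqrt (jfac (M2opp g) z) = (e * Csqrt (jfac g z))%C.
Proof.
  intros g Hg.
  assert (Hm : RtoC (-1) <> RtoC 0) by (intros E; apply RtoC_inj in E; lra).
  destruct (square_rigid (fun z => Csqrt (jfac (M2opp g) z))
    (fun z => Csqrt (jfac g z)) (RtoC (-1))) as [c [Hc H]].
  - intros z Hz. eexists. apply cderiv_sqrt_jfac; [rewrite det_opp; exact Hg|exact Hz].
  - intros z Hz. eexists. apply cderiv_sqrt_jfac; assumption.
  - intros z Hz. apply Csqrt_nz, jfac_nz; assumption.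
  - exact Hm.
  - intros z Hz. rewrite !Csqrt_sqr, jfac_opp by exact Hg.
    replace (RtoC (-1)) with (- (1))%C by (apply C_eq; simpl; lra). ring.
  - exists c. split; [|exact H]. intros E. apply Hm. rewrite <- Hc, E. ring.
Qed.

(** * The exponential functions q^r *)

Definition cexp (x : C) : C := (exp (Re x) * cos (Im x), exp (Re x) * sin (Im x)).

Lemma cexp_add : forall x y, cexp (x + y)%C = (cexp x * cexp y)%C.
Proof.
  intros [a b] [c d]. unfold cexp. simpl. rewrite exp_plus, cos_plus, sin_plus.
  apply C_eq; simpl; ring.
Qed.

Lemma cexp_0 : cexp (RtoC 0) = RtoC 1.
Proof. unfold cexp; simpl. rewrite exp_0, cos_0, sin_0. apply C_eq; simpl; ring. Qed.

Lemma Cmod_cexp : forall x, Cmod (cexp x) = exp (Re x).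
Proof.
  intros [a b]. unfold cexp. simpl. pose proof (exp_pos a).
  apply Rsqr_inj; [apply Cmod_ge_0|lra|]. unfold Rsqr. rewrite Cmod_sqr. simpl.
  pose proof (sin2_cos2 b) as H1. unfold Rsqr in H1.
  replace (exp a * cos b * (exp a * cos b) + exp a * sin b * (exp a * sin b))
    with (exp a * exp a * (sin b * sin b + cos b * cos b)) by ring.
  rewrite H1. ring.
Qed.

Lemma real_quot : forall f l, derivable_pt_lim f 0 l -> forall eps, 0 < eps ->
  exists d, 0 < d /\ forall t, Rabs t < d -> Rabs (f t - f 0 - l * t) <= eps * Rabs t.
Proof.
  intros f l H eps He. destruct (H eps He) as [d Hd]. exists d. split; [apply cond_pos|].
  intros t Ht. destruct (Req_dec t 0) as [->|Hn].
  - rewrite Rmult_0_r. replace (f 0 - f 0 - 0) with 0 by ring. rewrite Rabs_R0. lra.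
  - specialize (Hd t Hn Ht). rewrite Rplus_0_l in Hd.
    replace (f t - f 0 - l * t) with (((f t - f 0) / t - l) * t) by (field; exact Hn).
    rewrite Rabs_mult. apply Rmult_le_compat_r; [apply Rabs_pos|lra].
Qed.

Lemma cexp_small : forall eps, 0 < eps ->
  near (fun h => Cmod (cexp h - 1 - h)%C <= eps * Cmod h).
Proof.
  intros eps He. set (e := Rmin 1 (eps / 9)).
  assert (He0 : 0 < e) by (apply Rmin_pos; lra).
  assert (He1 : e <= 1) by apply Rmin_l. assert (He2 : e <= eps / 9) by apply Rmin_r.
  clearbody e.
  destruct (real_quot exp _ (derivable_pt_lim_exp 0) e He0) as [d1 [Hd1 H1]].
  destruct (real_quot sin _ (derivable_pt_lim_sin 0) e He0) as [d2 [Hd2 H2]].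
  destruct (real_quot cos _ (derivable_pt_lim_cos 0) e He0) as [d3 [Hd3 H3]].
  rewrite exp_0 in H1. rewrite sin_0, cos_0 in H2. rewrite sin_0, cos_0 in H3.
  exists (Rmin (Rmin d1 e) (Rmin d2 d3)). split; [repeat apply Rmin_pos; assumption|].
  intros [a b] Hh.
  pose proof (re_le_Cmod (a, b)) as Ha. pose proof (Rabs_Im_le (a, b)) as Hb. simpl in Ha, Hb.
  set (m := Cmod (a, b)) in *.
  assert (m < d1 /\ m < e /\ m < d2 /\ m < d3) as [M1 [M2 [M3 M4]]].
  { repeat split; eapply Rlt_le_trans; try exact Hh.
    - eapply Rle_trans; [apply Rmin_l|apply Rmin_l].
    - eapply Rle_trans; [apply Rmin_l|apply Rmin_r].
    - eapply Rle_trans; [apply Rmin_r|apply Rmin_l].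
    - eapply Rle_trans; [apply Rmin_r|apply Rmin_r]. }
  specialize (H1 a ltac:(lra)). specialize (H2 b ltac:(lra)). specialize (H3 b ltac:(lra)).
  assert (Hsum : forall x y, Cmod (x, y) <= Rabs x + Rabs y).
  { intros x y. pose proof (Cmod_triangle (RtoC x) (RtoC y * Ci)) as T.
    rewrite Cmod_mult, Cmod_Ci, !Cmod_R in T.
    replace (RtoC x + RtoC y * Ci)%C with (x, y) in T by (apply C_eq; simpl; ring). lra. }
  replace (cexp (a, b) - 1 - (a, b))%C
    with (exp a * cos b - 1 - a, exp a * sin b - b) by (apply C_eq; simpl; ring).
  eapply Rle_trans; [apply Hsum|].
  pose proof (Rabs_pos a) as Pa. pose proof (Rabs_pos b) as Pb.
  set (x := exp a - 1 - 1 * a) in *. set (y := sin b - 0 - 1 * b) in *.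
  set (t := cos b - 1 - - 0 * b) in *.
  assert (E1 : exp a * cos b - 1 - a = x + x * t + (1 + a) * t) by (unfold x, t; ring).
  assert (E2 : exp a * sin b - b = (x + 1 + a) * y + (x + a) * b) by (unfold x, y; ring).
  rewrite E1, E2.
  assert (Bx : Rabs x <= e * m) by nra. assert (By : Rabs y <= e * m) by nra.
  assert (Bt : Rabs t <= e * m) by nra.
  assert (Hm0 : 0 <= m) by apply Cmod_ge_0.
  pose proof (Rabs_pos x). pose proof (Rabs_pos y). pose proof (Rabs_pos t).
  assert (A1 : Rabs (x + x * t + (1 + a) * t) <= Rabs x + Rabs x * Rabs t + (1 + Rabs a) * Rabs t).
  { eapply Rle_trans; [apply Rabs_triang|]. rewrite (Rabs_mult (1 + a)).
    pose proof (Rabs_triang x (x * t)) as T1. rewrite Rabs_mult in T1.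
    pose proof (Rabs_triang 1 a) as T2. rewrite Rabs_R1 in T2. nra. }
  assert (A2 : Rabs ((x + 1 + a) * y + (x + a) * b)
     <= (Rabs x + 1 + Rabs a) * Rabs y + (Rabs x + Rabs a) * Rabs b).
  { eapply Rle_trans; [apply Rabs_triang|]. rewrite !Rabs_mult.
    pose proof (Rabs_triang (x + 1) a) as T1. pose proof (Rabs_triang x 1) as T2.
    rewrite Rabs_R1 in T2. pose proof (Rabs_triang x a) as T3. nra. }
  assert (Hme : e * m <= m) by nra.
  assert (Rabs x * Rabs t <= e * m) by (assert (Rabs t <= 1) by nra; nra).
  assert ((1 + Rabs a) * Rabs t <= 2 * (e * m)) by nra.
  assert ((Rabs x + 1 + Rabs a) * Rabs y <= 3 * (e * m)) by nra.
  assert (Rabs x * Rabs b <= e * m) by nra.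
  assert (Rabs a * Rabs b <= e * m) by nra.
  assert (e * m <= eps / 9 * m) by (apply Rmult_le_compat_r; lra).
  lra.
Qed.

Lemma cderiv_cexp : forall x, cderiv cexp x (cexp x).
Proof.
  intros x.
  exists (fun h => cexp x * (if Req_EM_T (Cmod h) 0 then 1 else (cexp h - 1) / h))%C. split.
  - apply near_all. intros h. rewrite cexp_add. destruct (Req_EM_T (Cmod h) 0) as [E|E].
    + apply Cmod_eq_0 in E. subst. rewrite cexp_0. ring.
    + field. intros ->. apply E, Cmod_0.
  - replace (cexp x) with (cexp x * 1)%C at 1 by ring. apply tends_mult; [apply tends_const|].
    intros eps He. eapply near_mono; [|apply (cexp_small (eps / 2)); lra].
    intros h Hh. simpl in Hh. destruct (Req_EM_T (Cmod h) 0) as [E|E].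
    + replace (1 - 1)%C with (RtoC 0) by ring. rewrite Cmod_0. exact He.
    + assert (Hn : h <> RtoC 0) by (intros ->; apply E, Cmod_0).
      assert (0 < Cmod h) by (apply Cmod_gt_0; exact Hn).
      replace ((cexp h - 1) / h - 1)%C with ((cexp h - 1 - h) * / h)%C by (field; exact Hn).
      rewrite Cmod_mult, Cmod_inv by exact Hn.
      apply (Rmult_lt_reg_r (Cmod h)); [assumption|].
      rewrite Rmult_assoc, Rinv_l by lra. nra.
Qed.

Definition c2pi : C := (0, 2 * PI).

Lemma c2pi_nz : c2pi <> RtoC 0.
Proof. intros E. injection E as E. pose proof PI_RGT_0. lra. Qed.

Lemma qpow_cexp : forall r z, qpow r z = cexp (c2pi * RtoC r * z)%C.
Proof.
  intros r [x y]. unfold qpow, cexp, ee, c2pi. simpl.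
  replace ((0 * r - 2 * PI * 0) * x - (0 * 0 + 2 * PI * r) * y) with (- (2 * PI * r * y)) by ring.
  replace ((0 * r - 2 * PI * 0) * y + (0 * 0 + 2 * PI * r) * x) with (2 * PI * (r * x)) by ring.
  apply C_eq; simpl; ring.
Qed.

Lemma ee_cexp : forall r, ee r = cexp (c2pi * RtoC r)%C.
Proof.
  intros r. unfold cexp, ee, c2pi. simpl.
  replace (0 * r - 2 * PI * 0) with 0 by ring. rewrite exp_0.
  replace (0 * 0 + 2 * PI * r) with (2 * PI * r) by ring. apply C_eq; simpl; ring.
Qed.

Lemma qpow_add : forall r s z, qpow (r + s) z = (qpow r z * qpow s z)%C.
Proof. intros. rewrite !qpow_cexp, <- cexp_add, RtoC_plus. f_equal. ring. Qed.

Lemma qpow_0 : forall z, qpow 0 z = RtoC 1.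
Proof.
  intros. rewrite qpow_cexp. replace (c2pi * RtoC 0 * z)%C with (RtoC 0) by ring. apply cexp_0.
Qed.

Lemma qpow_shift : forall r z t, qpow r (z + RtoC t)%C = (ee (r * t) * qpow r z)%C.
Proof.
  intros. rewrite qpow_cexp, qpow_cexp, ee_cexp, <- cexp_add, RtoC_mult. f_equal. ring.
Qed.

Lemma Cmod_qpow : forall r z, Cmod (qpow r z) = exp (- (2 * PI * r * Im z)).
Proof.
  intros r [x y]. rewrite qpow_cexp, Cmod_cexp. f_equal. unfold c2pi; simpl. ring.
Qed.

Lemma Cmod_pos_nz : forall x, 0 < Cmod x -> x <> RtoC 0.
Proof. intros; apply Cmod_gt_0; assumption. Qed.

Lemma qpow_nz : forall r z, qpow r z <> RtoC 0.
Proof. intros; apply Cmod_pos_nz; rewrite Cmod_qpow; apply exp_pos. Qed.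

Lemma qpow_nat : forall r i z, qpow (INR i * r) z = (qpow r z ^ i)%C.
Proof.
  intros r i z. induction i as [|i IH].
  - replace (INR 0 * r) with 0 by (simpl; ring). apply qpow_0.
  - rewrite S_INR, Cpow_S, <- IH, <- qpow_add. f_equal. ring.
Qed.

Lemma ee_add : forall r s, ee (r + s) = (ee r * ee s)%C.
Proof. intros. rewrite !ee_cexp, <- cexp_add, RtoC_plus. f_equal. ring. Qed.

Lemma ee_0 : ee 0 = RtoC 1.
Proof. rewrite ee_cexp. replace (c2pi * RtoC 0)%C with (RtoC 0) by ring. apply cexp_0. Qed.

Lemma Cmod_ee : forall r, Cmod (ee r) = 1.
Proof.
  intros r. rewrite ee_cexp, Cmod_cexp. replace (Re (c2pi * RtoC r)%C) with 0
    by (unfold c2pi; simpl; ring). apply exp_0.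
Qed.

Lemma ee_nz : forall r, ee r <> RtoC 0.
Proof. intros; apply Cmod_pos_nz; rewrite Cmod_ee; lra. Qed.

Lemma ee_opp : forall r, ee (- r) = (/ ee r)%C.
Proof.
  intros. assert (H : (ee (- r) * ee r)%C = RtoC 1) by (rewrite <- ee_add; replace (- r + r) with 0 by ring; apply ee_0).
  rewrite <- (Cmult_1_l (/ ee r)%C), <- H. field. apply ee_nz.
Qed.

Lemma ee_nat : forall n : nat, ee (INR n) = RtoC 1.
Proof.
  intros n. unfold ee. replace (2 * PI * INR n) with (0 + 2 * INR n * PI) by ring.
  rewrite cos_period, sin_period, cos_0, sin_0. reflexivity.
Qed.

Lemma ee_Z : forall n : Z, ee (IZR n) = RtoC 1.
Proof.
  intros n. destruct (Z_le_gt_dec 0 n) as [H|H].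
  - rewrite <- (Z2Nat.id n) by exact H. rewrite <- INR_IZR_INZ. apply ee_nat.
  - replace (IZR n) with (- INR (Z.to_nat (- n))).
    + rewrite ee_opp, ee_nat. field.
    + rewrite INR_IZR_INZ, Z2Nat.id, opp_IZR by lia. ring.
Qed.

Lemma cderiv_qpow : forall r z, cderiv (qpow r) z (c2pi * RtoC r * qpow r z)%C.
Proof.
  intros r z.
  assert (H : cderiv (fun x => cexp (c2pi * RtoC r * x)%C) z
    (cexp (c2pi * RtoC r * z) * (c2pi * RtoC r * 1))%C).
  { apply (cderiv_comp cexp (fun x => c2pi * RtoC r * x)%C); [apply cderiv_cexp|].
    apply cderiv_scal, cderiv_id. }
  destruct H as [q [E Hq]]. exists q. split.
  - eapply near_mono; [|exact E]. intros h Hh. rewrite !qpow_cexp. exact Hh.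
  - rewrite qpow_cexp. replace (c2pi * RtoC r * cexp (c2pi * RtoC r * z))%C
      with (cexp (c2pi * RtoC r * z) * (c2pi * RtoC r * 1))%C by ring. exact Hq.
Qed.

(** * Complex series *)

Notation CS := (@is_series C_AbsRing C_NormedModule).

Lemma sum_n_Re : forall (a : nat -> C) n,
  Re (@sum_n C_AbelianGroup a n) = sum_n (fun i => Re (a i)) n.
Proof.
  intros a n. induction n as [|n IH]; [rewrite !sum_O; reflexivity|].
  rewrite !sum_Sn, <- IH. reflexivity.
Qed.

Lemma sum_n_Im : forall (a : nat -> C) n,
  Im (@sum_n C_AbelianGroup a n) = sum_n (fun i => Im (a i)) n.
Proof.
  intros a n. induction n as [|n IH]; [rewrite !sum_O; reflexivity|].
  rewrite !sum_Sn, <- IH. reflexivity.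
Qed.

Lemma CS_iff : forall (a : nat -> C) (l : C),
  CS a l <-> is_series (fun i => Re (a i)) (Re l) /\ is_series (fun i => Im (a i)) (Im l).
Proof.
  intros a l. split.
  - intros H. split; intros P [e HP].
    + assert (L : locally (T := C_UniformSpace) l (fun x => P (Re x))).
      { exists e. intros y Hy. apply HP, Hy. }
      destruct (H _ L) as [N HN]. exists N. intros n Hn. rewrite <- sum_n_Re. apply HN, Hn.
    + assert (L : locally (T := C_UniformSpace) l (fun x => P (Im x))).
      { exists e. intros y Hy. apply HP, Hy. }
      destruct (H _ L) as [N HN]. exists N. intros n Hn. rewrite <- sum_n_Im. apply HN, Hn.
  - intros [H1 H2] P [e HP].
    destruct (H1 (fun x => ball (Re l) e x)) as [N1 HN1]; [exists e; auto|].
    destruct (H2 (fun x => ball (Im l) e x)) as [N2 HN2]; [exists e; auto|].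
    exists (max N1 N2). intros n Hn. apply HP. split.
    + specialize (HN1 n ltac:(lia)). rewrite <- sum_n_Re in HN1. exact HN1.
    + specialize (HN2 n ltac:(lia)). rewrite <- sum_n_Im in HN2. exact HN2.
Qed.

Lemma CS_ext : forall (a b : nat -> C) (l : C), (forall i, a i = b i) -> CS a l -> CS b l.
Proof. intros a b l E H. exact (is_series_ext a b l E H). Qed.

Lemma CS_plus : forall (a b : nat -> C) (l m : C), CS a l -> CS b m -> CS (fun i => a i + b i)%C (l + m)%C.
Proof. intros a b l m H H'. exact (is_series_plus a b l m H H'). Qed.

Lemma CS_scal : forall (c : C) (a : nat -> C) (l : C), CS a l -> CS (fun i => c * a i)%C (c * l)%C.
Proof. intros c a l H. exact (is_series_scal c a l H). Qed.

Lemma CS_incr : forall (a : nat -> C) (l : C), CS (fun i => a (S i)) l -> CS a (a 0%nat + l)%C.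
Proof.
  intros a l H. apply is_series_decr_1.
  match goal with |- CS _ ?x => assert (E : x = l) end.
  { change ((a 0%nat + l + - a 0%nat)%C = l). ring. }
  rewrite E. exact H.
Qed.

Lemma CS_decr : forall (a : nat -> C) (l : C), CS a (a 0%nat + l)%C -> CS (fun i => a (S i)) l.
Proof.
  intros a l H. apply is_series_incr_1.
  match goal with |- CS _ ?x => assert (E : x = (a 0%nat + l)%C) end.
  { change ((l + a 0%nat)%C = (a 0%nat + l)%C). ring. }
  rewrite E. exact H.
Qed.

(** Rotate the sum onto the positive axis and compare real parts. *)
Lemma CS_norm_le : forall (a : nat -> C) (b : nat -> R) (l : C) (s : R),
  CS a l -> is_series b s -> (forall i, Cmod (a i) <= b i) -> Cmod l <= s.
Proof.
  intros a b l s Ha Hb H.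
  assert (Hs : 0 <= s).
  { apply (is_lim_seq_le (fun _ => 0) (sum_n b) (Finite 0) (Finite s));
      [|apply is_lim_seq_const|exact Hb].
    intros n. assert (B : forall i, 0 <= b i)
      by (intros i; eapply Rle_trans; [apply Cmod_ge_0|apply H]).
    induction n as [|n IH]; [rewrite sum_O; apply B|].
    rewrite sum_Sn. specialize (B (S n)). change (0 <= sum_n b n + b (S n)). lra. }
  destruct (Req_dec (Cmod l) 0) as [E|E]; [rewrite E; exact Hs|].
  assert (Hl : 0 < Cmod l) by (pose proof (Cmod_ge_0 l); lra).
  set (c := (Cconj l * RtoC (/ Cmod l))%C).
  assert (Hc : Cmod c = 1).
  { unfold c. rewrite Cmod_mult, Cmod_conj, Cmod_R, Rabs_right by (left; apply Rinv_0_lt_compat; exact Hl).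
    field. exact E. }
  assert (Hcl : Re (c * l)%C = Cmod l).
  { unfold c. replace (Cconj l * RtoC (/ Cmod l) * l)%C
      with (RtoC (/ Cmod l) * (l * Cconj l))%C by ring.
    rewrite <- Cmod2_conj. rewrite <- RtoC_mult.
    change (Re (RtoC (/ Cmod l * Cmod l ^ 2))) with (/ Cmod l * Cmod l ^ 2). field. exact E. }
  rewrite <- Hcl.
  pose proof (CS_scal c a l Ha) as Hca. apply CS_iff in Hca. destruct Hca as [Hr _].
  apply (is_lim_seq_le (sum_n (fun i => Re (c * a i)%C)) (sum_n b)
    (Finite (Re (c * l)%C)) (Finite s)); [|exact Hr|exact Hb].
  intros n. apply sum_n_m_le. intros k. eapply Rle_trans; [|apply H].
  eapply Rle_trans; [apply Rle_abs|]. eapply Rle_trans; [apply re_le_Cmod|].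
  rewrite Cmod_mult, Hc. lra.
Qed.

Lemma CS_abs : forall (a : nat -> C), ex_series (fun i => Cmod (a i)) -> exists l, CS a l.
Proof.
  intros a H.
  assert (Hr : ex_series (fun i => Re (a i))).
  { apply (ex_series_le (K := R_AbsRing) (V := R_CompleteNormedModule) _ (fun i => Cmod (a i)));
      [|exact H]. intros n. apply re_le_Cmod. }
  assert (Hi : ex_series (fun i => Im (a i))).
  { apply (ex_series_le (K := R_AbsRing) (V := R_CompleteNormedModule) _ (fun i => Cmod (a i)));
      [|exact H]. intros n. apply Rabs_Im_le. }
  destruct Hr as [x Hx]. destruct Hi as [y Hy]. exists (x, y). apply CS_iff. split; assumption.
Qed.

Definition CSeries (a : nat -> C) : C :=
  (Series (fun i => Re (a i)), Series (fun i => Im (a i))).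

Lemma CS_CSeries : forall (a : nat -> C) (l : C), CS a l -> CSeries a = l.
Proof.
  intros a l H. apply CS_iff in H. destruct H as [H1 H2].
  apply C_eq; apply is_series_unique; assumption.
Qed.

(** ** Power series on the unit disc *)

(** Boundedness of [d i * r ^ i] for all [r < 1]: convergence on the unit disc. *)
Definition rb (d : nat -> C) : Prop :=
  forall r, 0 < r < 1 -> exists M, forall i, Cmod (d i) * r ^ i <= M.

Definition PSm (d : nat -> C) (u : C) : C := CSeries (fun i => d i * u ^ i)%C.

Lemma rb_radius : forall d, rb d -> forall r, 0 <= r < 1 ->
  Rbar_lt (Finite r) (CV_radius (fun i => Cmod (d i))).
Proof.
  intros d H r Hr. set (r' := (1 + r) / 2).
  assert (Hr' : r < r' < 1) by (unfold r'; lra).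
  destruct (CV_radius_bounded (fun i => Cmod (d i))) as [Hub _].
  apply (Rbar_lt_le_trans _ (Finite r')); [simpl; lra|].
  apply Hub. destruct (H r' ltac:(lra)) as [M HM]. exists M. intros n.
  rewrite Rabs_right; [apply HM|]. apply Rle_ge, Rmult_le_pos; [apply Cmod_ge_0|apply pow_le; lra].
Qed.

Lemma radius_abs : forall (a : nat -> R) r, 0 <= r -> (forall n, 0 <= a n) ->
  Rbar_lt (Finite r) (CV_radius a) -> ex_series (fun n => a n * r ^ n).
Proof.
  intros a r Hr Ha H. rewrite <- (Rabs_right r) in H by lra.
  apply CV_radius_inside in H. apply ex_pseries_R in H. exact H.
Qed.

Lemma rb_abs : forall d, rb d -> forall u, Cmod u < 1 ->
  ex_series (fun i => Cmod (d i * u ^ i)%C).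
Proof.
  intros d H u Hu.
  apply (ex_series_ext (fun i => Cmod (d i) * Cmod u ^ i)).
  - intros n. rewrite Cmod_mult, Cmod_pow. reflexivity.
  - apply radius_abs; [apply Cmod_ge_0|intros; apply Cmod_ge_0|].
    apply rb_radius; [exact H|]. pose proof (Cmod_ge_0 u). lra.
Qed.

Lemma rb_conv : forall d, rb d -> forall u, Cmod u < 1 -> CS (fun i => d i * u ^ i)%C (PSm d u).
Proof.
  intros d H u Hu. destruct (CS_abs _ (rb_abs d H u Hu)) as [l Hl].
  unfold PSm. rewrite (CS_CSeries _ _ Hl). exact Hl.
Qed.

Lemma CS_bounded : forall (a : nat -> C) (l : C), CS a l -> exists M, forall i, Cmod (a i) <= M.
Proof.
  intros a l H. apply CS_iff in H. destruct H as [H1 H2].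
  assert (B : forall (b : nat -> R) s, is_series b s -> exists M, forall i, Rabs (b i) <= M).
  { intros b s Hb. assert (L : is_lim_seq b 0) by (apply ex_series_lim_0; exists s; exact Hb).
    apply is_lim_seq_Reals in L. destruct (maj_by_pos b (exist _ 0 L)) as [M [_ HM]].
    exists M. exact HM. }
  destruct (B _ _ H1) as [M1 HM1]. destruct (B _ _ H2) as [M2 HM2].
  exists (sqrt 2 * (Rmax M1 M2)). intros i. eapply Rle_trans; [apply Cmod_2Rmax|].
  apply Rmult_le_compat_l; [apply sqrt_pos|]. apply Rmax_lub.
  - eapply Rle_trans; [apply HM1|apply Rmax_l].
  - eapply Rle_trans; [apply HM2|apply Rmax_r].
Qed.

Lemma conv_rb : forall d, (forall r, 0 < r < 1 -> exists l, CS (fun i => d i * RtoC r ^ i)%C l) -> rb d.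
Proof.
  intros d H r Hr. destruct (H r Hr) as [l Hl]. destruct (CS_bounded _ _ Hl) as [M HM].
  exists M. intros i. specialize (HM i). rewrite Cmod_mult, Cmod_pow, Cmod_R, Rabs_right in HM by lra.
  exact HM.
Qed.

Lemma PSm_eq : forall d u (l : C), CS (fun i => d i * u ^ i)%C l -> PSm d u = l.
Proof. intros. apply CS_CSeries. assumption. Qed.

Lemma Re_scal_r : forall (x : C) (r : R), Re (x * RtoC r)%C = Re x * r.
Proof. intros [a b] r; simpl; ring. Qed.
Lemma Im_scal_r : forall (x : C) (r : R), Im (x * RtoC r)%C = Im x * r.
Proof. intros [a b] r; simpl; ring. Qed.

Lemma CS_Re_real : forall d (u : R) (l : C), CS (fun i => d i * RtoC u ^ i)%C l ->
  is_pseries (fun i => Re (d i)) u (Re l) /\ is_pseries (fun i => Im (d i)) u (Im l).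
Proof.
  intros d u l H. apply CS_iff in H. destruct H as [H1 H2]. split; apply is_pseries_R.
  - eapply is_series_ext; [|exact H1]. intros n. cbv beta. rewrite <- RtoC_pow. apply Re_scal_r.
  - eapply is_series_ext; [|exact H2]. intros n. cbv beta. rewrite <- RtoC_pow. apply Im_scal_r.
Qed.

(** The constant coefficient is the limit at 0; the others follow by shifting. *)
Lemma real_pseries_zero : forall n (a : nat -> R),
  (forall u, 0 < u < 1 -> is_pseries a u 0) -> a n = 0.
Proof.
  assert (H0 : forall a : nat -> R, (forall u, 0 < u < 1 -> is_pseries a u 0) -> a 0%nat = 0).
  { intros a H.
    assert (Hr : Rbar_lt (Finite (Rabs 0)) (CV_radius a)).
    { rewrite Rabs_R0. apply Rbar_lt_le_trans with (Finite (1 / 2)); [simpl; lra|].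
      apply Rbar_not_lt_le. intros Hc.
      assert (E : ~ Rbar_lt (CV_radius a) (Rabs (1 / 2))).
      { intros Hd. apply CV_disk_outside in Hd. apply Hd.
        specialize (H (1 / 2) ltac:(lra)). apply is_pseries_R in H.
        apply ex_series_lim_0. exists 0. exact H. }
      apply E. rewrite Rabs_right by lra. exact Hc. }
    pose proof (PSeries_continuity a 0 Hr) as C. rewrite <- (PSeries_0 a).
    destruct (Req_dec (PSeries a 0) 0) as [E|E]; [exact E|exfalso].
    destruct (C (Rabs (PSeries a 0)) (Rabs_pos_lt _ E)) as [d [Hd HC]].
    set (u := Rmin (d / 2) (1 / 2)).
    assert (0 < u) by (apply Rmin_pos; lra).
    assert (u <= d / 2) by apply Rmin_l. assert (u <= 1 / 2) by apply Rmin_r.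
    specialize (HC u). simpl in HC. unfold R_dist in HC.
    rewrite (is_pseries_unique a u 0 (H u ltac:(lra))) in HC.
    rewrite Rminus_0_l, Rabs_Ropp in HC.
    assert (K : Rabs (PSeries a 0) < Rabs (PSeries a 0)).
    { apply HC. split; [split; [exact I|lra]|]. rewrite Rminus_0_r, Rabs_right; lra. }
    lra. }
  induction n as [|n IH]; intros a H; [apply H0; exact H|].
  change (a (S n)) with (PS_decr_1 a n). apply IH. intros u Hu.
  pose proof (H u Hu) as Hs. pose proof (H0 a H) as Ha.
  apply is_pseries_decr_1 with (y := / u) in Hs; [|change (/ u * u = 1); field; lra].
  change (is_pseries (PS_decr_1 a) u (/ u * (0 + - a 0%nat))) in Hs.
  rewrite Ha in Hs. replace (/ u * (0 + - 0)) with 0 in Hs by (field; lra). exact Hs.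
Qed.

Lemma rb_unique : forall d, (forall u, 0 < u < 1 -> CS (fun i => d i * RtoC u ^ i)%C (RtoC 0)) ->
  forall i, d i = RtoC 0.
Proof.
  intros d H i. apply C_eq.
  - apply (real_pseries_zero i (fun i => Re (d i))). intros u Hu.
    exact (proj1 (CS_Re_real _ _ _ (H u Hu))).
  - apply (real_pseries_zero i (fun i => Im (d i))). intros u Hu.
    exact (proj2 (CS_Re_real _ _ _ (H u Hu))).
Qed.

(** ** Cauchy products *)

Fixpoint Csumn (f : nat -> C) (n : nat) : C :=
  match n with O => f 0%nat | S m => (Csumn f m + f (S m))%C end.

Lemma Csumn_ext : forall f g n, (forall k, (k <= n)%nat -> f k = g k) -> Csumn f n = Csumn g n.
Proof.
  intros f g n. induction n as [|n IH]; intros H; simpl; [apply H; lia|].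
  rewrite IH by (intros; apply H; lia). rewrite H by lia. reflexivity.
Qed.

Lemma Csumn_Re : forall f n, Re (Csumn f n) = sum_f_R0 (fun k => Re (f k)) n.
Proof. intros f n. induction n as [|n IH]; simpl; [reflexivity|]. rewrite <- IH. reflexivity. Qed.
Lemma Csumn_Im : forall f n, Im (Csumn f n) = sum_f_R0 (fun k => Im (f k)) n.
Proof. intros f n. induction n as [|n IH]; simpl; [reflexivity|]. rewrite <- IH. reflexivity. Qed.

Lemma Csumn_scal : forall c f n, (c * Csumn f n)%C = Csumn (fun k => c * f k)%C n.
Proof. intros c f n. induction n as [|n IH]; simpl; [reflexivity|]. rewrite <- IH. ring. Qed.

Lemma ex_abs_le : forall (a : nat -> C) (b : nat -> R), (forall n, Rabs (b n) <= Cmod (a n)) ->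
  ex_series (fun n => Cmod (a n)) -> ex_series (fun n => Rabs (b n)).
Proof.
  intros a b H E. apply (ex_series_le (K := R_AbsRing) (V := R_CompleteNormedModule) _ (fun n => Cmod (a n)));
    [|exact E]. intros n. change (Rabs (Rabs (b n)) <= Cmod (a n)). rewrite Rabs_Rabsolu. apply H.
Qed.

Lemma CS_mult : forall (a b : nat -> C) (l m : C), CS a l -> CS b m ->
  ex_series (fun n => Cmod (a n)) -> ex_series (fun n => Cmod (b n)) ->
  CS (fun n => Csumn (fun k => a k * b (n - k)%nat)%C n) (l * m)%C.
Proof.
  intros a b l m Ha Hb Ea Eb. apply CS_iff in Ha. apply CS_iff in Hb.
  destruct Ha as [Ha1 Ha2]. destruct Hb as [Hb1 Hb2].
  assert (A1 : ex_series (fun n => Rabs (Re (a n)))) by (apply (ex_abs_le a); [intros; apply re_le_Cmod|exact Ea]).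
  assert (A2 : ex_series (fun n => Rabs (Im (a n)))) by (apply (ex_abs_le a); [intros; apply Rabs_Im_le|exact Ea]).
  assert (B1 : ex_series (fun n => Rabs (Re (b n)))) by (apply (ex_abs_le b); [intros; apply re_le_Cmod|exact Eb]).
  assert (B2 : ex_series (fun n => Rabs (Im (b n)))) by (apply (ex_abs_le b); [intros; apply Rabs_Im_le|exact Eb]).
  pose proof (is_series_mult _ _ _ _ Ha1 Hb1 A1 B1) as P11.
  pose proof (is_series_mult _ _ _ _ Ha2 Hb2 A2 B2) as P22.
  pose proof (is_series_mult _ _ _ _ Ha1 Hb2 A1 B2) as P12.
  pose proof (is_series_mult _ _ _ _ Ha2 Hb1 A2 B1) as P21.
  apply CS_iff. split.
  - replace (Re (l * m)%C) with (Re l * Re m + - (Im l * Im m)) by (destruct l, m; simpl; ring).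
    apply (is_series_ext (fun n => sum_f_R0 (fun k => Re (a k) * Re (b (n - k)%nat)) n +
      - sum_f_R0 (fun k => Im (a k) * Im (b (n - k)%nat)) n)).
    + intros n. rewrite Csumn_Re. symmetry. change (sum_f_R0 (fun k => Re (a k * b (n - k)%nat)%C) n =
        sum_f_R0 (fun k => Re (a k) * Re (b (n - k)%nat)) n - sum_f_R0 (fun k => Im (a k) * Im (b (n - k)%nat)) n).
      rewrite <- minus_sum. apply sum_eq. intros i _. destruct (a i), (b (n - i)%nat); reflexivity.
    + apply (is_series_plus _ _ _ _ P11). apply (is_series_opp _ _ P22).
  - replace (Im (l * m)%C) with (Re l * Im m + Im l * Re m) by (destruct l, m; simpl; ring).
    apply (is_series_ext (fun n => sum_f_R0 (fun k => Re (a k) * Im (b (n - k)%nat)) n +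
      sum_f_R0 (fun k => Im (a k) * Re (b (n - k)%nat)) n)).
    + intros n. rewrite Csumn_Im. symmetry. change (sum_f_R0 (fun k => Im (a k * b (n - k)%nat)%C) n =
        sum_f_R0 (fun k => Re (a k) * Im (b (n - k)%nat)) n + sum_f_R0 (fun k => Im (a k) * Re (b (n - k)%nat)) n).
      rewrite <- plus_sum. apply sum_eq. intros i _. destruct (a i), (b (n - i)%nat); simpl; ring.
    + apply (is_series_plus _ _ _ _ P12 P21).
Qed.

Definition conv (d e : nat -> C) (n : nat) : C := Csumn (fun k => d k * e (n - k)%nat)%C n.

Lemma PSm_mult : forall d e, rb d -> rb e ->
  rb (conv d e) /\ forall u, Cmod u < 1 -> PSm (conv d e) u = (PSm d u * PSm e u)%C.
Proof.
  intros d e Hd He.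
  assert (K : forall u, Cmod u < 1 -> CS (fun n => conv d e n * u ^ n)%C (PSm d u * PSm e u)%C).
  { intros u Hu.
    eapply CS_ext; [|apply (CS_mult _ _ _ _ (rb_conv d Hd u Hu) (rb_conv e He u Hu));
      apply rb_abs; assumption].
    intros n. unfold conv. rewrite (Cmult_comm (Csumn _ _)), Csumn_scal.
    apply Csumn_ext. intros k Hk. cbv beta.
    replace (u ^ n)%C with (u ^ k * u ^ (n - k))%C by (rewrite <- Cpow_add_r; f_equal; lia). ring. }
  split.
  - apply conv_rb. intros r Hr. eexists. apply K. rewrite Cmod_R, Rabs_right; lra.
  - intros u Hu. apply PSm_eq, K, Hu.
Qed.

(** ** Differentiation *)

Definition Cder (d : nat -> C) (i : nat) : C := (RtoC (INR (S i)) * d (S i))%C.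

Lemma rb_Cder_abs : forall d, rb d -> forall r, 0 <= r < 1 ->
  ex_series (fun n => INR (S n) * (INR (S (S n)) * Cmod (d (S (S n)))) * r ^ n).
Proof.
  intros d H r Hr.
  apply (radius_abs (PS_derive (PS_derive (fun i => Cmod (d i))))); [lra| |].
  - intros n. unfold PS_derive. repeat apply Rmult_le_pos; try apply pos_INR. apply Cmod_ge_0.
  - rewrite !CV_radius_derive. apply rb_radius; assumption.
Qed.

Lemma rb_Cder : forall d, rb d -> rb (Cder d).
Proof.
  intros d H r Hr.
  assert (E : ex_series (fun n => INR (S n) * Cmod (d (S n)) * r ^ n)).
  { apply (radius_abs (PS_derive (fun i => Cmod (d i)))); [lra| |].
    - intros n. unfold PS_derive. apply Rmult_le_pos; [apply pos_INR|apply Cmod_ge_0].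
    - rewrite CV_radius_derive. apply rb_radius; [exact H|lra]. }
  apply ex_series_lim_0, is_lim_seq_Reals in E.
  destruct (maj_by_pos _ (exist _ 0 E)) as [M [_ HM]].
  exists M. intros i. unfold Cder. rewrite Cmod_mult, Cmod_R.
  eapply Rle_trans; [|apply (HM i)]. eapply Rle_trans; [|apply Rle_abs].
  rewrite Rabs_right by (apply Rle_ge, pos_INR). lra.
Qed.

(** Second-order Taylor remainder of a monomial. *)
Lemma taylor_mono : forall (w u : C) rho n, Cmod w <= rho -> Cmod u <= rho ->
  Cmod (w ^ (S (S n)) - u ^ (S (S n)) - RtoC (INR (S (S n))) * u ^ (S n) * (w - u))%C
  <= INR (S n) * INR (S (S n)) * rho ^ n * (Cmod (w - u)%C * Cmod (w - u)%C).
Proof.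
  intros w u rho n Hw Hu. pose proof (Cmod_ge_0 u) as Pu.
  set (dl := (w - u)%C).
  assert (Pd : 0 <= Cmod dl * Cmod dl) by (apply Rmult_le_pos; apply Cmod_ge_0).
  induction n as [|n IH].
  - replace (w ^ 2 - u ^ 2 - RtoC (INR 2) * u ^ 1 * dl)%C with (dl * dl)%C
      by (unfold dl; simpl; replace (1 + 1) with 2 by ring; ring).
    rewrite Cmod_mult. simpl. nra.
  - replace (w ^ S (S (S n)) - u ^ S (S (S n)) - RtoC (INR (S (S (S n)))) * u ^ S (S n) * dl)%C
      with (w * (w ^ S (S n) - u ^ S (S n) - RtoC (INR (S (S n))) * u ^ S n * dl) +
        RtoC (INR (S (S n))) * u ^ S n * (dl * dl))%C.
    2: { rewrite (S_INR (S (S n))), RtoC_plus. unfold dl.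
         rewrite (Cpow_S w (S (S n))), (Cpow_S u (S (S n))), (Cpow_S u (S n)). ring. }
    eapply Rle_trans; [apply Cmod_triangle|]. rewrite !Cmod_mult, Cmod_pow, Cmod_R.
    rewrite (Rabs_right (INR _)) by (apply Rle_ge, pos_INR).
    assert (A1 : Cmod u ^ S n <= rho ^ S n) by (apply pow_incr; lra).
    assert (A0 : 0 <= rho ^ n) by (apply pow_le; lra).
    rewrite !S_INR in *. pose proof (pos_INR n) as Pn. set (x := INR n) in *.
    set (D := Cmod dl * Cmod dl) in *.
    pose proof (Cmod_ge_0 (w ^ S (S n) - u ^ S (S n) - RtoC (x + 1 + 1) * u ^ S n * dl)%C).
    pose proof (Cmod_ge_0 w).
    eapply Rle_trans; [apply Rplus_le_compat|].
    + apply Rmult_le_compat; [assumption|assumption|exact Hw|exact IH].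
    + apply Rmult_le_compat_r; [exact Pd|]. apply Rmult_le_compat_l; [lra|exact A1].
    + simpl. assert (0 <= rho * rho ^ n * D).
      { apply Rmult_le_pos; [apply Rmult_le_pos; lra|exact Pd]. }
      set (y := rho * rho ^ n * D) in *.
      replace (rho * ((x + 1) * (x + 1 + 1) * rho ^ n * D) + (x + 1 + 1) * (rho * rho ^ n) * D)
        with ((x + 2) * (x + 2) * y) by (unfold y; ring).
      replace ((x + 1 + 1) * (x + 1 + 1 + 1) * (rho * rho ^ n) * D) with ((x + 2) * (x + 3) * y)
        by (unfold y; ring).
      nra.
Qed.

(** The quadratic Taylor bound for monomials is summed on a disc of radius
    between [Cmod u] and 1. *)
Lemma cderiv_PSm : forall d u, rb d -> Cmod u < 1 -> cderiv (PSm d) u (PSm (Cder d) u).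
Proof.
  intros d u Hd Hu.
  set (rho := (1 + Cmod u) / 2).
  assert (Hrho : Cmod u < rho < 1) by (unfold rho; lra).
  pose proof (Cmod_ge_0 u) as Pu.
  destruct (rb_Cder_abs d Hd rho ltac:(lra)) as [S HS].
  assert (Key : forall h, Cmod h < rho - Cmod u ->
    Cmod (PSm d (u + h) - PSm d u - h * PSm (Cder d) u)%C <= S * (Cmod h * Cmod h)).
  { intros h Hh.
    assert (Hw : Cmod (u + h)%C <= rho) by (pose proof (Cmod_triangle u h); lra).
    set (w := (u + h)%C) in *. assert (Hh' : h = (w - u)%C) by (unfold w; ring).
    pose proof (rb_conv d Hd w ltac:(lra)) as C1. pose proof (rb_conv d Hd u Hu) as C2.
    pose proof (rb_conv (Cder d) (rb_Cder d Hd) u Hu) as C3.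
    assert (C3' : CS (fun i => RtoC (INR i) * d i * u ^ pred i)%C (PSm (Cder d) u)).
    { replace (PSm (Cder d) u) with (RtoC (INR 0) * d 0%nat * u ^ pred 0 + PSm (Cder d) u)%C
        by (simpl; ring).
      apply (CS_incr (fun i => RtoC (INR i) * d i * u ^ pred i)%C). exact C3. }
    pose proof (CS_plus _ _ _ _ (CS_plus _ _ _ _ C1 (CS_scal (- (1))%C _ _ C2))
      (CS_scal (- h)%C _ _ C3')) as C4. cbv beta in C4.
    set (t := fun i => (d i * w ^ i + - (1) * (d i * u ^ i) + - h * (RtoC (INR i) * d i * u ^ pred i))%C) in C4.
    assert (C5 : CS (fun i => t (Datatypes.S (Datatypes.S i)))
      (PSm d w - PSm d u - h * PSm (Cder d) u)%C).
    { apply (CS_decr (fun i => t (Datatypes.S i))).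
      replace (t 1%nat) with (RtoC 0) by (unfold t; simpl; rewrite Hh'; ring).
      apply (CS_decr t). replace (t 0%nat) with (RtoC 0) by (unfold t; simpl; ring).
      replace (0 + (0 + (PSm d w - PSm d u - h * PSm (Cder d) u)))%C
        with (PSm d w + - (1) * PSm d u + - h * PSm (Cder d) u)%C by ring. exact C4. }
    pose proof (is_series_scal (Cmod h * Cmod h) _ _ HS) as HS'.
    rewrite (Rmult_comm S).
    refine (CS_norm_le _ _ _ _ C5 HS' _).
    intros i. change (scal (Cmod h * Cmod h) ?x) with (Cmod h * Cmod h * x).
    replace (t (Datatypes.S (Datatypes.S i)))
      with (d (Datatypes.S (Datatypes.S i)) * (w ^ Datatypes.S (Datatypes.S i) - u ^ Datatypes.S (Datatypes.S i) -
        RtoC (INR (Datatypes.S (Datatypes.S i))) * u ^ (Datatypes.S i) * (w - u)))%C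
      by (unfold t; simpl pred; rewrite Hh'; ring).
    rewrite Cmod_mult.
    pose proof (taylor_mono w u rho i Hw ltac:(lra)) as T. rewrite <- Hh' in *.
    pose proof (Cmod_ge_0 (d (Datatypes.S (Datatypes.S i)))).
    eapply Rle_trans; [apply Rmult_le_compat_l; [assumption|exact T]|]. right.
    change (@scal R_Ring ?A (Cmod h * Cmod h) ?x) with (Cmod h * Cmod h * x).
    match goal with |- _ = ?r => change r with (Cmod h * Cmod h *
      (INR (Datatypes.S i) * (INR (Datatypes.S (Datatypes.S i)) * Cmod (d (Datatypes.S (Datatypes.S i)))) * rho ^ i)) end.
    ring. }
  exists (fun h => if Req_EM_T (Cmod h) 0 then PSm (Cder d) u
    else (PSm d (u + h) - PSm d u) / h)%C. split.
  - apply near_all. intros h. destruct (Req_EM_T (Cmod h) 0) as [E|E].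
    + apply Cmod_eq_0 in E. subst. replace (u + 0)%C with u by ring. ring.
    + field. intros ->. apply E, Cmod_0.
  - intros eps He.
    assert (HS0 : 0 <= S).
    { specialize (Key (RtoC ((rho - Cmod u) / 2))). rewrite Cmod_R, Rabs_right in Key by lra.
      specialize (Key ltac:(lra)).
      match type of Key with ?x <= _ => assert (0 <= x) by apply Cmod_ge_0 end.
      assert (0 < (rho - Cmod u) / 2 * ((rho - Cmod u) / 2)) by nra. nra. }
    exists (Rmin (rho - Cmod u) (eps / (1 + S))).
    assert (Hp : 0 < eps / (1 + S)) by (apply Rdiv_lt_0_compat; lra).
    split; [apply Rmin_pos; lra|]. intros h Hh.
    assert (H1 : Cmod h < rho - Cmod u) by (eapply Rlt_le_trans; [exact Hh|apply Rmin_l]).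
    assert (H2 : Cmod h < eps / (1 + S)) by (eapply Rlt_le_trans; [exact Hh|apply Rmin_r]).
    destruct (Req_EM_T (Cmod h) 0) as [E|E].
    + replace (PSm (Cder d) u - PSm (Cder d) u)%C with (RtoC 0) by ring. rewrite Cmod_0. exact He.
    + assert (Hn : h <> RtoC 0) by (intros ->; apply E, Cmod_0).
      assert (Hpos : 0 < Cmod h) by (apply Cmod_gt_0; exact Hn).
      replace ((PSm d (u + h) - PSm d u) / h - PSm (Cder d) u)%C
        with ((PSm d (u + h) - PSm d u - h * PSm (Cder d) u) * / h)%C by (field; exact Hn).
      rewrite Cmod_mult, Cmod_inv by exact Hn.
      apply (Rmult_lt_reg_r (Cmod h)); [exact Hpos|].
      rewrite Rmult_assoc, Rinv_l, Rmult_1_r by lra.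
      eapply Rle_lt_trans; [apply Key; exact H1|].
      apply (Rmult_lt_compat_r (1 + S)) in H2; [|lra].
      replace (eps / (1 + S) * (1 + S)) with eps in H2 by (field; lra). nra.
Qed.

(** * Fourier expansions *)

Notation xe w s n := ((IZR n + s) / w)%R.

(** [hexp w s] is [has_expansion] with the width [w] and the exponent shift [s]
    made explicit. *)
Definition hexp (w s : R) (f : C -> C) (a : R -> C) : Prop :=
  exists n0 : Z,
    (forall x, a x <> RtoC 0 -> exists n : Z, (n0 <= n)%Z /\ x = (IZR n + s) / w) /\
    forall z, upper z ->
      CS (fun i : nat =>
           let x := xe w s (n0 + Z.of_nat i)%Z in Cmult (a x) (qpow x z))
        (f z).

Lemma has_expansion_hexp : forall G K nu f a,
  has_expansion G K nu f a = hexp (width G) (Defs.sigma G K nu) f a.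
Proof. reflexivity. Qed.

(** The same data as a power series in q^(1/w), with starting exponent [n0]. *)
Definition hps (w s : R) (f : C -> C) (a : R -> C) (n0 : Z) : Prop :=
  (forall x, a x <> RtoC 0 -> exists n : Z, (n0 <= n)%Z /\ x = (IZR n + s) / w) /\
  rb (fun i => a (xe w s (n0 + Z.of_nat i)%Z)) /\
  forall z, upper z -> f z = (qpow (xe w s n0) z *
    PSm (fun i => a (xe w s (n0 + Z.of_nat i)%Z)) (qpow (/ w) z))%C.

Lemma Cmod_q_lt1 : forall w z, 0 < w -> upper z -> Cmod (qpow (/ w) z) < 1.
Proof.
  intros w z Hw Hz. rewrite Cmod_qpow. rewrite <- exp_0. apply exp_increasing.
  assert (0 < 2 * PI * / w * Im z); [|lra].
  pose proof PI_RGT_0. pose proof (Rinv_0_lt_compat w Hw).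
  apply Rmult_lt_0_compat; [|exact Hz]. nra.
Qed.

(** Every radius in (0,1) is reached on the imaginary axis. *)
Lemma q_surj : forall w r, 0 < w -> 0 < r < 1 ->
  exists z, upper z /\ qpow (/ w) z = RtoC r.
Proof.
  intros w r Hw Hr. pose proof PI_RGT_0 as HPI.
  assert (Hln : ln r < 0) by (rewrite <- ln_1; apply ln_increasing; lra).
  set (y := - ln r * w / (2 * PI)).
  assert (Hy : 0 < y) by (unfold y; apply Rdiv_lt_0_compat; nra).
  exists (0, y). split; [exact Hy|].
  unfold qpow, ee. simpl. rewrite Rmult_0_r, Rmult_0_r, cos_0, sin_0.
  replace (- (2 * PI * / w * y)) with (ln r) by (unfold y; field; lra).
  rewrite exp_ln by lra. apply C_eq; simpl; ring.
Qed.

Lemma qterm : forall w s n0 i z, 0 < w ->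
  qpow (xe w s (n0 + Z.of_nat i)%Z) z =
  (qpow (xe w s n0) z * qpow (/ w) z ^ i)%C.
Proof.
  intros w s n0 i z Hw. rewrite <- qpow_nat, <- qpow_add. f_equal.
  rewrite plus_IZR, <- INR_IZR_INZ. field. lra.
Qed.

Lemma hexp_hps : forall w s f a, 0 < w -> hexp w s f a -> exists n0, hps w s f a n0.
Proof.
  intros w s f a Hw [n0 [Hs Hc]]. exists n0.
  assert (K : forall z, upper z ->
    CS (fun i => a (xe w s (n0 + Z.of_nat i)%Z) * qpow (/ w) z ^ i)%C
      (/ qpow (xe w s n0) z * f z)%C).
  { intros z Hz. eapply CS_ext; [|apply CS_scal, (Hc z Hz)].
    intros i. cbv beta zeta. rewrite qterm by exact Hw. field. apply qpow_nz. }
  split; [exact Hs|]. split.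
  - apply conv_rb. intros r Hr. destruct (q_surj w r Hw Hr) as [z [Hz E]].
    rewrite <- E. eexists. apply (K z Hz).
  - intros z Hz. rewrite (PSm_eq _ _ _ (K z Hz)). field. apply qpow_nz.
Qed.

Definition Cshift1 (d : nat -> C) (i : nat) : C := match i with O => RtoC 0 | S j => d j end.

Lemma rb_shift1 : forall d, rb d -> rb (Cshift1 d).
Proof.
  intros d H r Hr. destruct (H r Hr) as [M HM]. exists M. intros [|i]; simpl.
  - rewrite Cmod_0. rewrite Rmult_0_l. eapply Rle_trans; [|apply (HM 0%nat)].
    apply Rmult_le_pos; [apply Cmod_ge_0|simpl; lra].
  - specialize (HM i). pose proof (Cmod_ge_0 (d i)).
    assert (0 <= Cmod (d i) * r ^ i) by (apply Rmult_le_pos; [assumption|apply pow_le; lra]).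
    nra.
Qed.

Lemma PSm_shift1 : forall d u, rb d -> Cmod u < 1 -> PSm (Cshift1 d) u = (u * PSm d u)%C.
Proof.
  intros d u Hd Hu. apply PSm_eq.
  replace (u * PSm d u)%C with (Cshift1 d 0 * u ^ 0 + u * PSm d u)%C by (simpl; ring).
  apply (CS_incr (fun i => Cshift1 d i * u ^ i)%C).
  eapply CS_ext; [|apply CS_scal, (rb_conv d Hd u Hu)]. intros i. simpl. ring.
Qed.

Lemma hps_lower : forall w s f a k n0, 0 < w -> hps w s f a n0 -> hps w s f a (n0 - Z.of_nat k).
Proof.
  intros w s f a k n0 Hw H. induction k as [|k IH].
  - replace (n0 - Z.of_nat 0)%Z with n0 by lia. exact H.
  - destruct IH as [Hs [Hr Hf]]. set (m := (n0 - Z.of_nat k)%Z) in *.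
    replace (n0 - Z.of_nat (S k))%Z with (m - 1)%Z by (unfold m; lia).
    assert (E : (fun i => a (xe w s (m - 1 + Z.of_nat i)%Z)) =
      Cshift1 (fun i => a (xe w s (m + Z.of_nat i)%Z))).
    { apply functional_extensionality. intros [|i]; simpl Cshift1.
      - apply NNPP. intros Hn. destruct (Hs _ Hn) as [n [Hn1 Hn2]].
        assert (Q : IZR (m - 1 + Z.of_nat 0) = IZR n).
        { apply Rmult_eq_reg_r with (/ w); [|apply Rinv_neq_0_compat; lra].
          unfold Rdiv in Hn2. lra. }
        apply eq_IZR in Q. lia.
      - f_equal. f_equal. f_equal. f_equal. lia. }
    split; [|split].
    + intros x Hx. destruct (Hs x Hx) as [n [Hn E']]. exists n. split; [lia|exact E'].
    + rewrite E. apply rb_shift1, Hr.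
    + intros z Hz. rewrite E, PSm_shift1 by (try exact Hr; apply Cmod_q_lt1; assumption).
      rewrite (Hf z Hz).
      replace (xe w s m) with ((IZR (m - 1) + s) / w + / w)
        by (rewrite minus_IZR; field; lra).
      rewrite qpow_add. ring.
Qed.

Lemma hps_common : forall w s f a g b, 0 < w -> hexp w s f a -> hexp w s g b ->
  exists n0, hps w s f a n0 /\ hps w s g b n0.
Proof.
  intros w s f a g b Hw Hf Hg.
  destruct (hexp_hps _ _ _ _ Hw Hf) as [n1 H1]. destruct (hexp_hps _ _ _ _ Hw Hg) as [n2 H2].
  exists (Z.min n1 n2). split.
  - replace (Z.min n1 n2) with (n1 - Z.of_nat (Z.to_nat (n1 - Z.min n1 n2)))%Z by lia.
    apply hps_lower; assumption.
  - replace (Z.min n1 n2) with (n2 - Z.of_nat (Z.to_nat (n2 - Z.min n1 n2)))%Z by lia.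
    apply hps_lower; assumption.
Qed.

Lemma hexp_ext : forall w s f g a, (forall z, upper z -> f z = g z) ->
  hexp w s f a -> hexp w s g a.
Proof.
  intros w s f g a E [n0 [H1 H2]]. exists n0. split; [exact H1|].
  intros z Hz. rewrite <- E by exact Hz. apply H2, Hz.
Qed.

Lemma hexp_plus : forall w s f a g b, 0 < w -> hexp w s f a -> hexp w s g b ->
  hexp w s (fun z => f z + g z)%C (fun x => a x + b x)%C.
Proof.
  intros w s f a g b Hw Hf Hg. destruct (hps_common _ _ _ _ _ _ Hw Hf Hg) as [n0 [H1 H2]].
  exists n0. split.
  - intros x Hx. destruct (classic (a x = RtoC 0)) as [E|E].
    + apply (proj1 H2). intros E2. apply Hx. rewrite E, E2. ring.
    + apply (proj1 H1), E.
  - intros z Hz. destruct H1 as [_ [R1 F1]]. destruct H2 as [_ [R2 F2]].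
    rewrite (F1 z Hz), (F2 z Hz).
    pose proof (Cmod_q_lt1 w z Hw Hz) as Hu.
    eapply CS_ext; [|apply CS_plus; apply CS_scal; [apply (rb_conv _ R1 _ Hu)|apply (rb_conv _ R2 _ Hu)]].
    intros i. cbv beta zeta. rewrite qterm by exact Hw. ring.
Qed.

Lemma hexp_scal : forall w s c f a, hexp w s f a ->
  hexp w s (fun z => c * f z)%C (fun x => c * a x)%C.
Proof.
  intros w s c f a [n0 [H1 H2]]. exists n0. split.
  - intros x Hx. apply H1. intros E. apply Hx. rewrite E. ring.
  - intros z Hz. eapply CS_ext; [|apply CS_scal, (H2 z Hz)]. intros i. cbv beta zeta. ring.
Qed.

Lemma CS_zero : CS (fun _ : nat => RtoC 0) (RtoC 0).
Proof.
  assert (Z0 : is_series (fun _ : nat => 0) 0).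
  { apply (is_lim_seq_ext (fun _ => 0) _ 0); [|apply is_lim_seq_const].
    intros n. rewrite sum_n_const. ring. }
  apply CS_iff. split; exact Z0.
Qed.

Lemma hexp_0 : forall w s, hexp w s (fun _ => RtoC 0) (fun _ => RtoC 0).
Proof.
  intros w s. exists 0%Z. split; [intros x Hx; contradiction|].
  intros z _. eapply CS_ext; [|exact CS_zero]. intros i. cbv beta zeta. ring.
Qed.

Lemma hexp_translate : forall w s f a r, hexp w s f a ->
  hexp w s (fun z => f (z + RtoC r)%C) (fun x => ee (r * x) * a x)%C.
Proof.
  intros w s f a r [n0 [H1 H2]]. exists n0. split.
  - intros x Hx. apply H1. intros E. apply Hx. rewrite E. ring.
  - intros z Hz. eapply CS_ext; [|apply (H2 _ (upper_shift z r Hz))].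
    intros i. cbv beta zeta. rewrite qpow_shift, (Rmult_comm r). ring.
Qed.

(** Every radius below 1 is a value of q, so uniqueness reduces to that of
    power series on the unit disc. *)
Lemma hexp_unique : forall w s f a b, 0 < w -> hexp w s f a -> hexp w s f b -> a = b.
Proof.
  intros w s f a b Hw Ha Hb. destruct (hps_common _ _ _ _ _ _ Hw Ha Hb) as [n0 [H1 H2]].
  destruct H1 as [S1 [R1 F1]]. destruct H2 as [S2 [R2 F2]].
  assert (E : forall i : nat, (a (xe w s (n0 + Z.of_nat i)%Z) -
    b (xe w s (n0 + Z.of_nat i)%Z))%C = RtoC 0).
  { apply rb_unique. intros u Hu. destruct (q_surj w u Hw Hu) as [z [Hz Eu]].
    pose proof (Cmod_q_lt1 w z Hw Hz) as Hq.
    pose proof (F1 z Hz) as E1. rewrite (F2 z Hz) in E1.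
    pose proof (CS_plus _ _ _ _ (rb_conv _ R1 _ Hq) (CS_scal (- (1))%C _ _ (rb_conv _ R2 _ Hq))) as K.
    rewrite Eu in *.
    assert (E2 : PSm (fun i => a (xe w s (n0 + Z.of_nat i)%Z)) (RtoC u) =
      PSm (fun i => b (xe w s (n0 + Z.of_nat i)%Z)) (RtoC u)).
    { pose proof (qpow_nz (xe w s n0) z) as Hn.
      rewrite <- (Cmult_1_l (PSm (fun i => a _) _)), <- (Cmult_1_l (PSm (fun i => b _) _)).
      rewrite <- (Cinv_l _ Hn), <- !Cmult_assoc, E1. reflexivity. }
    rewrite E2 in K. match type of K with CS _ ?l => replace l with (RtoC 0) in K by ring end.
    eapply CS_ext; [|exact K]. intros i. cbv beta. ring. }
  apply functional_extensionality. intros x.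
  assert (D : (exists n, (n0 <= n)%Z /\ x = (IZR n + s) / w) -> a x = b x).
  { intros [n [Hn ->]]. specialize (E (Z.to_nat (n - n0))).
    replace (n0 + Z.of_nat (Z.to_nat (n - n0)))%Z with n in E by lia.
    replace (a (xe w s n)) with (a (xe w s n) - b (xe w s n) + b (xe w s n))%C by ring.
    rewrite E. ring. }
  destruct (classic (a x = RtoC 0)) as [Ea|Ea]; [|apply D, S1, Ea].
  destruct (classic (b x = RtoC 0)) as [Eb|Eb]; [congruence|apply D, S2, Eb].
Qed.

(** ** Primitives *)

Lemma rb_le : forall d e, (forall i, Cmod (e i) <= Cmod (d i)) -> rb d -> rb e.
Proof.
  intros d e H Hd r Hr. destruct (Hd r Hr) as [M HM]. exists M. intros i.
  eapply Rle_trans; [|apply HM]. apply Rmult_le_compat_r; [apply pow_le; lra|apply H].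
Qed.

Lemma qpow_period : forall w n z, 0 < w -> qpow (IZR n / w) (z + RtoC w)%C = qpow (IZR n / w) z.
Proof.
  intros w n z Hw. rewrite qpow_shift. replace (IZR n / w * w) with (IZR n) by (field; lra).
  rewrite ee_Z. ring.
Qed.

(** Integrating [q^(-n1/w) sum_i d_i q^(i/w)] termwise: only the term [i = n1]
    contributes to the increment over a period. *)
Lemma primitive : forall w n1 d, 0 < w -> rb d ->
  exists Phi, forall z, upper z ->
    cderiv Phi z (qpow (IZR (- n1) / w) z * PSm d (qpow (/ w) z))%C /\
    Phi (z + RtoC w)%C =
      (Phi z + RtoC w * (if Z_le_dec 0 n1 then d (Z.to_nat n1) else RtoC 0))%C.
Proof.
  intros w n1 d Hw Hd.
  set (c0 := if Z_le_dec 0 n1 then d (Z.to_nat n1) else RtoC 0).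
  (* the resonant term is integrated to [c0 * z], the others keep the period *)
  set (b := fun i : nat => if Z.eq_dec (Z.of_nat i) n1 then RtoC 0
    else (d i * RtoC (/ IZR (Z.of_nat i - n1)))%C).
  assert (Hb : rb b).
  { apply (rb_le d); [|exact Hd]. intros i. unfold b. destruct (Z.eq_dec (Z.of_nat i) n1) as [E|E].
    - rewrite Cmod_0. apply Cmod_ge_0.
    - rewrite Cmod_mult, Cmod_R. rewrite <- (Rmult_1_r (Cmod (d i))) at 2.
      apply Rmult_le_compat_l; [apply Cmod_ge_0|]. rewrite Rabs_inv, <- abs_IZR.
      rewrite <- Rinv_1. apply Rinv_le_contravar; [lra|]. apply IZR_le. lia. }
  set (k := (RtoC w / c2pi)%C).
  set (Q := fun z => (qpow (IZR (- n1) / w) z * PSm b (qpow (/ w) z))%C).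
  exists (fun z => c0 * z + k * Q z)%C. intros z Hz. split.
  - pose proof (Cmod_q_lt1 w z Hw Hz) as Hu. set (u := qpow (/ w) z) in *.
    assert (D : cderiv (fun z => c0 * z + k * Q z)%C z
      (c0 * 1 + k * (c2pi * RtoC (IZR (- n1) / w) * qpow (IZR (- n1) / w) z * PSm b u +
        qpow (IZR (- n1) / w) z * (PSm (Cder b) u * (c2pi * RtoC (/ w) * u))))%C).
    { apply cderiv_plus; [apply cderiv_scal, cderiv_id|]. apply cderiv_scal. unfold Q.
      apply (cderiv_mult (qpow (IZR (- n1) / w)) (fun z => PSm b (qpow (/ w) z))); [apply cderiv_qpow|].
      apply (cderiv_comp (PSm b) (qpow (/ w))); [apply cderiv_PSm; assumption|apply cderiv_qpow]. }
    eapply cderiv_eq; [exact D|].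
    assert (Hq : qpow (IZR (- n1) / w) z <> RtoC 0) by apply qpow_nz.
    assert (HwC : RtoC w <> RtoC 0) by (intros E; apply RtoC_inj in E; lra).
    assert (S : (RtoC (IZR (- n1)) * PSm b u + u * PSm (Cder b) u + c0 * (/ qpow (IZR (- n1) / w) z))%C = PSm d u).
    { symmetry. apply PSm_eq.
      pose proof (CS_scal (RtoC (IZR (- n1))) _ _ (rb_conv b Hb u Hu)) as C1.
      assert (C2 : CS (fun i => RtoC (INR i) * b i * u ^ i)%C (u * PSm (Cder b) u)%C).
      { replace (u * PSm (Cder b) u)%C with (RtoC (INR 0) * b 0%nat * u ^ 0 + u * PSm (Cder b) u)%C
          by (simpl; ring).
        apply (CS_incr (fun i => RtoC (INR i) * b i * u ^ i)%C).
        eapply CS_ext; [|apply CS_scal, (rb_conv _ (rb_Cder b Hb) u Hu)].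
        intros i. unfold Cder. cbv beta. rewrite Cpow_S. ring. }
      set (e := fun i : nat => if Z.eq_dec (Z.of_nat i) n1 then d i else RtoC 0).
      assert (C3 : CS (fun i => e i * u ^ i)%C (c0 * / qpow (IZR (- n1) / w) z)%C).
      { assert (Zs : forall l : C, l = RtoC 0 -> CS (fun _ : nat => RtoC 0) l).
        { intros l ->. exact CS_zero. }
        unfold c0. destruct (Z_le_dec 0 n1) as [Hn|Hn].
        - assert (G : forall (N : nat) (d' : nat -> C), (forall i, i <> N -> d' i = RtoC 0) -> CS d' (d' N)).
          { induction N as [|N IH]; intros d' H'.
            - replace (d' 0%nat) with (d' 0%nat + 0)%C by ring. apply CS_incr.
              eapply CS_ext; [|apply Zs; reflexivity]. intros i. rewrite H' by lia. reflexivity.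
            - replace (d' (S N)) with (d' 0%nat + d' (S N))%C by (rewrite (H' 0%nat) by lia; ring).
              apply CS_incr. apply (IH (fun i => d' (S i))). intros i Hi. apply H'. lia. }
          assert (Hd' : (fun i => e i * u ^ i)%C (Z.to_nat n1) = (d (Z.to_nat n1) * / qpow (IZR (- n1) / w) z)%C).
          { cbv beta. unfold e. destruct (Z.eq_dec (Z.of_nat (Z.to_nat n1)) n1); [|lia].
            f_equal. unfold u. rewrite <- qpow_nat, INR_IZR_INZ, Z2Nat.id by exact Hn.
            assert (H1 : (qpow (IZR n1 * / w) z * qpow (IZR (- n1) / w) z)%C = RtoC 1).
            { rewrite <- qpow_add, <- (qpow_0 z). f_equal. rewrite opp_IZR. field. lra. }
            rewrite <- (Cmult_1_l (/ _)%C), <- H1. field. exact Hq. }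
          rewrite <- Hd'. apply (G _ (fun i => e i * u ^ i)%C). intros i Hi. cbv beta. unfold e.
          destruct (Z.eq_dec (Z.of_nat i) n1); [lia|ring].
        - eapply CS_ext; [|apply Zs; ring]. intros i. unfold e.
          destruct (Z.eq_dec (Z.of_nat i) n1); [lia|ring]. }
      eapply CS_ext; [|exact (CS_plus _ _ _ _ (CS_plus _ _ _ _ C1 C2) C3)].
      intros i. cbv beta. unfold b, e. destruct (Z.eq_dec (Z.of_nat i) n1) as [E|E]; [ring|].
      assert (Hx : IZR (Z.of_nat i - n1) <> 0) by (apply not_0_IZR; lia).
      assert (Hx2 : (RtoC (IZR (- n1)) + RtoC (INR i))%C = RtoC (IZR (Z.of_nat i - n1))).
      { rewrite <- RtoC_plus, INR_IZR_INZ, <- plus_IZR. f_equal. f_equal. lia. }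
      rewrite RtoC_inv by exact Hx. rewrite <- Hx2.
      assert (Hx3 : (RtoC (IZR (- n1)) + RtoC (INR i))%C <> RtoC 0)
        by (rewrite Hx2; intros E'; apply RtoC_inj in E'; contradiction).
      field. exact Hx3. }
    rewrite <- S. unfold k, Rdiv. rewrite RtoC_mult, RtoC_inv by lra. field.
    repeat split; assumption || apply c2pi_nz.
  - assert (E : Q (z + RtoC w)%C = Q z).
    { unfold Q. rewrite qpow_period by exact Hw. f_equal. f_equal.
      replace (/ w) with (IZR 1 / w) by (field; lra). apply qpow_period; exact Hw. }
    rewrite E. ring.
Qed.

(** The increment over a period of a primitive of a product is determined by
    the products of opposite coefficients, here supported on two exponents. *)
Lemma product_primitive : forall w s s' t f a g b p q, 0 < w ->
  hexp w s f a -> hexp w s' g b -> s + s' = IZR t -> p <> q ->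
  (forall x, x <> p -> x <> q -> (a x * b (- x)%R)%C = RtoC 0) ->
  exists Phi, forall z, upper z ->
    cderiv Phi z (f z * g z)%C /\
    Phi (z + RtoC w)%C = (Phi z + RtoC w * (a p * b (- p)%R + a q * b (- q)%R))%C.
Proof.
  intros w s s' t f a g b p q Hw Hf Hg Ht Hpq Hsupp.
  destruct (hexp_hps _ _ _ _ Hw Hf) as [n0 [S1 [R1 F1]]].
  destruct (hexp_hps _ _ _ _ Hw Hg) as [n0' [S2 [R2 F2]]].
  set (d := fun i : nat => a (xe w s (n0 + Z.of_nat i)%Z)) in *.
  set (e := fun i : nat => b (xe w s' (n0' + Z.of_nat i)%Z)) in *.
  destruct (PSm_mult d e R1 R2) as [R3 F3].
  (* the index at which the exponents of the product add up to 0 *)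
  set (n1 := (- (n0 + n0' + t))%Z).
  destruct (primitive w n1 (conv d e) Hw R3) as [Phi HPhi].
  exists Phi. intros z Hz. destruct (HPhi z Hz) as [D P]. split.
  - eapply cderiv_eq; [exact D|]. rewrite F3 by (apply Cmod_q_lt1; assumption).
    rewrite (F1 z Hz), (F2 z Hz).
    replace (IZR (- n1) / w) with ((IZR n0 + s) / w + (IZR n0' + s') / w).
    2: { unfold n1. rewrite Z.opp_involutive, !plus_IZR, <- Ht. field. lra. }
    rewrite qpow_add. ring.
  - rewrite P. f_equal. f_equal. clear P D.
    set (T := fun x => (a x * b (- x)%R)%C) in *.
    set (x := fun k : nat => (IZR (n0 + Z.of_nat k) + s) / w).
    assert (Hnot : forall v, T v <> RtoC 0 -> exists k : nat, (Z.of_nat k <= n1)%Z /\ v = x k).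
    { intros v Hv.
      assert (Ha : a v <> RtoC 0) by (intros E; apply Hv; unfold T; rewrite E; ring).
      assert (Hb : b (- v) <> RtoC 0) by (intros E; apply Hv; unfold T; rewrite E; ring).
      destruct (S1 v Ha) as [n [Hn En]]. destruct (S2 _ Hb) as [n' [Hn' En']].
      assert (Q : IZR (n + n' + t) = 0).
      { rewrite !plus_IZR, <- Ht. apply Rmult_eq_reg_r with (/ w); [|apply Rinv_neq_0_compat; lra].
        unfold Rdiv in *. rewrite Rmult_0_l. rewrite En in En'. lra. }
      apply eq_IZR in Q. exists (Z.to_nat (n - n0)). split; [unfold n1; lia|].
      unfold x. rewrite Z2Nat.id by lia. rewrite En. f_equal. f_equal. f_equal. lia. }
    destruct (Z_le_dec 0 n1) as [H0|H0].
    + unfold conv. set (N := Z.to_nat n1).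
      rewrite (Csumn_ext _ (fun k => T (x k))).
      2: { intros k Hk. unfold T, d, e. f_equal. f_equal.
           unfold x. rewrite Nat2Z.inj_sub by exact Hk. unfold N. rewrite Z2Nat.id by exact H0.
           unfold n1. rewrite !plus_IZR, minus_IZR, opp_IZR, !plus_IZR, <- Ht. field. lra. }
      assert (Hx : forall i j, x i = x j -> i = j).
      { intros i j E. unfold x, Rdiv in E. apply Rmult_eq_reg_r in E; [|apply Rinv_neq_0_compat; lra].
        assert (E' : IZR (n0 + Z.of_nat i) = IZR (n0 + Z.of_nat j)) by lra. apply eq_IZR in E'. lia. }
      (* partial sums pick up T p and T q exactly when their indices have been passed *)
      set (ind := fun v M => if excluded_middle_informative (exists k, (k <= M)%nat /\ x k = v) then T v else RtoC 0).
      assert (Hsum : forall M, Csumn (fun k => T (x k)) M = (ind p M + ind q M)%C).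
      { assert (Hstep : forall v M, ind v (S M) = (ind v M + if Req_EM_T (x (S M)) v then T v else RtoC 0)%C).
        { intros v M. unfold ind.
          destruct (excluded_middle_informative (exists k, (k <= S M)%nat /\ x k = v)) as [[k [Hk Ek]]|E1];
          destruct (excluded_middle_informative (exists k, (k <= M)%nat /\ x k = v)) as [[k' [Hk' Ek']]|E2];
          destruct (Req_EM_T (x (S M)) v) as [E3|E3]; try ring.
          - exfalso. assert (k' = S M) by (apply Hx; congruence). lia.
          - exfalso. apply E2. exists k. split; [|exact Ek].
            destruct (Nat.eq_dec k (S M)); [subst; contradiction|lia].
          - exfalso. apply E1. exists k'. split; [lia|exact Ek'].
          - exfalso. apply E1. exists k'. split; [lia|exact Ek'].
          - exfalso. apply E1. exists (S M). split; [lia|exact E3]. }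
        assert (H00 : forall v, ind v 0%nat = if Req_EM_T (x 0%nat) v then T v else RtoC 0).
        { intros v. unfold ind.
          destruct (excluded_middle_informative (exists k, (k <= 0)%nat /\ x k = v)) as [[k [Hk Ek]]|E1];
          destruct (Req_EM_T (x 0%nat) v) as [E3|E3]; try reflexivity.
          - exfalso. assert (k = 0%nat) by lia. subst k. contradiction.
          - exfalso. apply E1. exists 0%nat. split; [lia|exact E3]. }
        assert (Hone : forall k, T (x k) = ((if Req_EM_T (x k) p then T p else RtoC 0) +
          (if Req_EM_T (x k) q then T q else RtoC 0))%C).
        { intros k. destruct (Req_EM_T (x k) p) as [E|E]; destruct (Req_EM_T (x k) q) as [E'|E'].
          - exfalso. apply Hpq. congruence.
          - rewrite E. ring.
          - rewrite E'. ring.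
          - rewrite (Hsupp (x k) E E' : T (x k) = _). ring. }
        induction M as [|M IH]; simpl Csumn.
        - rewrite !H00. apply Hone.
        - rewrite IH, !Hstep, (Hone (S M)). ring. }
      rewrite Hsum.
      assert (Hind : forall v, ind v N = T v).
      { intros v. unfold ind.
        destruct (excluded_middle_informative (exists k, (k <= N)%nat /\ x k = v)) as [E|E]; [reflexivity|].
        symmetry. apply NNPP. intros Hv. apply E. destruct (Hnot v Hv) as [k [Hk Ek]].
        exists k. split; [unfold N; lia|symmetry; exact Ek]. }
      rewrite !Hind. reflexivity.
    + assert (HT0 : forall v, T v = RtoC 0).
      { intros v. apply NNPP. intros Hv. destruct (Hnot v Hv) as [k [Hk _]]. lia. }
      change (RtoC 0 = (T p + T q)%C). rewrite !HT0. ring.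
Qed.

(** * Matrices and subgroups of SL2(R) *)

Lemma M2_eq : forall g h, ma g = ma h -> mb g = mb h -> mc g = mc h -> md g = md h -> g = h.
Proof. intros [a b c d] [a' b' c' d']; simpl; intros; subst; reflexivity. Qed.

Lemma M2mul_assoc : forall g h k, M2mul g (M2mul h k) = M2mul (M2mul g h) k.
Proof. intros; apply M2_eq; simpl; ring. Qed.
Lemma M2mul_1l : forall g, M2mul M2one g = g.
Proof. intros; apply M2_eq; simpl; ring. Qed.
Lemma M2mul_1r : forall g, M2mul g M2one = g.
Proof. intros; apply M2_eq; simpl; ring. Qed.

Lemma M2inv_1 : forall g, det2 g = 1 -> M2inv g = mkM2 (md g) (- mb g) (- mc g) (ma g).
Proof. intros g H; unfold M2inv; rewrite H; apply M2_eq; simpl; field. Qed.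
Lemma det_inv : forall g, det2 g = 1 -> det2 (M2inv g) = 1.
Proof. intros g H; rewrite M2inv_1 by exact H; unfold det2 in *; simpl; lra. Qed.
Lemma M2inv_r : forall g, det2 g = 1 -> M2mul g (M2inv g) = M2one.
Proof. intros g H; rewrite M2inv_1 by exact H; unfold det2 in *; apply M2_eq; simpl; lra. Qed.
Lemma M2inv_l : forall g, det2 g = 1 -> M2mul (M2inv g) g = M2one.
Proof. intros g H; rewrite M2inv_1 by exact H; unfold det2 in *; apply M2_eq; simpl; lra. Qed.
Lemma M2inv_mul : forall g h, det2 g = 1 -> det2 h = 1 ->
  M2inv (M2mul g h) = M2mul (M2inv h) (M2inv g).
Proof.
  intros g h Hg Hh. rewrite !M2inv_1 by (try apply det_mul1; assumption).
  apply M2_eq; simpl; ring.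
Qed.
Lemma M2inv_inv : forall g, det2 g = 1 -> M2inv (M2inv g) = g.
Proof.
  intros g H. rewrite (M2inv_1 (M2inv g)) by (apply det_inv, H). rewrite M2inv_1 by exact H.
  apply M2_eq; simpl; ring.
Qed.
Lemma M2mul_Kl : forall g h, det2 g = 1 -> M2mul (M2inv g) (M2mul g h) = h.
Proof. intros; rewrite M2mul_assoc, M2inv_l, M2mul_1l; auto. Qed.
Lemma M2mul_Kl' : forall g h, det2 g = 1 -> M2mul g (M2mul (M2inv g) h) = h.
Proof. intros; rewrite M2mul_assoc, M2inv_r, M2mul_1l; auto. Qed.
Lemma M2mul_Kr : forall g h, det2 g = 1 -> M2mul (M2mul h g) (M2inv g) = h.
Proof. intros; rewrite <- M2mul_assoc, M2inv_r, M2mul_1r; auto. Qed.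
Lemma M2mul_Kr' : forall g h, det2 g = 1 -> M2mul (M2mul h (M2inv g)) g = h.
Proof. intros; rewrite <- M2mul_assoc, M2inv_l, M2mul_1r; auto. Qed.
Lemma det_one : det2 M2one = 1.
Proof. unfold det2; simpl; ring. Qed.
Lemma det_T : forall r, det2 (Tmat r) = 1.
Proof. intros; unfold det2; simpl; ring. Qed.
Lemma T_add : forall r s, M2mul (Tmat r) (Tmat s) = Tmat (r + s).
Proof. intros; apply M2_eq; simpl; ring. Qed.

Lemma T_inv : forall r, M2inv (Tmat r) = Tmat (- r).
Proof. intros; rewrite M2inv_1 by apply det_T; apply M2_eq; simpl; ring. Qed.
Lemma M2opp_mul_l : forall g h, M2mul (M2opp g) h = M2opp (M2mul g h).
Proof. intros; apply M2_eq; simpl; ring. Qed.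
Lemma M2opp_mul_r : forall g h, M2mul g (M2opp h) = M2opp (M2mul g h).
Proof. intros; apply M2_eq; simpl; ring. Qed.
Lemma M2opp_opp : forall g, M2opp (M2opp g) = g.
Proof. intros; apply M2_eq; simpl; ring. Qed.
Lemma M2inv_opp : forall g, det2 g = 1 -> M2inv (M2opp g) = M2opp (M2inv g).
Proof.
  intros g H. rewrite !M2inv_1 by (rewrite ?det_opp; exact H). apply M2_eq; simpl; ring.
Qed.

Lemma moebius_opp : forall g z, det2 g = 1 -> upper z -> moebius (M2opp g) z = moebius g z.
Proof.
  intros g z H Hz. pose proof (jden_nz g z H Hz) as Hn. unfold moebius. simpl.
  rewrite !RtoC_opp.
  replace (- RtoC (mc g) * z + - RtoC (md g))%C with (- (RtoC (mc g) * z + RtoC (md g)))%C by ring.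
  replace (- RtoC (ma g) * z + - RtoC (mb g))%C with (- (RtoC (ma g) * z + RtoC (mb g)))%C by ring.
  field. exact Hn.
Qed.
Lemma moebius_T : forall r z, moebius (Tmat r) z = (z + RtoC r)%C.
Proof. intros. unfold moebius. simpl. field. Qed.
Lemma moebius_one : forall z, moebius M2one z = z.
Proof. intros. change M2one with (Tmat 0). rewrite moebius_T. ring. Qed.
Lemma moebius_inv_l : forall g z, det2 g = 1 -> upper z -> moebius (M2inv g) (moebius g z) = z.
Proof.
  intros. rewrite <- moebius_mul, M2inv_l, moebius_one; auto using det_inv.
Qed.
Lemma moebius_inv_r : forall g z, det2 g = 1 -> upper z -> moebius g (moebius (M2inv g) z) = z.
Proof.
  intros. rewrite <- moebius_mul, M2inv_r, moebius_one; auto using det_inv.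
Qed.

(** The one-quotient form of the subgroup axioms passes to intersections and
    conjugates in one step. *)
Definition subgrp (S : M2 -> Prop) : Prop :=
  (forall g, S g -> det2 g = 1) /\ S M2one /\ forall g h, S g -> S h -> S (M2mul g (M2inv h)).

Lemma subgrp_iff : forall S, subgrp S <-> SL2R_subgroup S.
Proof.
  intros S. split.
  - intros [H1 [H2 H3]].
    assert (Hi : forall g, S g -> S (M2inv g)).
    { intros g Hg. rewrite <- M2mul_1l. apply H3; assumption. }
    repeat split; auto. intros g h Hg Hh. rewrite <- (M2inv_inv h) by auto. auto.
  - intros [H1 [H2 [H3 H4]]]. repeat split; auto.
Qed.

Lemma subgrp_mul : forall S g h, subgrp S -> S g -> S h -> S (M2mul g h).
Proof. intros S g h H. apply (proj1 (subgrp_iff S)) in H. destruct H as [_ [_ [H _]]]. apply H. Qed.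
Lemma subgrp_inv : forall S g, subgrp S -> S g -> S (M2inv g).
Proof. intros S g H. apply (proj1 (subgrp_iff S)) in H. destruct H as [_ [_ [_ H]]]. apply H. Qed.
Lemma subgrp_det : forall S g, subgrp S -> S g -> det2 g = 1.
Proof. intros S g H. apply H. Qed.

Lemma subgrp_inter : forall S T, subgrp S -> subgrp T -> subgrp (fun g => S g /\ T g).
Proof.
  intros S T [A1 [A2 A3]] [B1 [B2 B3]]. split; [|split]; try tauto.
  - intros g [Hg _]; auto.
  - intros g h [] []; auto.
Qed.

Lemma is_int_plus : forall x y, is_int x -> is_int y -> is_int (x + y).
Proof. intros x y [n ->] [m ->]; exists (n + m)%Z; rewrite plus_IZR; ring. Qed.
Lemma is_int_mult : forall x y, is_int x -> is_int y -> is_int (x * y).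
Proof. intros x y [n ->] [m ->]; exists (n * m)%Z; rewrite mult_IZR; ring. Qed.
Lemma is_int_opp : forall x, is_int x -> is_int (- x).
Proof. intros x [n ->]; exists (- n)%Z; rewrite opp_IZR; ring. Qed.
Lemma is_int_IZR : forall n, is_int (IZR n).
Proof. intros n; exists n; reflexivity. Qed.

Lemma subgrp_SL2Z : subgrp SL2Z.
Proof.
  split; [intros g H; apply H|split].
  - split; [apply det_one|]. simpl. repeat split; apply is_int_IZR.
  - intros g h [Dg [A [B [C D]]]] [Dh [A' [B' [C' D']]]]. split.
    + apply det_mul1; [exact Dg|apply det_inv; exact Dh].
    + rewrite M2inv_1 by exact Dh. simpl.
      repeat split; repeat (apply is_int_plus || apply is_int_mult || apply is_int_opp); assumption.
Qed.

Definition conjg (G : M2 -> Prop) (x : M2) : M2 -> Prop :=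
  fun d => G (M2mul (M2mul x d) (M2inv x)).

Lemma subgrp_conj : forall G x, subgrp G -> det2 x = 1 -> subgrp (conjg G x).
Proof.
  intros G x HG Hx. unfold conjg. split; [|split].
  - intros d Hd. apply (subgrp_det _ _ HG) in Hd. rewrite !det_mul, (det_inv x Hx), Hx in Hd. lra.
  - rewrite M2mul_1r, M2inv_r by exact Hx. apply HG.
  - intros g h Hg Hh.
    assert (Dh : det2 h = 1).
    { apply (subgrp_det _ _ HG) in Hh. rewrite !det_mul, (det_inv x Hx), Hx in Hh. lra. }
    replace (M2mul (M2mul x (M2mul g (M2inv h))) (M2inv x))
      with (M2mul (M2mul (M2mul x g) (M2inv x)) (M2inv (M2mul (M2mul x h) (M2inv x)))).
    + apply HG; assumption.
    + rewrite !M2inv_mul, M2inv_inv by (try apply det_mul1; try apply det_inv; assumption).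
      rewrite !M2mul_assoc. f_equal. rewrite <- (M2mul_assoc _ (M2inv x) x), M2inv_l by exact Hx.
      rewrite M2mul_1r. reflexivity.
Qed.

(** ** Finite index *)

(** One representative is chosen for each of the finitely many invariants. *)
Lemma finite_index_intro : forall (A : Type) (S G : M2 -> Prop) (vals : list A) (c : M2 -> A -> Prop),
  (forall g, G g -> det2 g = 1) ->
  (forall g, G g -> exists v, In v vals /\ c g v) ->
  (forall g h v, G g -> G h -> c g v -> c h v -> S (M2mul g (M2inv h))) ->
  finite_index S G.
Proof.
  intros A S G vals c Hd Hc Hs.
  assert (K : forall l : list A, exists t : list M2, forall g v, G g -> In v l -> c g v ->
    exists x, In x t /\ G x /\ c x v).
  { induction l as [|v l [t Ht]]; [exists nil; intros g v _ []|].
    destruct (classic (exists x, G x /\ c x v)) as [[x [Gx Cx]]|N].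
    - exists (x :: t). intros g v' Gg [<-|Hin] Cg.
      + exists x. simpl; auto.
      + destruct (Ht g v' Gg Hin Cg) as [y [Hy1 Hy2]]. exists y. simpl; auto.
    - exists t. intros g v' Gg [<-|Hin] Cg; [exfalso; apply N; eauto|eauto]. }
  destruct (K vals) as [t Ht]. exists t. intros g Gg.
  destruct (Hc g Gg) as [v [Hv Cv]]. destruct (Ht g v Gg Hv Cv) as [x [Hx [Gx Cx]]].
  exists (M2mul g (M2inv x)), x. split; [eapply Hs; eassumption|]. split; [exact Hx|].
  symmetry. apply M2mul_Kr'. auto.
Qed.

Lemma finite_index_restrict : forall S G A, subgrp S -> subgrp A -> (forall g, A g -> G g) ->
  (forall g, G g -> det2 g = 1) ->
  finite_index S G -> finite_index (fun g => S g /\ A g) A.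
Proof.
  intros S G A HS HA Hsub Hd [l Hl].
  apply (finite_index_intro M2 _ _ l (fun g x => exists h, S h /\ g = M2mul h x /\ det2 x = 1)).
  - intros g Ag. apply Hd, Hsub, Ag.
  - intros g Ag. destruct (Hl g (Hsub g Ag)) as [h [x [Sh [Hx E]]]].
    exists x. split; [exact Hx|]. exists h. repeat split; auto.
    pose proof (Hd g (Hsub g Ag)) as D. rewrite E, det_mul, (subgrp_det _ _ HS Sh) in D. lra.
  - intros g h x Ag Ah [s [Ss [E Dx]]] [s' [Ss' [E' _]]]. split; [|apply HA; assumption].
    subst. rewrite M2inv_mul by (try assumption; exact (subgrp_det _ _ HS Ss')).
    rewrite M2mul_assoc, M2mul_Kr by exact Dx. apply HS; assumption.
Qed.

Lemma finite_index_trans : forall A B G, finite_index A B -> finite_index B G -> finite_index A G.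
Proof.
  intros A B G [l Hl] [m Hm]. exists (flat_map (fun x => map (fun y => M2mul y x) l) m).
  intros g Gg. destruct (Hm g Gg) as [b [x [Hb [Hx E]]]]. destruct (Hl b Hb) as [a [y [Ha [Hy E']]]].
  exists a, (M2mul y x). split; [exact Ha|]. split.
  - apply in_flat_map. exists x. split; [exact Hx|]. apply in_map_iff. exists y; auto.
  - subst. rewrite M2mul_assoc. reflexivity.
Qed.

Lemma finite_index_mono : forall (A B G : M2 -> Prop), (forall g, A g -> B g) ->
  finite_index A G -> finite_index B G.
Proof.
  intros A B G H [l Hl]. exists l. intros g Gg. destruct (Hl g Gg) as [h [x [Ah R]]].
  exists h, x. auto.
Qed.

Lemma finite_index_conj : forall S G x, det2 x = 1 -> finite_index S G ->
  finite_index (conjg S x) (conjg G x).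
Proof.
  intros S G x Hx [l Hl]. exists (map (fun y => M2mul (M2mul (M2inv x) y) x) l).
  intros g Gg. destruct (Hl _ Gg) as [h [y [Sh [Hy E]]]].
  exists (M2mul (M2mul (M2inv x) h) x), (M2mul (M2mul (M2inv x) y) x). split; [|split].
  - unfold conjg. rewrite !M2mul_assoc, M2inv_r, M2mul_1l by exact Hx.
    rewrite M2mul_Kr by exact Hx. exact Sh.
  - apply in_map_iff. eauto.
  - apply (f_equal (fun k => M2mul (M2mul (M2inv x) k) x)) in E.
    rewrite <- !M2mul_assoc in E. rewrite M2inv_l, M2mul_1r, M2mul_Kl in E by exact Hx.
    rewrite E, <- !M2mul_assoc. rewrite (M2mul_Kl' x) by exact Hx. reflexivity.
Qed.

Fixpoint M2pow (g : M2) (n : nat) : M2 :=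
  match n with O => M2one | S m => M2mul (M2pow g m) g end.

Lemma M2pow_add : forall g n m, M2pow g (n + m) = M2mul (M2pow g n) (M2pow g m).
Proof.
  intros g n m. induction m as [|m IH].
  - rewrite Nat.add_0_r. simpl. rewrite M2mul_1r. reflexivity.
  - rewrite Nat.add_succ_r. simpl. rewrite IH, M2mul_assoc. reflexivity.
Qed.

Lemma M2pow_det : forall g n, det2 g = 1 -> det2 (M2pow g n) = 1.
Proof. intros g n H. induction n; simpl; [apply det_one|apply det_mul1; assumption]. Qed.

Lemma M2pow_in : forall S g n, subgrp S -> S g -> S (M2pow g n).
Proof. intros S g n HS H. induction n; simpl; [apply HS|apply subgrp_mul; assumption]. Qed.

Lemma M2pow_mul : forall g n m, M2pow g (n * m) = M2pow (M2pow g n) m.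
Proof.
  intros g n m. induction m as [|m IH].
  - rewrite Nat.mul_0_r. reflexivity.
  - rewrite Nat.mul_succ_r, M2pow_add, IH. reflexivity.
Qed.

Lemma M2pow_conj : forall x g n, det2 x = 1 ->
  M2pow (M2mul (M2mul x g) (M2inv x)) n = M2mul (M2mul x (M2pow g n)) (M2inv x).
Proof.
  intros x g n Hx. induction n as [|n IH]; simpl.
  - rewrite M2mul_1r, M2inv_r by exact Hx. reflexivity.
  - rewrite IH, !M2mul_assoc. f_equal. f_equal. rewrite M2mul_Kr' by exact Hx. reflexivity.
Qed.

Lemma M2pow_T : forall r n, M2pow (Tmat r) n = Tmat (INR n * r).
Proof.
  intros r n. induction n as [|n IH].
  - simpl. rewrite Rmult_0_l. reflexivity.
  - simpl M2pow. rewrite IH, T_add, S_INR. f_equal. ring.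
Qed.

(** Pigeonhole: two of the powers with exponent at most [length l] lie in one
    coset.  The factorial is a multiple of all the exponents that may occur. *)
Lemma finite_index_power : forall S G, subgrp S -> subgrp G -> finite_index S G ->
  exists N : nat, (0 < N)%nat /\ forall g, G g -> S (M2pow g N).
Proof.
  intros S G HS HG [l Hl].
  assert (K : forall g, G g -> exists n, (0 < n <= length l)%nat /\ S (M2pow g n)).
  { intros g Gg. pose proof (subgrp_det _ _ HG Gg) as Dg.
    assert (Hc : forall i : nat, exists x, In x l /\ exists h, S h /\ M2pow g i = M2mul h x).
    { intros i. destruct (Hl _ (M2pow_in G g i HG Gg)) as [h [x [H1 [H2 H3]]]]. eauto. }
    destruct (choice _ Hc) as [r Hr].
    set (L := map r (seq 0 (Datatypes.S (length l)))).
    assert (Hnd : ~ NoDup L).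
    { intros Hnd. assert (Hle : (length L <= length l)%nat).
      { apply NoDup_incl_length; [exact Hnd|]. intros x Hx. apply in_map_iff in Hx.
        destruct Hx as [i [<- _]]. apply Hr. }
      unfold L in Hle. rewrite length_map, length_seq in Hle. lia. }
    assert (Hij : exists i j, (i < j <= length l)%nat /\ r i = r j).
    { apply NNPP. intros N. apply Hnd. unfold L. apply NoDup_map_NoDup_ForallPairs; [|apply seq_NoDup].
      intros i j Hi Hj E. apply in_seq in Hi. apply in_seq in Hj.
      destruct (Nat.lt_trichotomy i j) as [C|[C|C]]; [|exact C|]; exfalso; apply N.
      - exists i, j. split; [lia|exact E].
      - exists j, i. split; [lia|congruence]. }
    destruct Hij as [i [j [Hij E]]]. exists (j - i)%nat. split; [lia|].
    destruct (Hr i) as [_ [h [Sh Eh]]]. destruct (Hr j) as [_ [h' [Sh' Eh']]].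
    pose proof (M2pow_det g i Dg) as Di.
    assert (Dx : det2 (r i) = 1).
    { rewrite Eh, det_mul, (subgrp_det _ _ HS Sh) in Di. lra. }
    replace (M2pow g (j - i)) with (M2mul (M2pow g j) (M2inv (M2pow g i))).
    - rewrite Eh, Eh', <- E, M2inv_mul by (assumption || exact (subgrp_det _ _ HS Sh)).
      rewrite M2mul_assoc, M2mul_Kr by exact Dx. apply HS; assumption.
    - replace j with ((j - i) + i)%nat at 1 by lia. rewrite M2pow_add. apply M2mul_Kr, Di. }
  exists (fact (length l)). split; [apply lt_O_fact|]. intros g Gg.
  destruct (K g Gg) as [n [Hn Sn]].
  assert (Hdiv : forall m n : nat, (0 < n <= m)%nat -> exists q, fact m = (n * q)%nat).
  { induction m as [|m IH]; intros k Hk; [lia|].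
    destruct (Nat.eq_dec k (Datatypes.S m)) as [->|Ne].
    - exists (fact m). reflexivity.
    - destruct (IH k ltac:(lia)) as [q Hq]. exists (q * Datatypes.S m)%nat.
      change (fact (Datatypes.S m)) with (Datatypes.S m * fact m)%nat. rewrite Hq. ring. }
  destruct (Hdiv _ _ Hn) as [q ->]. rewrite M2pow_mul. apply M2pow_in; assumption.
Qed.

(** Greedy choice: a representative is added only if its coset is not met yet. *)
Lemma transversal : forall S G, subgrp S -> subgrp G -> finite_index S G ->
  exists t : list M2, NoDup t /\ (forall x, In x t -> G x) /\
    (forall g, G g -> exists x, In x t /\ S (M2mul g (M2inv x))) /\
    (forall x y, In x t -> In y t -> S (M2mul x (M2inv y)) -> x = y).
Proof.
  intros S G HS HG [l Hl].
  assert (Htr : forall g x y, det2 x = 1 -> det2 y = 1 -> S (M2mul g (M2inv x)) -> S (M2mul x (M2inv y)) -> S (M2mul g (M2inv y))).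
  { intros g x y Dx Dy H1 H2. replace (M2mul g (M2inv y)) with (M2mul (M2mul g (M2inv x)) (M2mul x (M2inv y))).
    - apply subgrp_mul; assumption.
    - rewrite M2mul_assoc, M2mul_Kr' by exact Dx. reflexivity. }
  assert (Hsym : forall x y, det2 x = 1 -> det2 y = 1 -> S (M2mul x (M2inv y)) -> S (M2mul y (M2inv x))).
  { intros x y Dx Dy H. apply subgrp_inv in H; [|exact HS].
    rewrite M2inv_mul, M2inv_inv in H by (auto using det_inv). exact H. }
  assert (DG : forall g, G g -> det2 g = 1) by (intros; eapply subgrp_det; eauto).
  assert (K : forall l, exists t : list M2, NoDup t /\ (forall x, In x t -> G x) /\
    (forall g y h, G g -> In y l -> S h -> g = M2mul h y -> exists x, In x t /\ S (M2mul g (M2inv x))) /\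
    (forall x y, In x t -> In y t -> S (M2mul x (M2inv y)) -> x = y)).
  { clear l Hl. induction l as [|y l [t [T1 [T2 [T3 T4]]]]].
    - exists nil. repeat split; try (intros; contradiction). constructor.
    - destruct (classic (exists g h, G g /\ S h /\ g = M2mul h y /\ ~ exists x, In x t /\ S (M2mul g (M2inv x)))) as [[g [h [Gg [Sh [E N]]]]]|N].
      + exists (g :: t). split; [|split; [|split]].
        * constructor; [|exact T1]. intros Hin. apply N. exists g. split; [exact Hin|].
          rewrite M2inv_r by auto. apply HS.
        * intros x [<-|Hx]; auto.
        * intros g' y' h' Gg' [<-|Hy'] Sh' E'; [|destruct (T3 g' y' h' Gg' Hy' Sh' E') as [x [Hx Hx']]; exists x; simpl; auto].
          exists g. split; [left; reflexivity|]. pose proof (DG g Gg) as Dg.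
          assert (Dy : det2 y = 1) by (rewrite E, det_mul, (subgrp_det _ _ HS Sh) in Dg; lra).
          rewrite E, E', M2inv_mul by (assumption || exact (subgrp_det _ _ HS Sh)).
          rewrite M2mul_assoc, M2mul_Kr by exact Dy. apply HS; assumption.
        * intros x x' [<-|Hx] [<-|Hx'] Hs; auto.
          -- exfalso. apply N. eauto.
          -- exfalso. apply N. exists x. split; [exact Hx|]. apply Hsym; auto.
      + exists t. split; [exact T1|]. split; [exact T2|]. split; [|exact T4].
        intros g y' h Gg [<-|Hy'] Sh E; [|eauto].
        apply NNPP. intros N'. apply N. exists g, h. auto. }
  destruct (K l) as [t [T1 [T2 [T3 T4]]]]. exists t. repeat split; auto.
  intros g Gg. destruct (Hl g Gg) as [h [x [Sh [Hx E]]]]. eauto.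
Qed.

(** ** Commensurable groups *)

Lemma comm_subgrp : forall G, commensurable G -> subgrp G.
Proof. intros G [H _]. apply (proj2 (subgrp_iff G)), H. Qed.

Lemma comm_det : forall G g, commensurable G -> G g -> det2 g = 1.
Proof. intros G g H. apply subgrp_det, comm_subgrp, H. Qed.

Lemma conjg_self : forall G x, subgrp G -> G x -> forall d, conjg G x d <-> G d.
Proof.
  intros G x HG Gx d. unfold conjg. pose proof (subgrp_det _ _ HG Gx) as Dx. split; intros H.
  - replace d with (M2mul (M2mul (M2inv x) (M2mul (M2mul x d) (M2inv x))) x).
    + apply subgrp_mul; auto. apply subgrp_mul; auto. apply subgrp_inv; auto.
    + rewrite <- !M2mul_assoc, M2inv_l, M2mul_1r by exact Dx. apply M2mul_Kl, Dx.
  - apply HG; auto. apply subgrp_mul; auto.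
Qed.

(** Both groups are compared with their intersections with SL2(Z), which have
    finite index in SL2(Z). *)
Lemma comm_index : forall G H, commensurable G -> commensurable H -> (forall g, G g -> H g) ->
  finite_index G H.
Proof.
  intros G H cG cH Hsub.
  pose proof (comm_subgrp _ cG) as sG. pose proof (comm_subgrp _ cH) as sH.
  destruct cG as [_ [_ G2]]. destruct cH as [_ [H1 _]].
  pose proof subgrp_SL2Z as sZ.
  assert (R : finite_index (fun g => (G g /\ SL2Z g) /\ (H g /\ SL2Z g)) (fun g => H g /\ SL2Z g)).
  { apply finite_index_restrict with SL2Z; auto using subgrp_inter; try tauto.
    intros g Hg; apply Hg. }
  apply (finite_index_mono (fun g => (G g /\ SL2Z g) /\ (H g /\ SL2Z g))); [tauto|].
  eapply finite_index_trans; eassumption.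
Qed.

(** [conjg G x] has finite index in [conjg H x], which is [H]. *)
Lemma comm_conj : forall G H x, commensurable G -> commensurable H ->
  (forall g, G g -> H g) -> H x ->
  commensurable (conjg G x) /\ forall g, conjg G x g -> H g.
Proof.
  intros G H x cG cH Hsub Hx.
  pose proof (comm_subgrp _ cG) as sG. pose proof (comm_subgrp _ cH) as sH.
  pose proof (subgrp_det _ _ sH Hx) as Dx. pose proof subgrp_SL2Z as sZ.
  pose proof (subgrp_conj _ _ sG Dx) as sC.
  assert (Hc : forall g, conjg G x g -> H g).
  { intros g Hg. apply (conjg_self H x sH Hx). apply Hsub, Hg. }
  assert (I : finite_index (conjg G x) H).
  { destruct (finite_index_conj _ _ x Dx (comm_index G H cG cH Hsub)) as [l Hl].
    exists l. intros g Hg. apply Hl. apply conjg_self; assumption. }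
  split; [|exact Hc]. split; [apply (proj1 (subgrp_iff _)), sC|]. destruct cH as [_ [H1 H2]]. split.
  - apply (finite_index_mono (fun g => (H g /\ SL2Z g) /\ conjg G x g)); [tauto|].
    apply finite_index_restrict with H; auto using subgrp_inter.
    intros g Hg; exact (subgrp_det _ _ sH Hg).
  - apply (finite_index_mono (fun g => conjg G x g /\ (H g /\ SL2Z g))); [tauto|].
    eapply finite_index_trans; [|exact H2].
    apply finite_index_restrict with H; auto using subgrp_inter; [tauto|].
    intros g Hg; exact (subgrp_det _ _ sH Hg).
Qed.

(** ** Widths *)

Lemma nat_least : forall P : nat -> Prop, (exists n, P n) ->
  exists n, P n /\ forall m, P m -> (n <= m)%nat.
Proof.
  intros P [n Hn]. induction n as [n IH] using (well_founded_induction lt_wf).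
  destruct (classic (exists m, (m < n)%nat /\ P m)) as [[m [Hm Pm]]|N].
  - exact (IH m Hm Pm).
  - exists n. split; [exact Hn|]. intros m Pm. destruct (le_lt_dec n m); [assumption|].
    exfalso; apply N; eauto.
Qed.

(** The bounded denominators give a least positive element, and division with
    remainder shows that it generates. *)
Lemma cyclic_reals : forall (D : R -> Prop) N, 0 < N ->
  (forall r s, D r -> D s -> D (r - s)) -> (exists r, 0 < r /\ D r) ->
  (forall r, D r -> is_int (N * r)) ->
  exists w, 0 < w /\ forall r, D r <-> exists n : Z, r = IZR n * w.
Proof.
  intros D N HN Hsub [r0 [Hr0 Dr0]] Hint.
  assert (D0 : D 0) by (replace 0 with (r0 - r0) by ring; auto).
  assert (Dadd : forall r s, D r -> D s -> D (r + s)).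
  { intros r s Hr Hs. replace (r + s) with (r - (0 - s)) by ring. auto. }
  destruct (nat_least (fun k => (0 < k)%nat /\ D (INR k / N))) as [k [[Hk Dk] Hmin]].
  { destruct (Hint r0 Dr0) as [n Hn]. assert (0 < IZR n) by (rewrite <- Hn; nra).
    apply lt_IZR in H. exists (Z.to_nat n). split; [lia|].
    rewrite INR_IZR_INZ, Z2Nat.id, <- Hn by lia. replace (N * r0 / N) with r0 by (field; lra). exact Dr0. }
  set (w := INR k / N) in *.
  assert (Hw : 0 < w) by (unfold w; apply Rdiv_lt_0_compat; [apply lt_0_INR; exact Hk|exact HN]).
  assert (Dn : forall n : nat, D (INR n * w)).
  { induction n as [|n IH]; [simpl; rewrite Rmult_0_l; exact D0|].
    rewrite S_INR. replace ((INR n + 1) * w) with (INR n * w + w) by ring. auto. }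
  assert (Dz : forall n : Z, D (IZR n * w)).
  { intros n. destruct (Z_le_gt_dec 0 n) as [Hn|Hn].
    - rewrite <- (Z2Nat.id n Hn), <- INR_IZR_INZ. apply Dn.
    - replace (IZR n * w) with (0 - INR (Z.to_nat (- n)) * w); [auto|].
      rewrite INR_IZR_INZ, Z2Nat.id, opp_IZR by lia. ring. }
  exists w. split; [exact Hw|]. intros r. split; [|intros [n ->]; apply Dz].
  intros Dr. destruct (Hint r Dr) as [j Hj].
  exists (j / Z.of_nat k)%Z.
  pose proof (Z.div_mod j (Z.of_nat k) ltac:(lia)) as E.
  pose proof (Z.mod_pos_bound j (Z.of_nat k) ltac:(lia)) as B.
  set (q := (j / Z.of_nat k)%Z) in *. set (m := (j mod Z.of_nat k)%Z) in *.
  assert (Er : r = IZR q * w + IZR m / N).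
  { unfold w. rewrite INR_IZR_INZ. apply (Rmult_eq_reg_l N); [|lra]. rewrite Hj, E, plus_IZR, mult_IZR.
    field. lra. }
  assert (Dm : D (IZR m / N)).
  { replace (IZR m / N) with (r - IZR q * w) by lra. auto. }
  destruct (Z.eq_dec m 0) as [E0|E0].
  - rewrite Er, E0. field. lra.
  - specialize (Hmin (Z.to_nat m)). rewrite INR_IZR_INZ, Z2Nat.id in Hmin by lia.
    assert (k <= Z.to_nat m)%nat by (apply Hmin; split; [lia|exact Dm]). lia.
Qed.

Definition transl (G : M2 -> Prop) (r : R) : Prop := G (Tmat r) \/ G (M2opp (Tmat r)).

Lemma transl_sub : forall G r s, subgrp G -> transl G r -> transl G s -> transl G (r - s).
Proof.
  intros G r s HG Hr Hs. unfold transl in *.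
  replace (Tmat (r - s)) with (M2mul (Tmat r) (M2inv (Tmat s)))
    by (rewrite T_inv, T_add; f_equal; ring).
  destruct Hr as [Hr|Hr]; destruct Hs as [Hs|Hs].
  - left. apply HG; assumption.
  - right. rewrite <- M2opp_mul_r, <- M2inv_opp by apply det_T. apply HG; assumption.
  - right. rewrite <- M2opp_mul_l. apply HG; assumption.
  - left. replace (M2mul (Tmat r) (M2inv (Tmat s)))
      with (M2mul (M2opp (Tmat r)) (M2inv (M2opp (Tmat s)))); [apply HG; assumption|].
    rewrite M2inv_opp by apply det_T. rewrite M2opp_mul_l, M2opp_mul_r, M2opp_opp. reflexivity.
Qed.

Lemma comm_translation : forall G, commensurable G -> exists n : nat, (0 < n)%nat /\ G (Tmat (INR n)).
Proof.
  intros G cG. destruct (finite_index_power _ SL2Z (subgrp_inter _ _ (comm_subgrp _ cG) subgrp_SL2Z)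
    subgrp_SL2Z (proj2 (proj2 cG))) as [N [HN H]].
  exists N. split; [exact HN|]. rewrite <- (Rmult_1_r (INR N)), <- M2pow_T. apply H.
  split; [apply det_T|]. simpl. repeat split; apply is_int_IZR.
Qed.

(** A fixed power of each translation lies in SL2(Z). *)
Lemma comm_transl_int : forall G, commensurable G -> exists N : nat, (0 < N)%nat /\
  forall r, transl G r -> is_int (INR N * r).
Proof.
  intros G cG. pose proof (comm_subgrp _ cG) as sG.
  destruct (finite_index_power _ G (subgrp_inter _ _ sG subgrp_SL2Z) sG (proj1 (proj2 cG)))
    as [N [HN H]].
  exists (N * 2)%nat. split; [lia|]. intros r Hr.
  assert (G2 : G (Tmat (2 * r))).
  { replace (Tmat (2 * r)) with (M2mul (Tmat r) (Tmat r)) by (rewrite T_add; f_equal; ring).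
    destruct Hr as [Hr|Hr]; [apply subgrp_mul; assumption|].
    replace (M2mul (Tmat r) (Tmat r)) with (M2mul (M2opp (Tmat r)) (M2opp (Tmat r)))
      by (rewrite M2opp_mul_l, M2opp_mul_r, M2opp_opp; reflexivity).
    apply subgrp_mul; assumption. }
  destruct (H _ G2) as [_ Hz]. rewrite M2pow_T in Hz. destruct Hz as [_ [_ [Hb _]]]. simpl in Hb.
  rewrite mult_INR. replace (INR N * INR 2 * r) with (INR N * (2 * r)) by (simpl; ring). exact Hb.
Qed.

Lemma width_spec : forall G, commensurable G ->
  0 < width G /\ forall r, transl G r <-> exists n : Z, r = IZR n * width G.
Proof.
  intros G cG. pose proof (comm_subgrp _ cG) as sG.
  destruct (comm_translation G cG) as [n [Hn Tn]].
  destruct (comm_transl_int G cG) as [N [HN Hint]].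
  unfold width. apply epsilon_spec.
  apply (cyclic_reals (transl G) (INR N)).
  - apply lt_0_INR, HN.
  - intros r s. apply transl_sub, sG.
  - exists (INR n). split; [apply lt_0_INR, Hn|left; exact Tn].
  - exact Hint.
Qed.

Lemma width_pos : forall G, commensurable G -> 0 < width G.
Proof. intros G H. apply width_spec, H. Qed.

Lemma width_in : forall G, commensurable G -> transl G (width G).
Proof. intros G H. apply (width_spec G H). exists 1%Z. ring. Qed.

Lemma transl_rational : forall G r, commensurable G -> transl G r -> exists q : QArith_base.Q, r = Rdefinitions.Q2R q.
Proof.
  intros G r cG Hr. destruct (comm_transl_int G cG) as [N [HN Hint]].
  destruct (Hint r Hr) as [n Hn]. exists (QArith_base.Qmake n (Pos.of_nat N)).
  unfold Rdefinitions.Q2R. simpl. rewrite <- Hn.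
  replace (Z.pos (Pos.of_nat N)) with (Z.of_nat N) by lia.
  rewrite <- INR_IZR_INZ. field. apply not_0_INR. lia.
Qed.

(** An element of a commensurable group fixing oo is a translation up to sign:
    it normalizes the discrete group of translations. *)
Lemma comm_parabolic : forall G g, commensurable G -> G g -> mc g = 0 ->
  exists r, g = Tmat r \/ g = M2opp (Tmat r).
Proof.
  intros G g cG Gg Hc. pose proof (comm_subgrp _ cG) as sG.
  destruct (width_spec G cG) as [Hw Hiff]. set (w := width G) in *.
  pose proof (comm_det _ _ cG Gg) as D.
  assert (Dd : ma g * md g = 1) by (unfold det2 in D; rewrite Hc in D; lra).
  assert (K : forall h, G h -> mc h = 0 -> ma h * md h = 1 -> exists n : Z, ma h * ma h = IZR n).
  { intros h Gh Hch Hd. assert (Hh : transl G (w * (ma h * ma h))).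
    { pose proof (width_in G cG) as Hin. fold w in Hin. pose proof (comm_det _ _ cG Gh) as Dh.
      assert (E : M2mul (M2mul h (Tmat w)) (M2inv h) = Tmat (w * (ma h * ma h))).
      { rewrite M2inv_1 by exact Dh. apply M2_eq; simpl; rewrite ?Hch; nra. }
      destruct Hin as [Hin|Hin]; [left|right]; rewrite <- E.
      - apply sG; auto. apply subgrp_mul; auto.
      - rewrite <- M2opp_mul_l, <- M2opp_mul_r. apply sG; auto. apply subgrp_mul; auto. }
    apply Hiff in Hh. destruct Hh as [n Hn]. exists n. apply (Rmult_eq_reg_r w); lra. }
  destruct (K g Gg Hc Dd) as [n Hn].
  destruct (K (M2inv g)) as [m Hm].
  { apply subgrp_inv; assumption. }
  { rewrite M2inv_1 by exact D. simpl. rewrite Hc. ring. }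
  { rewrite M2inv_1 by exact D. simpl. lra. }
  rewrite M2inv_1 in Hm by exact D. simpl in Hm.
  assert (Hnm : IZR (n * m) = 1).
  { rewrite mult_IZR, <- Hn, <- Hm. replace (ma g * ma g * (md g * md g)) with (ma g * md g * (ma g * md g)) by ring.
    rewrite Dd. ring. }
  apply eq_IZR in Hnm.
  assert (Hn0 : (0 <= n)%Z) by (apply le_IZR; rewrite <- Hn; nra).
  destruct (Z.eq_mul_1_nonneg n m Hn0 Hnm) as [-> _]. simpl in Hn.
  assert (Ha : ma g = 1 \/ ma g = -1).
  { assert (E : (ma g - 1) * (ma g + 1) = 0) by lra.
    apply Rmult_integral in E. destruct E; [left|right]; lra. }
  destruct Ha as [Ha|Ha]; rewrite Ha in Dd.
  - exists (mb g). left. apply M2_eq; simpl; lra.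
  - exists (- mb g). right. apply M2_eq; simpl; lra.
Qed.

(** * Integer matrices *)

Record ZM : Type := mkZ { za : Z; zb : Z; zc : Z; zd : Z }.

Definition zdet (M : ZM) : Z := (za M * zd M - zb M * zc M)%Z.
Definition zmul (M N : ZM) : ZM :=
  mkZ (za M * za N + zb M * zc N) (za M * zb N + zb M * zd N)
      (zc M * za N + zd M * zc N) (zc M * zb N + zd M * zd N).
Definition zadj (M : ZM) : ZM := mkZ (zd M) (- zb M) (- zc M) (za M).
Definition zscl (k : Z) (M : ZM) : ZM := mkZ (k * za M) (k * zb M) (k * zc M) (k * zd M).
Definition zapp (M : ZM) (v : Z * Z) : Z * Z :=
  (za M * fst v + zb M * snd v, zc M * fst v + zd M * snd v)%Z.
Definition vscl (k : Z) (v : Z * Z) : Z * Z := (k * fst v, k * snd v)%Z.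
Definition zinj (M : ZM) : M2 := mkM2 (IZR (za M)) (IZR (zb M)) (IZR (zc M)) (IZR (zd M)).
Definition smul (r : R) (g : M2) : M2 := mkM2 (r * ma g) (r * mb g) (r * mc g) (r * md g).

Lemma ZM_eq : forall M N, za M = za N -> zb M = zb N -> zc M = zc N -> zd M = zd N -> M = N.
Proof. intros [] []; simpl; intros; subst; reflexivity. Qed.
Lemma pair_eqZ : forall u v : Z * Z, fst u = fst v -> snd u = snd v -> u = v.
Proof. intros [] []; simpl; intros; subst; reflexivity. Qed.

Definition zI : ZM := mkZ 1 0 0 1.

Ltac zm := apply ZM_eq; unfold zdet, zmul, zadj, zscl, zI; cbn [za zb zc zd]; ring.
Ltac zv := apply pair_eqZ; unfold zapp, vscl, zdet, zmul, zadj, zscl; cbn [za zb zc zd fst snd]; ring.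

Lemma zmul_assoc : forall A B C, zmul A (zmul B C) = zmul (zmul A B) C.
Proof. intros; zm. Qed.
Lemma zapp_mul : forall A B v, zapp (zmul A B) v = zapp A (zapp B v).
Proof. intros; zv. Qed.
Lemma zdet_mul : forall A B, zdet (zmul A B) = (zdet A * zdet B)%Z.
Proof. intros; unfold zdet, zmul; simpl; ring. Qed.
Lemma zdet_adj : forall A, zdet (zadj A) = zdet A.
Proof. intros; unfold zdet, zadj; simpl; ring. Qed.
Lemma zdet_scl : forall k A, zdet (zscl k A) = (k * k * zdet A)%Z.
Proof. intros; unfold zdet, zscl; simpl; ring. Qed.
Lemma zadj_app : forall A v, zapp (zadj A) (zapp A v) = vscl (zdet A) v.
Proof. intros; zv. Qed.
Lemma zadj_app' : forall A v, zapp A (zapp (zadj A) v) = vscl (zdet A) v.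
Proof. intros; zv. Qed.
Lemma zapp_vscl : forall A k v, zapp A (vscl k v) = vscl k (zapp A v).
Proof. intros; zv. Qed.
Lemma zapp_zscl : forall A k v, zapp (zscl k A) v = vscl k (zapp A v).
Proof. intros; zv. Qed.
Lemma vscl_vscl : forall k l v, vscl k (vscl l v) = vscl (k * l) v.
Proof. intros; zv. Qed.
Lemma vscl_inj : forall k u v, k <> 0%Z -> vscl k u = vscl k v -> u = v.
Proof.
  intros k [a b] [c d] Hk E. injection E as E1 E2. simpl in *.
  apply Z.mul_reg_l in E1; [|exact Hk]. apply Z.mul_reg_l in E2; [|exact Hk]. subst; reflexivity.
Qed.
Lemma zinj_mul : forall A B, zinj (zmul A B) = M2mul (zinj A) (zinj B).
Proof. intros; apply M2_eq; simpl; rewrite plus_IZR, !mult_IZR; reflexivity. Qed.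
Lemma zinj_det : forall A, det2 (zinj A) = IZR (zdet A).
Proof. intros; unfold det2, zdet; simpl; rewrite minus_IZR, !mult_IZR; reflexivity. Qed.

Lemma zinj_scl : forall k A, zinj (zscl k A) = smul (IZR k) (zinj A).
Proof. intros; apply M2_eq; simpl; apply mult_IZR. Qed.
Lemma smul_mul_l : forall r g h, M2mul (smul r g) h = smul r (M2mul g h).
Proof. intros; apply M2_eq; simpl; ring. Qed.
Lemma smul_mul_r : forall r g h, M2mul g (smul r h) = smul r (M2mul g h).
Proof. intros; apply M2_eq; simpl; ring. Qed.
Lemma smul_smul : forall r s g, smul r (smul s g) = smul (r * s) g.
Proof. intros; apply M2_eq; simpl; ring. Qed.
Lemma smul_1 : forall g, smul 1 g = g.
Proof. intros; apply M2_eq; simpl; ring. Qed.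
Lemma smul_det : forall r g, det2 (smul r g) = r * r * det2 g.
Proof. intros; unfold det2, smul; simpl; ring. Qed.
Lemma zadj_inj_l : forall A, M2mul (zinj (zadj A)) (zinj A) = smul (IZR (zdet A)) M2one.
Proof.
  intros A. rewrite <- zinj_mul. apply M2_eq; unfold zdet; simpl;
    rewrite ?plus_IZR, ?minus_IZR, ?mult_IZR, ?opp_IZR; ring.
Qed.
Lemma zadj_inj_r : forall A, M2mul (zinj A) (zinj (zadj A)) = smul (IZR (zdet A)) M2one.
Proof.
  intros A. rewrite <- zinj_mul. apply M2_eq; unfold zdet; simpl;
    rewrite ?plus_IZR, ?minus_IZR, ?mult_IZR, ?opp_IZR; ring.
Qed.

Definition zprim (M : ZM) : Prop :=
  exists x y u v, (x * za M + y * zb M + u * zc M + v * zd M = 1)%Z.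

Definition zdvd (k : Z) (M : ZM) : Prop := exists N, M = zscl k N.

Lemma zcontent : forall M, M <> mkZ 0 0 0 0 -> exists k N, (0 < k)%Z /\ M = zscl k N /\ zprim N.
Proof.
  intros M Hn.
  set (g1 := Z.gcd (za M) (zb M)). set (g2 := Z.gcd (zc M) (zd M)). set (k := Z.gcd g1 g2).
  assert (Hk0 : k <> 0%Z).
  { intros E. apply Hn. unfold k in E. apply Z.gcd_eq_0 in E. destruct E as [E1 E2].
    unfold g1 in E1. unfold g2 in E2. apply Z.gcd_eq_0 in E1. apply Z.gcd_eq_0 in E2.
    destruct M; simpl in *. destruct E1, E2; subst; reflexivity. }
  assert (Hk : (0 < k)%Z) by (pose proof (Z.gcd_nonneg g1 g2); unfold k in *; lia).
  assert (D1 : (k | g1)%Z) by apply Z.gcd_divide_l. assert (D2 : (k | g2)%Z) by apply Z.gcd_divide_r.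
  destruct (Z.divide_trans _ _ _ D1 (Z.gcd_divide_l (za M) (zb M))) as [a Ha].
  destruct (Z.divide_trans _ _ _ D1 (Z.gcd_divide_r (za M) (zb M))) as [b Hb].
  destruct (Z.divide_trans _ _ _ D2 (Z.gcd_divide_l (zc M) (zd M))) as [c Hc].
  destruct (Z.divide_trans _ _ _ D2 (Z.gcd_divide_r (zc M) (zd M))) as [d Hd].
  exists k, (mkZ a b c d). split; [exact Hk|]. split.
  - apply ZM_eq; simpl; lia.
  - destruct (Z.gcd_bezout _ _ _ (eq_refl g1)) as [x [y E1]].
    destruct (Z.gcd_bezout _ _ _ (eq_refl g2)) as [u [v E2]].
    destruct (Z.gcd_bezout _ _ _ (eq_refl k)) as [p [q E3]].
    exists (p * x)%Z, (p * y)%Z, (q * u)%Z, (q * v)%Z. simpl.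
    apply (Z.mul_reg_r _ _ k Hk0).
    transitivity (p * (x * (a * k) + y * (b * k)) + q * (u * (c * k) + v * (d * k)))%Z; [ring|].
    rewrite <- Ha, <- Hb, <- Hc, <- Hd, E1, E2, E3. ring.
Qed.

(** A Bezout combination of the entries of [M] is 1. *)
Lemma zdvd_prim : forall k l M, zprim M -> zdvd k (zscl l M) -> (k | l)%Z.
Proof.
  intros k l M [x [y [u [v E]]]] [N HN]. injection HN as E1 E2 E3 E4. simpl in *.
  exists (x * za N + y * zb N + u * zc N + v * zd N)%Z.
  transitivity (x * (l * za M) + y * (l * zb M) + u * (l * zc M) + v * (l * zd M))%Z.
  - transitivity (l * 1)%Z; [ring|]. rewrite <- E. ring.
  - rewrite E1, E2, E3, E4. ring.
Qed.

(** ** Squarefree integers *)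

Definition sqf (s : Z) : Prop := (0 < s)%Z /\ forall d, (d * d | s)%Z -> (d | 1)%Z.

Lemma divide_1_pos : forall d, (d | 1)%Z -> (0 <= d)%Z -> d = 1%Z.
Proof. intros d H Hd. apply Z.divide_1_r_nonneg in H; assumption. Qed.

Lemma sqf_decomp : forall e, (0 < e)%Z -> exists s t, (e = s * (t * t))%Z /\ (0 < t)%Z /\ sqf s.
Proof.
  intros e. induction e as [e IH] using (well_founded_induction (Z.lt_wf 0)).
  intros He. destruct (classic (sqf e)) as [H|H]; [exists e, 1%Z; split; [ring|split; [lia|exact H]]|].
  assert (N : exists d, (d * d | e)%Z /\ ~ (d | 1)%Z).
  { apply NNPP. intros N. apply H. split; [exact He|]. intros d Hd. apply NNPP. intros Hd'. apply N; eauto. }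
  destruct N as [d [[e' He'] Hd]].
  assert (Hd1 : (1 < d * d)%Z).
  { assert (d <> 0)%Z by (intros ->; lia). assert (d <> 1)%Z by (intros ->; apply Hd; exists 1%Z; ring).
    assert (d <> -1)%Z by (intros ->; apply Hd; exists (-1)%Z; ring). nia. }
  assert (He'0 : (0 < e')%Z) by nia.
  destruct (IH e') as [s [t [E [Ht Hs]]]]; [nia|exact He'0|].
  exists s, (t * Z.abs d)%Z. split; [|split; [nia|exact Hs]].
  rewrite He', E. replace (t * Z.abs d * (t * Z.abs d))%Z with (t * t * (Z.abs d * Z.abs d))%Z by ring.
  rewrite Z.abs_square. ring.
Qed.

Lemma coprime_reduce : forall x y, x <> 0%Z -> exists g a b, (0 < g)%Z /\ (x = g * a)%Z /\ (y = g * b)%Z /\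
  Z.gcd a b = 1%Z.
Proof.
  intros x y Hx. set (g := Z.gcd x y).
  assert (Hg : (0 < g)%Z).
  { pose proof (Z.gcd_nonneg x y). assert (g <> 0%Z) by (intros E; apply Z.gcd_eq_0_l in E; contradiction).
    unfold g in *; lia. }
  destruct (Z.gcd_divide_l x y) as [a Ha]. destruct (Z.gcd_divide_r x y) as [b Hb].
  fold g in Ha, Hb. exists g, a, b. split; [exact Hg|]. split; [lia|]. split; [lia|].
  assert (Ex : x = (g * a)%Z) by lia. assert (Ey : y = (g * b)%Z) by lia.
  apply (Z.mul_reg_l _ _ g); [lia|]. rewrite Z.mul_1_r. unfold g at 2. rewrite Ex at 1. rewrite Ey at 1.
  rewrite Z.gcd_mul_mono_l_nonneg by lia. reflexivity.
Qed.

Lemma Zcoprime_mul : forall a b c, Z.gcd a b = 1%Z -> Z.gcd a c = 1%Z -> Z.gcd a (b * c) = 1%Z.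
Proof.
  intros a b c H1 H2. apply Znumtheory.Zgcd_1_rel_prime.
  apply Znumtheory.rel_prime_mult; apply Znumtheory.Zgcd_1_rel_prime; assumption.
Qed.

(** Without the common factor of [x] and [y], the square of [x] divides [s]. *)
Lemma sqf_absorb : forall s A x y, sqf s -> x <> 0%Z -> (s * (y * y) = A * (x * x))%Z ->
  exists r, (A = s * (r * r))%Z /\ y = (r * x)%Z.
Proof.
  intros s A x y [Hs Hsq] Hx E.
  destruct (coprime_reduce x y Hx) as [g [a [b [Hg [Ea [Eb Hab]]]]]]. subst x y.
  assert (E' : (s * (b * b) = A * (a * a))%Z) by nia.
  assert (Hda : (a * a | s)%Z).
  { apply Z.gauss with (b * b)%Z; [exists A; lia|].
    assert (H1 : Z.gcd a (b * b) = 1%Z) by (apply Zcoprime_mul; assumption).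
    rewrite Z.gcd_comm in H1. rewrite Z.gcd_comm. apply Zcoprime_mul; assumption. }
  apply Hsq in Hda. assert (Ha : a = 1%Z \/ a = (-1)%Z) by (apply Z.divide_1_r; exact Hda).
  destruct Ha as [-> | ->].
  - exists b. split; [lia|ring].
  - exists (- b)%Z. split; [lia|ring].
Qed.

Lemma sqf_square_dvd : forall k x s, sqf s -> k <> 0%Z -> (k * k | x * x * s)%Z -> (k | x)%Z.
Proof.
  intros k x s [Hs Hsq] Hk H.
  destruct (coprime_reduce k x Hk) as [g [a [b [Hg [Ea [Eb Hab]]]]]]. subst k x.
  assert (H1 : (a * a | (b * b) * s)%Z).
  { destruct H as [q Hq]. exists q. nia. }
  assert (H2 : (a * a | s)%Z).
  { apply Z.gauss with (b * b)%Z; [exact H1|].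
    assert (H3 : Z.gcd a (b * b) = 1%Z) by (apply Zcoprime_mul; assumption).
    rewrite Z.gcd_comm in H3. rewrite Z.gcd_comm. apply Zcoprime_mul; assumption. }
  apply Hsq in H2. destruct H2 as [q Hq]. exists (q * b)%Z.
  transitivity (g * b * 1)%Z; [ring|]. rewrite Hq. ring.
Qed.

Lemma sqf_dvd_square : forall s x, sqf s -> (s | x * x)%Z -> (s | x)%Z.
Proof.
  intros s x [Hs Hsq] [q Hq].
  assert (Hs0 : s <> 0%Z) by lia.
  destruct (coprime_reduce s x Hs0) as [g [a [b [Hg [Ea [Eb Hab]]]]]].
  assert (H1 : (a | g * (b * b))%Z) by (exists q; apply (Z.mul_reg_l _ _ g); [lia|]; rewrite Ea, Eb in Hq; lia).
  assert (H2 : (a | g)%Z).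
  { apply Z.gauss with (b * b)%Z; [rewrite Z.mul_comm; exact H1|]. apply Zcoprime_mul; assumption. }
  assert (H3 : (a * a | s)%Z) by (destruct H2 as [c Hc]; exists c; subst; ring).
  apply Hsq in H3. destruct H3 as [c Hc]. exists (c * b)%Z.
  rewrite Eb, Ea. transitivity (g * b * 1)%Z; [ring|]. rewrite Hc. ring.
Qed.

(** ** Stacked bases *)

(** A lattice between [K Z^2] and [Z^2] is [P diag(d, d n) Z^2] with [P] in
    SL2(Z): [d] is the least positive first coordinate of a lattice vector in
    any unimodular basis, so it divides all coordinates in all bases. *)
Lemma stacked_basis : forall (L : Z * Z -> Prop) K, (0 < K)%Z ->
  (forall u v, L u -> L v -> L (fst u - fst v, snd u - snd v)%Z) ->
  L (K, 0%Z) -> L (0%Z, K) ->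
  exists P d n, zdet P = 1%Z /\ (0 < d)%Z /\ (0 < n)%Z /\
    forall v, L v <-> exists x y, v = zapp P (d * x, d * n * y)%Z.
Proof.
  intros L K HK Hsub HL1 HL2.
  assert (H0 : L (0, 0)%Z) by (replace (0, 0)%Z with (K - K, 0 - 0)%Z by (f_equal; ring); apply (Hsub (K, 0%Z) (K, 0%Z)); assumption).
  assert (Hadd : forall u v, L u -> L v -> L (fst u + fst v, snd u + snd v)%Z).
  { intros u v Hu Hv. pose proof (Hsub _ _ H0 Hv) as Hn. pose proof (Hsub _ _ Hu Hn) as H. simpl in H.
    match goal with |- L ?p => match type of H with L ?q => replace p with q by (f_equal; ring) end end. exact H. }
  assert (Hk : forall k v, L v -> L (vscl k v)).
  { intros k v Hv.
    assert (Hn : forall n : nat, L (vscl (Z.of_nat n) v)).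
    { induction n as [|n IH]; [exact H0|]. pose proof (Hadd _ _ IH Hv) as H.
      match type of H with L ?q => replace (vscl (Z.of_nat (S n)) v) with q end; [exact H|].
      rewrite Nat2Z.inj_succ; unfold Z.succ. zv. }
    destruct (Z_le_gt_dec 0 k) as [Hk|Hk].
    - rewrite <- (Z2Nat.id k Hk). apply Hn.
    - pose proof (Hsub _ _ H0 (Hn (Z.to_nat (- k)))) as H. rewrite Z2Nat.id in H by lia.
      match type of H with L ?q => replace (vscl k v) with q end; [exact H|].
      zv. }
  assert (HKall : forall v, L (vscl K v)).
  { intros [x y]. pose proof (Hadd _ _ (Hk x _ HL1) (Hk y _ HL2)) as H.
    match type of H with L ?q => replace (vscl K (x, y)) with q end; [exact H|].
    zv. }
  destruct (nat_least (fun m => (0 < m)%nat /\ exists P y, zdet P = 1%Z /\ L (zapp P (Z.of_nat m, y))))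
    as [m [[Hm [P0 [y0 [DP0 LP0]]]] Hmin]].
  { exists (Z.to_nat K). split; [lia|]. exists (mkZ 1 0 0 1), 0%Z. split; [reflexivity|].
    rewrite Z2Nat.id by lia. match goal with |- L ?p => replace p with (K, 0%Z) by zv end. exact HL1. }
  set (d := Z.of_nat m) in *. assert (Hd : (0 < d)%Z) by (unfold d; lia).
  assert (Hmin' : forall P r y, zdet P = 1%Z -> L (zapp P (r, y)) -> (0 <= r < d)%Z -> r = 0%Z).
  { intros P r y DP H Hr. destruct (Z.eq_dec r 0) as [E|E]; [exact E|exfalso].
    assert (m <= Z.to_nat r)%nat.
    { apply Hmin. split; [lia|]. exists P, y. rewrite Z2Nat.id by lia. auto. }
    unfold d in *. lia. }
  assert (C1 : forall P y, zdet P = 1%Z -> L (zapp P (d, y)) -> exists q, y = (q * d)%Z).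
  { intros P y DP H. exists (y / d)%Z.
    pose proof (Z.div_mod y d ltac:(lia)) as E. pose proof (Z.mod_pos_bound y d Hd) as B.
    assert (R0 : (y mod d)%Z = 0%Z).
    { apply (Hmin' (zmul P (zmul (mkZ 1 0 (y / d) 1) (mkZ 0 (-1) 1 0))) _ (- d)%Z); [| |exact B].
      - rewrite !zdet_mul, DP. unfold zdet; simpl. ring.
      - rewrite !zapp_mul. match goal with |- L (zapp P ?p) => replace p with (d, y) end; [exact H|].
        apply pair_eqZ; unfold zapp; cbn [fst snd za zb zc zd]; [ring|]. rewrite E at 1. ring. }
    lia. }
  destruct (C1 P0 y0 DP0 LP0) as [q0 Hq0].
  set (P := zmul P0 (mkZ 1 0 q0 1)).
  assert (DP : zdet P = 1%Z) by (unfold P; rewrite zdet_mul, DP0; unfold zdet; simpl; ring).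
  assert (Ld : L (zapp P (d, 0%Z))).
  { unfold P. rewrite zapp_mul. match goal with |- L (zapp P0 ?p) => replace p with (d, y0) end; [exact LP0|].
    apply pair_eqZ; unfold zapp; cbn [fst snd za zb zc zd]; [ring|]. rewrite Hq0. ring. }
  assert (Lin : forall x z x' z' k, L (zapp P (x, z)) -> L (zapp P (x', z')) ->
    L (zapp P (x - k * x', z - k * z')%Z)).
  { intros x z x' z' k H H'. pose proof (Hsub _ _ H (Hk k _ H')) as G.
    match type of G with L ?q => match goal with |- L ?p => replace p with q end end; [exact G|]. zv. }
  assert (C2 : forall x z, L (zapp P (x, z)) -> (d | x)%Z /\ (d | z)%Z).
  { intros x z H.
    pose proof (Z.div_mod x d ltac:(lia)) as E. pose proof (Z.mod_pos_bound x d Hd) as B.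
    pose proof (Lin _ _ _ _ (x / d)%Z H Ld) as H1.
    replace (x - x / d * d)%Z with (x mod d)%Z in H1 by lia.
    assert (R0 : (x mod d)%Z = 0%Z) by (eapply Hmin'; [exact DP|exact H1|exact B]).
    rewrite R0 in H1. pose proof (Lin _ _ _ _ (-1)%Z H1 Ld) as H2.
    replace (0 - -1 * d)%Z with d in H2 by ring.
    destruct (C1 P _ DP H2) as [q Hq]. split; [exists (x / d)%Z; lia|exists q; lia]. }
  assert (LK : L (zapp P (0%Z, K))).
  { replace (zapp P (0, K)%Z) with (vscl K (zapp P (0, 1)%Z)) by zv. apply HKall. }
  destruct (nat_least (fun z => (0 < z)%nat /\ L (zapp P (0%Z, Z.of_nat z)))) as [z0 [[Hz0 Lz0] Hzmin]].
  { exists (Z.to_nat K). rewrite Z2Nat.id by lia. split; [lia|exact LK]. }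
  destruct (C2 _ _ Lz0) as [_ [n Hn]].
  exists P, d, n. split; [exact DP|]. split; [exact Hd|]. split; [nia|].
  intros v. split.
  - intros Hv. set (u := zapp (zadj P) v).
    assert (Ev : v = zapp P u).
    { unfold u. rewrite zadj_app', DP. destruct v; unfold vscl; cbn [fst snd]; f_equal; ring. }
    destruct u as [x z]. rewrite Ev in Hv. destruct (C2 _ _ Hv) as [[x' Hx'] _].
    pose proof (Lin _ _ _ _ x' Hv Ld) as H1. replace (x - x' * d)%Z with 0%Z in H1 by lia.
    set (zz := Z.of_nat z0) in *.
    replace (z - x' * 0)%Z with z in H1 by ring.
    pose proof (Z.div_mod z zz ltac:(lia)) as E. pose proof (Z.mod_pos_bound z zz ltac:(lia)) as B.
    pose proof (Lin _ _ _ _ (z / zz)%Z H1 Lz0) as H2.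
    replace (0 - z / zz * 0)%Z with 0%Z in H2 by ring. replace (z - z / zz * zz)%Z with (z mod zz)%Z in H2 by lia.
    assert (R0 : (z mod zz)%Z = 0%Z).
    { destruct (Z.eq_dec (z mod zz) 0) as [E0|E0]; [exact E0|exfalso].
      assert (z0 <= Z.to_nat (z mod zz))%nat by (apply Hzmin; rewrite Z2Nat.id by lia; split; [lia|exact H2]).
      unfold zz in *. lia. }
    exists x', (z / zz)%Z. rewrite Ev. f_equal. f_equal; [lia|]. rewrite E at 1. rewrite R0, Hn. ring.
  - intros [x [y ->]].
    assert (Hx : L (zapp P (d * x, 0)%Z)).
    { replace (zapp P (d * x, 0)%Z) with (vscl x (zapp P (d, 0)%Z)) by zv. apply Hk, Ld. }
    pose proof (Lin _ _ _ _ (- y)%Z Hx Lz0) as H2.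
    match type of H2 with L (zapp P ?q) => match goal with |- L (zapp P ?p) => replace p with q end end; [exact H2|].
    f_equal; [ring|]. rewrite Hn. ring.
Qed.

(** * Maximal commensurable groups have one cusp *)

(** In the basis [A] the matrix [g] is a positive multiple of the integer
    matrix [X]. *)
Definition repA (A : ZM) (g : M2) (X : ZM) : Prop :=
  exists rho, 0 < rho /\ smul rho (M2mul g (zinj A)) = M2mul (zinj A) (zinj X).

Lemma zinj_I : zinj zI = M2one.
Proof. reflexivity. Qed.

Lemma zinj_cancel : forall A g h, zdet A <> 0%Z ->
  M2mul (zinj A) g = M2mul (zinj A) h -> g = h.
Proof.
  intros A g h HA E. apply (f_equal (M2mul (zinj (zadj A)))) in E.
  rewrite !M2mul_assoc, zadj_inj_l, !smul_mul_l, !M2mul_1l in E.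
  apply (f_equal (smul (/ IZR (zdet A)))) in E. rewrite !smul_smul in E.
  assert (IZR (zdet A) <> 0) by (apply not_0_IZR; exact HA).
  rewrite !Rinv_l, !smul_1 in E by assumption. exact E.
Qed.

Lemma repA_mul : forall A g h X Y, repA A g X -> repA A h Y -> repA A (M2mul g h) (zmul X Y).
Proof.
  intros A g h X Y [r [Hr E]] [s [Hs F]]. exists (r * s). split; [nra|].
  rewrite zinj_mul, M2mul_assoc, <- E, smul_mul_l, <- (M2mul_assoc g (zinj A)), <- F,
    smul_mul_r, smul_smul, M2mul_assoc. reflexivity.
Qed.

Lemma repA_det : forall A g X, zdet A <> 0%Z -> det2 g = 1 -> repA A g X ->
  exists rho, 0 < rho /\ IZR (zdet X) = rho * rho /\
    smul rho (M2mul g (zinj A)) = M2mul (zinj A) (zinj X).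
Proof.
  intros A g X HA Dg [r [Hr E]]. exists r. split; [exact Hr|]. split; [|exact E].
  apply (f_equal det2) in E. rewrite smul_det, !det_mul, !zinj_det, Dg in E.
  assert (IZR (zdet A) <> 0) by (apply not_0_IZR; exact HA).
  apply (Rmult_eq_reg_l (IZR (zdet A))); [|assumption]. lra.
Qed.

Lemma repA_det_pos : forall A g X, zdet A <> 0%Z -> det2 g = 1 -> repA A g X -> (0 < zdet X)%Z.
Proof.
  intros A g X HA Dg H. destruct (repA_det A g X HA Dg H) as [r [Hr [E _]]].
  apply lt_IZR. rewrite E. nra.
Qed.

Lemma repA_inv : forall A g X, zdet A <> 0%Z -> det2 g = 1 -> repA A g X -> repA A (M2inv g) (zadj X).
Proof.
  intros A g X HA Dg H. destruct (repA_det A g X HA Dg H) as [r [Hr [D E]]].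
  exists r. split; [exact Hr|].
  apply (f_equal (M2mul (M2inv g))) in E. rewrite smul_mul_r, M2mul_Kl in E by exact Dg.
  apply (f_equal (fun k => M2mul k (zinj (zadj X)))) in E.
  rewrite smul_mul_l, <- !M2mul_assoc, zadj_inj_r, !smul_mul_r, M2mul_1r, D in E.
  apply (f_equal (smul (/ r))) in E. rewrite !smul_smul in E.
  rewrite Rinv_l, smul_1 in E by lra. rewrite E. f_equal. field. lra.
Qed.

Lemma repA_scale : forall A g X X', zdet A <> 0%Z -> repA A g X -> repA A g X' -> zprim X ->
  exists k, (0 < k)%Z /\ X' = zscl k X.
Proof.
  intros A g X X' HA [r [Hr E]] [r' [Hr' E']] [x [y [u [v B]]]].
  assert (F : smul r' (zinj X) = smul r (zinj X')).
  { apply (zinj_cancel A _ _ HA). rewrite !smul_mul_r, <- E, <- E', !smul_smul. f_equal. ring. }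
  set (k := (x * za X' + y * zb X' + u * zc X' + v * zd X')%Z).
  unfold smul, zinj in F. cbn [ma mb mc md] in F. injection F as F1 F2 F3 F4.
  assert (Hk : r * IZR k = r').
  { unfold k. rewrite !plus_IZR, !mult_IZR.
    transitivity (r' * IZR (x * za X + y * zb X + u * zc X + v * zd X)); [|rewrite B; ring].
    rewrite !plus_IZR, !mult_IZR.
    transitivity (IZR x * (r * IZR (za X')) + IZR y * (r * IZR (zb X')) +
      IZR u * (r * IZR (zc X')) + IZR v * (r * IZR (zd X'))); [ring|].
    rewrite <- F1, <- F2, <- F3, <- F4. ring. }
  exists k. split.
  - apply lt_IZR. apply (Rmult_lt_reg_l r); lra.
  - apply ZM_eq; simpl; apply eq_IZR; rewrite mult_IZR; apply (Rmult_eq_reg_l r); try lra;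
      rewrite <- Rmult_assoc, Hk; lra.
Qed.

Lemma repA_unscale : forall A g k X, (0 < k)%Z -> repA A g (zscl k X) -> repA A g X.
Proof.
  intros A g k X Hk [r [Hr E]]. apply IZR_lt in Hk. exists (r / IZR k). split.
  - apply Rdiv_lt_0_compat; assumption.
  - rewrite zinj_scl, smul_mul_r in E. apply (f_equal (smul (/ IZR k))) in E.
    rewrite !smul_smul, Rinv_l, smul_1 in E by lra. rewrite <- E. f_equal. field. lra.
Qed.

Lemma sqf_prim : forall X, sqf (zdet X) -> zprim X.
Proof.
  intros X [H1 H2]. destruct (zcontent X) as [k [N [Hk [E Hp]]]].
  { intros ->. unfold zdet in H1. simpl in H1. lia. }
  assert (k = 1%Z).
  { apply divide_1_pos; [|lia]. apply H2. exists (zdet N). rewrite E, zdet_scl. ring. }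
  subst k. replace X with N; [exact Hp|]. rewrite E. zm.
Qed.

Lemma zprim_adj : forall X, zprim X -> zprim (zadj X).
Proof. intros X [x [y [u [v E]]]]. exists v, (- y)%Z, (- u)%Z, x. simpl. lia. Qed.

(** Conjugating both unipotent subgroups into SL2(Z) shows that the products of
    two entries of [g] have a common denominator. *)
Lemma rep_exists : forall G g, commensurable G -> G g -> exists X, zprim X /\ repA zI g X.
Proof.
  intros G g cG Gg. pose proof (comm_subgrp _ cG) as sG. pose proof (comm_det _ _ cG Gg) as D.
  pose proof (subgrp_inter _ _ sG subgrp_SL2Z) as sI.
  destruct (finite_index_power _ SL2Z sI subgrp_SL2Z (proj2 (proj2 cG))) as [N1 [HN1 P1']].
  destruct (finite_index_power _ G sI sG (proj1 (proj2 cG))) as [N2 [HN2 P2']].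
  assert (U : forall s, SL2Z s -> SL2Z (M2mul (M2mul g (M2pow s (N1 * N2))) (M2inv g))).
  { intros s Hs. rewrite M2pow_mul, <- M2pow_conj by exact D. apply P2'.
    apply sG; [apply subgrp_mul; auto; apply P1', Hs|exact Gg]. }
  set (Q := INR (N1 * N2)).
  assert (HQ : 0 < Q) by (unfold Q; apply lt_0_INR; lia).
  assert (HQi : is_int Q) by (unfold Q; rewrite INR_IZR_INZ; apply is_int_IZR).
  assert (SU : SL2Z (mkM2 1 0 1 1)).
  { split; [unfold det2; simpl; ring|]. simpl. repeat split; apply is_int_IZR. }
  assert (ST : SL2Z (Tmat 1)).
  { split; [apply det_T|]. simpl. repeat split; apply is_int_IZR. }
  assert (EU : forall n, M2pow (mkM2 1 0 1 1) n = mkM2 1 0 (INR n) 1).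
  { induction n as [|n IH]; [reflexivity|]. cbn [M2pow]. rewrite IH, S_INR. apply M2_eq; simpl; ring. }
  pose proof (U _ ST) as UT. pose proof (U _ SU) as UU. clear U.
  rewrite M2pow_T, Rmult_1_r in UT. rewrite EU in UU. fold Q in UT, UU.
  destruct UT as [_ [T1 [T2 [T3 T4]]]]. destruct UU as [_ [U1 [U2 [U3 U4]]]].
  rewrite M2inv_1 in * by exact D. simpl in T1, T2, T3, T4, U1, U2, U3, U4.
  unfold det2 in D. set (a := ma g) in *. set (b := mb g) in *. set (c := mc g) in *. set (d := md g) in *.
  assert (int_eq : forall x y, is_int x -> x = y -> is_int y) by (intros; subst; assumption).
  assert (I1 : is_int 1) by apply is_int_IZR.
  assert (Ac : is_int (Q * (a * c))).
  { apply (int_eq (1 + - ((a * 1 + b * 0) * d + (a * Q + b * 1) * - c))); [apply is_int_plus; [|apply is_int_opp]; assumption|]. nra. }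
  assert (Aa : is_int (Q * (a * a))).
  { apply (int_eq ((a * 1 + b * 0) * - b + (a * Q + b * 1) * a)); [assumption|]. nra. }
  assert (Cc : is_int (Q * (c * c))).
  { apply (int_eq (- ((c * 1 + d * 0) * d + (c * Q + d * 1) * - c))); [apply is_int_opp; assumption|]. nra. }
  assert (Bd : is_int (Q * (b * d))).
  { apply (int_eq (((a * 1 + b * Q) * d + (a * 0 + b * 1) * - c) + - 1)); [apply is_int_plus; [|apply is_int_opp]; assumption|]. nra. }
  assert (Bb : is_int (Q * (b * b))).
  { apply (int_eq (- ((a * 1 + b * Q) * - b + (a * 0 + b * 1) * a))); [apply is_int_opp; assumption|]. nra. }
  assert (Dd : is_int (Q * (d * d))).
  { apply (int_eq ((c * 1 + d * Q) * d + (c * 0 + d * 1) * - c)); [assumption|]. nra. }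
  (* the conjugates of the two nilpotents multiply to those of the idempotents *)
  assert (Ad : is_int (Q * Q * (a * d))).
  { apply (int_eq (- (Q * (a * c)) * (Q * (b * d)) + Q * (a * a) * (Q * (d * d))));
      [apply is_int_plus; apply is_int_mult; try apply is_int_opp; assumption|].
    transitivity (Q * Q * (a * d * (a * d - b * c))); [ring|]. rewrite D. ring. }
  assert (Ab : is_int (Q * Q * (a * b))).
  { apply (int_eq (- (Q * (a * c)) * (Q * (b * b)) + Q * (a * a) * (Q * (b * d))));
      [apply is_int_plus; apply is_int_mult; try apply is_int_opp; assumption|].
    transitivity (Q * Q * (a * b * (a * d - b * c))); [ring|]. rewrite D. ring. }
  assert (Cd : is_int (Q * Q * (c * d))).
  { apply (int_eq (- (Q * (c * c)) * (Q * (b * d)) + Q * (a * c) * (Q * (d * d))));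
      [apply is_int_plus; apply is_int_mult; try apply is_int_opp; assumption|].
    transitivity (Q * Q * (c * d * (a * d - b * c))); [ring|]. rewrite D. ring. }
  assert (Bc : is_int (Q * Q * (b * c))).
  { apply (int_eq (- (Q * (c * c)) * (Q * (b * b)) + Q * (a * c) * (Q * (b * d))));
      [apply is_int_plus; apply is_int_mult; try apply is_int_opp; assumption|].
    transitivity (Q * Q * (b * c * (a * d - b * c))); [ring|]. rewrite D. ring. }
  assert (R : exists t, t <> 0 /\ is_int (t * a) /\ is_int (t * b) /\ is_int (t * c) /\ is_int (t * d)).
  { destruct (Req_dec a 0) as [Ea|Ea].
    - assert (Ec : c <> 0) by (intros E; rewrite Ea, E in D; lra).
      exists (Q * Q * c). split; [apply Rmult_integral_contrapositive; split; nra|].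
      split; [apply (int_eq (Q * (Q * (a * c)))); [apply is_int_mult; assumption|ring]|].
      split; [apply (int_eq (Q * Q * (b * c))); [assumption|ring]|].
      split; [apply (int_eq (Q * (Q * (c * c)))); [apply is_int_mult; assumption|ring]|].
      apply (int_eq (Q * Q * (c * d))); [assumption|ring].
    - exists (Q * Q * a). split; [apply Rmult_integral_contrapositive; split; nra|].
      split; [apply (int_eq (Q * (Q * (a * a)))); [apply is_int_mult; assumption|ring]|].
      split; [apply (int_eq (Q * Q * (a * b))); [assumption|ring]|].
      split; [apply (int_eq (Q * (Q * (a * c)))); [apply is_int_mult; assumption|ring]|].
      apply (int_eq (Q * Q * (a * d))); [assumption|ring]. }
  assert (R' : exists t, 0 < t /\ is_int (t * a) /\ is_int (t * b) /\ is_int (t * c) /\ is_int (t * d)).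
  { destruct R as [t [Ht [A [B [C' D']]]]]. destruct (Rlt_dec 0 t) as [H|H]; [exists t; auto|].
    exists (- t). split; [lra|]. rewrite <- !Ropp_mult_distr_l. repeat split; apply is_int_opp; assumption. }
  destruct R' as [t [Ht [[na A] [[nb B] [[nc C'] [nd D']]]]]].
  destruct (zcontent (mkZ na nb nc nd)) as [k [X [Hk [E Hp]]]].
  { intros E. injection E as -> -> -> ->.
    assert (a = 0 /\ b = 0 /\ c = 0 /\ d = 0) as [Ea [Eb [Ec Ed]]]
      by (repeat split; apply (Rmult_eq_reg_l t); lra).
    rewrite Ea, Eb in D. lra. }
  exists X. split; [exact Hp|]. apply (repA_unscale _ _ k); [exact Hk|]. rewrite <- E.
  exists t. split; [exact Ht|]. rewrite zinj_I, M2mul_1r, M2mul_1l. apply M2_eq; simpl; assumption.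
Qed.

Lemma zI_det : zdet zI <> 0%Z.
Proof. unfold zdet; simpl; lia. Qed.

Lemma repA_I_SL2Z : forall h, SL2Z h -> exists H, zdet H = 1%Z /\ zinj H = h.
Proof.
  intros h [D [[a Ha] [[b Hb] [[c Hc] [d Hd]]]]]. exists (mkZ a b c d). split.
  - apply eq_IZR. rewrite <- zinj_det. rewrite <- D. unfold det2; simpl. rewrite Ha, Hb, Hc, Hd. reflexivity.
  - apply M2_eq; simpl; congruence.
Qed.

Lemma repA_I_inj : forall H, repA zI (zinj H) H.
Proof. intros H. exists 1. split; [lra|]. rewrite smul_1, zinj_I, M2mul_1r, M2mul_1l. reflexivity. Qed.

(** Left multiplication by SL2(Z) preserves the determinant of the primitive
    integer matrix, so only finitely many determinants occur. *)
Lemma rep_bounded : forall G, commensurable G -> exists K, (0 < K)%Z /\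
  forall g X, G g -> zprim X -> repA zI g X -> (zdet X | K)%Z.
Proof.
  intros G cG. pose proof (comm_subgrp _ cG) as sG.
  destruct (transversal _ _ (subgrp_inter _ _ sG subgrp_SL2Z) sG (proj1 (proj2 cG)))
    as [t [_ [Ht [Hcov _]]]].
  assert (K : exists K, (0 < K)%Z /\ forall x, In x t -> exists X, zprim X /\ repA zI x X /\ (zdet X | K)%Z).
  { clear Hcov. induction t as [|x t IH]; [exists 1%Z; split; [lia|intros x []]|].
    destruct IH as [K [HK H]]; [intros; apply Ht; right; assumption|].
    destruct (rep_exists G x cG (Ht x (or_introl eq_refl))) as [X [Hp Hr]].
    pose proof (repA_det_pos _ _ _ zI_det (comm_det _ _ cG (Ht x (or_introl eq_refl))) Hr) as Hd.
    exists (zdet X * K)%Z. split; [nia|]. intros y [<-|Hy].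
    - exists X. split; [exact Hp|]. split; [exact Hr|]. exists K. ring.
    - destruct (H y Hy) as [Y [H1 [H2 H3]]]. exists Y. split; [exact H1|]. split; [exact H2|].
      apply Z.divide_mul_r, H3. }
  destruct K as [K [HK H]]. exists K. split; [exact HK|]. intros g X Gg Hp Hr.
  destruct (Hcov g Gg) as [x [Hx [_ Hz]]]. destruct (H x Hx) as [Y [HYp [HYr HYd]]].
  pose proof (comm_det _ _ cG (Ht x Hx)) as Dx.
  destruct (repA_I_SL2Z _ Hz) as [S [DS ES]].
  assert (R1 : repA zI g (zmul S Y)).
  { replace g with (M2mul (M2mul g (M2inv x)) x) by (apply M2mul_Kr'; exact Dx).
    apply repA_mul; [rewrite <- ES; apply repA_I_inj|exact HYr]. }
  assert (R2 : repA zI x (zmul (zadj S) X)).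
  { replace x with (M2mul (M2inv (M2mul g (M2inv x))) g).
    - apply repA_mul; [|exact Hr]. rewrite <- ES. apply repA_inv; [exact zI_det| |apply repA_I_inj].
      rewrite zinj_det, DS. reflexivity.
    - rewrite M2inv_mul, M2inv_inv by (auto using det_inv; exact (comm_det _ _ cG Gg)).
      apply M2mul_Kr'. exact (comm_det _ _ cG Gg). }
  destruct (repA_scale _ _ _ _ zI_det Hr R1 Hp) as [k [Hk E1]].
  destruct (repA_scale _ _ _ _ zI_det HYr R2 HYp) as [l [Hl E2]].
  pose proof (repA_det_pos _ _ _ zI_det Dx HYr) as PY.
  apply (f_equal zdet) in E1. apply (f_equal zdet) in E2.
  rewrite zdet_mul, zdet_scl, DS in E1. rewrite zdet_mul, zdet_scl, zdet_adj, DS in E2.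
  replace (zdet X) with (zdet Y); [exact HYd|].
  assert (k * k * (l * l) = 1)%Z by nia.
  assert (l = 1%Z) by nia. subst l. lia.
Qed.

Lemma matrix_of_columns : forall T A (c : Z), (forall v, exists w, zapp T v = vscl c (zapp A w)) ->
  exists Y, T = zscl c (zmul A Y).
Proof.
  intros T A c H. destruct (H (1, 0)%Z) as [[p r] E1]. destruct (H (0, 1)%Z) as [[q s] E2].
  unfold zapp, vscl in E1, E2. cbn [fst snd] in E1, E2.
  exists (mkZ p q r s). injection E1 as E11 E12. injection E2 as E21 E22.
  apply ZM_eq; unfold zscl, zmul; cbn [za zb zc zd]; lia.
Qed.

(** The lattice [L] of all [v] with [t v] in [X Z^2], where [X / sqrt (s t^2)]
    runs over [G], is carried by [X] into [t L].  In a basis of [L] the elements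
    of [G] therefore have squarefree determinants [s]. *)
Lemma squarefree_basis : forall G, commensurable G -> exists A K, (0 < zdet A)%Z /\ (0 < K)%Z /\
  forall g, G g -> exists X, repA A g X /\ sqf (zdet X) /\ (zdet X | K)%Z.
Proof.
  intros G cG. pose proof (comm_subgrp _ cG) as sG.
  destruct (rep_bounded G cG) as [K [HK Hbd]].
  set (L := fun v => forall g X s t, G g -> zprim X -> repA zI g X ->
    zdet X = (s * (t * t))%Z -> (0 < t)%Z -> sqf s -> exists w, vscl t v = zapp X w).
  assert (LK : forall v, L (vscl K v)).
  { intros v g X s t Gg Hp Hr E Ht Hs. destruct (Hbd g X Gg Hp Hr) as [q Hq].
    exists (vscl (t * q) (zapp (zadj X) v)). rewrite zapp_vscl, zadj_app', !vscl_vscl. f_equal. rewrite Hq. ring. }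
  destruct (stacked_basis L K HK) as [P [d [n [DP [Hd [Hn HL]]]]]].
  { intros u v Hu Hv g X s t Gg Hp Hr E Ht Hs.
    destruct (Hu g X s t Gg Hp Hr E Ht Hs) as [w1 E1]. destruct (Hv g X s t Gg Hp Hr E Ht Hs) as [w2 E2].
    exists (fst w1 - fst w2, snd w1 - snd w2)%Z.
    injection E1 as E11 E12. injection E2 as E21 E22.
    apply pair_eqZ; unfold vscl, zapp; cbn [fst snd]; lia. }
  { replace (K, 0%Z) with (vscl K (1, 0)%Z) by zv. apply LK. }
  { replace (0%Z, K) with (vscl K (0, 1)%Z) by zv. apply LK. }
  set (A := zmul P (mkZ d 0 0 (d * n))).
  assert (HA : forall v, L v <-> exists w, v = zapp A w).
  { intros v. rewrite HL. split.
    - intros [x [y ->]]. exists (x, y). unfold A. rewrite zapp_mul. f_equal. zv.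
    - intros [[x y] ->]. exists x, y. unfold A. rewrite zapp_mul. f_equal. zv. }
  assert (DA : (0 < zdet A)%Z).
  { unfold A. rewrite zdet_mul, DP. unfold zdet; cbn [za zb zc zd]. nia. }
  exists A, K. split; [exact DA|]. split; [exact HK|]. intros h Gh.
  pose proof (comm_det _ _ cG Gh) as Dh.
  destruct (rep_exists G h cG Gh) as [X [Xp Xr]].
  pose proof (repA_det_pos _ _ _ zI_det Dh Xr) as Xpos.
  destruct (sqf_decomp _ Xpos) as [s [t [Es [Ht Hs]]]].
  assert (Hs0 : (0 < s)%Z) by apply Hs.
  (* [X] maps [L] into [t L]: apply the condition on [v] to h^-1 and to h^-1 g *)
  assert (Stab : forall v, L v -> exists v', L v' /\ zapp X v = vscl t v').
  { intros v Lv.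
    destruct (Lv (M2inv h) (zadj X) s t) as [w Hw]; auto.
    { apply subgrp_inv; assumption. } { apply zprim_adj, Xp. }
    { apply repA_inv; auto using zI_det. } { rewrite zdet_adj; exact Es. }
    assert (Ev' : zapp X v = vscl t (vscl s w)).
    { apply (vscl_inj t); [lia|]. rewrite <- zapp_vscl, Hw, zadj_app', Es, !vscl_vscl. f_equal. ring. }
    exists (vscl s w). split; [|exact Ev'].
    intros g Xg sg tg Gg Xgp Xgr Eg Htg Hsg.
    set (u := M2mul (M2inv h) g).
    assert (Gu : G u) by (apply subgrp_mul; auto; apply subgrp_inv; auto).
    destruct (rep_exists G u cG Gu) as [Xu [Xup Xur]].
    pose proof (repA_det_pos _ _ _ zI_det (comm_det _ _ cG Gu) Xur) as Xupos.
    destruct (sqf_decomp _ Xupos) as [su [tu [Eu [Htu Hsu]]]].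
    destruct (repA_scale _ _ _ (zmul (zadj X) Xg) zI_det Xur) as [k [Hk Ek]]; [|exact Xup|].
    { apply repA_mul; [apply repA_inv; auto using zI_det|exact Xgr]. }
    destruct (Lv u Xu su tu Gu Xup Xur Eu Htu Hsu) as [w2 Hw2].
    pose proof (f_equal zdet Ek) as Dk. rewrite zdet_mul, zdet_adj, zdet_scl, Es, Eg, Eu in Dk.
    destruct (sqf_absorb sg (s * su) (k * tu) (tg * s * t) Hsg) as [r [_ Hr]]; [nia|nia|].
    exists (vscl r w2).
    apply (vscl_inj (k * tu * t)); [nia|].
    transitivity (vscl (tg * (k * tu)) (zapp X v)).
    { rewrite Ev', !vscl_vscl. f_equal. ring. }
    transitivity (vscl (tg * k) (zapp X (zapp Xu w2))).
    { rewrite <- Hw2, zapp_vscl, !vscl_vscl. f_equal. ring. }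
    transitivity (vscl tg (zapp X (zapp (zmul (zadj X) Xg) w2))).
    { rewrite Ek, zapp_zscl, zapp_vscl, vscl_vscl. reflexivity. }
    rewrite zapp_mul, zadj_app', zapp_vscl, !vscl_vscl. f_equal. rewrite Es.
    transitivity (tg * s * t * t)%Z; [ring|]. rewrite Hr. ring. }
  destruct (matrix_of_columns (zmul X A) A t) as [Y HY].
  { intros v. rewrite zapp_mul. destruct (Stab (zapp A v)) as [v' [Lv' E']]; [apply HA; eauto|].
    apply HA in Lv'. destruct Lv' as [w ->]. eauto. }
  exists Y. destruct Xr as [rho [Hrho Er]]. rewrite zinj_I, M2mul_1r, M2mul_1l in Er.
  assert (DY : zdet Y = s).
  { apply (f_equal zdet) in HY. rewrite zdet_scl, !zdet_mul, Es in HY. nia. }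
  split; [|rewrite DY; split; [exact Hs|]].
  - apply (repA_unscale _ _ t _ Ht). exists rho. split; [exact Hrho|].
    rewrite <- smul_mul_l, Er, <- !zinj_mul, HY. f_equal. zm.
  - eapply Z.divide_trans; [|apply (Hbd h X Gh Xp); exists rho; rewrite zinj_I, M2mul_1r, M2mul_1l; auto].
    exists (t * t)%Z. rewrite Es. ring.
Qed.

(** [X / sqrt (zdet X)] is an Atkin-Lehner element of level [N]. *)
Definition AL (N : Z) (X : ZM) : Prop :=
  (0 < zdet X)%Z /\ (zdet X | N)%Z /\ (zdet X | za X)%Z /\ (zdet X | zd X)%Z /\ (N | zc X)%Z.

Section Level.

Variables (G : M2 -> Prop) (A : ZM) (K : Z).
Hypotheses (sG : subgrp G) (DA : (0 < zdet A)%Z).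

(** The squarefree normalisation of the integer matrix of an element. *)
Definition Rsq (g : M2) (X : ZM) : Prop := repA A g X /\ sqf (zdet X) /\ (zdet X | K)%Z.
Hypothesis (Hall : forall g, G g -> exists X, Rsq g X).

Lemma DA0 : zdet A <> 0%Z.
Proof. lia. Qed.

Lemma Rsq_inv : forall g X, G g -> Rsq g X -> Rsq (M2inv g) (zadj X).
Proof.
  intros g X Gg [H1 [H2 H3]]. unfold Rsq. rewrite zdet_adj. split; [|auto].
  apply repA_inv; [exact DA0|exact (subgrp_det _ _ sG Gg)|exact H1].
Qed.

(** Squarefree matrices are primitive, so the product of the integer matrices
    is a multiple of the integer matrix of the product. *)
Lemma Rsq_mul : forall g h X Y, G g -> G h -> Rsq g X -> Rsq h Y ->
  exists k Z, (0 < k)%Z /\ Rsq (M2mul g h) Z /\ zmul X Y = zscl k Z /\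
    (zdet X * zdet Y = k * k * zdet Z)%Z.
Proof.
  intros g h X Y Gg Gh HX HY. destruct (Hall (M2mul g h)) as [Z HZ]; [apply subgrp_mul; assumption|].
  destruct (repA_scale A (M2mul g h) Z (zmul X Y) DA0 (proj1 HZ)) as [k [Hk E]].
  { apply repA_mul; [apply HX|apply HY]. } { apply sqf_prim, HZ. }
  exists k, Z. repeat split; try apply HZ; try assumption.
  apply (f_equal zdet) in E. rewrite zdet_mul, zdet_scl in E. exact E.
Qed.

(** The lattice [d Z + d n Z] below is the intersection of the images [X Z^2].
    Its exponent [d n] is the least common multiple of the determinants, hence
    squarefree.  If a determinant had a factor in common with [d], the
    corresponding matrix would be divisible by it; so [d = 1].  Now (1, 0) lies in
    all images, of [X] and of its adjugate, which makes the first column and the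
    lower row of [X] divisible by its determinant.  The same for products shows
    that all determinants divide the lower left entry. *)
Lemma level_structure : forall d n, (0 < d)%Z -> (0 < n)%Z ->
  (forall v, (forall g X, G g -> Rsq g X -> exists w, v = zapp X w) <->
     exists x y, v = (d * x, d * n * y)%Z) ->
  sqf n /\ forall g X, G g -> Rsq g X -> AL n X.
Proof.
  intros d n Hd Hn HM. set (m := (d * n)%Z). assert (Hm : (0 < m)%Z) by (unfold m; nia).
  (* F1 and F2: [m] is the least common multiple of the determinants *)
  assert (F1 : forall g X, G g -> Rsq g X -> (zdet X | m)%Z).
  { intros g X Gg HX. apply (zdvd_prim _ _ (zadj X)); [apply zprim_adj, sqf_prim, HX|].
    destruct (proj2 (HM (m, 0)%Z)) with (g := g) (X := X) as [[p q] E1]; auto.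
    { exists n, 0%Z. unfold m. f_equal; ring. }
    destruct (proj2 (HM (0, m)%Z)) with (g := g) (X := X) as [[r s] E2]; auto.
    { exists 0%Z, 1%Z. unfold m. f_equal; ring. }
    exists (mkZ p r q s).
    apply (f_equal (zapp (zadj X))) in E1. apply (f_equal (zapp (zadj X))) in E2.
    rewrite zadj_app in E1, E2. injection E1 as E11 E12. injection E2 as E21 E22.
    cbn [fst snd] in *. apply ZM_eq; unfold zscl, zadj in *; cbn [za zb zc zd] in *; lia. }
  assert (F2 : forall N', (forall g X, G g -> Rsq g X -> (zdet X | N')%Z) -> (m | N')%Z).
  { intros N' H. destruct (proj1 (HM (0, N')%Z)) as [x [y E]].
    - intros g X Gg HX. destruct (H g X Gg HX) as [q Hq].
      exists (vscl q (zapp (zadj X) (0, 1)%Z)). rewrite zapp_vscl, zadj_app', vscl_vscl, Hq. zv.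
    - injection E as _ E. exists y. unfold m. lia. }
  assert (F3 : sqf m).
  { split; [exact Hm|]. intros e [k Hk].
    assert (H : (m | k * e)%Z).
    { apply F2. intros g X Gg HX. apply sqf_dvd_square; [apply HX|].
      destruct (F1 g X Gg HX) as [q Hq]. exists (q * k)%Z.
      replace (k * e * (k * e))%Z with (m * k)%Z by (rewrite Hk; ring). rewrite Hq. ring. }
    destruct H as [q Hq]. exists q.
    assert (k * e <> 0)%Z by (intros E; rewrite Z.mul_assoc, E in Hk; lia).
    apply (Z.mul_reg_l _ _ (k * e)); [assumption|]. rewrite Z.mul_1_r. rewrite Hq at 1. rewrite Hk. ring. }
  assert (F4 : d = 1%Z).
  { destruct (classic (forall g X, G g -> Rsq g X -> Z.gcd (zdet X) d = 1%Z)) as [H|H].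
    - assert (Hmn : (m | n)%Z).
      { apply F2. intros g X Gg HX. apply Z.gauss with d; [exact (F1 g X Gg HX)|apply (H g X Gg HX)]. }
      destruct Hmn as [q Hq]. unfold m in Hq.
      apply divide_1_pos; [|lia]. exists q. apply (Z.mul_reg_r _ _ n); [lia|]. lia.
    - exfalso. apply H. intros g X Gg HX. set (dl := Z.gcd (zdet X) d).
      assert (Hdl : (0 < dl)%Z).
      { pose proof (Z.gcd_nonneg (zdet X) d). assert (dl <> 0%Z) by (intros E; apply Z.gcd_eq_0_r in E; lia).
        unfold dl in *; lia. }
      assert (Hdld : (dl | d)%Z) by apply Z.gcd_divide_r.
      assert (Hdlm : (dl | m)%Z) by (apply Z.divide_mul_l; exact Hdld).
      destruct Hdlm as [K0 HK0].
      (* [K0 X Z^2] lies in all images, where [m = K0 dl]; hence [dl] divides [K0 X] *)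
      assert (HM' : forall e, exists x y, vscl K0 (zapp X e) = (d * x, d * n * y)%Z).
      { intros e. apply HM. intros h Y Gh HY.
        destruct (Rsq_mul (M2inv h) g (zadj Y) X) as [k [Z0 [Hk [HZ [Ek Dk]]]]]; auto.
        { apply subgrp_inv; assumption. } { apply Rsq_inv; assumption. }
        rewrite zdet_adj in Dk.
        assert (Hkap : (Z.gcd (zdet Y) (zdet X) | k)%Z).
        { apply (sqf_square_dvd _ _ (zdet Z0)); [apply HZ| |].
          - intros E. apply Z.gcd_eq_0_l in E. destruct HY as [_ [[HY _] _]]. lia.
          - rewrite <- Dk.
            destruct (Z.gcd_divide_l (zdet Y) (zdet X)) as [p Hp].
            destruct (Z.gcd_divide_r (zdet Y) (zdet X)) as [q Hq].
            set (gg := Z.gcd (zdet Y) (zdet X)) in *. exists (p * q)%Z. rewrite Hp, Hq. ring. }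
        assert (HsK : (zdet Y | K0 * k)%Z).
        { destruct (Z.gcd_bezout _ _ _ (eq_refl (Z.gcd (zdet Y) dl))) as [p [q Hpq]].
          assert (H1 : (zdet Y | K0 * Z.gcd (zdet Y) dl)%Z).
          { destruct (F1 h Y Gh HY) as [c Hc]. exists (K0 * p + q * c)%Z. rewrite <- Hpq.
            transitivity (K0 * p * zdet Y + q * (K0 * dl))%Z; [ring|]. rewrite <- HK0, Hc. ring. }
          eapply Z.divide_trans; [exact H1|]. apply Z.mul_divide_mono_l.
          eapply Z.divide_trans; [|exact Hkap]. apply Z.gcd_greatest; [apply Z.gcd_divide_l|].
          eapply Z.divide_trans; [apply Z.gcd_divide_r|]. apply Z.gcd_divide_l. }
        destruct HsK as [q Hq]. exists (vscl q (zapp Z0 e)).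
        apply (vscl_inj (zdet Y)); [destruct HY as [_ [[HY _] _]]; lia|].
        transitivity (vscl K0 (zapp Y (zapp (zmul (zadj Y) X) e))).
        { rewrite zapp_mul, zadj_app', !vscl_vscl. f_equal. ring. }
        rewrite Ek, zapp_zscl, !zapp_vscl, !vscl_vscl. f_equal. lia. }
      destruct (HM' (1, 0)%Z) as [x1 [y1 E1]]. destruct (HM' (0, 1)%Z) as [x2 [y2 E2]].
      unfold vscl, zapp in E1, E2. cbn [fst snd] in E1, E2. injection E1 as E11 E12. injection E2 as E21 E22.
      assert (Hco : Z.gcd dl K0 = 1%Z).
      { apply divide_1_pos; [|apply Z.gcd_nonneg]. apply F3.
        destruct (Z.gcd_divide_l dl K0) as [p Hp]. destruct (Z.gcd_divide_r dl K0) as [q Hq].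
        set (gg := Z.gcd dl K0) in *. exists (q * p)%Z. rewrite HK0, Hp, Hq. ring. }
      destruct Hdld as [c Hc].
      assert (D1 : (dl | za X)%Z) by (apply Z.gauss with K0; [exists (c * x1)%Z; rewrite Hc in *; lia|exact Hco]).
      assert (D2 : (dl | zc X)%Z) by (apply Z.gauss with K0; [exists (c * n * y1)%Z; rewrite Hc in *; lia|exact Hco]).
      assert (D3 : (dl | zb X)%Z) by (apply Z.gauss with K0; [exists (c * x2)%Z; rewrite Hc in *; lia|exact Hco]).
      assert (D4 : (dl | zd X)%Z) by (apply Z.gauss with K0; [exists (c * n * y2)%Z; rewrite Hc in *; lia|exact Hco]).
      destruct D1 as [q1 D1], D2 as [q2 D2], D3 as [q3 D3], D4 as [q4 D4].
      apply divide_1_pos; [|lia]. apply (zdvd_prim dl 1 X); [apply sqf_prim, HX|].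
      exists (mkZ q1 q3 q2 q4). apply ZM_eq; unfold zscl; cbn [za zb zc zd]; lia. }
  subst d. assert (Em : m = n) by (unfold m; ring). rewrite Em in *.
  split; [exact F3|].
  assert (Hcol : forall g X, G g -> Rsq g X ->
    (zdet X | za X)%Z /\ (zdet X | zc X)%Z /\ (zdet X | zd X)%Z).
  { intros g X Gg HX.
    destruct (proj2 (HM (1, 0)%Z)) with (g := M2inv g) (X := zadj X) as [[p q] E1];
      [exists 1%Z, 0%Z; f_equal; ring|apply subgrp_inv; assumption|apply Rsq_inv; assumption|].
    destruct (proj2 (HM (1, 0)%Z)) with (g := g) (X := X) as [[r s] E2];
      [exists 1%Z, 0%Z; f_equal; ring|assumption|assumption|].
    apply (f_equal (zapp X)) in E1. rewrite zadj_app' in E1.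
    apply (f_equal (zapp (zadj X))) in E2. rewrite zadj_app in E2.
    injection E1 as E11 E12. injection E2 as E21 E22. cbn [fst snd za zc zd zadj] in *.
    split; [exists p; lia|]. split; [exists q; lia|exists r; lia]. }
  intros g X Gg HX. pose proof HX as [_ [[Hpos _] _]].
  destruct (Hcol g X Gg HX) as [C1 [C2 C3]].
  split; [exact Hpos|]. split; [exact (F1 g X Gg HX)|]. split; [exact C1|]. split; [exact C3|].
  apply F2. intros h Y Gh HY.
  set (u := M2mul (M2inv h) g).
  assert (Gu : G u) by (apply subgrp_mul; auto; apply subgrp_inv; auto).
  destruct (Hall u Gu) as [U HU].
  destruct (repA_scale A g X (zmul Y U) DA0 (proj1 HX)) as [k [Hk Ek]].
  { replace g with (M2mul h u) by (apply M2mul_Kl', (subgrp_det _ _ sG Gh)).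
    apply repA_mul; [apply HY|apply HU]. } { apply sqf_prim, HX. }
  pose proof (f_equal zdet Ek) as Dk. rewrite zdet_mul, zdet_scl in Dk.
  destruct (Hcol h Y Gh HY) as [_ [[p Hp] [q Hq]]]. destruct (Hcol u U Gu HU) as [[r Hr] [[s Hs] _]].
  pose proof (f_equal zc Ek) as Ec. unfold zmul, zscl in Ec. cbn [zc] in Ec.
  rewrite Hp, Hr, Hq, Hs in Ec.
  assert (Ec' : (k * zdet X * (p * r + q * s) = zc X)%Z).
  { apply (Z.mul_reg_l _ _ k); [lia|]. rewrite <- Ec.
    transitivity (k * k * zdet X * (p * r + q * s))%Z; [ring|]. rewrite <- Dk. ring. }
  eapply Z.divide_trans; [|exists (p * r + q * s)%Z; rewrite Z.mul_comm; symmetry; exact Ec'].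
  apply sqf_dvd_square; [apply HY|]. exists (zdet U * zdet X)%Z.
  transitivity (k * k * zdet X * zdet X)%Z; [ring|]. rewrite <- Dk. ring.
Qed.

End Level.

Lemma repA_change : forall A B g X Y, repA A g X -> zmul X B = zmul B Y -> repA (zmul A B) g Y.
Proof.
  intros A B g X Y [r [Hr E]] H. exists r. split; [exact Hr|].
  rewrite !zinj_mul, M2mul_assoc, <- smul_mul_l, E, <- !M2mul_assoc, <- !zinj_mul, H. reflexivity.
Qed.

Lemma zadj_conj : forall P X, zdet P = 1%Z -> zmul X P = zmul P (zmul (zadj P) (zmul X P)).
Proof.
  intros P X D. rewrite zmul_assoc. transitivity (zmul (zscl (zdet P) zI) (zmul X P)).
  - rewrite D. zm.
  - f_equal. zm.
Qed.

(** The intersection of the lattices [X Z^2] has an adapted basis [P], and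
    changing the basis by [P] does not change the determinants. *)
Lemma atkin_lehner_basis : forall G, commensurable G -> exists C N, (0 < zdet C)%Z /\ sqf N /\
  forall g, G g -> exists X, repA C g X /\ AL N X.
Proof.
  intros G cG. pose proof (comm_subgrp _ cG) as sG.
  destruct (squarefree_basis G cG) as [A [K [DA [HK Hall]]]].
  assert (DA0 : zdet A <> 0%Z) by lia.
  set (M := fun v => forall g X, G g -> Rsq A K g X -> exists w, v = zapp X w).
  assert (MK : forall v, M (vscl K v)).
  { intros v g X Gg [HX [_ [q Hq]]]. exists (vscl q (zapp (zadj X) v)).
    rewrite zapp_vscl, zadj_app', vscl_vscl, Hq. reflexivity. }
  destruct (stacked_basis M K HK) as [P [d [n [DP [Hd [Hn HM]]]]]].
  { intros u v Hu Hv g X Gg HX. destruct (Hu g X Gg HX) as [w1 E1]. destruct (Hv g X Gg HX) as [w2 E2].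
    exists (fst w1 - fst w2, snd w1 - snd w2)%Z. subst. zv. }
  { replace (K, 0%Z) with (vscl K (1, 0)%Z) by zv. apply MK. }
  { replace (0%Z, K) with (vscl K (0, 1)%Z) by zv. apply MK. }
  set (B := zmul A P).
  assert (DB : (0 < zdet B)%Z) by (unfold B; rewrite zdet_mul, DP; lia).
  assert (Hto : forall g X, Rsq A K g X -> Rsq B K g (zmul (zadj P) (zmul X P))).
  { intros g X [H1 H2]. unfold Rsq. rewrite !zdet_mul, zdet_adj, DP, Z.mul_1_l, Z.mul_1_r.
    split; [|exact H2]. apply (repA_change A P g X); [exact H1|]. apply zadj_conj, DP. }
  assert (Hfrom : forall g Y, Rsq B K g Y -> Rsq A K g (zmul P (zmul Y (zadj P)))).
  { intros g Y [H1 H2]. unfold Rsq. rewrite !zdet_mul, zdet_adj, DP, Z.mul_1_l, Z.mul_1_r.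
    split; [|exact H2].
    replace A with (zmul B (zadj P)).
    2: { unfold B. rewrite <- zmul_assoc. transitivity (zmul A (zscl (zdet P) zI)); [f_equal; zm|].
         rewrite DP. zm. }
    apply (repA_change B (zadj P) g Y); [exact H1|].
    rewrite zmul_assoc. transitivity (zmul (zscl (zdet P) zI) (zmul Y (zadj P))); [rewrite DP; zm|].
    f_equal. zm. }
  destruct (level_structure G B K sG DB) with (d := d) (n := n) as [Hsq HAL]; try assumption.
  { intros g Gg. destruct (Hall g Gg) as [X HX]. eexists. apply Hto, HX. }
  { intros v. split.
    - intros H. assert (Mv : M (zapp P v)).
      { intros g X Gg HX. destruct (H g _ Gg (Hto g X HX)) as [w ->].
        exists (zapp P w). rewrite <- !zapp_mul, <- zadj_conj by exact DP. reflexivity. }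
      apply HM in Mv. destruct Mv as [x [y E]]. exists x, y.
      apply (f_equal (zapp (zadj P))) in E. rewrite !zadj_app, DP in E.
      apply (vscl_inj 1); [lia|exact E].
    - intros [x [y ->]] g Y Gg HY.
      assert (Mv : M (zapp P (d * x, d * n * y)%Z)) by (apply HM; eauto).
      destruct (Mv g _ Gg (Hfrom g Y HY)) as [w E]. exists (zapp (zadj P) w).
      rewrite !zapp_mul in E. apply (f_equal (zapp (zadj P))) in E. rewrite !zadj_app, DP in E.
      apply (vscl_inj 1); [lia|exact E]. }
  exists B, n. split; [exact DB|]. split; [exact Hsq|].
  intros g Gg. destruct (Hall g Gg) as [X HX].
  exists (zmul (zadj P) (zmul X P)). split; [apply (Hto g X HX)|apply (HAL g _ Gg (Hto g X HX))].
Qed.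

(** ** The group Gamma_0(N)+ in the basis [C] *)

Definition G0plus (C : ZM) (N : Z) (g : M2) : Prop :=
  det2 g = 1 /\ exists X, repA C g X /\ AL N X.

Lemma AL_adj : forall N X, AL N X -> AL N (zadj X).
Proof.
  intros N X [H1 [H2 [H3 [H4 H5]]]]. unfold AL. rewrite zdet_adj. cbn [zadj za zb zc zd].
  repeat split; auto. apply Z.divide_opp_r, H5.
Qed.

(** If the determinants are g a and g b with a, b coprime, the product is g
    times a matrix of determinant a b. *)
Lemma AL_mul : forall N X Y, AL N X -> AL N Y ->
  exists k Z, (0 < k)%Z /\ zmul X Y = zscl k Z /\ AL N Z.
Proof.
  intros N X Y [X1 [X2 [X3 [X4 X5]]]] [Y1 [Y2 [Y3 [Y4 Y5]]]].
  assert (Hx0 : zdet X <> 0%Z) by lia.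
  destruct (coprime_reduce (zdet X) (zdet Y) Hx0) as [g [a [b [Hg [Ea [Eb Hab]]]]]].
  assert (Ha : (0 < a)%Z) by nia. assert (Hb : (0 < b)%Z) by nia.
  assert (HN : exists n', (N = g * a * b * n')%Z).
  { destruct X2 as [x Hx]. destruct Y2 as [y Hy]. rewrite Ea in Hx. rewrite Eb in Hy.
    assert (H : (b | a * x)%Z) by (exists y; apply (Z.mul_reg_l _ _ g); [lia|]; lia).
    apply Z.gauss in H; [|rewrite Z.gcd_comm; exact Hab]. destruct H as [n' Hn'].
    exists n'. rewrite Hx, Hn'. ring. }
  destruct HN as [n' HN].
  destruct X3 as [a1 X3], X4 as [d1 X4], X5 as [c1 X5], Y3 as [a2 Y3], Y4 as [d2 Y4], Y5 as [c2 Y5].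
  rewrite Ea in X3, X4. rewrite Eb in Y3, Y4. rewrite HN in X5, Y5.
  set (Z0 := mkZ (a * b * (g * a1 * a2 + n' * zb X * c2)) (a * a1 * zb Y + b * zb X * d2)
    (N * (c1 * b * a2 + a * d1 * c2)) (a * b * (n' * c1 * zb Y + g * d1 * d2))).
  assert (E : zmul X Y = zscl g Z0).
  { apply ZM_eq; unfold zmul, zscl, Z0; cbn [za zb zc zd]; rewrite ?X3, ?X4, ?X5, ?Y3, ?Y4, ?Y5, ?HN; ring. }
  assert (DZ : zdet Z0 = (a * b)%Z).
  { apply (f_equal zdet) in E. rewrite zdet_mul, zdet_scl, Ea, Eb in E. nia. }
  exists g, Z0. split; [exact Hg|]. split; [exact E|]. unfold AL. rewrite DZ. unfold Z0; cbn [za zb zc zd].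
  split; [nia|]. split; [exists (g * n')%Z; rewrite HN; ring|].
  split; [eexists; apply Z.mul_comm|]. split; [eexists; apply Z.mul_comm|].
  eexists; apply Z.mul_comm.
Qed.

Lemma G0plus_subgrp : forall C N, (0 < zdet C)%Z -> (0 < N)%Z -> subgrp (G0plus C N).
Proof.
  intros C N DC HN. assert (DC0 : zdet C <> 0%Z) by lia. split; [intros g H; apply H|split].
  - split; [apply det_one|]. exists zI. split.
    + exists 1. split; [lra|]. rewrite smul_1, zinj_I, M2mul_1l, M2mul_1r. reflexivity.
    + unfold AL, zdet, zI; cbn [za zb zc zd]. change (1 * 1 - 0 * 0)%Z with 1%Z.
      repeat split; try lia; try apply Z.divide_1_l. exists 0%Z; ring.
  - intros g h [Dg [X [RX AX]]] [Dh [Y [RY AY]]].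
    split; [apply det_mul1; [exact Dg|apply det_inv, Dh]|].
    destruct (AL_mul N X (zadj Y) AX (AL_adj N Y AY)) as [k [Z0 [Hk [E AZ]]]].
    exists Z0. split; [|exact AZ]. apply (repA_unscale _ _ k); [exact Hk|]. rewrite <- E.
    apply repA_mul; [exact RX|]. apply repA_inv; assumption.
Qed.

(** Any such matrix, divided by the square root of its determinant, comes from
    SL2(R). *)
Lemma G0plus_elem : forall C N X, (0 < zdet C)%Z -> AL N X -> exists g, G0plus C N g /\ repA C g X.
Proof.
  intros C N X DC AX. pose proof AX as [HX _]. apply IZR_lt in HX. apply IZR_lt in DC.
  set (g := smul (/ (sqrt (IZR (zdet X)) * IZR (zdet C))) (M2mul (M2mul (zinj C) (zinj X)) (zinj (zadj C)))).
  assert (Hs : 0 < sqrt (IZR (zdet X))) by (apply sqrt_lt_R0; exact HX).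
  assert (Hss : sqrt (IZR (zdet X)) * sqrt (IZR (zdet X)) = IZR (zdet X)) by (apply sqrt_sqrt; lra).
  assert (R : repA C g X).
  { exists (sqrt (IZR (zdet X))). split; [exact Hs|]. unfold g.
    rewrite smul_mul_l, <- M2mul_assoc, zadj_inj_l, smul_mul_r, M2mul_1r, !smul_smul.
    rewrite <- (smul_1 (M2mul (zinj C) (zinj X))) at 2. f_equal. field. lra. }
  exists g. split; [|exact R]. split; [|eauto].
  unfold g. rewrite smul_det, !det_mul, !zinj_det, zdet_adj.
  set (s := sqrt (IZR (zdet X))) in *. rewrite <- Hss. field. lra.
Qed.

Definition zcong (Q : Z) (X Y : ZM) : Prop := exists W, X = mkZ (za Y + Q * za W) (zb Y + Q * zb W)
  (zc Y + Q * zc W) (zd Y + Q * zd W).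

Definition residues (Q : Z) (X : ZM) : Z * Z * Z * Z := (za X mod Q, zb X mod Q, zc X mod Q, zd X mod Q)%Z.

Lemma residues_cong : forall Q X Y, (0 < Q)%Z -> residues Q X = residues Q Y -> zcong Q X Y.
Proof.
  intros Q X Y HQ E. injection E as E1 E2 E3 E4.
  exists (mkZ (za X / Q - za Y / Q) (zb X / Q - zb Y / Q) (zc X / Q - zc Y / Q) (zd X / Q - zd Y / Q)).
  apply ZM_eq; cbn [za zb zc zd].
  - pose proof (Z.div_mod (za X) Q ltac:(lia)). pose proof (Z.div_mod (za Y) Q ltac:(lia)). lia.
  - pose proof (Z.div_mod (zb X) Q ltac:(lia)). pose proof (Z.div_mod (zb Y) Q ltac:(lia)). lia.
  - pose proof (Z.div_mod (zc X) Q ltac:(lia)). pose proof (Z.div_mod (zc Y) Q ltac:(lia)). lia.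
  - pose proof (Z.div_mod (zd X) Q ltac:(lia)). pose proof (Z.div_mod (zd Y) Q ltac:(lia)). lia.
Qed.

Definition zrange (n : Z) : list Z := map Z.of_nat (seq 0 (Z.to_nat n)).

Lemma in_zrange : forall n x, (0 <= x < n)%Z -> In x (zrange n).
Proof.
  intros n x H. unfold zrange. apply in_map_iff. exists (Z.to_nat x). split; [lia|]. apply in_seq. lia.
Qed.

Definition allres (Q : Z) : list (Z * Z * Z * Z) :=
  list_prod (list_prod (list_prod (zrange Q) (zrange Q)) (zrange Q)) (zrange Q).

Lemma in_allres : forall Q X, (0 < Q)%Z -> In (residues Q X) (allres Q).
Proof.
  intros Q X H. unfold residues, allres. repeat apply in_prod; apply in_zrange, Z.mod_pos_bound, H.
Qed.

Lemma zcong_adj : forall Q X Y, zcong Q X Y -> exists W,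
  zmul X (zadj Y) = mkZ (zdet Y + Q * za W) (Q * zb W) (Q * zc W) (zdet Y + Q * zd W).
Proof.
  intros Q X Y [W ->]. exists (zmul W (zadj Y)). apply ZM_eq; unfold zmul, zadj, zdet; cbn [za zb zc zd]; ring.
Qed.

(** Conjugation by [C] turns a congruence modulo [zdet C] into integrality. *)
Lemma conj_integral : forall C k U, zmul C (zmul (mkZ (1 + k * zdet C * za U) (k * zdet C * zb U)
    (k * zdet C * zc U) (1 + k * zdet C * zd U)) (zadj C)) =
  zscl (zdet C) (let V := zmul C (zmul U (zadj C)) in
    mkZ (1 + k * za V) (k * zb V) (k * zc V) (1 + k * zd V)).
Proof. intros. cbv zeta. zm. Qed.

(** The determinant and the residues modulo [N * zdet C] separate the cosets of
    the intersection with SL2(Z), on both sides. *)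
Lemma G0plus_comm : forall C N, (0 < zdet C)%Z -> (0 < N)%Z -> commensurable (G0plus C N).
Proof.
  intros C N DC HN. pose proof (G0plus_subgrp C N DC HN) as sG.
  assert (DC0 : zdet C <> 0%Z) by lia.
  set (Q := (N * zdet C)%Z). assert (HQ : (0 < Q)%Z) by (unfold Q; nia).
  split; [apply (proj1 (subgrp_iff _)), sG|]. split.
  - apply (finite_index_intro (Z * (Z * Z * Z * Z)) _ _ (list_prod (zrange (N + 1)) (allres Q))
      (fun g v => exists X, repA C g X /\ AL N X /\ v = (zdet X, residues Q X))).
    + intros g H; apply H.
    + intros g [Dg [X [RX AX]]]. exists (zdet X, residues Q X). split; [|eauto].
      apply in_prod; [|apply in_allres, HQ]. apply in_zrange. destruct AX as [H1 [H2 _]].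
      apply Z.divide_pos_le in H2; lia.
    + intros g h v Gg Gh [X [RX [AX EX]]] [Y [RY [AY EY]]]. split; [apply sG; assumption|].
      rewrite EX in EY. injection EY as ED ER.
      assert (Hc : zcong Q X Y) by (apply residues_cong; [exact HQ|]; unfold residues; congruence).
      destruct (zcong_adj Q X Y Hc) as [W HW].
      pose proof AY as [Ypos [[q Hq] _]].
      set (U := mkZ (1 + q * zdet C * za W) (q * zdet C * zb W) (q * zdet C * zc W) (1 + q * zdet C * zd W)).
      assert (EU : zmul X (zadj Y) = zscl (zdet Y) U).
      { rewrite HW. unfold Q, U. rewrite Hq. zm. }
      assert (RU : repA C (M2mul g (M2inv h)) U).
      { apply (repA_unscale _ _ (zdet Y)); [exact Ypos|]. rewrite <- EU.
        apply repA_mul; [exact RX|]. apply repA_inv; [exact DC0|apply Gh|exact RY]. }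
      assert (Dk : det2 (M2mul g (M2inv h)) = 1) by (apply det_mul1; [apply Gg|apply det_inv, Gh]).
      destruct (repA_det _ _ _ DC0 Dk RU) as [rho [Hrho [Er RE]]].
      assert (DU : zdet U = 1%Z).
      { apply (f_equal zdet) in EU. rewrite zdet_mul, zdet_adj, zdet_scl, ED in EU. nia. }
      rewrite DU in Er. assert (rho = 1) by nra. subst rho. rewrite smul_1 in RE.
      apply (f_equal (fun k => M2mul k (zinj (zadj C)))) in RE.
      rewrite <- !M2mul_assoc, zadj_inj_r, !M2mul_assoc, smul_mul_r, M2mul_1r in RE.
      rewrite <- !zinj_mul, <- zmul_assoc in RE. unfold U in RE. rewrite conj_integral, zinj_scl in RE.
      apply (f_equal (smul (/ IZR (zdet C)))) in RE. rewrite !smul_smul in RE.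
      rewrite Rinv_l, !smul_1 in RE by (apply not_0_IZR; exact DC0).
      split; [exact Dk|]. rewrite RE. simpl. repeat split; apply is_int_IZR.
  - apply (finite_index_intro (Z * Z * Z * Z) _ _ (allres Q)
      (fun g v => exists X, zinj X = g /\ zdet X = 1%Z /\ v = residues Q X)).
    + intros g H; apply H.
    + intros g Hg. destruct (repA_I_SL2Z g Hg) as [X [DX EX]]. exists (residues Q X).
      split; [apply in_allres, HQ|eauto].
    + intros g h v Gg Gh [X [EX [DX RX]]] [Y [EY [DY RY]]].
      assert (HZ : SL2Z (M2mul g (M2inv h))) by (apply subgrp_SL2Z; assumption).
      split; [|exact HZ].
      assert (Hc : zcong Q X Y) by (apply residues_cong; [exact HQ|]; congruence).
      destruct (zcong_adj Q X Y Hc) as [W HW]. rewrite DY in HW.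
      assert (EV : M2mul g (M2inv h) = zinj (zmul X (zadj Y))).
      { rewrite zinj_mul, EX. f_equal. rewrite M2inv_1 by apply Gh. rewrite <- EY.
        apply M2_eq; simpl; rewrite ?opp_IZR; reflexivity. }
      split; [apply HZ|].
      set (V := zmul (zadj C) (zmul W (zadj (zadj C)))).
      exists (mkZ (1 + N * za V) (N * zb V) (N * zc V) (1 + N * zd V)). split.
      * exists 1. split; [lra|]. rewrite smul_1, EV, HW, <- !zinj_mul. f_equal.
        unfold V, Q. zm.
      * assert (DV : zdet (mkZ (1 + N * za V) (N * zb V) (N * zc V) (1 + N * zd V)) = 1%Z).
        { pose proof (conj_integral (zadj C) N W) as CI. cbv zeta in CI. fold V in CI.
          apply (f_equal zdet) in CI. rewrite zdet_scl, !zdet_mul, !zdet_adj in CI.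
          assert (DW : zdet (mkZ (1 + N * zdet C * za W) (N * zdet C * zb W) (N * zdet C * zc W)
            (1 + N * zdet C * zd W)) = 1%Z).
          { apply (f_equal zdet) in HW. rewrite zdet_mul, zdet_adj, DX, DY in HW. symmetry. exact HW. }
          rewrite DW in CI. nia. }
        unfold AL. rewrite DV. cbn [za zb zc zd]. repeat split; try lia; try apply Z.divide_1_l.
        eexists; apply Z.mul_comm.
Qed.

(** Every cusp [x / y] is the image of oo under an Atkin-Lehner matrix: with
    [f = gcd y N] and [N = e f] take the one of determinant [e]. *)
Lemma AL_transitive : forall N x y, sqf N -> (x <> 0 \/ y <> 0)%Z ->
  exists X, AL N X /\ (za X * y = zc X * x)%Z.
Proof.
  intros N x y HN Hxy. pose proof HN as [Npos Nsq].
  assert (Red : exists g x' y', g <> 0%Z /\ (x = g * x')%Z /\ (y = g * y')%Z /\ Z.gcd x' y' = 1%Z).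
  { destruct (Z.eq_dec x 0) as [->|Hx].
    - exists y, 0%Z, 1%Z. repeat split; lia.
    - destruct (coprime_reduce x y Hx) as [g [a [b [Hg [Ea [Eb Hab]]]]]]. exists g, a, b. repeat split; auto; lia. }
  destruct Red as [g [x' [y' [Hg [Ex [Ey Hco]]]]]].
  assert (N0 : N <> 0%Z) by lia.
  destruct (coprime_reduce N y' N0) as [f [e [c [Hf [EN [Ec Hec]]]]]].
  assert (He : (0 < e)%Z) by nia.
  assert (Hef : Z.gcd e f = 1%Z).
  { apply divide_1_pos; [|apply Z.gcd_nonneg]. apply Nsq.
    destruct (Z.gcd_divide_l e f) as [p Hp]. destruct (Z.gcd_divide_r e f) as [q Hq].
    set (h := Z.gcd e f) in *. exists (q * p)%Z. rewrite EN, Hp, Hq. ring. }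
  assert (Hgc : Z.gcd (e * x') (f * c) = 1%Z).
  { rewrite Z.gcd_comm. apply Zcoprime_mul.
    - rewrite Z.gcd_comm. apply Zcoprime_mul; assumption.
    - rewrite <- Ec, Z.gcd_comm. exact Hco. }
  destruct (Z.gcd_bezout _ _ _ Hgc) as [d [b Hdb]].
  set (X := mkZ (e * x') (- b) (N * c) (e * d)).
  assert (DX : zdet X = e).
  { unfold zdet, X; cbn [za zb zc zd]. rewrite EN.
    transitivity (e * (d * (e * x') + b * (f * c)))%Z; [ring|]. rewrite Hdb. ring. }
  exists X. split.
  - unfold AL. rewrite DX. unfold X; cbn [za zb zc zd]. split; [exact He|].
    split; [exists f; exact EN|]. repeat split; eexists; apply Z.mul_comm.
  - unfold X; cbn [za zc]. rewrite Ex, Ey, Ec, EN. ring.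
Qed.

(** The points C^-1 oo and C^-1 (x / y) are both images of oo under
    Atkin-Lehner matrices. *)
Lemma G0plus_transitive : forall C N x y, (0 < zdet C)%Z -> sqf N -> (x <> 0 \/ y <> 0)%Z ->
  exists g, G0plus C N g /\ ma g * IZR y = mc g * IZR x.
Proof.
  intros C N x y DC HN Hxy. assert (DC0 : zdet C <> 0%Z) by lia.
  assert (nz : forall a c, (a <> 0 \/ c <> 0)%Z -> (zd C * a - zb C * c <> 0 \/ za C * c - zc C * a <> 0)%Z).
  { intros a c H. destruct (Z.eq_dec (zd C * a - zb C * c) 0) as [E1|E1]; [right|left; exact E1].
    intros E2. assert (zdet C * a = 0 /\ zdet C * c = 0)%Z as [F1 F2].
    { split.
      - transitivity (za C * (zd C * a - zb C * c) + zb C * (za C * c - zc C * a))%Z; [unfold zdet; ring|].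
        rewrite E1, E2. ring.
      - transitivity (zc C * (zd C * a - zb C * c) + zd C * (za C * c - zc C * a))%Z; [unfold zdet; ring|].
        rewrite E1, E2. ring. }
    apply Z.mul_eq_0 in F1. apply Z.mul_eq_0 in F2. lia. }
  destruct (AL_transitive N _ _ HN (nz 1%Z 0%Z ltac:(lia))) as [X0 [A0 E0]].
  destruct (AL_transitive N _ _ HN (nz x y Hxy)) as [X1 [A1 E1]].
  destruct (G0plus_elem C N X0 DC A0) as [g0 [G0 R0]].
  destruct (G0plus_elem C N X1 DC A1) as [g1 [G1 R1]].
  assert (sG : subgrp (G0plus C N)) by (apply G0plus_subgrp; [exact DC|apply HN]).
  exists (M2mul g1 (M2inv g0)). split; [apply sG; assumption|].
  destruct (repA_mul C _ _ _ _ R1 (repA_inv C g0 X0 DC0 (proj1 G0) R0)) as [rho [Hrho E]].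
  apply (f_equal (fun k => M2mul k (zinj (zadj C)))) in E.
  rewrite smul_mul_l, <- !M2mul_assoc, zadj_inj_r in E.
  rewrite (M2mul_assoc g1), smul_mul_r, M2mul_1r, smul_smul, <- !zinj_mul in E.
  set (g := M2mul g1 (M2inv g0)) in *.
  set (W := zmul C (zmul (zmul X1 (zadj X0)) (zadj C))) in *.
  assert (HW : (za W * y = zc W * x)%Z).
  { set (al := (zd X0 * zd C + zb X0 * zc C)%Z).
    assert (Z1 : (za X0 * zc C + zc X0 * zd C = 0)%Z) by lia.
    assert (EW1 : za W = (al * (za C * za X1 + zb C * zc X1) + (za C * zb X1 + zb C * zd X1) * - (za X0 * zc C + zc X0 * zd C))%Z)
      by (unfold W, al, zmul, zadj; cbn [za zb zc zd]; ring).
    assert (EW2 : zc W = (al * (zc C * za X1 + zd C * zc X1) + (zc C * zb X1 + zd C * zd X1) * - (za X0 * zc C + zc X0 * zd C))%Z)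
      by (unfold W, al, zmul, zadj; cbn [za zb zc zd]; ring).
    rewrite Z1 in EW1, EW2. rewrite EW1, EW2.
    assert (H : (za X1 * (za C * y - zc C * x) - zc X1 * (zd C * x - zb C * y) = 0)%Z) by lia.
    apply Zminus_eq. transitivity (al * (za X1 * (za C * y - zc C * x) - zc X1 * (zd C * x - zb C * y)))%Z; [ring|].
    rewrite H. ring. }
  apply (f_equal IZR) in HW. rewrite !mult_IZR in HW.
  assert (Ea : rho * IZR (zdet C) * ma g = IZR (za W)) by (change (ma (smul (rho * IZR (zdet C)) g) = ma (zinj W)); rewrite E; reflexivity).
  assert (Ec : rho * IZR (zdet C) * mc g = IZR (zc W)) by (change (mc (smul (rho * IZR (zdet C)) g) = mc (zinj W)); rewrite E; reflexivity).
  apply IZR_lt in DC. apply (Rmult_eq_reg_l (rho * IZR (zdet C))); [|nra].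
  rewrite <- !Rmult_assoc, Ea, Ec. exact HW.
Qed.

(** Helling: a maximal commensurable group is some Gamma_0(N)+, up to
    conjugation in GL2(Q). *)
Theorem maximal_transitive : forall G, maximal_commensurable G ->
  G (M2opp M2one) /\
  forall x y : Z, (x <> 0 \/ y <> 0)%Z -> exists g, G g /\ ma g * IZR y = mc g * IZR x.
Proof.
  intros G [cG Hmax].
  destruct (atkin_lehner_basis G cG) as [C [N [DC [HN Hall]]]].
  assert (HG : forall g, G0plus C N g -> G g).
  { apply Hmax; [apply G0plus_comm; [exact DC|apply HN]|].
    intros g Gg. split; [exact (comm_det _ _ cG Gg)|apply Hall, Gg]. }
  split.
  - apply HG. split; [rewrite det_opp; apply det_one|]. exists (mkZ (-1) 0 0 (-1)). split.
    + exists 1. split; [lra|]. apply M2_eq; simpl; ring.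
    + unfold AL, zdet; cbn [za zb zc zd]. change (-1 * -1 - 0 * 0)%Z with 1%Z.
      repeat split; try lia; try apply Z.divide_1_l. exists 0%Z; ring.
  - intros x y Hxy. destruct (G0plus_transitive C N x y DC HN Hxy) as [g [Gg E]].
    exists g. split; [apply HG, Gg|exact E].
Qed.

(** * The residue theorem *)

Lemma Csum_perm : forall l m, Permutation l m -> Csum l = Csum m.
Proof. intros l m H. induction H; simpl; try congruence; try ring. Qed.

Lemma Csum_plus : forall (A : Type) (f g : A -> C) l,
  Csum (map (fun x => f x + g x)%C l) = (Csum (map f l) + Csum (map g l))%C.
Proof. intros A f g l. induction l as [|x l IH]; simpl; [ring|]. rewrite IH. ring. Qed.

Lemma Csum_scal : forall (A : Type) c (f : A -> C) l,
  Csum (map (fun x => c * f x)%C l) = (c * Csum (map f l))%C.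
Proof. intros A c f l. induction l as [|x l IH]; simpl; [ring|]. rewrite IH. ring. Qed.

Lemma Csum_ext : forall (A : Type) (f g : A -> C) l, (forall x, In x l -> f x = g x) ->
  Csum (map f l) = Csum (map g l).
Proof. intros A f g l H. f_equal. apply map_ext_in. exact H. Qed.

Definition is_transversal (S B : M2 -> Prop) (t : list M2) : Prop :=
  NoDup t /\ (forall x, In x t -> B x) /\
  (forall g, B g -> exists x, In x t /\ S (M2mul g (M2inv x))) /\
  (forall x y, In x t -> In y t -> S (M2mul x (M2inv y)) -> x = y).

(** For instance a primitive of an invariant differential, the constants being
    its periods. *)
Definition qinv (B : M2 -> Prop) (F : C -> C) : Prop :=
  forall b, B b -> exists k, forall z, upper z -> F (moebius b z) = (F z + k)%C.

(** Transfer: summing over coset representatives extends quasi-invariance,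
    because right multiplication permutes the cosets. *)
Lemma transfer : forall S B t F, subgrp S -> subgrp B -> (forall g, S g -> B g) ->
  is_transversal S B t -> qinv S F ->
  qinv B (fun z => Csum (map (fun x => F (moebius x z)) t)).
Proof.
  intros S B t F sS sB Hsub [T1 [T2 [T3 T4]]] HF b Bb.
  assert (DB : forall g, B g -> det2 g = 1) by (intros g; apply subgrp_det, sB).
  assert (Hy : forall x, exists y, In x t -> In y t /\ S (M2mul (M2mul x b) (M2inv y))).
  { intros x. destruct (classic (In x t)) as [Hx|Hx]; [|exists x; tauto].
    destruct (T3 (M2mul x b)) as [y Hy]; [apply subgrp_mul; auto|]. exists y; auto. }
  destruct (choice _ Hy) as [y Hy'].
  assert (Hk : forall x, exists k, In x t -> forall z, upper z ->
    F (moebius x (moebius b z)) = (F (moebius (y x) z) + k)%C).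
  { intros x. destruct (classic (In x t)) as [Hx|Hx]; [|exists (RtoC 0); tauto].
    destruct (Hy' x Hx) as [Hy1 Hy2]. destruct (HF _ Hy2) as [k Hk]. exists k. intros _ z Hz.
    rewrite <- Hk by (apply moebius_upper; auto).
    rewrite <- !moebius_mul; auto using det_mul1, det_inv, moebius_upper.
    rewrite M2mul_Kr' by auto. reflexivity. }
  destruct (choice _ Hk) as [k Hk'].
  assert (P : Permutation (map y t) t).
  { apply NoDup_Permutation_bis.
    - apply NoDup_map_NoDup_ForallPairs; [|exact T1]. intros u v Hu Hv E.
      apply T4; auto. destruct (Hy' u Hu) as [Y1 Y2]. destruct (Hy' v Hv) as [Y3 Y4]. rewrite E in Y2.
      pose proof (proj2 (proj2 sS) _ _ Y2 Y4) as H.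
      rewrite M2inv_mul, M2inv_inv, M2inv_mul in H by auto using det_mul1, det_inv.
      rewrite M2mul_assoc, M2mul_Kr', M2mul_assoc, M2mul_Kr in H by auto. exact H.
    - rewrite length_map. lia.
    - intros v Hv. apply in_map_iff in Hv. destruct Hv as [u [<- Hu]]. apply (Hy' u Hu). }
  exists (Csum (map k t)). intros z Hz.
  rewrite (Csum_ext _ _ (fun x => F (moebius (y x) z) + k x)%C) by (intros x Hx; apply Hk'; assumption).
  rewrite Csum_plus. f_equal.
  rewrite <- (map_map y (fun v => F (moebius v z))). apply Csum_perm, Permutation_map, P.
Qed.

(** The abelianization of SL2(Z) kills [T] up to torsion: [S^2] and [(S T)^3]
    are scalar. *)
Lemma SL2Z_qinv_T : forall F, qinv SL2Z F -> forall z n, upper z -> F (z + RtoC (INR n))%C = F z.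
Proof.
  intros F HF.
  set (Sm := mkM2 0 (-1) 1 0).
  assert (Z0 : is_int 0) by apply is_int_IZR. assert (Z1 : is_int 1) by apply is_int_IZR.
  assert (Zm : is_int (-1)) by apply is_int_IZR.
  assert (HS : SL2Z Sm) by (split; [unfold det2; simpl; ring|simpl; auto]).
  assert (HT : SL2Z (Tmat 1)) by (split; [apply det_T|simpl; auto]).
  pose proof (proj1 HS) as DS. pose proof (det_T 1) as DT.
  destruct (HF _ HS) as [kS ES]. destruct (HF _ HT) as [kT ET].
  assert (U : upper Ci) by apply upper_Ci.
  assert (HkS : (kS + kS)%C = RtoC 0).
  { assert (E : F (moebius (M2mul Sm Sm) Ci) = (F Ci + (kS + kS))%C).
    { rewrite moebius_mul, ES, ES by auto using moebius_upper. ring. }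
    replace (M2mul Sm Sm) with (M2opp M2one) in E by (apply M2_eq; simpl; ring).
    rewrite moebius_opp, moebius_one in E by auto using det_one.
    replace (kS + kS)%C with (F Ci + (kS + kS) - F Ci)%C by ring. rewrite <- E. ring. }
  set (ST := M2mul Sm (Tmat 1)). assert (DST : det2 ST = 1) by (apply det_mul1; assumption).
  assert (EST : forall z, upper z -> F (moebius ST z) = (F z + (kS + kT))%C).
  { intros z Hz. unfold ST. rewrite moebius_mul, ES, ET by auto using moebius_upper. ring. }
  assert (H3 : ((kS + kT) + (kS + kT) + (kS + kT))%C = RtoC 0).
  { assert (E : F (moebius (M2mul ST (M2mul ST ST)) Ci) = (F Ci + ((kS + kT) + (kS + kT) + (kS + kT)))%C).
    { rewrite !moebius_mul by auto using det_mul1, moebius_upper.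
      rewrite !EST by auto using moebius_upper. ring. }
    replace (M2mul ST (M2mul ST ST)) with (M2opp M2one) in E by (unfold ST; apply M2_eq; simpl; ring).
    rewrite moebius_opp, moebius_one in E by auto using det_one.
    match goal with |- ?x = _ => replace x with (F Ci + x - F Ci)%C by ring end. rewrite <- E. ring. }
  assert (N2 : RtoC 2 <> RtoC 0) by (intros E; apply RtoC_inj in E; lra).
  assert (N3 : RtoC 3 <> RtoC 0) by (intros E; apply RtoC_inj in E; lra).
  assert (K1 : kS = RtoC 0).
  { assert (E : (RtoC 2 * kS)%C = RtoC 0) by (rewrite <- HkS; ring).
    apply Cmult_integral in E. tauto. }
  assert (K2 : kT = RtoC 0).
  { assert (E : (RtoC 3 * kT)%C = RtoC 0) by (rewrite <- H3, K1; ring).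
    apply Cmult_integral in E. tauto. }
  intros z n Hz. induction n as [|n IH].
  - simpl. f_equal. ring.
  - rewrite S_INR, RtoC_plus, Cplus_assoc. rewrite <- IH.
    rewrite <- (moebius_T 1). rewrite ET by (apply upper_shift, Hz). rewrite K2. ring.
Qed.

Definition pm (G : M2 -> Prop) (g : M2) : Prop := G g \/ G (M2opp g).

Lemma pm_subgrp : forall G, subgrp G -> subgrp (pm G).
Proof.
  intros G sG. split; [|split].
  - intros g [H|H]; apply (subgrp_det _ _ sG) in H; rewrite ?det_opp in H; exact H.
  - left. apply sG.
  - intros g h Hg Hh. assert (Dh : det2 h = 1).
    { destruct Hh as [H|H]; apply (subgrp_det _ _ sG) in H; rewrite ?det_opp in H; exact H. }
    destruct Hg as [Hg|Hg]; destruct Hh as [Hh|Hh].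
    + left. apply sG; assumption.
    + right. rewrite <- M2opp_mul_r, <- M2inv_opp by exact Dh. apply sG; assumption.
    + right. rewrite <- M2opp_mul_l. apply sG; assumption.
    + left. replace (M2mul g (M2inv h)) with (M2mul (M2opp g) (M2inv (M2opp h))); [apply sG; assumption|].
      rewrite M2inv_opp by exact Dh. rewrite M2opp_mul_l, M2opp_mul_r, M2opp_opp. reflexivity.
Qed.

Lemma iter_shift : forall (F : C -> C) (r : R) k, (forall z, upper z -> F (z + RtoC r)%C = (F z + k)%C) ->
  forall n z, upper z -> F (z + RtoC (INR n * r))%C = (F z + RtoC (INR n) * k)%C.
Proof.
  intros F r k H n z Hz. induction n as [|n IH].
  - simpl. rewrite Rmult_0_l. replace (z + RtoC 0)%C with z by ring. ring.
  - rewrite S_INR, Rmult_plus_distr_r, Rmult_1_l, RtoC_plus, Cplus_assoc, H by (apply upper_shift, Hz).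
    rewrite IH, RtoC_plus. ring.
Qed.

Lemma iter_shift_Z : forall (F : C -> C) (r : R) k, (forall z, upper z -> F (z + RtoC r)%C = (F z + k)%C) ->
  forall n z, upper z -> F (z + RtoC (IZR n * r))%C = (F z + RtoC (IZR n) * k)%C.
Proof.
  intros F r k H n z Hz. destruct (Z_le_gt_dec 0 n) as [Hn|Hn].
  - rewrite <- (Z2Nat.id n Hn), <- INR_IZR_INZ. apply iter_shift; assumption.
  - pose proof (iter_shift F r k H (Z.to_nat (- n)) (z + RtoC (IZR n * r))%C (upper_shift _ _ Hz)) as E.
    rewrite INR_IZR_INZ, Z2Nat.id, opp_IZR in E by lia.
    replace (z + RtoC (IZR n * r) + RtoC (- IZR n * r))%C with z in E
      by (rewrite <- Cplus_assoc, <- RtoC_plus; replace (IZR n * r + - IZR n * r) with 0 by ring; ring).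
    rewrite E, RtoC_opp. ring.
Qed.

(** A primitive [Phi] of the weight 2 form is quasi-invariant; transfer it to [H],
    then to SL2(Z), where translations act trivially.  All cusps of SL2(Z) lead to
    the one cusp of [H], so each translation of SL2(Z) contributes a positive
    multiple of the sum. *)
Lemma residue_sum : forall (G H : M2 -> Prop) (phi : C -> C) (c : M2 -> C) t,
  commensurable G -> maximal_commensurable H -> (forall g, G g -> H g) ->
  (forall g z, G g -> upper z -> phi (moebius g z) = (jfac g z * jfac g z * phi z)%C) ->
  (forall l, H l -> exists Phi, forall z, upper z ->
     cderiv Phi z (phi (moebius l z) * / (jfac l z * jfac l z))%C /\
     Phi (z + RtoC (width (conjg G l)))%C = (Phi z + RtoC (width (conjg G l)) * c l)%C) ->
  is_transversal (pm G) H t ->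
  Csum (map c t) = RtoC 0.
Proof.
  intros G H phi c t cG mH Hsub Hinv Hprim Ht.
  destruct (maximal_transitive H mH) as [Hm1 Htrans]. destruct mH as [cH _].
  pose proof (comm_subgrp _ cG) as sG. pose proof (comm_subgrp _ cH) as sH.
  assert (DH : forall g, H g -> det2 g = 1) by (intros g; apply subgrp_det, sH).
  destruct (Hprim M2one) as [Phi HPhi]; [apply sH|].
  assert (DPhi : forall z, upper z -> cderiv Phi z (phi z)).
  { intros z Hz. eapply cderiv_eq; [apply HPhi, Hz|].
    rewrite moebius_one, jfac_det1 by apply det_one. simpl. field. }
  assert (Dl : forall l z, H l -> upper z ->
    cderiv (fun w => Phi (moebius l w)) z (phi (moebius l z) * / (jfac l z * jfac l z))%C).
  { intros l z Hl Hz. apply (cderiv_comp Phi (moebius l)).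
    - apply DPhi, moebius_upper; auto.
    - apply cderiv_moebius; auto. }
  assert (Cst : forall F1 F2 d, (forall z, upper z -> cderiv F1 z (d z)) ->
    (forall z, upper z -> cderiv F2 z (d z)) -> forall z w, upper z -> upper w ->
    (F1 z - F2 z)%C = (F1 w - F2 w)%C).
  { intros F1 F2 d H1 H2 z w Hz Hw.
    assert (E : forall z w, upper z -> upper w -> (F1 z + - (1) * F2 z)%C = (F1 w + - (1) * F2 w)%C).
    { apply (cderiv_zero_const (fun z => F1 z + - (1) * F2 z)%C). intros x Hx.
      eapply cderiv_eq; [apply cderiv_plus; [apply H1, Hx|apply cderiv_scal, H2, Hx]|]. ring. }
    specialize (E z w Hz Hw). replace (F1 z - F2 z)%C with (F1 z + - (1) * F2 z)%C by ring. rewrite E. ring. }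
  (* increments of Phi along the translations at each cusp *)
  assert (Per : forall l r, H l -> transl (conjg G l) r -> forall z, upper z ->
    Phi (moebius l (z + RtoC r)%C) = (Phi (moebius l z) + RtoC r * c l)%C).
  { intros l r Hl Hr z Hz.
    destruct (comm_conj G H l cG cH Hsub Hl) as [cC _].
    destruct (width_spec _ cC) as [Hw Hiff]. apply Hiff in Hr. destruct Hr as [n ->].
    set (w := width (conjg G l)) in *.
    destruct (Hprim l Hl) as [Pl HPl]. fold w in HPl.
    assert (E1 : forall x, upper x -> Phi (moebius l (x + RtoC w)%C) = (Phi (moebius l x) + RtoC w * c l)%C).
    { intros x Hx. pose proof (Cst _ _ _ (fun z Hz => Dl l z Hl Hz) (fun z Hz => proj1 (HPl z Hz))
        (x + RtoC w)%C x (upper_shift _ _ Hx) Hx) as E.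
      rewrite (proj2 (HPl x Hx)) in E. cbv beta in E.
      replace (Phi (moebius l (x + RtoC w)%C))
        with (Phi (moebius l (x + RtoC w)%C) - (Pl x + RtoC w * c l) + (Pl x + RtoC w * c l))%C by ring.
      rewrite E. ring. }
    pose proof (iter_shift_Z (fun x => Phi (moebius l x)) w _ E1 n z Hz) as E. cbv beta in E.
    rewrite E, RtoC_mult. ring. }
  assert (Q1 : qinv (pm G) Phi).
  { assert (K : forall g, G g -> exists k, forall z, upper z -> Phi (moebius g z) = (Phi z + k)%C).
    { intros g Gg. exists (Phi (moebius g Ci) - Phi Ci)%C. intros z Hz.
      assert (D' : forall z, upper z -> cderiv (fun w => Phi (moebius g w)) z (phi z)).
      { intros x Hx. eapply cderiv_eq; [apply Dl; auto|]. rewrite Hinv by assumption.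
        pose proof (jfac_nz g x (DH g (Hsub g Gg)) Hx). field. assumption. }
      pose proof (Cst _ _ _ D' DPhi z Ci Hz upper_Ci) as E. cbv beta in E. rewrite <- E. ring. }
    intros g [Gg|Gg]; [apply K, Gg|]. destruct (K _ Gg) as [k Hk]. exists k. intros z Hz.
    rewrite <- Hk by exact Hz. rewrite <- (M2opp_opp g) at 1. apply f_equal, moebius_opp; [|exact Hz].
    exact (DH _ (Hsub _ Gg)). }
  assert (HsubP : forall g, pm G g -> H g).
  { intros g [Gg|Gg]; [apply Hsub, Gg|]. rewrite <- (M2opp_opp g), <- (M2mul_1l (M2opp g)), <- M2opp_mul_l.
    apply subgrp_mul; auto. }
  set (Psi := fun z => Csum (map (fun x => Phi (moebius x z)) t)).
  pose proof (transfer _ _ t Phi (pm_subgrp G sG) sH HsubP Ht Q1) as Q2. fold Psi in Q2.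
  set (Sc := Csum (map c t)).
  (* compute the period of a multiple of [r] that is a translation at each cusp *)
  assert (PsiT : forall r, H (Tmat r) -> forall z, upper z -> Psi (z + RtoC r)%C = (Psi z + RtoC r * Sc)%C).
  { intros r Hr.
    destruct (finite_index_power G H sG sH (comm_index G H cG cH Hsub)) as [N [HN HP]].
    assert (E1 : forall z, upper z -> Psi (z + RtoC (INR N * r))%C = (Psi z + RtoC (INR N * r) * Sc)%C).
    { intros z Hz. unfold Psi, Sc. rewrite <- Csum_scal, <- Csum_plus. apply Csum_ext. intros x Hx.
      assert (Hx' : H x) by apply Ht, Hx.
      apply Per; auto. left. unfold conjg. rewrite <- M2pow_T, <- M2pow_conj by auto.
      apply HP. apply sH; auto. apply subgrp_mul; auto. }
    destruct (Q2 _ Hr) as [k Hk].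
    assert (E2 : forall z, upper z -> Psi (z + RtoC r)%C = (Psi z + k)%C).
    { intros z Hz. rewrite <- moebius_T. apply Hk, Hz. }
    assert (Ek : k = (RtoC r * Sc)%C).
    { pose proof (iter_shift Psi r k E2 N Ci upper_Ci) as E3. rewrite (E1 Ci upper_Ci) in E3.
      assert (NN : RtoC (INR N) <> RtoC 0).
      { intros E. apply RtoC_inj in E. apply lt_0_INR in HN. lra. }
      assert (E4 : (RtoC (INR N) * (k - RtoC r * Sc))%C = RtoC 0).
      { transitivity (Psi Ci + RtoC (INR N) * k - (Psi Ci + RtoC (INR N * r) * Sc))%C;
          [rewrite RtoC_mult; ring|]. rewrite <- E3. ring. }
      apply Cmult_integral in E4. destruct E4 as [E4|E4]; [contradiction|].
      replace k with (k - RtoC r * Sc + RtoC r * Sc)%C by ring. rewrite E4. ring. }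
    intros z Hz. rewrite E2, Ek by exact Hz. reflexivity. }
  pose proof (subgrp_inter _ _ sH subgrp_SL2Z) as sI.
  destruct (transversal _ _ sI subgrp_SL2Z (proj2 (proj2 cH))) as [t2 Ht2].
  pose proof (transfer _ SL2Z t2 Psi sI subgrp_SL2Z (fun g Hg => proj2 Hg) Ht2
    (fun g Hg => Q2 g (proj1 Hg))) as Q3.
  set (Om := fun z => Csum (map (fun x => Psi (moebius x z)) t2)) in Q3.
  destruct (finite_index_power _ _ sI subgrp_SL2Z (proj2 (proj2 cH))) as [N [HN HP]].
  pose proof (SL2Z_qinv_T Om Q3 Ci N upper_Ci) as E0.
  assert (Step : forall g, SL2Z g -> exists p, 0 < p /\
    Psi (moebius g (Ci + RtoC (INR N))%C) = (Psi (moebius g Ci) + RtoC p * Sc)%C).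
  { intros g Hg. pose proof Hg as [Dg [[a Ha] [_ [[cc Hc] _]]]].
    destruct (Htrans a cc) as [l [Hl El]].
    { destruct (Z.eq_dec a 0) as [Ea|Ea]; [right|left; exact Ea]. intros Ec. subst.
      unfold det2 in Dg. rewrite Ha, Hc in Dg. lra. }
    rewrite <- Ha, <- Hc in El.
    set (u := M2mul (M2inv l) g).
    assert (Du : det2 u = 1) by (apply det_mul1; auto using det_inv).
    assert (Hcu : mc u = 0) by (unfold u; rewrite M2inv_1 by auto; simpl; lra).
    assert (Hg' : g = M2mul l u) by (unfold u; rewrite M2mul_Kl' by auto; reflexivity).
    clearbody u.
    (* conjugation by the triangular [u] scales translations by a square *)
    set (p := INR N * (ma u * ma u)).
    assert (Hau : ma u <> 0).
    { intros E. unfold det2 in Du. rewrite E, Hcu in Du. lra. }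
    assert (Ep : M2mul u (Tmat (INR N)) = M2mul (Tmat p) u).
    { unfold p. unfold det2 in Du. rewrite Hcu in Du. apply M2_eq; simpl; rewrite ?Hcu; try ring.
      transitivity (INR N * ma u * (ma u * md u - mb u * 0) + mb u); [rewrite Du; ring|ring]. }
    exists p. split; [unfold p; apply Rmult_lt_0_compat; [apply lt_0_INR, HN|]; pose proof (Rsqr_pos_lt _ Hau); unfold Rsqr in *; lra|].
    assert (HTp : H (Tmat p)).
    { destruct (HP (M2mul (M2mul g (Tmat 1)) (M2inv g))) as [HT _].
      - apply subgrp_SL2Z; [apply subgrp_mul; auto using subgrp_SL2Z|exact Hg].
        split; [apply det_T|]. simpl. repeat split; apply is_int_IZR.
      - rewrite M2pow_conj, M2pow_T, Rmult_1_r in HT by exact Dg.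
        replace (Tmat p) with (M2mul (M2mul (M2inv l) (M2mul (M2mul g (Tmat (INR N))) (M2inv g))) l).
        + apply subgrp_mul; auto. apply subgrp_mul; auto. apply subgrp_inv; auto.
        + rewrite Hg', M2inv_mul by auto. rewrite <- !M2mul_assoc, M2mul_Kl by auto.
          rewrite M2inv_l, M2mul_1r by auto. rewrite (M2mul_assoc u), Ep, M2mul_Kr by auto. reflexivity. }
    destruct (Q2 l Hl) as [k Hk].
    assert (Hun : upper (Ci + RtoC (INR N))%C) by (apply upper_shift, upper_Ci).
    rewrite Hg', !moebius_mul by auto using upper_Ci.
    rewrite !Hk by (apply moebius_upper; auto using upper_Ci).
    rewrite <- moebius_T, <- moebius_mul, Ep, moebius_mul, moebius_T by auto using det_T, upper_Ci.
    rewrite PsiT by (auto; apply moebius_upper; auto using upper_Ci). ring. }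
  assert (Tot : forall l : list M2, (forall g, In g l -> SL2Z g) -> exists p, 0 <= p /\ (l <> nil -> 0 < p) /\
    Csum (map (fun g => Psi (moebius g (Ci + RtoC (INR N))%C)) l) =
    (Csum (map (fun g => Psi (moebius g Ci)) l) + RtoC p * Sc)%C).
  { induction l as [|g l IH]; intros Hall.
    - exists 0. split; [lra|]. split; [intros E; contradiction|]. simpl. ring.
    - destruct IH as [p [Hp [_ E]]]; [intros; apply Hall; right; assumption|].
      destruct (Step g (Hall g (or_introl eq_refl))) as [q [Hq E']].
      exists (q + p). split; [lra|]. split; [intros _; lra|].
      cbn [map Csum fold_right]. fold (Csum (map (fun g => Psi (moebius g (Ci + RtoC (INR N))%C)) l)).
      fold (Csum (map (fun g => Psi (moebius g Ci)) l)). rewrite E, E', RtoC_plus. ring. }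
  destruct (Tot t2) as [p [_ [Hp E]]]; [intros g Hg; apply Ht2, Hg|].
  assert (Hne : t2 <> nil).
  { intros E2. destruct Ht2 as [_ [_ [Hcov _]]]. destruct (Hcov M2one) as [x [Hx _]]; [apply subgrp_SL2Z|].
    rewrite E2 in Hx. contradiction. }
  specialize (Hp Hne).
  assert (E1 : (RtoC p * Sc)%C = RtoC 0).
  { unfold Om in E0. rewrite E in E0.
    replace (RtoC p * Sc)%C with (Csum (map (fun x => Psi (moebius x Ci)) t2) + RtoC p * Sc -
      Csum (map (fun x => Psi (moebius x Ci)) t2))%C by ring. rewrite E0. ring. }
  apply Cmult_integral in E1. destruct E1 as [E1|E1]; [apply RtoC_inj in E1; lra|exact E1].
Qed.

(** ** Counting cosets in a cusp class *)

Definition cusp_eq (G : M2 -> Prop) (l x : M2) : Prop :=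
  exists mu r, G mu /\ (l = M2mul (M2mul mu x) (Tmat r) \/ l = M2opp (M2mul (M2mul mu x) (Tmat r))).

Lemma pm_cusp_eq : forall G l x r, det2 x = 1 -> subgrp G -> pm G (M2mul l (M2inv (M2mul x (Tmat r)))) -> cusp_eq G l x.
Proof.
  intros G l x r Dx sG H.
  assert (E : M2mul (M2mul (M2mul l (M2inv (M2mul x (Tmat r)))) x) (Tmat r) = l).
  { rewrite <- M2mul_assoc. apply M2mul_Kr'. apply det_mul1; auto using det_T. }
  destruct H as [H|H].
  - exists (M2mul l (M2inv (M2mul x (Tmat r)))), r. split; [exact H|left; symmetry; exact E].
  - exists (M2opp (M2mul l (M2inv (M2mul x (Tmat r))))), r. split; [exact H|right].
    rewrite !M2opp_mul_l, M2opp_opp, E. reflexivity.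
Qed.

Lemma indicator_sum : forall (A : Type) (P : A -> Prop) (b : C) (l : list A),
  Csum (map (fun x => if excluded_middle_informative (P x) then b else RtoC 0) l) =
  (RtoC (INR (length (filter (fun x => if excluded_middle_informative (P x) then true else false) l))) * b)%C.
Proof.
  intros A P b l. induction l as [|x l IH]; [simpl; ring|].
  cbn [map Csum fold_right filter]. fold (Csum (map (fun x => if excluded_middle_informative (P x) then b else RtoC 0) l)).
  rewrite IH. destruct (excluded_middle_informative (P x)).
  - cbn [length]. rewrite S_INR, RtoC_plus. ring.
  - ring.
Qed.

(** The cosets in the class of [x] are those of [x T^(j w)], with [w] the width
    of [H] and [0 <= j < width (conjg G x) / w]. *)
Lemma cusp_count : forall G H t x, commensurable G -> commensurable H -> (forall g, G g -> H g) ->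
  H (M2opp M2one) -> is_transversal (pm G) H t -> H x ->
  exists n : nat, INR n * width H = width (conjg G x) /\
    forall b, Csum (map (fun l => if excluded_middle_informative (cusp_eq G l x) then b else RtoC 0) t) = (RtoC (INR n) * b)%C.
Proof.
  intros G H t x cG cH Hsub Hm1 [T1 [T2 [T3 T4]]] Hx.
  pose proof (comm_subgrp _ cG) as sG. pose proof (comm_subgrp _ cH) as sH.
  assert (DH : forall g, H g -> det2 g = 1) by (intros g; apply subgrp_det, sH).
  assert (Hopp : forall g, H (M2opp g) -> H g).
  { intros g Hg. rewrite <- (M2opp_opp g), <- (M2mul_1l (M2opp g)), <- M2opp_mul_l. apply subgrp_mul; auto. }
  destruct (comm_conj G H x cG cH Hsub Hx) as [cC HC].
  destruct (width_spec _ cH) as [Hw0 Hiff0]. destruct (width_spec _ cC) as [Hw Hiff].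
  set (w0 := width H) in *. set (w := width (conjg G x)) in *.
  assert (Htr : forall r, transl H r <-> H (Tmat r)) by (intros r; split; [intros [K|K]; auto|left; assumption]).
  assert (Hpm : forall r, pm G (M2mul (M2mul x (Tmat r)) (M2inv x)) <-> exists n : Z, r = IZR n * w).
  { intros r. rewrite <- Hiff. unfold pm, transl, conjg. rewrite M2opp_mul_r, M2opp_mul_l. reflexivity. }
  assert (Hk : exists k : Z, w = IZR k * w0).
  { apply Hiff0. assert (K : transl (conjg G x) w) by (apply Hiff; exists 1%Z; ring).
    destruct K as [K|K]; [left|right]; apply HC, K. }
  destruct Hk as [k Hk].
  assert (Hk0 : (0 < k)%Z) by (apply lt_IZR; apply (Rmult_lt_reg_r w0); lra).
  set (n := Z.to_nat k).
  assert (Hn : INR n * w0 = w) by (unfold n; rewrite INR_IZR_INZ, Z2Nat.id by lia; lra).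
  exists n. split; [exact Hn|]. intros b. rewrite indicator_sum. f_equal. f_equal. f_equal.
  assert (HT : forall j : Z, H (Tmat (IZR j * w0))) by (intros j; apply Htr, Hiff0; eauto).
  assert (Hy : forall j : nat, exists y, In y t /\ pm G (M2mul (M2mul x (Tmat (INR j * w0))) (M2inv y))).
  { intros j. apply T3. apply subgrp_mul; auto. rewrite INR_IZR_INZ. apply HT. }
  destruct (choice _ Hy) as [y Hy'].
  assert (sP : subgrp (pm G)) by (apply pm_subgrp, sG).
  assert (Hsym : forall u v, det2 u = 1 -> det2 v = 1 -> pm G (M2mul u (M2inv v)) -> pm G (M2mul v (M2inv u))).
  { intros u v Du Dv K. apply subgrp_inv in K; [|exact sP].
    rewrite M2inv_mul, M2inv_inv in K by auto using det_inv. exact K. }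
  assert (Htrn : forall u v s, det2 u = 1 -> det2 v = 1 -> pm G (M2mul s (M2inv u)) -> pm G (M2mul u (M2inv v)) -> pm G (M2mul s (M2inv v))).
  { intros u v s Du Dv K1 K2. replace (M2mul s (M2inv v)) with (M2mul (M2mul s (M2inv u)) (M2mul u (M2inv v))).
    - apply subgrp_mul; assumption.
    - rewrite M2mul_assoc, M2mul_Kr' by exact Du. reflexivity. }
  assert (Dxj : forall r, det2 (M2mul x (Tmat r)) = 1) by (intros; apply det_mul1; auto using det_T).
  assert (Eij : forall r s, M2mul (M2mul x (Tmat r)) (M2inv (M2mul x (Tmat s))) = M2mul (M2mul x (Tmat (r - s))) (M2inv x)).
  { intros r s. rewrite M2inv_mul, T_inv by auto using det_T. rewrite !M2mul_assoc. f_equal.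
    rewrite <- M2mul_assoc, T_add. reflexivity. }
  set (f := fun l => if excluded_middle_informative (cusp_eq G l x) then true else false).
  assert (P : Permutation (filter f t) (map y (seq 0 n))).
  { apply NoDup_Permutation.
    - apply NoDup_filter, T1.
    - apply NoDup_map_NoDup_ForallPairs; [|apply seq_NoDup]. intros i j Hi Hj E.
      apply in_seq in Hi. apply in_seq in Hj.
      destruct (Hy' i) as [Y1 Y2]. destruct (Hy' j) as [Y3 Y4]. rewrite <- E in Y4.
      assert (K : pm G (M2mul (M2mul x (Tmat (INR i * w0))) (M2inv (M2mul x (Tmat (INR j * w0)))))).
      { apply (Htrn (y i)); auto. }
      rewrite Eij in K. apply Hpm in K. destruct K as [q Hq].
      assert (Hq' : IZR (Z.of_nat i - Z.of_nat j) = IZR (q * k)).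
      { rewrite minus_IZR, mult_IZR, <- !INR_IZR_INZ. apply (Rmult_eq_reg_r w0); [|lra].
        rewrite Hk in Hq. lra. }
      apply eq_IZR in Hq'. assert (Hnk : Z.of_nat n = k) by (unfold n; lia).
      assert (q = 0%Z) by nia. subst q. lia.
    - intros l. rewrite filter_In, in_map_iff. unfold f. split.
      + intros [Hl Hf]. destruct (excluded_middle_informative (cusp_eq G l x)) as [[mu [r [Gmu E]]]|]; [|discriminate].
        assert (Hr : H (Tmat r)).
        { assert (Dmx : H (M2mul mu x)) by (apply subgrp_mul; auto).
          assert (K : Tmat r = M2mul (M2inv (M2mul mu x)) l \/ M2opp (Tmat r) = M2mul (M2inv (M2mul mu x)) l).
          { destruct E as [->| ->]; [left|right].
            - rewrite M2mul_Kl by auto. reflexivity.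
            - rewrite M2opp_mul_r, M2mul_Kl by auto. reflexivity. }
          assert (KH : H (M2mul (M2inv (M2mul mu x)) l)) by (apply subgrp_mul; auto; apply subgrp_inv; auto).
          destruct K as [<-|K] in KH; [exact KH|]. apply Hopp. rewrite K. exact KH. }
        apply Htr, Hiff0 in Hr. destruct Hr as [m ->].
        pose proof (Z.div_mod m k ltac:(lia)) as Em. pose proof (Z.mod_pos_bound m k Hk0) as Bm.
        set (j := Z.to_nat (m mod k)).
        exists j. split; [|apply in_seq; unfold j, n; lia].
        apply T4; [apply Hy'|exact Hl|].
        assert (K1 : pm G (M2mul l (M2inv (M2mul x (Tmat (IZR m * w0)))))).
        { destruct E as [->| ->]; [left|right].
          - rewrite <- (M2mul_assoc mu x), M2mul_Kr by auto. exact Gmu.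
          - rewrite M2opp_mul_l, M2opp_opp, <- (M2mul_assoc mu x), M2mul_Kr by auto. exact Gmu. }
        assert (K2 : pm G (M2mul (M2mul x (Tmat (IZR m * w0))) (M2inv (M2mul x (Tmat (INR j * w0)))))).
        { rewrite Eij. apply Hpm. exists (m / k)%Z. unfold j. rewrite INR_IZR_INZ, Z2Nat.id by lia.
          rewrite Em at 1. rewrite plus_IZR, mult_IZR, Hk. ring. }
        apply (Hsym l); auto. { apply DH, T2, Hy'. }
        apply (Htrn (M2mul x (Tmat (INR j * w0)))); auto; [apply DH, T2, Hy'| |apply Hy'].
        apply (Htrn (M2mul x (Tmat (IZR m * w0)))); auto.
      + intros [j [<- Hj]]. split; [apply Hy'|].
        destruct (excluded_middle_informative (cusp_eq G (y j) x)) as [|Hne]; [reflexivity|].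
        exfalso. apply Hne. apply (pm_cusp_eq G (y j) x (INR j * w0)); auto.
        apply Hsym; auto; [apply DH, T2, Hy'|apply Hy']. }
  apply Permutation_length in P. rewrite length_map, length_seq in P. exact P.
Qed.

(** A cusp class consists of as many cosets as its width is a multiple of the
    width of the maximal group, and they contribute equal terms. *)
Lemma residue_two_cusps : forall (G H : M2 -> Prop) (phi : C -> C) x y a b,
  commensurable G -> maximal_commensurable H -> (forall g, G g -> H g) -> H x -> H y ->
  (forall g z, G g -> upper z -> phi (moebius g z) = (jfac g z * jfac g z * phi z)%C) ->
  (forall l, H l -> exists Phi, forall z, upper z ->
     cderiv Phi z (phi (moebius l z) * / (jfac l z * jfac l z))%C /\
     Phi (z + RtoC (width (conjg G l)))%C = (Phi z + RtoC (width (conjg G l)) *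
       ((if excluded_middle_informative (cusp_eq G l x) then a else RtoC 0) +
        (if excluded_middle_informative (cusp_eq G l y) then b else RtoC 0)))%C) ->
  (RtoC (width (conjg G x)) * a + RtoC (width (conjg G y)) * b)%C = RtoC 0.
Proof.
  intros G H phi x y a b cG mH Hsub Hx Hy Hinv Hprim.
  pose proof (proj1 (maximal_transitive H mH)) as Hm1. pose proof (proj1 mH) as cH.
  pose proof (comm_subgrp _ cG) as sG. pose proof (comm_subgrp _ cH) as sH.
  destruct (transversal (pm G) H (pm_subgrp G sG) sH) as [t Ht].
  { apply (finite_index_mono G); [intros g Hg; left; exact Hg|]. apply comm_index; assumption. }
  pose proof (residue_sum G H phi _ t cG mH Hsub Hinv Hprim Ht) as E.
  rewrite Csum_plus in E.
  destruct (cusp_count G H t x cG cH Hsub Hm1 Ht Hx) as [n [Hn En]].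
  destruct (cusp_count G H t y cG cH Hsub Hm1 Ht Hy) as [m [Hm Em]].
  rewrite En, Em in E. rewrite <- Hn, <- Hm, !RtoC_mult.
  transitivity (RtoC (width H) * (RtoC (INR n) * a + RtoC (INR m) * b))%C; [ring|]. rewrite E. ring.
Qed.

(** * Multipliers *)

(** The factor of automorphy. *)
Definition aut (K : Z) (nu : M2 -> C) (g : M2) (z : C) : C := (nu g * jpow K g z)%C.

Definition scalar_mat (g : M2) : Prop := mb g = 0 /\ mc g = 0 /\ ma g = md g.

(** Consistency, stated without the group of pairs. *)
Definition mult_ok (G : M2 -> Prop) (K : Z) (nu : M2 -> C) : Prop :=
  (forall g, G g -> Cmod (nu g) = 1) /\
  (forall g h z, G g -> G h -> upper z ->
     aut K nu (M2mul g h) z = (aut K nu g (moebius h z) * aut K nu h z)%C) /\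
  (forall g z, G g -> scalar_mat g -> upper z -> aut K nu g z = RtoC 1).

Lemma Rpower_pos : forall x y, 0 < Rpower x y.
Proof. intros. unfold Rpower. apply exp_pos. Qed.

Lemma Cmod_Cpowz : forall (s : C) K, s <> RtoC 0 -> Cmod (Cpowz s K) = Rpower (Cmod s) (IZR K).
Proof.
  intros s K Hs. destruct (Z_split_nat K) as [p [q ->]]. rewrite Cpowz_spec by exact Hs.
  rewrite Cmod_div by (apply Cpow_nz; exact Hs). rewrite !Cmod_pow.
  assert (Hp : 0 < Cmod s) by (apply Cmod_gt_0; exact Hs).
  rewrite <- !Rpower_pow by exact Hp. rewrite minus_IZR, <- !INR_IZR_INZ.
  unfold Rminus, Rdiv. rewrite Rpower_plus, Rpower_Ropp. reflexivity.
Qed.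

Lemma Cmod_jpow : forall K g z, det2 g = 1 -> upper z ->
  Cmod (jpow K g z) = Rpower (Cmod (RtoC (mc g) * z + RtoC (md g))%C) (IZR K / 2).
Proof.
  intros K g z Dg Hz. unfold jpow.
  pose proof (jfac_nz g z Dg Hz) as Hj. pose proof (Csqrt_nz _ Hj) as Hs.
  rewrite Cmod_Cpowz by exact Hs. rewrite <- jfac_det1 by exact Dg.
  rewrite <- (Cmod_Csqrt_sqr (jfac g z)).
  assert (Hp : 0 < Cmod (Csqrt (jfac g z))) by (apply Cmod_gt_0; exact Hs).
  set (s := Cmod (Csqrt (jfac g z))) in *.
  replace (s * s) with (Rpower s 2).
  - rewrite Rpower_mult. f_equal. field.
  - change 2 with (1 + 1). rewrite Rpower_plus, Rpower_1 by exact Hp. reflexivity.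
Qed.

Lemma jpow_nz : forall K g z, det2 g = 1 -> upper z -> jpow K g z <> RtoC 0.
Proof. intros. apply Cpowz_nz, Csqrt_nz, jfac_nz; assumption. Qed.

Lemma ex_cderiv_Cpow : forall f z n, (exists l, cderiv f z l) -> exists l, cderiv (fun x => f x ^ n)%C z l.
Proof.
  intros f z n [l Hl]. induction n as [|n [m IH]].
  - exists (RtoC 0). exact (cderiv_const (RtoC 1) z).
  - eexists. apply (cderiv_mult f (fun x => f x ^ n)%C); eassumption.
Qed.

Lemma ex_cderiv_Cpowz : forall f z K, (exists l, cderiv f z l) -> f z <> RtoC 0 ->
  exists l, cderiv (fun x => Cpowz (f x) K) z l.
Proof.
  intros f z K Hl Hn. destruct K as [|p|p]; simpl.
  - exists (RtoC 0). exact (cderiv_const (RtoC 1) z).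
  - apply ex_cderiv_Cpow, Hl.
  - destruct (ex_cderiv_Cpow f z (Pos.to_nat p) Hl) as [m Hm]. eexists.
    apply (cderiv_inv (fun x => f x ^ Pos.to_nat p)%C); [exact Hm|apply Cpow_nz; exact Hn].
Qed.

(** The absolute value of nu(g) is found by comparing absolute values at one
    point. *)
Lemma consistent_mult_ok : forall G K nu, subgrp G -> consistent_multiplier G K nu -> mult_ok G K nu.
Proof.
  intros G K nu sG [_ [[H1 [_ [H3 _]]] H5]].
  assert (P : forall g, G g -> G (fst (g, aut K nu g)) /\ forall z, upper z ->
    snd (g, aut K nu g) z = (nu (fst (g, aut K nu g)) * jpow K (fst (g, aut K nu g)) z)%C).
  { intros g Gg. split; [exact Gg|reflexivity]. }
  split; [|split].
  - intros g Gg. pose proof (subgrp_det _ _ sG Gg) as Dg.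
    destruct (H1 _ (P g Gg)) as [_ [_ Hm]]. specialize (Hm Ci upper_Ci). simpl in Hm. unfold aut in Hm.
    rewrite Cmod_mult, (Cmod_jpow K g Ci Dg upper_Ci), Dg in Hm.
    replace (Rpower 1 (- (IZR K / 2) / 2)) with 1 in Hm
      by (unfold Rpower; rewrite ln_1, Rmult_0_r, exp_0; reflexivity).
    apply (Rmult_eq_reg_r (Rpower (Cmod (RtoC (mc g) * Ci + RtoC (md g))%C) (IZR K / 2)));
      [exact Hm|apply Rgt_not_eq, Rpower_pos].
  - intros g h z Gg Gh Hz. destruct (H3 _ _ (P g Gg) (P h Gh)) as [_ E]. symmetry. apply (E z Hz).
  - intros g z Gg [A [B D]] Hz. apply H5; assumption.
Qed.

Lemma aut_nz : forall G K nu g z, subgrp G -> mult_ok G K nu -> G g -> upper z -> aut K nu g z <> RtoC 0.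
Proof.
  intros G K nu g z sG [H _] Gg Hz. apply Cmult_neq_0.
  - apply Cmod_gt_0. rewrite H by exact Gg. lra.
  - apply jpow_nz; [exact (subgrp_det _ _ sG Gg)|exact Hz].
Qed.

Lemma mult_ok_consistent : forall G K nu, subgrp G -> mult_ok G K nu -> consistent_multiplier G K nu.
Proof.
  intros G K nu sG HK. pose proof HK as [H1 [H2 H3]].
  assert (DG : forall g, G g -> det2 g = 1) by (intros g; apply subgrp_det, sG).
  split; [|split].
  - intros g Gg. apply Cmod_gt_0. rewrite H1 by exact Gg. lra.
  - split; [|split; [|split]].
    + intros [g ph] [Gg E]. simpl in *. pose proof (DG g Gg) as Dg. split; [simpl; lra|]. split.
      * apply holomorphic_iff. intros z Hz. simpl.
        destruct (ex_cderiv_Cpowz (fun x => Csqrt (jfac g x)) z K) as [l Hl].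
        { eexists. apply cderiv_sqrt_jfac; assumption. } { apply Csqrt_nz, jfac_nz; assumption. }
        exists (nu g * l)%C. apply (cderiv_ext_upper (fun x => nu g * jpow K g x)%C); [exact Hz| |].
        -- intros x Hx. symmetry. apply E, Hx.
        -- apply cderiv_scal, Hl.
      * intros z Hz. simpl. rewrite E, Cmod_mult, H1, Dg, Cmod_jpow by assumption.
        replace (Rpower 1 (- (IZR K / 2) / 2)) with 1
          by (unfold Rpower; rewrite ln_1, Rmult_0_r, exp_0; reflexivity). reflexivity.
    + split; [apply sG|]. intros z Hz. symmetry. apply (H3 M2one z); [apply sG| |exact Hz].
      repeat split.
    + intros [g p] [h q] [Gg E] [Gh F]. simpl in *. split; [apply subgrp_mul; assumption|].
      intros z Hz. rewrite E, F by (try apply moebius_upper; auto). symmetry. apply (H2 g h z); assumption.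
    + intros [g p] [Gg E]. simpl in *. pose proof (subgrp_inv _ _ sG Gg) as Gi. split; [exact Gi|].
      intros z Hz. pose proof (moebius_upper _ z (det_inv g (DG g Gg)) Hz) as Hz'.
      rewrite E by exact Hz'.
      pose proof (H2 g (M2inv g) z Gg Gi Hz) as C. rewrite M2inv_r in C by auto.
      rewrite H3 in C; [|apply sG|repeat split|exact Hz]. unfold aut in C.
      pose proof (aut_nz G K nu g _ sG HK Gg Hz') as Hn. unfold aut in Hn.
      rewrite <- (Cmult_1_l (/ _)%C), C. field. split; [apply jpow_nz; auto|].
      intros E0. apply Hn. rewrite E0. ring.
  - intros g Gg Hb Hc Had z Hz. apply (H3 g z Gg); [repeat split; assumption|exact Hz].
Qed.

(** ** Pairs over SL2(R) *)

Definition sgn1 (e : C) : Prop := e = RtoC 1 \/ e = RtoC (-1).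

Lemma sgn1_sqr : forall e, sgn1 e -> (e * e)%C = RtoC 1.
Proof. intros e [->| ->]; apply C_eq; simpl; ring. Qed.
Lemma sgn1_nz : forall e, sgn1 e -> e <> RtoC 0.
Proof. intros e H E. apply C1_nz. rewrite <- (sgn1_sqr e H), E. ring. Qed.
Lemma sgn1_mul : forall e f, sgn1 e -> sgn1 f -> sgn1 (e * f)%C.
Proof.
  intros e f [->| ->] [->| ->]; unfold sgn1; [left|right|right|left]; apply C_eq; simpl; ring.
Qed.

(** The pairs generated by the lifts: principal branch up to a sign. *)
Definition sqrt_pair (x : Gelt) : Prop :=
  det2 (fst x) = 1 /\ exists e, sgn1 e /\ forall z, upper z ->
    snd x z = (e * Csqrt (jfac (fst x) z))%C.

Lemma sqrt_pair_lift : forall a, det2 a = 1 -> sqrt_pair (lift a).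
Proof.
  intros a H. split; [exact H|]. exists (RtoC 1). split; [left; reflexivity|]. intros; simpl; ring.
Qed.

Lemma sqrt_pair_nz : forall x z, sqrt_pair x -> upper z -> snd x z <> RtoC 0.
Proof.
  intros x z [D [e [He E]]] Hz. rewrite E by exact Hz.
  apply Cmult_neq_0; [apply sgn1_nz, He|apply Csqrt_nz, jfac_nz; assumption].
Qed.

Lemma sqrt_pair_sqr : forall x z, sqrt_pair x -> upper z -> (snd x z * snd x z)%C = jfac (fst x) z.
Proof.
  intros x z [D [e [He E]]] Hz. rewrite !E by exact Hz.
  transitivity ((e * e) * (Csqrt (jfac (fst x) z) * Csqrt (jfac (fst x) z)))%C; [ring|].
  rewrite sgn1_sqr, Csqrt_sqr by exact He. ring.
Qed.

Lemma sqrt_pair_mul : forall x y, sqrt_pair x -> sqrt_pair y -> sqrt_pair (Gmul x y).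
Proof.
  intros x y [Dx [e [He E]]] [Dy [f [Hf F]]]. split; [apply det_mul1; assumption|].
  destruct (sqrt_cocycle _ _ Dx Dy) as [k [Hk HK]].
  exists (e * f * k)%C. split; [apply sgn1_mul; [apply sgn1_mul|]; assumption|].
  intros z Hz. simpl. rewrite E, F, HK by (try apply moebius_upper; assumption).
  transitivity (e * f * (k * k) * (Csqrt (jfac (fst x) (moebius (fst y) z)) * Csqrt (jfac (fst y) z)))%C;
    [|ring]. rewrite sgn1_sqr by exact Hk. ring.
Qed.

Lemma sqrt_pair_inv : forall x, sqrt_pair x -> sqrt_pair (Ginv x).
Proof.
  intros x [Dx [e [He E]]]. pose proof (det_inv _ Dx) as Di. split; [exact Di|].
  destruct (sqrt_cocycle _ _ Dx Di) as [k [Hk HK]].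
  exists (e * k)%C. split; [apply sgn1_mul; assumption|]. intros z Hz. simpl.
  pose proof (moebius_upper _ z Di Hz) as Hz'.
  specialize (HK z Hz). rewrite M2inv_r, jfac_det1 in HK by auto using det_one.
  replace (RtoC (mc M2one) * z + RtoC (md M2one))%C with (RtoC 1) in HK by (simpl; ring).
  rewrite Csqrt_1 in HK. rewrite E by exact Hz'.
  set (s := Csqrt (jfac (fst x) (moebius (M2inv (fst x)) z))) in *.
  assert (Hs : s <> RtoC 0) by (apply Csqrt_nz, jfac_nz; assumption).
  rewrite <- (Cmult_1_l (/ _)%C), HK.
  transitivity ((/ (e * e)) * (e * k * Csqrt (jfac (M2inv (fst x)) z)))%C.
  - field. split; [apply sgn1_nz, He|exact Hs].
  - rewrite sgn1_sqr by exact He. field.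
Qed.

Definition Jx (K : Z) (x : Gelt) (z : C) : C := Cpowz (snd x z) K.

Lemma Jx_nz : forall K x z, sqrt_pair x -> upper z -> Jx K x z <> RtoC 0.
Proof. intros. apply Cpowz_nz, sqrt_pair_nz; assumption. Qed.

Lemma Jx_mul : forall K x y z, sqrt_pair x -> sqrt_pair y -> upper z ->
  Jx K (Gmul x y) z = (Jx K x (moebius (fst y) z) * Jx K y z)%C.
Proof.
  intros K x y z Hx Hy Hz. unfold Jx. simpl. apply Cpowz_mult; apply sqrt_pair_nz; try assumption.
  apply moebius_upper; [apply Hy|exact Hz].
Qed.

Lemma Jx_dual : forall K x z, sqrt_pair x -> upper z ->
  (Jx K x z * Jx (4 - K) x z)%C = (jfac (fst x) z * jfac (fst x) z)%C.
Proof.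
  intros K x z Hx Hz. unfold Jx. rewrite Cpowz_dual by (apply sqrt_pair_nz; assumption).
  rewrite sqrt_pair_sqr by assumption. reflexivity.
Qed.

Lemma slash_mul : forall K f x y z, sqrt_pair x -> sqrt_pair y -> upper z ->
  slash K (slash K f x) y z = slash K f (Gmul x y) z.
Proof.
  intros K f x y z Hx Hy Hz. unfold slash. fold (Jx K y z).
  fold (Jx K x (moebius (fst y) z)). fold (Jx K (Gmul x y) z). rewrite Jx_mul by assumption.
  simpl fst. rewrite moebius_mul by (try apply Hx; try apply Hy; assumption).
  field. split; apply Jx_nz; try assumption. apply moebius_upper; [apply Hy|exact Hz].
Qed.

Lemma slash_eq : forall K f h x z, sqrt_pair x -> upper z -> (forall z, upper z -> f z = h z) ->
  slash K f x z = slash K h x z.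
Proof.
  intros K f h x z Hx Hz E. unfold slash. rewrite E; [reflexivity|]. apply moebius_upper; [apply Hx|exact Hz].
Qed.

(** Equality of pairs as the half-plane sees it; the group laws of the pairs
    hold in this sense. *)
Definition geq (x y : Gelt) : Prop := fst x = fst y /\ forall z, upper z -> snd x z = snd y z.

Lemma geq_slash : forall K f x y z, geq x y -> upper z -> slash K f x z = slash K f y z.
Proof. intros K f x y z [E1 E2] Hz. unfold slash. rewrite E1, E2 by exact Hz. reflexivity. Qed.

Lemma geq_Jx : forall K x y z, geq x y -> upper z -> Jx K x z = Jx K y z.
Proof. intros K x y z [E1 E2] Hz. unfold Jx. rewrite E2 by exact Hz. reflexivity. Qed.

Lemma geq_sym : forall x y, geq x y -> geq y x.
Proof. intros x y [E1 E2]. split; [auto|]. intros; symmetry; auto. Qed.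

Lemma geq_good : forall x y, geq x y -> sqrt_pair x -> sqrt_pair y.
Proof.
  intros x y [E1 E2] [D [e [He E]]]. split; [congruence|]. exists e. split; [exact He|].
  intros z Hz. rewrite <- E2, E, E1 by exact Hz. reflexivity.
Qed.

Lemma geq_inv_r : forall x, sqrt_pair x -> geq (Gmul x (Ginv x)) Gone.
Proof.
  intros x Hx. pose proof (proj1 Hx) as D. split; [apply M2inv_r, D|]. intros z Hz. simpl.
  apply Cinv_r. apply sqrt_pair_nz; [exact Hx|]. apply moebius_upper; [apply det_inv, D|exact Hz].
Qed.

Lemma geq_inv_l : forall x, sqrt_pair x -> geq (Gmul (Ginv x) x) Gone.
Proof.
  intros x Hx. pose proof (proj1 Hx) as D. split; [apply M2inv_l, D|]. intros z Hz. simpl.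
  rewrite moebius_inv_l by assumption. apply Cinv_l, sqrt_pair_nz; assumption.
Qed.

Lemma geq_assoc : forall x y w, sqrt_pair y -> sqrt_pair w -> geq (Gmul (Gmul x y) w) (Gmul x (Gmul y w)).
Proof.
  intros x y w Hy Hw. split; [symmetry; apply M2mul_assoc|]. intros z Hz. simpl.
  rewrite moebius_mul by (try apply Hy; try apply Hw; assumption). ring.
Qed.

Lemma geq_trans : forall x y w, geq x y -> geq y w -> geq x w.
Proof. intros x y w [A B] [A' B']. split; [congruence|]. intros z Hz. rewrite B, B'; auto. Qed.

Lemma geq_mul : forall x x' y y', sqrt_pair y -> geq x x' -> geq y y' -> geq (Gmul x y) (Gmul x' y').
Proof.
  intros x x' y y' Hy [A B] [A' B']. split; [simpl; congruence|]. intros z Hz. simpl.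
  rewrite <- A', B, B' by (try apply moebius_upper; try apply Hy; assumption). reflexivity.
Qed.

Lemma sqrt_pair_one : sqrt_pair Gone.
Proof.
  split; [apply det_one|]. exists (RtoC 1). split; [left; reflexivity|]. intros z Hz.
  rewrite jfac_det1 by apply det_one. simpl. replace (0 * z + 1)%C with (RtoC 1) by ring. rewrite Csqrt_1. ring.
Qed.

Lemma geq_one_l : forall x, geq (Gmul Gone x) x.
Proof. intros x. split; [apply M2mul_1l|]. intros; simpl; ring. Qed.
Lemma geq_one_r : forall x, geq (Gmul x Gone) x.
Proof. intros x. split; [apply M2mul_1r|]. intros z _; simpl. rewrite moebius_one. ring. Qed.

Lemma geq_Kl : forall x y, sqrt_pair x -> sqrt_pair y -> geq (Gmul x (Gmul (Ginv x) y)) y.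
Proof.
  intros x y Hx Hy. eapply geq_trans; [apply geq_sym, geq_assoc; [apply sqrt_pair_inv, Hx|exact Hy]|].
  eapply geq_trans; [apply geq_mul; [exact Hy|apply geq_inv_r, Hx|split; reflexivity]|apply geq_one_l].
Qed.

(** ** Conjugate multipliers *)

(** Both sides are square roots of the same cocycle, so they differ by a
    constant sign; evaluating [conj_mult] at [Ci] gives its value for all [z]. *)
Lemma conj_mult_sign : forall K nu x d, sqrt_pair x -> det2 d = 1 ->
  let g := M2mul (M2mul (fst x) d) (M2inv (fst x)) in
  exists e, sgn1 e /\ conj_mult K nu x d = (nu g * Cpowz e K)%C /\
    forall z, upper z ->
      (jpow K g (moebius (fst x) z) * Jx K x z)%C =
      (Cpowz e K * (Jx K x (moebius d z) * jpow K d z))%C.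
Proof.
  intros K nu x d Hx Dd g. pose proof Hx as [Dx [e [He E]]].
  assert (Dg : det2 g = 1) by (unfold g; auto using det_mul1, det_inv).
  assert (Egx : M2mul g (fst x) = M2mul (fst x) d) by (unfold g; apply M2mul_Kr', Dx).
  destruct (sqrt_cocycle g (fst x) Dg Dx) as [e1 [He1 E1]].
  destruct (sqrt_cocycle (fst x) d Dx Dd) as [e2 [He2 E2]].
  assert (Hk : forall z, upper z -> (Csqrt (jfac g (moebius (fst x) z)) * snd x z)%C =
    (e1 * e2 * (snd x (moebius d z) * Csqrt (jfac d z)))%C).
  { intros z Hz. rewrite !E by (try apply moebius_upper; assumption).
    transitivity (e * (e1 * (e1 * (Csqrt (jfac g (moebius (fst x) z)) * Csqrt (jfac (fst x) z)))))%C.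
    - transitivity ((e1 * e1) * (e * (Csqrt (jfac g (moebius (fst x) z)) * Csqrt (jfac (fst x) z))))%C; [|ring].
      rewrite sgn1_sqr by exact He1. ring.
    - rewrite <- E1, Egx, E2 by exact Hz. ring. }
  assert (Hs : sgn1 (e1 * e2)%C) by (apply sgn1_mul; assumption).
  assert (HK : forall z, upper z ->
      (jpow K g (moebius (fst x) z) * Jx K x z)%C =
      (Cpowz (e1 * e2) K * (Jx K x (moebius d z) * jpow K d z))%C).
  { intros z Hz. unfold jpow, Jx.
    pose proof (moebius_upper _ z Dx Hz). pose proof (moebius_upper _ z Dd Hz).
    assert (N1 : Csqrt (jfac g (moebius (fst x) z)) <> RtoC 0) by (apply Csqrt_nz, jfac_nz; assumption).
    assert (N2 : Csqrt (jfac d z) <> RtoC 0) by (apply Csqrt_nz, jfac_nz; assumption).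
    assert (N3 : snd x z <> RtoC 0) by (apply sqrt_pair_nz; assumption).
    assert (N4 : snd x (moebius d z) <> RtoC 0) by (apply sqrt_pair_nz; assumption).
    rewrite <- !Cpowz_mult; try assumption.
    - rewrite Hk by exact Hz. reflexivity.
    - apply sgn1_nz, Hs.
    - apply Cmult_neq_0; assumption. }
  exists (e1 * e2)%C. split; [exact Hs|]. split; [|exact HK].
  unfold conj_mult. fold g. fold (Jx K x Ci). fold (Jx K x (moebius d Ci)).
  rewrite HK by apply upper_Ci. field. split.
  - apply jpow_nz; [exact Dd|apply upper_Ci].
  - apply Jx_nz; [exact Hx|]. apply moebius_upper; [exact Dd|apply upper_Ci].
Qed.

Lemma aut_conj : forall K nu x d z, sqrt_pair x -> det2 d = 1 -> upper z ->
  (aut K (conj_mult K nu x) d z * Jx K x (moebius d z))%C =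
  (aut K nu (M2mul (M2mul (fst x) d) (M2inv (fst x))) (moebius (fst x) z) * Jx K x z)%C.
Proof.
  intros K nu x d z Hx Dd Hz. destruct (conj_mult_sign K nu x d Hx Dd) as [e [He [E H]]].
  unfold aut. rewrite E, <- !Cmult_assoc, H by exact Hz. ring.
Qed.

Lemma conj_mult_ok : forall G K nu x, subgrp G -> sqrt_pair x -> mult_ok G K nu ->
  mult_ok (conjg G (fst x)) K (conj_mult K nu x).
Proof.
  intros G K nu x sG Hx [H1 [H2 H3]]. pose proof (proj1 Hx) as Dx.
  pose proof (subgrp_conj G _ sG Dx) as sC.
  assert (DC : forall d, conjg G (fst x) d -> det2 d = 1) by (intros d; apply subgrp_det, sC).
  split; [|split].
  - intros d Hd. destruct (conj_mult_sign K nu x d Hx (DC d Hd)) as [e [He [E _]]].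
    rewrite E, Cmod_mult, H1 by exact Hd. destruct (Cpowz_sign e K He) as [E'|E']; rewrite E', Cmod_R;
      [rewrite Rabs_R1|rewrite Rabs_left]; lra.
  - intros d f z Hd Hf Hz. pose proof (DC d Hd) as Dd. pose proof (DC f Hf) as Df.
    pose proof (moebius_upper f z Df Hz) as Hfz.
    pose proof (moebius_upper (M2mul d f) z (det_mul1 _ _ Dd Df) Hz) as Hdfz.
    pose proof (aut_conj K nu x (M2mul d f) z Hx (det_mul1 _ _ Dd Df) Hz) as C1.
    pose proof (aut_conj K nu x d (moebius f z) Hx Dd Hfz) as C2.
    pose proof (aut_conj K nu x f z Hx Df Hz) as C3.
    replace (M2mul (M2mul (fst x) (M2mul d f)) (M2inv (fst x))) with
      (M2mul (M2mul (M2mul (fst x) d) (M2inv (fst x))) (M2mul (M2mul (fst x) f) (M2inv (fst x)))) in C1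
      by (rewrite !M2mul_assoc, M2mul_Kr' by exact Dx; reflexivity).
    rewrite H2 in C1; [|exact Hd|exact Hf|apply moebius_upper; assumption].
    rewrite <- moebius_mul in C1 by auto using det_mul1, det_inv, moebius_upper.
    rewrite M2mul_Kr' in C1 by exact Dx. rewrite moebius_mul in C1 by assumption.
    rewrite moebius_mul in C1 by assumption. rewrite <- moebius_mul in C1 by assumption.
    rewrite moebius_mul in C1 by assumption.
    rewrite <- Cmult_assoc, <- C3 in C1.
    apply (f_equal (fun w => w * Jx K x (moebius f z))%C) in C1.
    assert (N1 : Jx K x (moebius f z) <> RtoC 0) by (apply Jx_nz; assumption).
    assert (N2 : Jx K x (moebius d (moebius f z)) <> RtoC 0) by (apply Jx_nz; auto using moebius_upper).
    assert (C4 : (aut K (conj_mult K nu x) (M2mul d f) z * (Jx K x (moebius d (moebius f z)) * Jx K x (moebius f z)))%C =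
      (aut K (conj_mult K nu x) d (moebius f z) * aut K (conj_mult K nu x) f z * (Jx K x (moebius d (moebius f z)) * Jx K x (moebius f z)))%C).
    { rewrite Cmult_assoc, C1.
      transitivity ((aut K nu (M2mul (M2mul (fst x) d) (M2inv (fst x))) (moebius (fst x) (moebius f z)) * Jx K x (moebius f z)) *
        aut K (conj_mult K nu x) f z * Jx K x (moebius f z))%C; [ring|]. rewrite <- C2. ring. }
    set (m := (Jx K x (moebius d (moebius f z)) * Jx K x (moebius f z))%C) in *.
    assert (Nm : m <> RtoC 0) by (apply Cmult_neq_0; assumption).
    apply (f_equal (fun w => w * / m)%C) in C4. rewrite <- !(Cmult_assoc _ m), Cinv_r, !Cmult_1_r in C4 by exact Nm.
    exact C4.
  - intros d z Hd Hs Hz. pose proof (DC d Hd) as Dd.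
    pose proof (aut_conj K nu x d z Hx Dd Hz) as C1.
    assert (Ed : M2mul (M2mul (fst x) d) (M2inv (fst x)) = d).
    { rewrite M2inv_1 by exact Dx. destruct Hs as [Hb [Hc Ha]]. unfold det2 in Dx.
      apply M2_eq; simpl; rewrite ?Hb, ?Hc, ?Ha.
      - transitivity (md d * (ma (fst x) * md (fst x) - mb (fst x) * mc (fst x))); [ring|]. rewrite Dx. ring.
      - ring.
      - ring.
      - transitivity (md d * (ma (fst x) * md (fst x) - mb (fst x) * mc (fst x))); [ring|]. rewrite Dx. ring. }
    assert (Hd' : G d) by (unfold conjg in Hd; rewrite Ed in Hd; exact Hd).
    rewrite Ed in C1. rewrite H3 in C1; [|exact Hd'|exact Hs|apply moebius_upper; assumption].
    assert (Em : moebius d z = z).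
    { destruct Hs as [Hb [Hc Ha]]. unfold moebius. rewrite Hb, Hc, <- Ha.
      assert (ma d <> 0) by (intros E0; unfold det2 in Dd; rewrite E0, Hb in Dd; lra).
      field. intros E0. apply H. apply RtoC_inj. rewrite <- E0. ring. }
    rewrite Em in C1. pose proof (Jx_nz K x z Hx Hz) as Nz.
    apply (f_equal (fun w => w * / Jx K x z)%C) in C1.
    rewrite <- !(Cmult_assoc _ (Jx K x z)), Cinv_r, !Cmult_1_r in C1 by exact Nz. exact C1.
Qed.

Lemma conj_mult_finite : forall G K nu x, subgrp G -> sqrt_pair x -> finite_multiplier G nu ->
  finite_multiplier (conjg G (fst x)) (conj_mult K nu x).
Proof.
  intros G K nu x sG Hx [l Hl]. exists (l ++ map (fun u => u * RtoC (-1))%C l). intros d Hd.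
  pose proof (subgrp_det _ _ (subgrp_conj G _ sG (proj1 Hx)) Hd) as Dd.
  destruct (conj_mult_sign K nu x d Hx Dd) as [e [He [E _]]]. rewrite E. apply in_or_app.
  destruct (Cpowz_sign e K He) as [E'|E']; rewrite E'; [left|right].
  - rewrite Cmult_1_r. apply Hl, Hd.
  - apply in_map_iff. eexists. split; [reflexivity|apply Hl, Hd].
Qed.

(** ** Duality *)

Lemma cbar_cbar : forall nu, cbar (cbar nu) = nu.
Proof. intros nu. apply functional_extensionality. intros g. apply Cconj_conj. Qed.

Lemma aut_dual : forall K nu g z, det2 g = 1 -> Cmod (nu g) = 1 -> upper z ->
  (aut K nu g z * aut (4 - K) (cbar nu) g z)%C = (jfac g z * jfac g z)%C.
Proof.
  intros K nu g z Dg Hn Hz. unfold aut, cbar.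
  transitivity ((nu g * Cconj (nu g)) * (jpow K g z * jpow (4 - K) g z))%C; [ring|].
  rewrite <- Cmod2_conj, Hn. unfold jpow. rewrite Cpowz_dual by (apply Csqrt_nz, jfac_nz; assumption).
  rewrite Csqrt_sqr. replace (1 ^ 2) with 1 by ring. ring.
Qed.

Lemma mult_ok_dual : forall G K nu, subgrp G -> mult_ok G K nu -> mult_ok G (4 - K) (cbar nu).
Proof.
  intros G K nu sG HK. pose proof HK as [H1 [H2 H3]].
  assert (DG : forall g, G g -> det2 g = 1) by (intros g; apply subgrp_det, sG).
  assert (Q : forall g z, G g -> upper z -> aut (4 - K) (cbar nu) g z = (jfac g z * jfac g z / aut K nu g z)%C).
  { intros g z Gg Hz. rewrite <- (aut_dual K nu g z) by auto. field. eapply aut_nz; eassumption. }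
  split; [|split].
  - intros g Gg. unfold cbar. rewrite Cmod_conj. apply H1, Gg.
  - intros g h z Gg Gh Hz. pose proof (moebius_upper h z (DG h Gh) Hz) as Hz'.
    rewrite !Q by (auto; apply subgrp_mul; assumption).
    rewrite H2, jfac_mul by auto. field.
    split; eapply aut_nz; eassumption.
  - intros g z Gg Hs Hz. rewrite Q, H3 by assumption.
    destruct Hs as [Hb [Hc Ha]]. pose proof (DG g Gg) as D. rewrite jfac_det1 by exact D.
    unfold det2 in D. rewrite Hb, Hc, Ha in *.
    replace (RtoC 0 * z + RtoC (md g))%C with (RtoC (md g)) by ring.
    rewrite <- RtoC_mult. replace (md g * md g) with 1 by lra. field.
Qed.

Lemma finite_dual : forall G nu, finite_multiplier G nu -> finite_multiplier G (cbar nu).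
Proof.
  intros G nu [l Hl]. exists (map Cconj l). intros g Gg. unfold cbar. apply in_map, Hl, Gg.
Qed.

(** ** The exponent shift *)

Lemma ee_surj : forall u : C, Cmod u = 1 -> exists s, 0 <= s < 1 /\ ee s = u.
Proof.
  intros [x y] Hu. pose proof (Cmod_sqr (x, y)) as E. rewrite Hu in E. simpl in E.
  pose proof PI_RGT_0 as HPI.
  assert (Hx : -1 <= x <= 1) by nra.
  pose proof (acos_bound x) as Hb. pose proof (cos_acos x Hx) as Hc.
  assert (Hs : 0 <= sin (acos x)) by (apply sin_ge_0; lra).
  pose proof (sin2_cos2 (acos x)) as Hsc. unfold Rsqr in Hsc. rewrite Hc in Hsc.
  assert (Hs2 : sin (acos x) * sin (acos x) = y * y) by lra.
  destruct (Rle_dec 0 y) as [Hy|Hy].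
  - exists (acos x / (2 * PI)). split.
    + split; [apply Rdiv_le_0_compat; lra|].
      apply (Rmult_lt_reg_r (2 * PI)); [lra|]. unfold Rdiv. rewrite Rmult_assoc, Rinv_l by lra. lra.
    + unfold ee. replace (2 * PI * (acos x / (2 * PI))) with (acos x) by (field; lra).
      apply C_eq; simpl; [exact Hc|]. nra.
  - assert (Hxl : x <> 1) by (intros ->; nra).
    assert (Hap : 0 < acos x).
    { destruct (Req_dec (acos x) 0) as [E0|E0]; [|lra]. rewrite E0, cos_0 in Hc. lra. }
    exists (1 - acos x / (2 * PI)). split.
    + assert (0 < acos x / (2 * PI)) by (apply Rdiv_lt_0_compat; lra).
      assert (acos x / (2 * PI) <= 1).
      { apply (Rmult_le_reg_r (2 * PI)); [lra|]. unfold Rdiv. rewrite Rmult_assoc, Rinv_l by lra. lra. }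
      lra.
    + unfold ee. replace (2 * PI * (1 - acos x / (2 * PI))) with (- acos x + 2 * PI) by (field; lra).
      rewrite cos_plus, sin_plus, cos_2PI, sin_2PI, cos_neg, sin_neg. apply C_eq; simpl; nra.
Qed.

Lemma ee_1_int : forall x, ee x = RtoC 1 -> exists n : Z, x = IZR n.
Proof.
  intros x E. destruct (archimed x) as [A1 A2]. set (n := (up x - 1)%Z).
  assert (Hf : 0 <= x - IZR n < 1) by (unfold n; rewrite minus_IZR; lra).
  exists n. set (f := x - IZR n) in *.
  assert (Ef : ee f = RtoC 1).
  { unfold f, Rminus. rewrite ee_add, E, ee_opp, ee_Z. field. }
  destruct (Req_dec f 0) as [E0|E0]; [unfold f in E0; lra|exfalso].
  pose proof PI_RGT_0 as HPI. injection Ef as Ec _.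
  replace (2 * PI * f) with (2 * (PI * f)) in Ec by ring. rewrite cos_2a_sin in Ec.
  assert (0 < sin (PI * f)) by (apply sin_gt_0; nra). nra.
Qed.

Lemma jpow_T : forall K r z, jpow K (Tmat r) z = RtoC 1.
Proof.
  intros. unfold jpow. rewrite jfac_det1 by apply det_T. simpl.
  replace (0 * z + 1)%C with (RtoC 1) by ring. rewrite Csqrt_1. apply Cpowz_1.
Qed.

Lemma jpow_opp_T : forall K r z, jpow K (M2opp (Tmat r)) z = Cpowz Ci K.
Proof.
  intros. unfold jpow. replace (jfac (M2opp (Tmat r)) z) with (RtoC (-1)).
  - rewrite Csqrt_m1. reflexivity.
  - rewrite jfac_det1 by (rewrite det_opp; apply det_T). apply C_eq; destruct z; simpl; ring.
Qed.

(** The generator of the translations in [G], up to sign, as [sigma] selects it. *)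
Definition wgen (G : M2 -> Prop) : M2 :=
  if excluded_middle_informative (G (Tmat (width G))) then Tmat (width G) else M2opp (Tmat (width G)).

Lemma wgen_in : forall G, commensurable G -> G (wgen G).
Proof.
  intros G cG. unfold wgen. destruct (excluded_middle_informative (G (Tmat (width G)))) as [H|H]; [exact H|].
  destruct (width_in G cG); [contradiction|assumption].
Qed.

Lemma sigma_spec : forall G K nu, commensurable G -> mult_ok G K nu ->
  0 <= Defs.sigma G K nu < 1 /\ forall z, ee (Defs.sigma G K nu) = aut K nu (wgen G) z.
Proof.
  intros G K nu cG HK.
  set (P := fun s => 0 <= s < 1 /\
    (G (Tmat (width G)) -> ee s = nu (Tmat (width G))) /\
    (~ G (Tmat (width G)) -> ee s = Cmult (Cpowz Ci K) (nu (M2opp (Tmat (width G)))))).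
  assert (HP : P (Defs.sigma G K nu)).
  { unfold Defs.sigma. apply (epsilon_spec (inhabits 0) P).
    pose proof (wgen_in G cG) as Hg. unfold wgen in Hg.
    destruct (excluded_middle_informative (G (Tmat (width G)))) as [H|H].
    - destruct (ee_surj (nu (Tmat (width G)))) as [s [Hs E]]; [apply HK, Hg|].
      exists s. split; [exact Hs|]. split; [auto|contradiction].
    - destruct (ee_surj (Cmult (Cpowz Ci K) (nu (M2opp (Tmat (width G)))))) as [s [Hs E]].
      + rewrite Cmod_mult, Cmod_Cpowz, Cmod_Ci, (proj1 HK) by (auto; intros E; apply (f_equal Im) in E; simpl in E; lra).
        unfold Rpower. rewrite ln_1, Rmult_0_r, exp_0. ring.
      + exists s. split; [exact Hs|]. split; [contradiction|auto]. }
  destruct HP as [H1 [H2 H3]]. split; [exact H1|]. intros z. unfold aut, wgen.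
  destruct (excluded_middle_informative (G (Tmat (width G)))) as [H|H].
  - rewrite H2, jpow_T by exact H. ring.
  - rewrite H3, jpow_opp_T by exact H. ring.
Qed.

(** The dual factors of automorphy of a translation, up to sign, multiply to 1:
    the exponents for dual multipliers are negatives of each other. *)
Lemma sigma_dual : forall G K nu nu', commensurable G -> mult_ok G K nu -> mult_ok G (4 - K) nu' ->
  (forall g z, G g -> upper z -> (aut K nu g z * aut (4 - K) nu' g z)%C = (jfac g z * jfac g z)%C) ->
  exists t : Z, Defs.sigma G K nu + Defs.sigma G (4 - K) nu' = IZR t.
Proof.
  intros G K nu nu' cG H1 H2 HD. apply ee_1_int. rewrite ee_add.
  rewrite (proj2 (sigma_spec G K nu cG H1) Ci), (proj2 (sigma_spec G _ nu' cG H2) Ci).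
  rewrite HD by (try apply wgen_in; auto using upper_Ci).
  unfold wgen. destruct (excluded_middle_informative (G (Tmat (width G)))).
  - rewrite jfac_det1 by apply det_T. simpl. ring.
  - rewrite jfac_opp, jfac_det1 by apply det_T. simpl. ring.
Qed.

(** * Frames: a group with a multiplier, up to translation *)

(** [(G2, nu2)] is the conjugate of [(G1, nu1)] by the translation by [r]. *)
Definition trel (K : Z) (r : R) (G1 : M2 -> Prop) (nu1 : M2 -> C) (G2 : M2 -> Prop) (nu2 : M2 -> C) : Prop :=
  (forall d, G2 d <-> conjg G1 (Tmat r) d) /\
  forall d z, G2 d -> upper z ->
    aut K nu2 d z = aut K nu1 (M2mul (M2mul (Tmat r) d) (M2inv (Tmat r))) (z + RtoC r)%C.

Definition frame (K : Z) (G : M2 -> Prop) (nu : M2 -> C) : Prop := commensurable G /\ mult_ok G K nu.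

Lemma conj_T0 : forall d, M2mul (M2mul (Tmat 0) d) (M2inv (Tmat 0)) = d.
Proof. intros d. rewrite T_inv. apply M2_eq; simpl; ring. Qed.

Lemma trel_0 : forall K G1 nu1 G2 nu2, (forall d, G2 d <-> G1 d) ->
  (forall d z, G2 d -> upper z -> aut K nu2 d z = aut K nu1 d z) -> trel K 0 G1 nu1 G2 nu2.
Proof.
  intros K G1 nu1 G2 nu2 H1 H2. split.
  - intros d. unfold conjg. rewrite conj_T0. apply H1.
  - intros d z Hd Hz. rewrite conj_T0. replace (z + RtoC 0)%C with z by ring. apply H2; assumption.
Qed.

Lemma trel_0_inv : forall K G1 nu1 G2 nu2, trel K 0 G1 nu1 G2 nu2 ->
  (forall d, G2 d <-> G1 d) /\
  (forall d z, G2 d -> upper z -> aut K nu2 d z = aut K nu1 d z).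
Proof.
  intros K G1 nu1 G2 nu2 [H1 H2]. split.
  - intros d. rewrite H1. unfold conjg. rewrite conj_T0. reflexivity.
  - intros d z Hd Hz. rewrite H2, conj_T0 by assumption. f_equal. ring.
Qed.

Lemma conj_TT : forall r s d, M2mul (M2mul (Tmat r) (M2mul (M2mul (Tmat s) d) (M2inv (Tmat s)))) (M2inv (Tmat r)) =
  M2mul (M2mul (Tmat (r + s)) d) (M2inv (Tmat (r + s))).
Proof. intros. rewrite !T_inv. apply M2_eq; simpl; ring. Qed.

Lemma trel_trans : forall K r s G1 nu1 G2 nu2 G3 nu3,
  trel K r G1 nu1 G2 nu2 -> trel K s G2 nu2 G3 nu3 -> trel K (r + s) G1 nu1 G3 nu3.
Proof.
  intros K r s G1 nu1 G2 nu2 G3 nu3 [A1 A2] [B1 B2]. split.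
  - intros d. rewrite B1. unfold conjg at 1. rewrite A1. unfold conjg. rewrite conj_TT. reflexivity.
  - intros d z Hd Hz. rewrite B2 by assumption. rewrite A2.
    + rewrite conj_TT. f_equal. rewrite RtoC_plus. ring.
    + apply B1 in Hd. exact Hd.
    + apply upper_shift, Hz.
Qed.

Lemma trel_sym : forall K r G1 nu1 G2 nu2, trel K r G1 nu1 G2 nu2 -> trel K (- r) G2 nu2 G1 nu1.
Proof.
  intros K r G1 nu1 G2 nu2 [A1 A2].
  assert (E : forall d, M2mul (M2mul (Tmat r) (M2mul (M2mul (Tmat (- r)) d) (M2inv (Tmat (- r))))) (M2inv (Tmat r)) = d).
  { intros d. rewrite conj_TT. replace (r + - r) with 0 by ring. apply conj_T0. }
  split.
  - intros d. unfold conjg. rewrite A1. unfold conjg. rewrite E. reflexivity.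
  - intros d z Hd Hz. rewrite A2.
    + rewrite E. f_equal. rewrite RtoC_opp. ring.
    + apply A1. unfold conjg. rewrite E. exact Hd.
    + apply upper_shift, Hz.
Qed.

Lemma trel_0trans : forall K r G1 nu1 G2 nu2 G3 nu3,
  trel K 0 G1 nu1 G2 nu2 -> trel K r G2 nu2 G3 nu3 -> trel K r G1 nu1 G3 nu3.
Proof. intros. rewrite <- (Rplus_0_l r). eapply trel_trans; eassumption. Qed.

Lemma trel_sym0 : forall K G1 nu1 G2 nu2, trel K 0 G1 nu1 G2 nu2 -> trel K 0 G2 nu2 G1 nu1.
Proof. intros. rewrite <- Ropp_0. apply trel_sym. assumption. Qed.

Lemma conj_T_T : forall r s, M2mul (M2mul (Tmat r) (Tmat s)) (M2inv (Tmat r)) = Tmat s.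
Proof. intros. rewrite T_inv, !T_add. f_equal. ring. Qed.

Lemma trel_T : forall K r G1 nu1 G2 nu2, trel K r G1 nu1 G2 nu2 -> forall s,
  (G2 (Tmat s) <-> G1 (Tmat s)) /\ (G2 (M2opp (Tmat s)) <-> G1 (M2opp (Tmat s))).
Proof.
  intros K r G1 nu1 G2 nu2 [H _] s. rewrite !H. unfold conjg.
  rewrite M2opp_mul_r, M2opp_mul_l, conj_T_T. split; reflexivity.
Qed.

Lemma trel_width : forall K r G1 nu1 G2 nu2, trel K r G1 nu1 G2 nu2 -> width G2 = width G1.
Proof.
  intros K r G1 nu1 G2 nu2 H. unfold width. f_equal. apply functional_extensionality. intros w.
  apply propositional_extensionality.
  split; intros [H1 H2]; (split; [exact H1|]); intros s; rewrite <- H2;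
    destruct (trel_T _ _ _ _ _ _ H s) as [E1 E2]; tauto.
Qed.

Lemma trel_sigma : forall K r G1 nu1 G2 nu2, frame K G1 nu1 -> frame K G2 nu2 ->
  trel K r G1 nu1 G2 nu2 -> Defs.sigma G2 K nu2 = Defs.sigma G1 K nu1.
Proof.
  intros K r G1 nu1 G2 nu2 [c1 o1] [c2 o2] H.
  destruct (sigma_spec G1 K nu1 c1 o1) as [B1 E1]. destruct (sigma_spec G2 K nu2 c2 o2) as [B2 E2].
  assert (Ew : wgen G2 = wgen G1).
  { unfold wgen. rewrite (trel_width _ _ _ _ _ _ H). destruct (trel_T _ _ _ _ _ _ H (width G1)) as [E _].
    destruct (excluded_middle_informative (G2 (Tmat (width G1)))); destruct (excluded_middle_informative (G1 (Tmat (width G1)))); tauto. }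
  specialize (E2 Ci). rewrite (proj2 H) in E2; [|apply wgen_in, c2|apply upper_Ci].
  assert (Et : M2mul (M2mul (Tmat r) (wgen G2)) (M2inv (Tmat r)) = wgen G1).
  { rewrite Ew. unfold wgen. destruct (excluded_middle_informative (G1 (Tmat (width G1)))).
    - apply conj_T_T.
    - rewrite M2opp_mul_r, M2opp_mul_l, conj_T_T. reflexivity. }
  rewrite Et, <- (E1 (Ci + RtoC r)%C) in E2.
  assert (Ed : ee (Defs.sigma G2 K nu2 - Defs.sigma G1 K nu1) = RtoC 1).
  { unfold Rminus. rewrite ee_add, ee_opp, E2. apply Cinv_r, ee_nz. }
  apply ee_1_int in Ed. destruct Ed as [n Hn].
  assert (-1 < IZR n < 1) by lra. assert (n = 0%Z) by (destruct H0; apply lt_IZR in H0; apply lt_IZR in H1; lia).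
  subst n. lra.
Qed.

Lemma coef_spec : forall G K nu f a, has_expansion G K nu f a -> has_expansion G K nu f (coef G K nu f).
Proof. intros. unfold coef. apply epsilon_spec. eauto. Qed.

Lemma coef_unique : forall G K nu f a, commensurable G -> has_expansion G K nu f a -> coef G K nu f = a.
Proof.
  intros G K nu f a cG H. apply (hexp_unique (width G) (Defs.sigma G K nu) f);
    [apply width_pos, cG| |exact H]. apply (coef_spec G K nu f a H).
Qed.

Lemma has_expansion_ext : forall G K nu f h a, (forall z, upper z -> f z = h z) ->
  has_expansion G K nu f a -> has_expansion G K nu h a.
Proof. intros G K nu f h a E H. exact (hexp_ext (width G) (Defs.sigma G K nu) f h a E H). Qed.

Lemma coef_ext : forall G K nu f h, (forall z, upper z -> f z = h z) -> coef G K nu f = coef G K nu h.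
Proof.
  intros G K nu f h E. unfold coef. f_equal. apply functional_extensionality. intros a.
  apply propositional_extensionality. split; apply has_expansion_ext; intros; [|symmetry]; auto.
Qed.

Lemma trel_expansion : forall K r G1 nu1 G2 nu2 f a, frame K G1 nu1 -> frame K G2 nu2 ->
  trel K r G1 nu1 G2 nu2 -> has_expansion G1 K nu1 f a ->
  has_expansion G2 K nu2 (fun z => f (z + RtoC r)%C) (fun x => ee (r * x) * a x)%C.
Proof.
  intros K r G1 nu1 G2 nu2 f a F1 F2 H Ha. rewrite has_expansion_hexp.
  rewrite (trel_width _ _ _ _ _ _ H), (trel_sigma _ _ _ _ _ _ F1 F2 H).
  apply hexp_translate, Ha.
Qed.

Lemma trel0_coef : forall K G1 nu1 G2 nu2 f, frame K G1 nu1 -> frame K G2 nu2 ->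
  trel K 0 G1 nu1 G2 nu2 -> coef G2 K nu2 f = coef G1 K nu1 f.
Proof.
  intros K G1 nu1 G2 nu2 f F1 F2 H. unfold coef. f_equal. apply functional_extensionality. intros a.
  rewrite !has_expansion_hexp.
  rewrite (trel_width _ _ _ _ _ _ H), (trel_sigma _ _ _ _ _ _ F1 F2 H). reflexivity.
Qed.

Lemma trel0_expansion : forall K G1 nu1 G2 nu2 f a, frame K G1 nu1 -> frame K G2 nu2 ->
  trel K 0 G1 nu1 G2 nu2 -> has_expansion G1 K nu1 f a -> has_expansion G2 K nu2 f a.
Proof.
  intros K G1 nu1 G2 nu2 f a F1 F2 H. rewrite !has_expansion_hexp.
  rewrite (trel_width _ _ _ _ _ _ H), (trel_sigma _ _ _ _ _ _ F1 F2 H). auto.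
Qed.

Lemma expansion_scal : forall G K nu c f a, has_expansion G K nu f a ->
  has_expansion G K nu (fun z => c * f z)%C (fun x => c * a x)%C.
Proof. intros G K nu c f a H. exact (hexp_scal (width G) (Defs.sigma G K nu) c f a H). Qed.

(** Duality of translates: the two factors of automorphy multiply to [jfac^2]. *)
Lemma trel_dual : forall K r G1 nu1 G2 nu2, subgrp G1 -> subgrp G2 -> mult_ok G1 K nu1 -> mult_ok G2 K nu2 ->
  trel K r G1 nu1 G2 nu2 -> trel (4 - K) r G1 (cbar nu1) G2 (cbar nu2).
Proof.
  intros K r G1 nu1 G2 nu2 s1 s2 o1 o2 [H1 H2]. split; [exact H1|]. intros d z Hd Hz.
  pose proof (subgrp_det _ _ s2 Hd) as Dd. set (d' := M2mul (M2mul (Tmat r) d) (M2inv (Tmat r))).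
  assert (Hd' : G1 d') by (apply H1, Hd). pose proof (subgrp_det _ _ s1 Hd') as Dd'.
  pose proof (upper_shift z r Hz) as Hz'.
  pose proof (aut_dual K nu2 d z Dd (proj1 o2 d Hd) Hz) as E2.
  pose proof (aut_dual K nu1 d' (z + RtoC r)%C Dd' (proj1 o1 d' Hd') Hz') as E1.
  rewrite H2 in E2 by assumption. fold d' in E2.
  assert (Ej : jfac d' (z + RtoC r)%C = jfac d z).
  { rewrite !jfac_det1 by assumption. unfold d'. rewrite T_inv. simpl. rewrite !RtoC_plus, !RtoC_mult, RtoC_opp, !RtoC_plus, !RtoC_mult. ring. }
  rewrite Ej, <- E2 in E1.
  pose proof (aut_nz G1 K nu1 d' _ s1 o1 Hd' Hz') as Hn.
  apply (f_equal (fun w => / aut K nu1 d' (z + RtoC r) * w)%C) in E1.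
  rewrite !Cmult_assoc, Cinv_l, !Cmult_1_l in E1 by exact Hn. symmetry. exact E1.
Qed.

(** ** Conjugation in stages, and conjugation of the dual *)

Lemma conjg_mul : forall G x y d, det2 x = 1 -> det2 y = 1 ->
  conjg (conjg G x) y d <-> conjg G (M2mul x y) d.
Proof.
  intros G x y d Dx Dy. unfold conjg. rewrite M2inv_mul by assumption. rewrite !M2mul_assoc. reflexivity.
Qed.

(** This is (f|x)|y = f|(x y), read on the factors of automorphy. *)
Lemma conj_stages : forall K G nu x y, subgrp G -> sqrt_pair x -> sqrt_pair y ->
  trel K 0 (conjg G (fst (Gmul x y))) (conj_mult K nu (Gmul x y))
    (conjg (conjg G (fst x)) (fst y)) (conj_mult K (conj_mult K nu x) y).
Proof.
  intros K G nu x y sG Hx Hy. pose proof (proj1 Hx) as Dx. pose proof (proj1 Hy) as Dy.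
  apply trel_0; [intros d; apply conjg_mul; assumption|]. intros d z Hd Hz.
  assert (Dd : det2 d = 1) by (eapply subgrp_det; [|exact Hd]; auto using subgrp_conj).
  pose proof (sqrt_pair_mul x y Hx Hy) as Hxy.
  pose proof (aut_conj K nu (Gmul x y) d z Hxy Dd Hz) as E1.
  pose proof (aut_conj K (conj_mult K nu x) y d z Hy Dd Hz) as E2.
  set (e := M2mul (M2mul (fst y) d) (M2inv (fst y))) in *.
  assert (De : det2 e = 1) by (unfold e; auto using det_mul1, det_inv).
  pose proof (moebius_upper _ z Dy Hz) as Hyz. pose proof (moebius_upper _ z Dd Hz) as Hdz.
  pose proof (aut_conj K nu x e (moebius (fst y) z) Hx De Hyz) as E3.
  assert (Ee : moebius e (moebius (fst y) z) = moebius (fst y) (moebius d z)).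
  { rewrite <- !moebius_mul by assumption. unfold e. rewrite M2mul_Kr' by exact Dy. reflexivity. }
  assert (Eg : M2mul (M2mul (fst (Gmul x y)) d) (M2inv (fst (Gmul x y))) = M2mul (M2mul (fst x) e) (M2inv (fst x))).
  { unfold e. simpl fst. rewrite M2inv_mul by assumption. rewrite !M2mul_assoc. reflexivity. }
  rewrite Eg in E1. rewrite Ee in E3. rewrite !Jx_mul in E1 by assumption.
  simpl fst in E1. rewrite moebius_mul in E1 by assumption.
  rewrite (Cmult_assoc (aut K nu _ _)) in E1. rewrite <- E3 in E1.
  assert (N1 : Jx K x (moebius (fst y) (moebius d z)) <> RtoC 0) by (apply Jx_nz; auto using moebius_upper).
  assert (N2 : Jx K y (moebius d z) <> RtoC 0) by (apply Jx_nz; assumption).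
  set (j1 := Jx K x (moebius (fst y) (moebius d z))) in *. set (j2 := Jx K y (moebius d z)) in *.
  set (A2 := aut K (conj_mult K (conj_mult K nu x) y) d z) in *.
  set (A1 := aut K (conj_mult K nu (Gmul x y)) d z) in *.
  assert (E : (A2 * (j1 * j2))%C = (A1 * (j1 * j2))%C).
  { rewrite E1. transitivity (A2 * j2 * j1)%C; [ring|]. rewrite E2. ring. }
  assert (N : (j1 * j2)%C <> RtoC 0) by (apply Cmult_neq_0; assumption).
  exact (Cmult_cancel_r _ _ _ N E).
Qed.

Lemma conj_of_trel0 : forall K G1 nu1 G2 nu2 x, subgrp G2 -> sqrt_pair x -> trel K 0 G1 nu1 G2 nu2 ->
  trel K 0 (conjg G1 (fst x)) (conj_mult K nu1 x) (conjg G2 (fst x)) (conj_mult K nu2 x).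
Proof.
  intros K G1 nu1 G2 nu2 x s2 Hx H. apply trel_0_inv in H. destruct H as [H1 H2].
  apply trel_0; [intros d; apply H1|]. intros d z Hd Hz. pose proof (proj1 Hx) as Dx.
  assert (Dd : det2 d = 1) by (eapply subgrp_det; [|exact Hd]; auto using subgrp_conj).
  pose proof (aut_conj K nu1 x d z Hx Dd Hz) as E1. pose proof (aut_conj K nu2 x d z Hx Dd Hz) as E2.
  rewrite H2, <- E1 in E2 by (try apply moebius_upper; assumption).
  assert (N : Jx K x (moebius d z) <> RtoC 0) by (apply Jx_nz; auto using moebius_upper).
  exact (Cmult_cancel_r _ _ _ N E2).
Qed.

Lemma conj_geq : forall K G nu x y, subgrp G -> sqrt_pair x -> geq x y ->
  trel K 0 (conjg G (fst x)) (conj_mult K nu x) (conjg G (fst y)) (conj_mult K nu y).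
Proof.
  intros K G nu x y sG Hx E. pose proof (geq_good x y E Hx) as Hy. pose proof E as [E1 E2]. pose proof (proj1 Hy) as Dy.
  apply trel_0; [intros d; rewrite E1; reflexivity|]. intros d z Hd Hz.
  assert (Dd : det2 d = 1) by (eapply subgrp_det; [|exact Hd]; auto using subgrp_conj).
  pose proof (aut_conj K nu x d z Hx Dd Hz) as F1. pose proof (aut_conj K nu y d z Hy Dd Hz) as F2.
  rewrite E1 in F1. rewrite !(geq_Jx K x y _ E) in F1 by auto using moebius_upper. rewrite <- F1 in F2.
  assert (N : Jx K y (moebius d z) <> RtoC 0) by (apply Jx_nz; auto using moebius_upper).
  exact (Cmult_cancel_r _ _ _ N F2).
Qed.

(** Both factors are complementary to that of [conj_mult K nu x]: the product
    is the square of [jfac]. *)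
Lemma conj_dual : forall K G nu x, subgrp G -> mult_ok G K nu -> sqrt_pair x ->
  trel (4 - K) 0 (conjg G (fst x)) (conj_mult (4 - K) (cbar nu) x)
    (conjg G (fst x)) (cbar (conj_mult K nu x)).
Proof.
  intros K G nu x sG oG Hx. apply trel_0; [reflexivity|]. intros d z Hd Hz. pose proof (proj1 Hx) as Dx.
  pose proof (subgrp_conj G _ sG Dx) as sC. pose proof (subgrp_det _ _ sC Hd) as Dd.
  pose proof (conj_mult_ok G K nu x sG Hx oG) as oC.
  destruct (conj_mult_sign K nu x d Hx Dd) as [e [He [E H]]].
  pose proof (aut_conj (4 - K) (cbar nu) x d z Hx Dd Hz) as F1.
  pose proof (aut_conj K nu x d z Hx Dd Hz) as F2.
  set (g := M2mul (M2mul (fst x) d) (M2inv (fst x))) in *.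
  assert (Dg : det2 g = 1) by (apply (subgrp_det _ _ sG); exact Hd).
  pose proof (moebius_upper _ z Dx Hz) as Hxz. pose proof (moebius_upper _ z Dd Hz) as Hdz.
  pose proof (aut_dual K nu g (moebius (fst x) z) Dg (proj1 oG g Hd) Hxz) as D1.
  pose proof (aut_dual K (conj_mult K nu x) d z Dd (proj1 oC d Hd) Hz) as D2.
  pose proof (Jx_dual K x z Hx Hz) as D3. pose proof (Jx_dual K x (moebius d z) Hx Hdz) as D4.
  assert (Ej : (jfac g (moebius (fst x) z) * jfac (fst x) z)%C = (jfac (fst x) (moebius d z) * jfac d z)%C).
  { rewrite <- !jfac_mul by assumption. unfold g. rewrite M2mul_Kr' by exact Dx. reflexivity. }
  set (a := aut K (conj_mult K nu x) d z) in *.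
  set (b := aut (4 - K) (conj_mult (4 - K) (cbar nu) x) d z) in *.
  set (b' := aut (4 - K) (cbar (conj_mult K nu x)) d z) in *.
  assert (Na : a <> RtoC 0) by (unfold a; eapply aut_nz; eassumption).
  assert (Nj : (jfac (fst x) (moebius d z) * jfac (fst x) (moebius d z))%C <> RtoC 0)
    by (apply Cmult_neq_0; apply jfac_nz; assumption).
  assert (P : (b * a * (jfac (fst x) (moebius d z) * jfac (fst x) (moebius d z)))%C =
    (b' * a * (jfac (fst x) (moebius d z) * jfac (fst x) (moebius d z)))%C).
  { rewrite (Cmult_comm b' a), D2, <- D4.
    transitivity ((a * Jx K x (moebius d z)) * (b * Jx (4 - K) x (moebius d z)))%C; [ring|]. rewrite F1, F2, D4.
    transitivity ((aut K nu g (moebius (fst x) z) * aut (4 - K) (cbar nu) g (moebius (fst x) z)) *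
      (Jx K x z * Jx (4 - K) x z))%C; [ring|]. rewrite D1, D3.
    transitivity ((jfac g (moebius (fst x) z) * jfac (fst x) z) * (jfac g (moebius (fst x) z) * jfac (fst x) z))%C; [ring|].
    rewrite Ej. ring. }
  apply (Cmult_cancel_r _ _ _ Na). symmetry. exact (Cmult_cancel_r _ _ _ Nj P).
Qed.

Lemma modular_aut : forall G K nu f g z, subgrp G -> mult_ok G K nu -> modular G K nu f -> G g -> upper z ->
  f (moebius g z) = (aut K nu g z * f z)%C.
Proof.
  intros G K nu f g z sG oG Hf Gg Hz. rewrite <- (Hf g z Gg Hz).
  pose proof (aut_nz G K nu g z sG oG Gg Hz) as N. unfold aut in *. field.
  split; intros E; apply N; rewrite E; ring.
Qed.

Lemma aut_modular : forall G K nu f, subgrp G -> mult_ok G K nu ->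
  (forall g z, G g -> upper z -> f (moebius g z) = (aut K nu g z * f z)%C) -> modular G K nu f.
Proof.
  intros G K nu f sG oG H g z Gg Hz. rewrite H by assumption.
  pose proof (aut_nz G K nu g z sG oG Gg Hz) as N. unfold aut in *. field.
  split; intros E; apply N; rewrite E; ring.
Qed.

(** ** Two matrices leading to the same cusp *)

Section CuspFactor.

Variables (K : Z) (G : M2 -> Prop) (nu : M2 -> C).
Hypothesis (sG : subgrp G) (oG : mult_ok G K nu).

Lemma CF_cusp_eq : forall lam al r c, cusp_factor G K nu lam al r c -> cusp_eq G (fst lam) (fst al).
Proof. intros lam al r c [mu [Gmu [E _]]]. exists mu, r. split; assumption. Qed.

Lemma CF_unfold : forall lam al r c, sqrt_pair lam -> sqrt_pair al -> cusp_factor G K nu lam al r c ->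
  exists mu, G mu /\
    (fst lam = M2mul (M2mul mu (fst al)) (Tmat r) \/ fst lam = M2opp (M2mul (M2mul mu (fst al)) (Tmat r))) /\
    c <> RtoC 0 /\
    (forall z, upper z -> (c * Jx K lam z)%C =
      (aut K nu mu (moebius (fst al) (z + RtoC r)%C) * Jx K al (z + RtoC r)%C)%C) /\
    (forall z, upper z -> moebius (fst lam) z = moebius mu (moebius (fst al) (z + RtoC r)%C)).
Proof.
  intros lam al r c Hl Ha [mu [Gmu [E H]]]. exists mu. split; [exact Gmu|]. split; [exact E|].
  assert (E1 : forall z, upper z -> (c * Jx K lam z)%C =
      (aut K nu mu (moebius (fst al) (z + RtoC r)%C) * Jx K al (z + RtoC r)%C)%C) by exact H.
  pose proof (subgrp_det _ _ sG Gmu) as Dmu. pose proof (proj1 Ha) as Da.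
  split; [|split; [exact E1|]].
  - intros E0. pose proof (upper_shift Ci r upper_Ci) as Hz'. specialize (E1 Ci upper_Ci). rewrite E0, Cmult_0_l in E1.
    symmetry in E1. revert E1. apply Cmult_neq_0; [|apply Jx_nz; assumption].
    eapply aut_nz; try eassumption. apply moebius_upper; assumption.
  - intros z Hz. pose proof (upper_shift z r Hz) as Hz'.
    assert (E' : moebius (M2mul (M2mul mu (fst al)) (Tmat r)) z = moebius mu (moebius (fst al) (z + RtoC r)%C)).
    { rewrite moebius_mul, moebius_T, moebius_mul; auto using det_mul1, det_T. }
    destruct E as [-> | ->]; [exact E'|]. rewrite moebius_opp; auto using det_mul1, det_T.
Qed.

(** The constant of [cusp_factor] is defined for this identity. *)
Lemma CF_slash : forall lam al r c f z, sqrt_pair lam -> sqrt_pair al -> cusp_factor G K nu lam al r c ->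
  modular G K nu f -> upper z -> slash K f lam z = (c * slash K f al (z + RtoC r)%C)%C.
Proof.
  intros lam al r c f z Hl Ha HC Hf Hz.
  destruct (CF_unfold lam al r c Hl Ha HC) as [mu [Gmu [_ [Nc [E Em]]]]].
  pose proof (upper_shift z r Hz) as Hz'. pose proof (moebius_upper _ _ (proj1 Ha) Hz') as Hu.
  unfold slash. fold (Jx K lam z). fold (Jx K al (z + RtoC r)%C).
  rewrite Em, (modular_aut G K nu f mu) by assumption.
  pose proof (Jx_nz K lam z Hl Hz) as N1. pose proof (Jx_nz K al _ Ha Hz') as N2.
  pose proof (aut_nz G K nu mu _ sG oG Gmu Hu) as N3.
  assert (E2 : Jx K lam z = (aut K nu mu (moebius (fst al) (z + RtoC r)) * Jx K al (z + RtoC r) / c)%C).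
  { rewrite <- E by exact Hz. field. exact Nc. }
  rewrite E2. field. repeat split; assumption.
Qed.

(** Substitute the defining identity of [c] at [z] and at [moebius d z]; the
    constant cancels. *)
Lemma CF_trel : forall lam al r c, sqrt_pair lam -> sqrt_pair al -> cusp_factor G K nu lam al r c ->
  trel K r (conjg G (fst al)) (conj_mult K nu al) (conjg G (fst lam)) (conj_mult K nu lam).
Proof.
  intros lam al r c Hl Ha HC.
  destruct (CF_unfold lam al r c Hl Ha HC) as [mu [Gmu [Efst [Nc [E Em]]]]].
  pose proof (subgrp_det _ _ sG Gmu) as Dmu. pose proof (proj1 Ha) as Da. pose proof (proj1 Hl) as Dl.
  assert (Eg : forall d, M2mul (M2mul (fst lam) d) (M2inv (fst lam)) =
    M2mul (M2mul mu (M2mul (M2mul (fst al) (M2mul (M2mul (Tmat r) d) (M2inv (Tmat r)))) (M2inv (fst al)))) (M2inv mu)).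
  { intros d. assert (E0 : M2mul (M2mul (M2mul (M2mul mu (fst al)) (Tmat r)) d) (M2inv (M2mul (M2mul mu (fst al)) (Tmat r))) =
      M2mul (M2mul mu (M2mul (M2mul (fst al) (M2mul (M2mul (Tmat r) d) (M2inv (Tmat r)))) (M2inv (fst al)))) (M2inv mu)).
    { rewrite !M2inv_mul by auto using det_mul1, det_T. rewrite !M2mul_assoc. reflexivity. }
    destruct Efst as [-> | ->]; [exact E0|].
    rewrite M2inv_opp, M2opp_mul_l, M2opp_mul_l, M2opp_mul_r, M2opp_opp by auto using det_mul1, det_T. exact E0. }
  split.
  - intros d. unfold conjg. rewrite Eg. apply (conjg_self G mu sG Gmu).
  - intros d z Hd Hz.
    assert (Dd : det2 d = 1) by (eapply subgrp_det; [|exact Hd]; auto using subgrp_conj).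
    set (d' := M2mul (M2mul (Tmat r) d) (M2inv (Tmat r))).
    assert (Dd' : det2 d' = 1) by (unfold d'; auto using det_mul1, det_T, det_inv).
    set (z' := (z + RtoC r)%C). pose proof (upper_shift z r Hz : upper z') as Hz'.
    pose proof (moebius_upper _ _ Dd Hz) as Hdz. pose proof (moebius_upper _ _ Dd' Hz') as Hdz'.
    assert (Edz : (moebius d z + RtoC r)%C = moebius d' z').
    { unfold z'. rewrite <- !moebius_T, <- !moebius_mul by auto using det_T, det_mul1, det_inv.
      unfold d'. rewrite M2mul_Kr' by apply det_T. reflexivity. }
    pose proof (aut_conj K nu lam d z Hl Dd Hz) as F1.
    pose proof (aut_conj K nu al d' z' Ha Dd' Hz') as F2.
    rewrite Eg in F1. fold d' in F1. set (g' := M2mul (M2mul (fst al) d') (M2inv (fst al))) in *.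
    assert (Gg' : G g').
    { apply (conjg_self G mu sG Gmu). unfold conjg, g', d'. rewrite <- Eg. exact Hd. }
    pose proof (subgrp_det _ _ sG Gg') as Dg'.
    pose proof (E z Hz) as E1. pose proof (E (moebius d z) Hdz) as E2.
    fold z' in E1. rewrite Edz in E2. rewrite Em in F1 by exact Hz. fold z' in F1.
    pose proof (moebius_upper _ _ Da Hz') as Haz. 
    assert (Eal : moebius g' (moebius (fst al) z') = moebius (fst al) (moebius d' z')).
    { rewrite <- !moebius_mul by auto. unfold g'. rewrite M2mul_Kr' by exact Da. reflexivity. }
    assert (Cc : (aut K nu (M2mul (M2mul mu g') (M2inv mu)) (moebius mu (moebius (fst al) z')) *
        aut K nu mu (moebius (fst al) z'))%C =
      (aut K nu mu (moebius (fst al) (moebius d' z')) * aut K nu g' (moebius (fst al) z'))%C).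
    { destruct oG as [_ [o2 _]].
      rewrite <- o2 by (auto; apply sG; auto; apply subgrp_mul; auto).
      rewrite M2mul_Kr' by exact Dmu. rewrite o2 by assumption. rewrite Eal. reflexivity. }
    assert (N1 : Jx K lam (moebius d z) <> RtoC 0) by (apply Jx_nz; assumption).
    assert (P : (aut K (conj_mult K nu lam) d z * (c * Jx K lam (moebius d z)))%C =
      (aut K (conj_mult K nu al) d' z' * (c * Jx K lam (moebius d z)))%C).
    { transitivity (c * (aut K (conj_mult K nu lam) d z * Jx K lam (moebius d z)))%C; [ring|]. rewrite F1.
      transitivity (aut K nu (M2mul (M2mul mu g') (M2inv mu)) (moebius mu (moebius (fst al) z')) * (c * Jx K lam z))%C; [ring|].
      rewrite E1, E2, Cmult_assoc, Cc.
      transitivity (aut K nu mu (moebius (fst al) (moebius d' z')) * (aut K nu g' (moebius (fst al) z') * Jx K al z'))%C; [ring|].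
      rewrite <- F2. ring. }
    assert (N : (c * Jx K lam (moebius d z))%C <> RtoC 0) by (apply Cmult_neq_0; assumption).
    exact (Cmult_cancel_r _ _ _ N P).
Qed.

(** All square roots involved agree up to constants, so the defining identity
    of [c] holds at all points once it holds at one. *)
Lemma CF_intro : forall lam al mu r, sqrt_pair lam -> sqrt_pair al -> G mu ->
  (fst lam = M2mul (M2mul mu (fst al)) (Tmat r) \/ fst lam = M2opp (M2mul (M2mul mu (fst al)) (Tmat r))) ->
  exists c, cusp_factor G K nu lam al r c.
Proof.
  intros lam al mu r [Dl [e [He El]]] [Da [e' [He' Ea]]] Gmu E.
  pose proof (subgrp_det _ _ sG Gmu) as Dmu. pose proof (det_mul1 _ _ Dmu Da) as Dma.
  set (h := M2mul (M2mul mu (fst al)) (Tmat r)) in *.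
  assert (Dh : det2 h = 1) by (unfold h; auto using det_mul1, det_T).
  assert (Hk : exists k, k <> RtoC 0 /\ forall z, upper z -> Csqrt (jfac (fst lam) z) = (k * Csqrt (jfac h z))%C).
  { destruct E as [-> | ->]; [exists (RtoC 1); split; [apply C1_nz|intros; ring]|apply sqrt_opp, Dh]. }
  destruct Hk as [k [Nk Hk]].
  destruct (sqrt_cocycle (M2mul mu (fst al)) (Tmat r) Dma (det_T r)) as [e1 [He1 E1]].
  destruct (sqrt_cocycle mu (fst al) Dmu Da) as [e2 [He2 E2]].
  set (q := (e * k * e1 * e2 * e')%C).
  assert (Nq : q <> RtoC 0) by (unfold q; repeat apply Cmult_neq_0; auto using sgn1_nz).
  assert (Hq : forall z, upper z -> snd lam z =
    (q * (Csqrt (jfac mu (moebius (fst al) (z + RtoC r))) * snd al (z + RtoC r)))%C).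
  { intros z Hz. pose proof (upper_shift z r Hz) as Hz'. rewrite El, Hk, Ea by assumption. unfold h. rewrite E1 by exact Hz.
    rewrite moebius_T, E2 by exact Hz'. rewrite (jfac_det1 (Tmat r)) by apply det_T.
    replace (RtoC (mc (Tmat r)) * z + RtoC (md (Tmat r)))%C with (RtoC 1) by (simpl; ring). rewrite Csqrt_1.
    unfold q. transitivity (e * k * e1 * e2 * (e' * e') * (Csqrt (jfac mu (moebius (fst al) (z + RtoC r))) * Csqrt (jfac (fst al) (z + RtoC r))))%C; [|ring].
    rewrite (sgn1_sqr e' He'). ring. }
  exists (nu mu / Cpowz q K)%C. exists mu. split; [exact Gmu|]. split; [exact E|].
  intros z Hz. cbv zeta. pose proof (upper_shift z r Hz) as Hz'. pose proof (moebius_upper _ _ Da Hz') as Hu.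
  rewrite Hq by exact Hz.
  assert (N1 : Csqrt (jfac mu (moebius (fst al) (z + RtoC r))) <> RtoC 0) by (apply Csqrt_nz, jfac_nz; assumption).
  assert (N2 : snd al (z + RtoC r)%C <> RtoC 0).
  { rewrite Ea by exact Hz'. apply Cmult_neq_0; [apply sgn1_nz, He'|apply Csqrt_nz, jfac_nz; assumption]. }
  rewrite !Cpowz_mult by (try assumption; apply Cmult_neq_0; assumption).
  unfold jpow. field. apply Cpowz_nz, Nq.
Qed.

Lemma CF_trans : forall a b d r s c e, sqrt_pair a -> sqrt_pair b -> sqrt_pair d ->
  cusp_factor G K nu a b r c -> cusp_factor G K nu b d s e -> cusp_factor G K nu a d (s + r) (c * e)%C.
Proof.
  intros a b d r s c e Ha Hb Hd H1 H2.
  destruct (CF_unfold _ _ _ _ Ha Hb H1) as [m1 [G1 [F1 [_ [E1 M1]]]]].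
  destruct (CF_unfold _ _ _ _ Hb Hd H2) as [m2 [G2 [F2 [_ [E2 M2']]]]].
  exists (M2mul m1 m2). split; [apply subgrp_mul; assumption|]. split.
  - destruct F1 as [-> | ->]; destruct F2 as [-> | ->];
      rewrite ?M2opp_mul_r, ?M2opp_mul_l, ?M2opp_opp, <- ?T_add, ?M2mul_assoc; auto.
  - intros z Hz. cbv zeta. pose proof (upper_shift z r Hz) as Hz'. pose proof (upper_shift _ s Hz') as Hz''.
    replace (z + RtoC (s + r))%C with (z + RtoC r + RtoC s)%C by (rewrite RtoC_plus; ring).
    specialize (E1 z Hz). specialize (E2 _ Hz'). specialize (M2' _ Hz').
    fold (Jx K a z). fold (Jx K d (z + RtoC r + RtoC s)%C).
    fold (aut K nu (M2mul m1 m2) (moebius (fst d) (z + RtoC r + RtoC s)%C)).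
    rewrite (proj1 (proj2 oG)) by (try apply moebius_upper; try apply Hd; assumption).
    rewrite <- M2'. transitivity (e * (c * Jx K a z))%C; [ring|]. rewrite E1.
    transitivity (aut K nu m1 (moebius (fst b) (z + RtoC r)) * (e * Jx K b (z + RtoC r)))%C; [ring|].
    rewrite E2. ring.
Qed.

(** The two identities multiply to the cocycle relation for the square of
    [jfac], where the constant is 1. *)
Lemma CF_dual : forall lam al r c, sqrt_pair lam -> sqrt_pair al -> cusp_factor G K nu lam al r c ->
  cusp_factor G (4 - K) (cbar nu) lam al r (/ c)%C.
Proof.
  intros lam al r c Hl Ha HC.
  destruct (CF_unfold lam al r c Hl Ha HC) as [mu [Gmu [Efst [Nc [E Em]]]]].
  exists mu. split; [exact Gmu|]. split; [exact Efst|]. intros z Hz. cbv zeta.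
  pose proof (upper_shift z r Hz) as Hz'. set (z' := (z + RtoC r)%C) in *.
  fold (Jx (4 - K) lam z). fold (Jx (4 - K) al z'). fold (aut (4 - K) (cbar nu) mu (moebius (fst al) z')).
  pose proof (subgrp_det _ _ sG Gmu) as Dmu. pose proof (proj1 Ha) as Da. pose proof (proj1 Hl) as Dl.
  pose proof (moebius_upper _ _ Da Hz') as Hu.
  pose proof (aut_dual K nu mu _ Dmu (proj1 oG mu Gmu) Hu) as D1.
  pose proof (Jx_dual K lam z Hl Hz) as D2. pose proof (Jx_dual K al z' Ha Hz') as D3.
  specialize (E z Hz). fold z' in E.
  assert (Ej : (jfac (fst lam) z * jfac (fst lam) z)%C = (jfac mu (moebius (fst al) z') * jfac (fst al) z' *
    (jfac mu (moebius (fst al) z') * jfac (fst al) z'))%C).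
  { assert (E0 : jfac (M2mul (M2mul mu (fst al)) (Tmat r)) z = (jfac mu (moebius (fst al) z') * jfac (fst al) z')%C).
    { rewrite jfac_mul, moebius_T, jfac_mul by auto using det_mul1, det_T.
      rewrite (jfac_det1 (Tmat r)) by apply det_T. unfold z'. simpl. ring. }
    destruct Efst as [-> | ->]; [rewrite E0; ring|]. rewrite jfac_opp, E0 by auto using det_mul1, det_T. ring. }
  assert (N1 : Jx K lam z <> RtoC 0) by (apply Jx_nz; assumption).
  set (A := aut K nu mu (moebius (fst al) z')) in *. set (B := aut (4 - K) (cbar nu) mu (moebius (fst al) z')) in *.
  set (ja := Jx K al z') in *. set (ja' := Jx (4 - K) al z') in *. set (jl := Jx K lam z) in *. set (jl' := Jx (4 - K) lam z) in *.
  assert (P : ((/ c * jl') * (c * jl))%C = (B * ja' * (c * jl))%C).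
  { transitivity (jl * jl')%C; [field; exact Nc|]. rewrite D2, Ej, E.
    transitivity ((A * B) * (ja * ja'))%C; [rewrite D1, D3; ring|ring]. }
  assert (N : (c * jl)%C <> RtoC 0) by (apply Cmult_neq_0; assumption).
  exact (Cmult_cancel_r _ _ _ N P).
Qed.

Lemma CF_geq : forall lam lam' al al' r c, sqrt_pair al -> geq lam lam' -> geq al al' ->
  cusp_factor G K nu lam al r c -> cusp_factor G K nu lam' al' r c.
Proof.
  intros lam lam' al al' r c Ha [E1 E2] [F1 F2] [mu [Gmu [E H]]]. exists mu. split; [exact Gmu|].
  rewrite <- E1, <- F1. split; [exact E|]. intros z Hz. specialize (H z Hz). cbv zeta in *.
  rewrite <- E2, <- F2 by auto using upper_shift. exact H.
Qed.

(** Conjugating [mu] by [be] multiplies both sides of the defining identity of [c]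
    by the same value of the root of [be]. *)
Lemma CF_push : forall be lam al r c, sqrt_pair be -> sqrt_pair lam -> sqrt_pair al ->
  cusp_factor (conjg G (fst be)) K (conj_mult K nu be) lam al r c <->
  cusp_factor G K nu (Gmul be lam) (Gmul be al) r c.
Proof.
  intros be lam al r c Hb Hl Ha. pose proof (proj1 Hb) as Db. pose proof (proj1 Ha) as Da. pose proof (proj1 Hl) as Dl.
  pose proof (subgrp_conj G _ sG Db) as sC.
  assert (Key : forall mu, det2 mu = 1 -> let mu' := M2mul (M2mul (fst be) mu) (M2inv (fst be)) in
    (fst lam = M2mul (M2mul mu (fst al)) (Tmat r) \/ fst lam = M2opp (M2mul (M2mul mu (fst al)) (Tmat r))) ->
    forall z, upper z -> let z' := (z + RtoC r)%C in
    (c * Jx K (Gmul be lam) z)%C = (c * Jx K lam z * Jx K be (moebius (fst lam) z))%C /\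
    (aut K nu mu' (moebius (fst (Gmul be al)) z') * Jx K (Gmul be al) z')%C =
    (aut K (conj_mult K nu be) mu (moebius (fst al) z') * Jx K al z' * Jx K be (moebius (fst lam) z))%C).
  { intros mu Dmu mu' E z Hz z'. pose proof (upper_shift z r Hz : upper z') as Hz'.
    pose proof (moebius_upper _ _ Da Hz') as Hu. rewrite !Jx_mul by assumption. split; [ring|].
    simpl fst. rewrite moebius_mul by assumption.
    assert (El : moebius (fst lam) z = moebius mu (moebius (fst al) z')).
    { assert (E' : moebius (M2mul (M2mul mu (fst al)) (Tmat r)) z = moebius mu (moebius (fst al) z')).
      { rewrite moebius_mul, moebius_T, moebius_mul; auto using det_mul1, det_T. }
      destruct E as [-> | ->]; [exact E'|]. rewrite moebius_opp; auto using det_mul1, det_T. }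
    pose proof (aut_conj K nu be mu (moebius (fst al) z') Hb Dmu Hu) as F. fold mu' in F. rewrite <- El in F.
    transitivity (aut K nu mu' (moebius (fst be) (moebius (fst al) z')) * Jx K be (moebius (fst al) z') * Jx K al z')%C; [ring|].
    rewrite <- F. ring. }
  assert (Hfst : forall mu, det2 mu = 1 -> let mu' := M2mul (M2mul (fst be) mu) (M2inv (fst be)) in
    M2mul (M2mul mu' (fst (Gmul be al))) (Tmat r) = M2mul (fst be) (M2mul (M2mul mu (fst al)) (Tmat r))).
  { intros mu Dmu mu'. unfold mu'. simpl fst. rewrite !M2mul_assoc. rewrite M2mul_Kr' by exact Db. reflexivity. }
  split.
  - intros [mu [Gmu [E H]]]. pose proof (subgrp_det _ _ sC Gmu) as Dmu.
    exists (M2mul (M2mul (fst be) mu) (M2inv (fst be))). split; [exact Gmu|]. split.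
    + rewrite Hfst by exact Dmu. simpl fst. destruct E as [-> | ->]; [left|right]; rewrite ?M2opp_mul_r; reflexivity.
    + intros z Hz. destruct (Key mu Dmu E z Hz) as [K1 K2]. specialize (H z Hz). cbv zeta in *.
      unfold Jx, aut in *. rewrite K1, K2, H. reflexivity.
  - intros [mu [Gmu [E H]]]. pose proof (subgrp_det _ _ sG Gmu) as Dmu.
    set (m := M2mul (M2mul (M2inv (fst be)) mu) (fst be)).
    assert (Em : M2mul (M2mul (fst be) m) (M2inv (fst be)) = mu).
    { unfold m. rewrite !M2mul_assoc, M2inv_r, M2mul_1l, M2mul_Kr by exact Db. reflexivity. }
    assert (Dm : det2 m = 1) by (unfold m; auto using det_mul1, det_inv).
    exists m. split; [unfold conj_group, conjg; rewrite Em; exact Gmu|].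
    pose proof (Hfst m Dm) as Hf. cbv zeta in Hf. rewrite Em in Hf. rewrite Hf in E. simpl fst in E.
    assert (E' : fst lam = M2mul (M2mul m (fst al)) (Tmat r) \/ fst lam = M2opp (M2mul (M2mul m (fst al)) (Tmat r))).
    { destruct E as [E|E]; [left|right]; apply (f_equal (M2mul (M2inv (fst be)))) in E.
      - rewrite !M2mul_Kl in E by exact Db. exact E.
      - rewrite M2opp_mul_r, !M2mul_Kl in E by exact Db. exact E. }
    split; [exact E'|]. intros z Hz. destruct (Key m Dm E' z Hz) as [K1 K2]. specialize (H z Hz).
    cbv zeta in *. rewrite Em in K2.
    fold (Jx K (Gmul be lam) z) in H. fold (Jx K (Gmul be al) (z + RtoC r)%C) in H.
    fold (aut K nu mu (moebius (fst (Gmul be al)) (z + RtoC r)%C)) in H.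
    rewrite K1, K2 in H.
    assert (N : Jx K be (moebius (fst lam) z) <> RtoC 0) by (apply Jx_nz; auto using moebius_upper).
    exact (Cmult_cancel_r _ _ _ N H).
Qed.

End CuspFactor.

(** ** Cusp classes and inverses of pairs *)

Lemma cusp_eq_sym : forall G l x, subgrp G -> det2 x = 1 -> cusp_eq G l x -> cusp_eq G x l.
Proof.
  intros G l x sG Dx [mu [r [Gmu E]]]. pose proof (subgrp_det _ _ sG Gmu) as Dmu.
  assert (E0 : M2mul (M2mul (M2inv mu) (M2mul (M2mul mu x) (Tmat r))) (Tmat (- r)) = x).
  { rewrite !M2mul_assoc, M2inv_l, M2mul_1l by assumption. rewrite <- M2mul_assoc, T_add. replace (r + - r) with 0 by ring.
    apply M2_eq; simpl; ring. }
  exists (M2inv mu), (- r). split; [apply subgrp_inv; assumption|].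
  destruct E as [-> | ->]; [left|right]; rewrite ?M2opp_mul_r, ?M2opp_mul_l, ?M2opp_opp; auto.
Qed.

Lemma cusp_eq_trans : forall G l x y, subgrp G -> cusp_eq G l x -> cusp_eq G x y -> cusp_eq G l y.
Proof.
  intros G l x y sG [mu [r [Gmu E]]] [mu' [r' [Gmu' E']]]. exists (M2mul mu mu'), (r' + r).
  split; [apply subgrp_mul; assumption|].
  destruct E as [-> | ->]; destruct E' as [-> | ->];
    rewrite ?M2opp_mul_r, ?M2opp_mul_l, ?M2opp_opp, <- ?T_add, ?M2mul_assoc; auto.
Qed.

Lemma cusp_eq_push : forall G b l x, subgrp G -> det2 b = 1 ->
  (cusp_eq (conjg G b) l x <-> cusp_eq G (M2mul b l) (M2mul b x)).
Proof.
  intros G b l x sG Db.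
  assert (Key : forall mu r, M2mul (M2mul (M2mul (M2mul b mu) (M2inv b)) (M2mul b x)) (Tmat r) =
    M2mul b (M2mul (M2mul mu x) (Tmat r))).
  { intros mu r. rewrite !M2mul_assoc, M2mul_Kr' by exact Db. reflexivity. }
  split.
  - intros [mu [r [Gmu E]]]. exists (M2mul (M2mul b mu) (M2inv b)), r. split; [exact Gmu|]. rewrite Key.
    destruct E as [-> | ->]; [left|right]; rewrite ?M2opp_mul_r; reflexivity.
  - intros [mu [r [Gmu E]]]. set (m := M2mul (M2mul (M2inv b) mu) b).
    assert (Em : M2mul (M2mul b m) (M2inv b) = mu).
    { unfold m. rewrite !M2mul_assoc, M2inv_r, M2mul_1l, M2mul_Kr by exact Db. reflexivity. }
    exists m, r. split; [unfold conjg; rewrite Em; exact Gmu|]. specialize (Key m r). rewrite Em in Key. rewrite Key in E.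
    destruct E as [E|E]; [left|right]; apply (f_equal (M2mul (M2inv b))) in E.
    + rewrite !M2mul_Kl in E by exact Db. exact E.
    + rewrite M2opp_mul_r, !M2mul_Kl in E by exact Db. exact E.
Qed.

Lemma geq_inv_mul : forall a b, sqrt_pair a -> sqrt_pair b -> geq (Ginv (Gmul (Ginv a) b)) (Gmul (Ginv b) a).
Proof.
  intros a b Ha Hb. pose proof (proj1 Ha) as Da. pose proof (proj1 Hb) as Db.
  assert (E : M2inv (M2mul (M2inv (fst a)) (fst b)) = M2mul (M2inv (fst b)) (fst a)).
  { rewrite M2inv_mul, M2inv_inv; auto using det_inv. }
  split; [exact E|]. intros z Hz. simpl. rewrite E.
  pose proof (moebius_upper _ _ Da Hz) as Hu. pose proof (moebius_upper _ _ (det_inv _ Db) Hu) as Hv.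
  rewrite moebius_mul by auto using det_inv. rewrite moebius_inv_r, moebius_inv_l by assumption.
  field. split; apply sqrt_pair_nz; assumption.
Qed.

Lemma slash_inv_div : forall K h a b z, sqrt_pair a -> sqrt_pair b -> upper z ->
  slash K h (Ginv (Gmul (Ginv b) a)) z = slash K (slash K h (Ginv a)) b z.
Proof.
  intros K h a b z Ha Hb Hz. rewrite slash_mul by auto using sqrt_pair_inv.
  apply geq_slash; [apply geq_inv_mul; assumption|exact Hz].
Qed.

Lemma slash_at_inv : forall K F a z, sqrt_pair a -> upper z -> slash K (slash K F a) (Ginv a) z = F z.
Proof.
  intros K F a z Ha Hz. rewrite slash_mul by auto using sqrt_pair_inv.
  rewrite (geq_slash K F _ _ z (geq_inv_r a Ha) Hz). unfold slash. simpl. rewrite Cpowz_1, moebius_one. field.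
Qed.

(** * Forms at all cusps *)

Section Forms.

Variable Gh : M2 -> Prop.
Hypothesis hGh : maximal_commensurable Gh.

Definition inH (x : Gelt) : Prop := sqrt_pair x /\ Gh (fst x).

Lemma Gh_subgrp : subgrp Gh.
Proof. apply comm_subgrp, hGh. Qed.

Lemma inH_mul : forall x y, inH x -> inH y -> inH (Gmul x y).
Proof. intros x y [A B] [C D]. split; [apply sqrt_pair_mul; assumption|simpl; apply subgrp_mul; auto using Gh_subgrp]. Qed.
Lemma inH_inv : forall x, inH x -> inH (Ginv x).
Proof. intros x [A B]. split; [apply sqrt_pair_inv; assumption|simpl; apply subgrp_inv; auto using Gh_subgrp]. Qed.
Lemma inH_one : inH Gone.
Proof. split; [apply sqrt_pair_one|apply Gh_subgrp]. Qed.
Lemma inH_lift : forall l, Gh l -> inH (lift l).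
Proof. intros l H. split; [apply sqrt_pair_lift, (subgrp_det _ _ Gh_subgrp H)|exact H]. Qed.
Lemma inH_good : forall x, inH x -> sqrt_pair x.
Proof. intros x H; apply H. Qed.
Hint Resolve inH_mul inH_inv inH_one inH_lift inH_good : core.

Definition admissible (K : Z) (G : M2 -> Prop) (nu : M2 -> C) : Prop :=
  commensurable G /\ (forall g, G g -> Gh g) /\ mult_ok G K nu /\ finite_multiplier G nu.

Lemma admissible_frame : forall K G nu, admissible K G nu -> frame K G nu.
Proof. intros K G nu H. split; apply H. Qed.
Lemma admissible_subgrp : forall K G nu, admissible K G nu -> subgrp G.
Proof. intros K G nu H. apply comm_subgrp, H. Qed.
Lemma admissible_ok : forall K G nu, admissible K G nu -> mult_ok G K nu.
Proof. intros K G nu H. apply H. Qed.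

Lemma admissible_conj : forall K G nu x, admissible K G nu -> inH x -> admissible K (conjg G (fst x)) (conj_mult K nu x).
Proof.
  intros K G nu x H [Hx Gx]. pose proof (admissible_subgrp _ _ _ H) as sG. destruct H as [cG [Hs [oG fG]]].
  destruct (comm_conj G Gh (fst x) cG (proj1 hGh) Hs Gx) as [c1 s1].
  repeat split; try assumption; try apply c1; try (apply (conj_mult_ok G K nu x); assumption).
  apply conj_mult_finite; assumption.
Qed.

Lemma admissible_dual : forall K G nu, admissible K G nu -> admissible (4 - K) G (cbar nu).
Proof.
  intros K G nu H. pose proof (admissible_subgrp _ _ _ H) as sG. destruct H as [cG [Hs [oG fG]]].
  split; [exact cG|]. split; [exact Hs|]. split; [apply mult_ok_dual; assumption|apply finite_dual, fG].
Qed.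
Hint Resolve admissible_frame admissible_subgrp admissible_ok admissible_conj admissible_dual : core.

(** The translation in a representation of [lam] lies in the maximal group up
    to sign, so it is rational. *)
Lemma CF_exists : forall K G nu lam al, admissible K G nu -> inH lam -> inH al -> cusp_eq G (fst lam) (fst al) ->
  exists (r : QArith_base.Q) c, cusp_factor G K nu lam al (Rdefinitions.Q2R r) c.
Proof.
  intros K G nu lam al H [Hl Gl] [Ha Ga] [mu [r [Gmu E]]].
  pose proof (admissible_subgrp _ _ _ H) as sG. pose proof (subgrp_det _ _ sG Gmu) as Dmu. pose proof (proj1 Ha) as Da.
  assert (Ht : transl Gh r).
  { assert (D : det2 (M2mul mu (fst al)) = 1) by auto using det_mul1.
    assert (Hg : Gh (M2mul (M2inv (M2mul mu (fst al))) (fst lam))).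
    { pose proof Gh_subgrp as sH. apply subgrp_mul; auto. apply subgrp_inv; auto. apply subgrp_mul; auto. apply H, Gmu. }
    destruct E as [E|E]; rewrite E in Hg; [left|right]; rewrite ?M2opp_mul_r, M2mul_Kl in Hg by exact D; exact Hg. }
  destruct (transl_rational Gh r (proj1 hGh) Ht) as [q Hq]. exists q. rewrite <- Hq.
  apply (CF_intro K G nu sG lam al mu r); assumption.
Qed.

Lemma CF_sign : forall K G nu x y, subgrp G -> sqrt_pair x -> sqrt_pair y -> fst x = fst y ->
  exists c, cusp_factor G K nu x y 0 c.
Proof.
  intros K G nu x y sG Hx Hy E. apply (CF_intro K G nu sG x y M2one 0 Hx Hy); [apply sG|].
  left. rewrite E. apply M2_eq; simpl; ring.
Qed.

(** Weak holomorphy seen from all pairs, instead of the lifts alone. *)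
Definition qform (G : M2 -> Prop) (K : Z) (nu : M2 -> C) (F : C -> C) : Prop :=
  modular G K nu F /\ forall x, inH x -> exists a,
    has_expansion (conjg G (fst x)) K (conj_mult K nu x) (slash K F x) a.

Lemma CF_expansion : forall K G nu lam al r c F a, admissible K G nu -> inH lam -> inH al ->
  cusp_factor G K nu lam al r c -> modular G K nu F ->
  has_expansion (conjg G (fst al)) K (conj_mult K nu al) (slash K F al) a ->
  has_expansion (conjg G (fst lam)) K (conj_mult K nu lam) (slash K F lam) (fun x => c * (ee (r * x) * a x))%C.
Proof.
  intros K G nu lam al r c F a H Hl Ha HC HF He.
  apply (has_expansion_ext _ _ _ (fun z => c * slash K F al (z + RtoC r))%C).
  - intros z Hz. symmetry. apply (CF_slash K G nu); eauto.
  - apply expansion_scal. apply (trel_expansion K r (conjg G (fst al)) (conj_mult K nu al)); auto.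
    apply (CF_trel K G nu) with (c := c); eauto.
Qed.

Lemma coef_at_spec : forall K G nu x F, qform G K nu F -> inH x ->
  has_expansion (conjg G (fst x)) K (conj_mult K nu x) (slash K F x) (coef_at G K nu x F).
Proof. intros K G nu x F [_ H] Hx. destruct (H x Hx) as [a Ha]. eapply coef_spec, Ha. Qed.

Lemma CF_coef : forall K G nu lam al r c F x, admissible K G nu -> inH lam -> inH al ->
  cusp_factor G K nu lam al r c -> qform G K nu F ->
  coef_at G K nu lam F x = (c * (ee (r * x) * coef_at G K nu al F x))%C.
Proof.
  intros K G nu lam al r c F x H Hl Ha HC HF. unfold coef_at at 1.
  rewrite (coef_unique _ _ _ _ (fun x => c * (ee (r * x) * coef_at G K nu al F x))%C); [reflexivity|..].
  - apply (admissible_conj K G nu lam H Hl).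
  - apply (CF_expansion K G nu) with (al := al); auto; [apply HF|]. apply coef_at_spec; assumption.
Qed.

Lemma whf_qform : forall K G nu f, admissible K G nu -> weakly_holomorphic_form Gh G K nu f -> qform G K nu f.
Proof.
  intros K G nu f H [_ [Hm He]]. split; [exact Hm|]. intros x Hx.
  destruct (He (fst x) (proj2 Hx)) as [a Ha].
  destruct (CF_sign K G nu x (lift (fst x))) as [c Hc]; eauto; [apply sqrt_pair_lift, Hx|].
  eexists. apply (CF_expansion K G nu x (lift (fst x)) 0 c); auto. apply inH_lift, Hx. exact Ha.
Qed.

Lemma geq_expansion : forall K G nu x y f a, admissible K G nu -> inH x -> geq x y ->
  has_expansion (conjg G (fst x)) K (conj_mult K nu x) (slash K f x) a ->
  has_expansion (conjg G (fst y)) K (conj_mult K nu y) (slash K f y) a.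
Proof.
  intros K G nu x y f a H Hx E He.
  assert (Hy : inH y) by (destruct Hx as [A B]; split; [eapply geq_good; eassumption|rewrite <- (proj1 E); exact B]).
  apply (has_expansion_ext _ _ _ (slash K f x)); [intros; apply geq_slash; assumption|].
  apply (trel0_expansion K (conjg G (fst x)) (conj_mult K nu x)); auto. apply conj_geq; eauto.
Qed.

Lemma geq_coef : forall K G nu x y f, admissible K G nu -> inH x -> geq x y ->
  coef_at G K nu x f = coef_at G K nu y f.
Proof.
  intros K G nu x y f H Hx E.
  assert (Hy : inH y) by (destruct Hx as [A B]; split; [eapply geq_good; eassumption|rewrite <- (proj1 E); exact B]).
  unfold coef_at, coef. f_equal. apply functional_extensionality. intros a. apply propositional_extensionality.
  split; apply geq_expansion; auto using geq_sym.
Qed.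

(** ** From a conjugate group back to the group *)

Lemma slash_back : forall K f al eta z, sqrt_pair al -> sqrt_pair eta -> upper z ->
  slash K (slash K f (Ginv al)) (Gmul al eta) z = slash K f eta z.
Proof.
  intros K f al eta z Ha He Hz. rewrite slash_mul by auto using sqrt_pair_inv, sqrt_pair_mul.
  apply geq_slash; [|exact Hz].
  eapply geq_trans; [apply geq_sym, geq_assoc; assumption|].
  eapply geq_trans; [apply geq_mul; [exact He|apply geq_inv_l, Ha|split; reflexivity]|apply geq_one_l].
Qed.

Lemma slash_inv_at : forall K f al z, sqrt_pair al -> upper z ->
  slash K (slash K f (Ginv al)) al z = f z.
Proof.
  intros K f al z Ha Hz. rewrite slash_mul by auto using sqrt_pair_inv.
  rewrite (geq_slash K f _ _ z (geq_inv_l al Ha) Hz). unfold slash. simpl. rewrite Cpowz_1, moebius_one. field.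
Qed.

Lemma back_modular : forall K G nu al f, admissible K G nu -> inH al ->
  modular (conjg G (fst al)) K (conj_mult K nu al) f -> modular G K nu (slash K f (Ginv al)).
Proof.
  intros K G nu al f H Ha Hf. pose proof (inH_good al Ha) as Ga. pose proof (proj1 Ga) as Da.
  pose proof (admissible_conj _ _ _ _ H Ha) as HC.
  assert (Key : forall w, upper w -> slash K f (Ginv al) (moebius (fst al) w) = (Jx K al w * f w)%C).
  { intros w Hw. rewrite <- (slash_inv_at K f al w Ga Hw). unfold slash at 2. fold (Jx K al w). field.
    apply Jx_nz; assumption. }
  apply aut_modular; eauto. intros g z Gg Hz.
  pose proof (subgrp_det _ _ (admissible_subgrp _ _ _ H) Gg) as Dg.
  set (d := M2mul (M2mul (M2inv (fst al)) g) (fst al)). set (w := moebius (M2inv (fst al)) z).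
  assert (Hw : upper w) by (apply moebius_upper; auto using det_inv).
  assert (Dd : det2 d = 1) by (unfold d; auto using det_mul1, det_inv).
  assert (Ew : moebius (fst al) w = z) by (apply moebius_inv_r; assumption).
  assert (Ed : M2mul (M2mul (fst al) d) (M2inv (fst al)) = g).
  { unfold d. rewrite !M2mul_assoc, M2inv_r, M2mul_1l, M2mul_Kr by exact Da. reflexivity. }
  assert (Hd : conjg G (fst al) d) by (unfold conjg; rewrite Ed; exact Gg).
  assert (Eg : moebius g z = moebius (fst al) (moebius d w)).
  { rewrite <- Ew, <- !moebius_mul by assumption. f_equal. rewrite <- Ed, M2mul_Kr' by exact Da. reflexivity. }
  rewrite Eg, Key by (apply moebius_upper; assumption).
  rewrite (modular_aut (conjg G (fst al)) K (conj_mult K nu al) f d w) by eauto.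
  rewrite <- Ew, Key by assumption.
  pose proof (aut_conj K nu al d w Ga Dd Hw) as E. rewrite Ed in E.
  transitivity (aut K (conj_mult K nu al) d w * Jx K al (moebius d w) * f w)%C; [ring|]. rewrite E. ring.
Qed.

Lemma back_expansion : forall K G nu al eta f a, admissible K G nu -> inH al -> inH eta ->
  has_expansion (conjg (conjg G (fst al)) (fst eta)) K (conj_mult K (conj_mult K nu al) eta) (slash K f eta) a <->
  has_expansion (conjg G (fst (Gmul al eta))) K (conj_mult K nu (Gmul al eta))
    (slash K (slash K f (Ginv al)) (Gmul al eta)) a.
Proof.
  intros K G nu al eta f a H Ha He.
  pose proof (admissible_frame _ _ _ (admissible_conj _ _ _ _ H (inH_mul _ _ Ha He))) as F1.
  pose proof (admissible_frame _ _ _ (admissible_conj _ _ _ _ (admissible_conj _ _ _ _ H Ha) He)) as F2.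
  assert (T : trel K 0 (conjg G (fst (Gmul al eta))) (conj_mult K nu (Gmul al eta))
    (conjg (conjg G (fst al)) (fst eta)) (conj_mult K (conj_mult K nu al) eta)) by (apply conj_stages; eauto).
  split; intros X.
  - apply (has_expansion_ext _ _ _ (slash K f eta)); [intros; symmetry; apply slash_back; auto|].
    eapply trel0_expansion; [exact F2|exact F1|apply trel_sym0, T|exact X].
  - apply (has_expansion_ext _ _ _ (slash K (slash K f (Ginv al)) (Gmul al eta))); [intros; apply slash_back; auto|].
    eapply trel0_expansion; [exact F1|exact F2|exact T|exact X].
Qed.

(** Forms on different conjugates of [G] become forms on [G] itself, where they
    can be multiplied; their expansions only change place. *)
Lemma back_coef : forall K G nu al eta f, admissible K G nu -> inH al -> inH eta ->
  coef_at G K nu (Gmul al eta) (slash K f (Ginv al)) = coef_at (conjg G (fst al)) K (conj_mult K nu al) eta f.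
Proof.
  intros K G nu al eta f H Ha He. unfold coef_at, coef. f_equal. apply functional_extensionality. intros a.
  apply propositional_extensionality. symmetry. apply (back_expansion K G nu al eta f a H Ha He).
Qed.

Lemma back_qform : forall K G nu al f, admissible K G nu -> inH al ->
  qform (conjg G (fst al)) K (conj_mult K nu al) f -> qform G K nu (slash K f (Ginv al)).
Proof.
  intros K G nu al f H Ha [Hm He]. split; [apply back_modular; assumption|]. intros x Hx.
  destruct (He (Gmul (Ginv al) x)) as [a Ea]; [auto|]. exists a.
  apply back_expansion in Ea; auto.
  apply (geq_expansion K G nu (Gmul al (Gmul (Ginv al) x)) x); auto. apply geq_Kl; auto.
Qed.

(** The expansion at oo, as an expansion at the identity. *)
Lemma conj_one : forall K G nu, admissible K G nu -> trel K 0 G nu (conjg G (fst Gone)) (conj_mult K nu Gone).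
Proof.
  intros K G nu H. apply trel_0.
  - intros d. apply conjg_self; [eauto|apply (admissible_subgrp _ _ _ H)].
  - intros d z Hd Hz.
    assert (Dd : det2 d = 1) by (apply (subgrp_det _ _ (admissible_subgrp _ _ _ (admissible_conj _ _ _ _ H inH_one)) Hd)).
    pose proof (aut_conj K nu Gone d z sqrt_pair_one Dd Hz) as E. unfold Jx in E. simpl snd in E.
    rewrite Cpowz_1, !Cmult_1_r in E. rewrite E. simpl fst. rewrite moebius_one. f_equal.
    apply M2_eq; unfold M2inv; simpl; unfold det2; simpl; field.
Qed.

Lemma coef_one : forall K G nu f, admissible K G nu -> coef_at G K nu Gone f = coef G K nu f.
Proof.
  intros K G nu f H. unfold coef_at.
  rewrite (coef_ext _ _ _ (slash K f Gone) f).
  - apply (trel0_coef K G nu (conjg G (fst Gone)) (conj_mult K nu Gone)); auto. apply conj_one, H.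
  - intros z Hz. unfold slash. simpl. rewrite Cpowz_1, moebius_one. field.
Qed.

(** The principal branch of a translation is 1. *)
Lemma trel_conjT : forall K r G1 nu1 G2 nu2, subgrp G1 -> subgrp G2 -> trel K r G1 nu1 G2 nu2 ->
  trel K 0 (conjg G1 (Tmat r)) (conj_mult K nu1 (lift (Tmat r))) G2 nu2.
Proof.
  intros K r G1 nu1 G2 nu2 s1 s2 [H1 H2]. apply trel_0; [exact H1|]. intros d z Hd Hz.
  rewrite H2 by assumption. pose proof (subgrp_det _ _ s2 Hd) as Dd.
  pose proof (aut_conj K nu1 (lift (Tmat r)) d z (sqrt_pair_lift _ (det_T r)) Dd Hz) as E.
  assert (J : forall w, Jx K (lift (Tmat r)) w = RtoC 1) by (intros w; apply (jpow_T K r w)).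
  rewrite !J, !Cmult_1_r in E. rewrite E. simpl fst. rewrite moebius_T. reflexivity.
Qed.

Lemma trel0_coef_at : forall K G1 nu1 G2 nu2 x f, admissible K G1 nu1 -> admissible K G2 nu2 -> inH x ->
  trel K 0 G1 nu1 G2 nu2 -> coef_at G2 K nu2 x f = coef_at G1 K nu1 x f.
Proof.
  intros K G1 nu1 G2 nu2 x f H1 H2 Hx T.
  apply (trel0_coef K (conjg G1 (fst x)) (conj_mult K nu1 x) (conjg G2 (fst x)) (conj_mult K nu2 x)); auto.
  apply conj_of_trel0; eauto.
Qed.

Lemma trel0_qform : forall K G1 nu1 G2 nu2 f, admissible K G1 nu1 -> admissible K G2 nu2 ->
  trel K 0 G1 nu1 G2 nu2 -> qform G1 K nu1 f -> qform G2 K nu2 f.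
Proof.
  intros K G1 nu1 G2 nu2 f H1 H2 T [Hm He]. split.
  - destruct (trel_0_inv _ _ _ _ _ T) as [T1 T2]. apply aut_modular; eauto. intros g z Gg Hz.
    rewrite T2 by assumption. apply (modular_aut G1 K nu1); eauto. apply T1, Gg.
  - intros x Hx. destruct (He x Hx) as [a Ha]. exists a.
    apply (trel0_expansion K (conjg G1 (fst x)) (conj_mult K nu1 x)); auto. apply conj_of_trel0; eauto.
Qed.

Lemma qform_ext : forall K G nu f h, admissible K G nu -> (forall z, upper z -> f z = h z) -> qform G K nu f -> qform G K nu h.
Proof.
  intros K G nu f h H E [Hm He]. split.
  - intros g z Gg Hz. rewrite <- !E by (try apply moebius_upper; try apply (subgrp_det _ _ (admissible_subgrp _ _ _ H)); assumption).
    apply Hm; assumption.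
  - intros x Hx. destruct (He x Hx) as [a Ha]. exists a. eapply has_expansion_ext; [|exact Ha].
    intros z Hz. apply slash_eq; auto.
Qed.

Lemma coef_at_ext : forall K G nu x f h, inH x -> (forall z, upper z -> f z = h z) ->
  coef_at G K nu x f = coef_at G K nu x h.
Proof. intros K G nu x f h Hx E. apply coef_ext. intros z Hz. apply slash_eq; auto. Qed.

Lemma qform_expansion : forall K G nu f, admissible K G nu -> qform G K nu f ->
  has_expansion G K nu f (coef G K nu f).
Proof.
  intros K G nu f H Hf. destruct (proj2 Hf Gone (inH_one)) as [a Ha]. apply (coef_spec _ _ _ _ a).
  apply (trel0_expansion K (conjg G (fst Gone)) (conj_mult K nu Gone)); auto.
  - apply trel_sym0, (conj_one K G nu H).
  - eapply has_expansion_ext; [|exact Ha]. intros z Hz. unfold slash. simpl. rewrite Cpowz_1, moebius_one. field.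
Qed.

(** * Reduced echelon bases *)

(** For [P] the negative exponents these are the holomorphic forms, for [P] the
    nonpositive exponents the cusp forms. *)
Definition formP (P : R -> Prop) (G : M2 -> Prop) (K : Z) (nu : M2 -> C) (f : C -> C) : Prop :=
  weakly_holomorphic_form Gh G K nu f /\
  forall l, Gh l -> forall x, P x -> coef_at G K nu (lift l) f x = RtoC 0.

Lemma formP_iff : forall P K G nu f, admissible K G nu ->
  (formP P G K nu f <-> holomorphic f /\ qform G K nu f /\
    forall y, inH y -> forall x, P x -> coef_at G K nu y f x = RtoC 0).
Proof.
  intros P K G nu f H. split.
  - intros [Hw Hc]. pose proof (whf_qform K G nu f H Hw) as Hq. split; [apply Hw|]. split; [exact Hq|].
    intros y Hy x Px. destruct (CF_sign K G nu y (lift (fst y))) as [c HC]; eauto; [apply sqrt_pair_lift, Hy|].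
    rewrite (CF_coef K G nu y (lift (fst y)) 0 c) by (auto; apply inH_lift, Hy).
    rewrite Hc by (try apply Hy; assumption). ring.
  - intros [Hh [Hq Hc]]. split; [split; [exact Hh|]; split; [apply Hq|]|].
    + intros l Hl. apply (proj2 Hq (lift l)). auto.
    + intros l Hl. apply Hc. auto.
Qed.

Lemma slash_T : forall K f r z, slash K f (lift (Tmat r)) z = f (z + RtoC r)%C.
Proof.
  intros K f r z. unfold slash. simpl fst. rewrite moebius_T.
  replace (Cpowz (snd (lift (Tmat r)) z) K) with (RtoC 1) by (symmetry; apply (jpow_T K r z)). field.
Qed.

Lemma slash_Tinv : forall K f r z, upper z -> slash K f (Ginv (lift (Tmat (- r)))) z = f (z + RtoC r)%C.
Proof.
  intros K f r z Hz. pose proof (sqrt_pair_lift _ (det_T (- r))) as Gd. pose proof (upper_shift z r Hz) as Hz'.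
  pose proof (slash_inv_at K f (lift (Tmat (- r))) (z + RtoC r)%C Gd Hz') as E. rewrite slash_T in E.
  rewrite <- E. f_equal. rewrite RtoC_opp. ring.
Qed.

(** The translate is the form pulled back along the translation by [- r], whose
    conjugate group is [G1]. *)
Lemma translate_form : forall P K r G1 nu1 G2 nu2 f, admissible K G1 nu1 -> admissible K G2 nu2 ->
  trel K r G1 nu1 G2 nu2 -> Gh (Tmat (- r)) -> formP P G1 K nu1 f ->
  formP P G2 K nu2 (fun z => f (z + RtoC r)%C).
Proof.
  intros P K r G1 nu1 G2 nu2 f H1 H2 T HT Hf. apply formP_iff; [exact H2|]. apply formP_iff in Hf; [|exact H1].
  destruct Hf as [Hh [Hq Hc]].
  set (al := lift (Tmat (- r))). assert (Ha : inH al) by (apply inH_lift; assumption).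
  pose proof (trel_conjT K (- r) G2 nu2 G1 nu1 (admissible_subgrp _ _ _ H2) (admissible_subgrp _ _ _ H1) (trel_sym _ _ _ _ _ _ T)) as T'.
  assert (Ad : admissible K (conjg G2 (fst al)) (conj_mult K nu2 al)) by auto.
  assert (Es : forall z, upper z -> slash K f (Ginv al) z = f (z + RtoC r)%C) by (intros; apply slash_Tinv; assumption).
  split; [|split].
  - apply holomorphic_iff. intros z Hz. pose proof (upper_shift z r Hz) as Hz'.
    destruct (proj1 (holomorphic_iff f) Hh _ Hz') as [l Hl]. exists (l * (1 + 0))%C.
    apply (cderiv_comp f (fun w => w + RtoC r)%C); [exact Hl|].
    apply cderiv_plus; [apply cderiv_id|apply cderiv_const].
  - apply (qform_ext K G2 nu2 (slash K f (Ginv al))); auto.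
    apply back_qform; auto. apply (trel0_qform K G1 nu1); auto. apply trel_sym0, T'.
  - intros y Hy x Px. rewrite <- (coef_at_ext K G2 nu2 y (slash K f (Ginv al))) by assumption.
    rewrite <- (geq_coef K G2 nu2 (Gmul al (Gmul (Ginv al) y)) y) by (auto; apply geq_Kl; auto).
    rewrite (back_coef) by auto.
    rewrite (trel0_coef_at K G1 nu1) by (auto; apply trel_sym0, T'). auto.
Qed.

Lemma translate_coef : forall K r G1 nu1 G2 nu2 f x, admissible K G1 nu1 -> admissible K G2 nu2 ->
  trel K r G1 nu1 G2 nu2 -> qform G1 K nu1 f ->
  coef G2 K nu2 (fun z => f (z + RtoC r)%C) x = (ee (r * x) * coef G1 K nu1 f x)%C.
Proof.
  intros K r G1 nu1 G2 nu2 f x H1 H2 T Hq.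
  rewrite (coef_unique G2 K nu2 _ (fun x => ee (r * x) * coef G1 K nu1 f x)%C); [reflexivity|apply H2|].
  apply (trel_expansion K r G1 nu1); auto. apply qform_expansion; assumption.
Qed.

(** ** Coefficients determine the combination *)

Lemma Csum_single : forall (f : R -> C) l m, NoDup l -> In m l ->
  (forall j, In j l -> j <> m -> f j = RtoC 0) -> Csum (map f l) = f m.
Proof.
  intros f l m. induction l as [|j l IH]; intros Hn Hm H0; [destruct Hm|].
  inversion Hn as [|? ? Hj Hn']; subst. simpl. destruct (Req_dec j m) as [->|Hjm].
  - replace (Csum (map f l)) with (RtoC 0); [unfold Csum; ring|].
    clear IH Hn Hn' Hm. induction l as [|i l IH]; [reflexivity|]. simpl. rewrite <- IH.
    + rewrite (H0 i); [unfold Csum; ring|simpl; auto|intros ->; apply Hj; simpl; auto].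
    + intros Hi. apply Hj. simpl; auto.
    + intros k [->|Hk] Hkm; [contradiction|]. apply H0; simpl; auto.
  - rewrite (H0 j) by (simpl; auto). fold (Csum (map f l)). rewrite IH; [ring|exact Hn'| |].
    + destruct Hm as [E|Hm]; [contradiction|exact Hm].
    + intros k Hk. apply H0. simpl; auto.
Qed.

Lemma lin_comb_expansion : forall w s l c F a, 0 < w -> (forall m, In m l -> hexp w s (F m) (a m)) ->
  hexp w s (lin_comb l c F) (fun x => Csum (map (fun m => c m * a m x)%C l)).
Proof.
  intros w s l c F a Hw. induction l as [|m l IH]; intros H; [exact (hexp_0 w s)|].
  apply (hexp_plus w s (fun z => c m * F m z)%C (fun x => c m * a m x)%C (lin_comb l c F)); [exact Hw| |].
  - apply hexp_scal, H. simpl; auto.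
  - apply IH. intros k Hk. apply H. simpl; auto.
Qed.

Section OneBasis.

Variables (P : R -> Prop) (K : Z) (G : M2 -> Prop) (nu : M2 -> C) (B : echelon).
Hypothesis (hA : admissible K G nu) (hB : reduced_echelon_basis (formP P G K nu) G K nu B).

Lemma formP_qform : forall h, formP P G K nu h -> qform G K nu h.
Proof. intros h Hh. apply formP_iff in Hh; [apply Hh|exact hA]. Qed.

(** The coefficients of a reduced echelon basis at its indices form the
    identity matrix. *)
Lemma echelon_coef : forall h, formP P G K nu h ->
  (forall x, coef G K nu h x = Csum (map (fun m => coef G K nu h m * coef G K nu (form B m) x)%C (idx B))) /\
  (forall z, upper z -> h z = lin_comb (idx B) (coef G K nu h) (form B) z).
Proof.
  intros h Hh. destruct hB as [Hn [Hf [Hs _]]]. destruct (Hs h Hh) as [c Hc].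
  assert (E : coef G K nu h = fun x => Csum (map (fun m => c m * coef G K nu (form B m) x)%C (idx B))).
  { apply coef_unique; [apply hA|]. apply (has_expansion_ext _ _ _ (lin_comb (idx B) c (form B))); [intros; symmetry; auto|].
    rewrite has_expansion_hexp. apply (lin_comb_expansion (width G) _ (idx B) c (form B) (fun m => coef G K nu (form B m))).
    - apply width_pos, hA.
    - intros m Hm. rewrite <- has_expansion_hexp. apply qform_expansion; [exact hA|]. apply formP_qform, Hf, Hm. }
  assert (Em : forall m, In m (idx B) -> coef G K nu h m = c m).
  { intros m Hm. rewrite E, (Csum_single _ _ m Hn Hm).
    - destruct (Hf m Hm) as [_ [-> _]]. ring.
    - intros j Hj Hjm. destruct (Hf j Hj) as [_ [_ [_ H]]]. rewrite H by auto. ring. }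
  split.
  - intros x. pose proof (f_equal (fun u => u x) E) as Ex. cbv beta in Ex. rewrite Ex. f_equal. apply map_ext_in. intros m Hm. rewrite Em by exact Hm. reflexivity.
  - intros z Hz. rewrite Hc by exact Hz. unfold lin_comb. f_equal. apply map_ext_in. intros m Hm.
    rewrite Em by exact Hm. reflexivity.
Qed.

(** An index [j] that contributes to the coefficient of [h] at [m] satisfies
    [m <= j], because [h] leads with [m], and [j <= m], because [form B j] leads
    with [j]. *)
Lemma echelon_lead : forall h m, formP P G K nu h -> coef G K nu h m <> RtoC 0 ->
  (forall x, x < m -> coef G K nu h x = RtoC 0) -> In m (idx B).
Proof.
  intros h m Hh Hm Hl. destruct (echelon_coef h Hh) as [E _]. destruct hB as [_ [Hf _]].
  apply NNPP. intros Hi. apply Hm. rewrite E.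
  replace (RtoC 0) with (Csum (map (fun _ : R => RtoC 0) (idx B))).
  - f_equal. apply map_ext_in. intros j Hj.
    destruct (Rtotal_order j m) as [Hjm|[Hjm|Hjm]].
    + rewrite Hl by exact Hjm. ring.
    + subst j. contradiction.
    + destruct (Hf j Hj) as [_ [_ [H _]]]. rewrite H by exact Hjm. ring.
  - generalize (idx B). clear. intros l. induction l as [|j l IH]; [reflexivity|]. simpl. rewrite IH. ring.
Qed.

End OneBasis.

(** Translation multiplies coefficients by roots of unity, so a translated basis
    element still leads with its index. *)
Lemma translate_idx : forall P K r G1 nu1 G2 nu2 B1 B2, admissible K G1 nu1 -> admissible K G2 nu2 ->
  trel K r G1 nu1 G2 nu2 -> Gh (Tmat (- r)) ->
  reduced_echelon_basis (formP P G1 K nu1) G1 K nu1 B1 ->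
  reduced_echelon_basis (formP P G2 K nu2) G2 K nu2 B2 ->
  forall m, In m (idx B1) -> In m (idx B2).
Proof.
  intros P K r G1 nu1 G2 nu2 B1 B2 H1 H2 T HT HB1 HB2 m Hm.
  destruct (proj1 (proj2 HB1) m Hm) as [Hf [Hc [Hl _]]].
  pose proof (formP_qform P K G1 nu1 H1 _ Hf) as Hq.
  apply (echelon_lead P K G2 nu2 B2 H2 HB2 (fun z => form B1 m (z + RtoC r)%C)).
  - apply (translate_form P K r G1 nu1); assumption.
  - rewrite (translate_coef K r G1 nu1) by assumption. rewrite Hc, Cmult_1_r. apply ee_nz.
  - intros x Hx. rewrite (translate_coef K r G1 nu1) by assumption. rewrite Hl by exact Hx. ring.
Qed.

Lemma translate_idx_iff : forall P K r G1 nu1 G2 nu2 B1 B2, admissible K G1 nu1 -> admissible K G2 nu2 ->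
  trel K r G1 nu1 G2 nu2 -> Gh (Tmat r) ->
  reduced_echelon_basis (formP P G1 K nu1) G1 K nu1 B1 ->
  reduced_echelon_basis (formP P G2 K nu2) G2 K nu2 B2 ->
  forall m, In m (idx B1) <-> In m (idx B2).
Proof.
  intros P K r G1 nu1 G2 nu2 B1 B2 H1 H2 T HT HB1 HB2 m.
  assert (HT' : Gh (Tmat (- r))) by (rewrite <- T_inv; apply subgrp_inv; [apply (Gh_subgrp)|exact HT]).
  split.
  - apply (translate_idx P K r G1 nu1 G2 nu2); assumption.
  - apply (translate_idx P K (- r) G2 nu2 G1 nu1); try assumption; [apply trel_sym, T|].
    rewrite Ropp_involutive. exact HT.
Qed.

Lemma translate_basis : forall P K r G1 nu1 G2 nu2 B1 B2, admissible K G1 nu1 -> admissible K G2 nu2 ->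
  trel K r G1 nu1 G2 nu2 -> Gh (Tmat r) ->
  reduced_echelon_basis (formP P G1 K nu1) G1 K nu1 B1 ->
  reduced_echelon_basis (formP P G2 K nu2) G2 K nu2 B2 ->
  forall m z, In m (idx B1) -> upper z -> form B1 m (z + RtoC r)%C = (ee (r * m) * form B2 m z)%C.
Proof.
  intros P K r G1 nu1 G2 nu2 B1 B2 H1 H2 T HT HB1 HB2 m z Hm Hz.
  assert (HT' : Gh (Tmat (- r))) by (rewrite <- T_inv; apply subgrp_inv; [apply (Gh_subgrp)|exact HT]).
  destruct (proj1 (proj2 HB1) m Hm) as [Hf [Hc [Hl Hd]]].
  pose proof (formP_qform P K G1 nu1 H1 _ Hf) as Hq.
  pose proof (translate_form P K r G1 nu1 G2 nu2 _ H1 H2 T HT' Hf) as Hf2.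
  destruct (echelon_coef P K G2 nu2 B2 H2 HB2 _ Hf2) as [_ E]. rewrite E by exact Hz.
  unfold lin_comb. rewrite (Csum_single _ _ m).
  - rewrite (translate_coef K r G1 nu1), Hc by assumption. ring.
  - apply HB2.
  - apply (translate_idx_iff P K r G1 nu1 G2 nu2 B1 B2); assumption.
  - intros j Hj Hjm. rewrite (translate_coef K r G1 nu1) by assumption. rewrite Hd; [ring| |exact Hjm].
    apply (translate_idx_iff P K r G1 nu1 G2 nu2 B1 B2); assumption.
Qed.

(** * Principal parts on the base group *)

Lemma inH_det : forall x, inH x -> det2 (fst x) = 1.
Proof. intros x H. apply H. Qed.
Hint Resolve inH_det : core.

(** An element of the maximal group that fixes oo is a translation up to sign. *)
Lemma same_cusp_iff : forall K G nu x y, admissible K G nu -> inH x -> inH y ->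
  (same_cusp G x y <-> cusp_eq G (fst y) (fst x)).
Proof.
  intros K G nu x y H Hx Hy. pose proof (inH_det x Hx) as Dx. pose proof (inH_det y Hy) as Dy.
  pose proof (admissible_subgrp _ _ _ H) as sG. split.
  - intros [mu [Gmu E]]. pose proof (subgrp_det _ _ sG Gmu) as Dmu.
    set (u := M2mul (M2inv (fst y)) (M2mul mu (fst x))).
    assert (Hu : Gh u).
    { pose proof (Gh_subgrp) as sH. unfold u. apply subgrp_mul; [exact sH|apply subgrp_inv; [exact sH|apply Hy]|].
      apply subgrp_mul; [exact sH|apply H, Gmu|apply Hx]. }
    assert (Cu : mc u = 0).
    { unfold u. rewrite M2inv_1 by exact Dy. set (w := M2mul mu (fst x)) in *. simpl. simpl in E. lra. }
    destruct (comm_parabolic Gh u (proj1 hGh) Hu Cu) as [r Hr].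
    assert (Ey : M2mul mu (fst x) = M2mul (fst y) u) by (unfold u; rewrite M2mul_Kl'; auto).
    assert (E1 : cusp_eq G (M2mul mu (fst x)) (fst y)).
    { exists M2one, r. split; [apply sG|]. rewrite M2mul_1l, Ey.
      destruct Hr as [-> | ->]; [left|right]; rewrite ?M2opp_mul_r; reflexivity. }
    apply cusp_eq_sym in E1; auto. eapply cusp_eq_trans; [exact sG|exact E1|].
    exists mu, 0. split; [exact Gmu|]. left. apply M2_eq; simpl; ring.
  - intros [mu [r [Gmu E]]]. exists mu. split; [exact Gmu|].
    set (w := M2mul mu (fst x)) in *. destruct E as [-> | ->]; simpl; ring.
Qed.

(** The maximal group contains -1. *)
Lemma CF_T : forall K G nu lam al r c, admissible K G nu -> inH lam -> inH al -> cusp_factor G K nu lam al r c -> Gh (Tmat r).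
Proof.
  intros K G nu lam al r c H Hl Ha [mu [Gmu [E _]]]. pose proof (Gh_subgrp) as sH.
  pose proof (subgrp_det _ _ (admissible_subgrp _ _ _ H) Gmu) as Dmu.
  assert (D : det2 (M2mul mu (fst al)) = 1) by auto using det_mul1.
  assert (Hg : Gh (M2mul (M2inv (M2mul mu (fst al))) (fst lam))).
  { apply subgrp_mul; [exact sH| |apply Hl]. apply subgrp_inv; [exact sH|].
    apply subgrp_mul; [exact sH|apply H, Gmu|apply Ha]. }
  destruct E as [E|E]; rewrite E in Hg; rewrite ?M2opp_mul_r, M2mul_Kl in Hg by exact D; [exact Hg|].
  pose proof (subgrp_mul _ _ _ sH (proj1 (maximal_transitive Gh hGh)) Hg) as Hg'.
  rewrite M2opp_mul_l, M2opp_mul_r, M2opp_opp, M2mul_1l in Hg'. exact Hg'.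
Qed.

(** A value of [cusp_family], for any representation of [lam].  Admitting all
    representations makes it unnecessary to compare them. *)
Definition family_value (K : Z) (G : M2 -> Prop) (nu : M2 -> C) (lam al : Gelt) (s : R -> C) (x : R) (v : C) : Prop :=
  (exists r c, cusp_factor G K nu lam al r c /\ v = (c * (ee (r * x) * s x))%C) \/
  (~ cusp_eq G (fst lam) (fst al) /\ v = RtoC 0).

Lemma family_spec : forall K G nu lam al s x, admissible K G nu -> inH lam -> inH al ->
  family_value K G nu lam al s x (cusp_family G K nu al s lam x).
Proof.
  intros K G nu lam al s x H Hl Ha.
  set (P := fun v => (exists (r : QArith_base.Q) c, cusp_factor G K nu lam al (Rdefinitions.Q2R r) c /\
       v = Cmult (Cmult c (ee (Rdefinitions.Q2R r * x))) (s x)) \/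
    ((forall (r : QArith_base.Q) c, ~ cusp_factor G K nu lam al (Rdefinitions.Q2R r) c) /\ v = RtoC 0)).
  assert (HP : P (cusp_family G K nu al s lam x)).
  { unfold cusp_family. apply (epsilon_spec (inhabits (RtoC 0)) P).
    destruct (classic (cusp_eq G (fst lam) (fst al))) as [E|E].
    - destruct (CF_exists K G nu lam al H Hl Ha E) as [r [c Hc]]. eexists. left. exists r, c. split; [exact Hc|reflexivity].
    - exists (RtoC 0). right. split; [|reflexivity]. intros r c Hc. apply E. eapply CF_cusp_eq, Hc. }
  destruct HP as [[r [c [Hc Ev]]]|[Hn Ev]].
  - left. exists (Rdefinitions.Q2R r), c. split; [exact Hc|]. rewrite Ev. ring.
  - right. split; [|exact Ev]. intros E. destruct (CF_exists K G nu lam al H Hl Ha E) as [r [c Hc]].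
    exact (Hn r c Hc).
Qed.

Lemma family_value_step : forall K G nu lam lam' al r c s x v, admissible K G nu -> inH lam -> inH lam' -> inH al ->
  cusp_factor G K nu lam lam' r c -> family_value K G nu lam' al s x v ->
  family_value K G nu lam al s x (c * (ee (r * x) * v))%C.
Proof.
  intros K G nu lam lam' al r c s x v H Hl Hl' Ha HC [[r' [c' [HC' ->]]]|[Hn ->]].
  - left. exists (r' + r), (c * c')%C. split; [apply (CF_trans K G nu) with (b := lam'); eauto|].
    rewrite Rmult_plus_distr_r, ee_add. ring.
  - right. split; [|ring]. intros E. apply Hn. eapply cusp_eq_trans; [eauto| |exact E].
    apply cusp_eq_sym; eauto. eapply CF_cusp_eq, HC.
Qed.

Lemma family_value_back : forall K G nu be lam al al' s x v, admissible K G nu -> inH be -> inH lam -> inH al ->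
  geq (Gmul be al) al' -> family_value K (conjg G (fst be)) (conj_mult K nu be) lam al s x v ->
  family_value K G nu (Gmul be lam) al' s x v.
Proof.
  intros K G nu be lam al al' s x v H Hb Hl Ha E [[r [c [HC Ev]]]|[Hn Ev]].
  - left. exists r, c. split; [|exact Ev]. apply (CF_push K G nu) in HC; eauto.
    apply (CF_geq K G nu (Gmul be lam) _ (Gmul be al)); auto. split; reflexivity.
  - right. split; [|exact Ev]. rewrite <- (proj1 E). intros F. apply Hn. apply cusp_eq_push; eauto.
Qed.

(** Up to sign the pair [xi] is [al] times a lift, and [cusp_factor] absorbs the
    sign. *)
Lemma principal_back : forall (P : R -> Prop) K G nu al be ga f s1 s2, admissible K G nu -> inH al -> inH be -> inH ga ->
  qform (conjg G (fst al)) K (conj_mult K nu al) f ->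
  (forall l, Gh l -> forall x, P x -> coef_at (conj_group G al) K (conj_mult K nu al) (lift l) f x =
    Cminus (cusp_family (conj_group G al) K (conj_mult K nu al) (Gmul (Ginv al) be) s1 (lift l) x)
      (cusp_family (conj_group G al) K (conj_mult K nu al) (Gmul (Ginv al) ga) s2 (lift l) x)) ->
  forall xi, inH xi -> forall x, P x -> exists p q,
    coef_at G K nu xi (slash K f (Ginv al)) x = Cminus p q /\
    family_value K G nu xi be s1 x p /\ family_value K G nu xi ga s2 x q.
Proof.
  intros P K G nu al be ga f s1 s2 H Ha Hb Hg Hq Hp xi Hx x Px.
  set (l := M2mul (M2inv (fst al)) (fst xi)).
  assert (Hl : Gh l) by (apply (inH_mul (Ginv al) xi); auto).
  set (xi0 := Gmul al (lift l)). assert (H0 : inH xi0) by (unfold xi0; auto).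
  assert (E0 : fst xi = fst xi0) by (unfold xi0, l; simpl; rewrite M2mul_Kl'; auto).
  destruct (CF_sign K G nu xi xi0) as [c HC]; eauto.
  set (p := cusp_family (conj_group G al) K (conj_mult K nu al) (Gmul (Ginv al) be) s1 (lift l) x) in *.
  set (q := cusp_family (conj_group G al) K (conj_mult K nu al) (Gmul (Ginv al) ga) s2 (lift l) x) in *.
  exists (c * (ee (0 * x) * p))%C, (c * (ee (0 * x) * q))%C. split; [|split].
  - rewrite (CF_coef K G nu xi xi0 0 c) by (auto; apply back_qform; auto).
    unfold xi0. rewrite (back_coef) by auto. fold (conj_group G al).
    change (coef_at (conjg G (fst al))) with (coef_at (conj_group G al)). rewrite Hp by auto. fold p q.
    unfold Cminus. ring.
  - apply (family_value_step K G nu xi xi0); auto. apply (family_value_back K G nu al (lift l) (Gmul (Ginv al) be)); auto.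
    + apply geq_Kl; auto.
    + apply (family_spec K (conjg G (fst al)) (conj_mult K nu al)); auto.
  - apply (family_value_step K G nu xi xi0); auto. apply (family_value_back K G nu al (lift l) (Gmul (Ginv al) ga)); auto.
    + apply geq_Kl; auto.
    + apply (family_spec K (conjg G (fst al)) (conj_mult K nu al)); auto.
Qed.

Lemma mono_1 : forall l, mono l l = RtoC 1.
Proof. intros l. unfold mono. destruct (Req_EM_T l l); [reflexivity|contradiction]. Qed.
Lemma mono_0 : forall l x, x <> l -> mono l x = RtoC 0.
Proof. intros l x H. unfold mono. destruct (Req_EM_T x l); [contradiction|reflexivity]. Qed.

(** Against the coefficients [B] of a form for the dual multiplier, only the
    monomial part of a principal part survives. *)
Lemma pairing : forall (P : R -> Prop) K G nu K' nu' be ga F F' m s, admissible K G nu -> admissible K' G nu' -> inH be -> inH ga ->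
  (forall lam al r c, sqrt_pair lam -> sqrt_pair al -> cusp_factor G K nu lam al r c -> c <> RtoC 0 /\ cusp_factor G K' nu' lam al r (/ c)%C) ->
  qform G K' nu' F' ->
  (forall xi, inH xi -> forall x, P x -> exists p q, coef_at G K nu xi F x = Cminus p q /\
    family_value K G nu xi be (mono (- m)) x p /\ family_value K G nu xi ga s x q) ->
  (forall x, s x <> RtoC 0 -> coef_at G K' nu' ga F' (- x) = RtoC 0) ->
  forall xi x, inH xi -> P x ->
    (coef_at G K nu xi F x * coef_at G K' nu' xi F' (- x))%C =
    if Req_EM_T x (- m) then
      (if excluded_middle_informative (cusp_eq G (fst xi) (fst be)) then coef_at G K' nu' be F' m else RtoC 0)
    else RtoC 0.
Proof.
  intros P K G nu K' nu' be ga F F' m s H H' Hb Hg HD HF' Hp Hk xi x Hx Px.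
  destruct (Hp xi Hx x Px) as [p [q [-> [Fp Fq]]]].
  assert (Eq0 : (q * coef_at G K' nu' xi F' (- x))%C = RtoC 0).
  { destruct Fq as [[r [c [HC ->]]]|[_ ->]]; [|ring].
    destruct (HD xi ga r c (inH_good _ Hx) (inH_good _ Hg) HC) as [_ HC'].
    rewrite (CF_coef K' G nu' xi ga r (/ c)%C) by assumption.
    destruct (classic (s x = RtoC 0)) as [E|E]; [rewrite E; ring|rewrite Hk by exact E; ring]. }
  transitivity (p * coef_at G K' nu' xi F' (- x) - q * coef_at G K' nu' xi F' (- x))%C; [ring|].
  rewrite Eq0. destruct (Req_EM_T x (- m)) as [Em|Em].
  - destruct (excluded_middle_informative (cusp_eq G (fst xi) (fst be))) as [E|E].
    + destruct Fp as [[r [c [HC ->]]]|[Hn _]]; [|contradiction].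
      destruct (HD xi be r c (inH_good _ Hx) (inH_good _ Hb) HC) as [Nc HC'].
      rewrite (CF_coef K' G nu' xi be r (/ c)%C) by assumption. rewrite Em, mono_1, Ropp_involutive.
      replace (r * m) with (- (r * - m)) by ring. rewrite ee_opp. field. split; [apply ee_nz|exact Nc].
    + destruct Fp as [[r [c [HC _]]]|[_ ->]]; [exfalso; eapply E, CF_cusp_eq, HC|ring].
  - destruct Fp as [[r [c [HC ->]]]|[_ ->]]; [rewrite mono_0 by exact Em|]; ring.
Qed.

Lemma CF_dual' : forall K G nu, admissible K G nu -> forall lam al r c, sqrt_pair lam -> sqrt_pair al ->
  cusp_factor G K nu lam al r c -> c <> RtoC 0 /\ cusp_factor G (4 - K) (cbar nu) lam al r (/ c)%C.
Proof.
  intros K G nu H lam al r c Hl Ha HC. split; [|apply CF_dual; eauto].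
  destruct (CF_unfold K G nu (admissible_subgrp _ _ _ H) (admissible_ok _ _ _ H) lam al r c Hl Ha HC) as [mu [_ [_ [Nc _]]]]. exact Nc.
Qed.

Lemma CF_undual' : forall K G nu, admissible K G nu -> forall lam al r c, sqrt_pair lam -> sqrt_pair al ->
  cusp_factor G (4 - K) (cbar nu) lam al r c -> c <> RtoC 0 /\ cusp_factor G K nu lam al r (/ c)%C.
Proof.
  intros K G nu H lam al r c Hl Ha HC.
  destruct (CF_dual' (4 - K) G (cbar nu) (admissible_dual _ _ _ H) lam al r c Hl Ha HC) as [Nc HC'].
  split; [exact Nc|]. replace (4 - (4 - K))%Z with K in HC' by lia. rewrite cbar_cbar in HC'. exact HC'.
Qed.

(** For [x < 0] the coefficient of [F] at [x] is prescribed, for [x >= 0] the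
    coefficient of [F'] at [- x].  Every term of the constant term of [F F'] at a
    cusp is therefore governed by [pairing]. *)
Lemma residue_pairing : forall K G nu al be ga F F' m n s s', admissible K G nu -> inH al -> inH be -> inH ga ->
  0 < m -> 0 <= n -> qform G K nu F -> qform G (4 - K) (cbar nu) F' ->
  (forall xi, inH xi -> forall x, x < 0 -> exists p q, coef_at G K nu xi F x = Cminus p q /\
    family_value K G nu xi be (mono (- m)) x p /\ family_value K G nu xi ga s x q) ->
  (forall x, s x <> RtoC 0 -> coef_at G (4 - K) (cbar nu) ga F' (- x) = RtoC 0) ->
  (forall xi, inH xi -> forall x, x <= 0 -> exists p q, coef_at G (4 - K) (cbar nu) xi F' x = Cminus p q /\
    family_value (4 - K) G (cbar nu) xi al (mono (- n)) x p /\ family_value (4 - K) G (cbar nu) xi ga s' x q) ->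
  (forall x, s' x <> RtoC 0 -> coef_at G K nu ga F (- x) = RtoC 0) ->
  (RtoC (width (conjg G (fst be))) * coef_at G (4 - K) (cbar nu) be F' m +
   RtoC (width (conjg G (fst al))) * coef_at G K nu al F n)%C = RtoC 0.
Proof.
  intros K G nu al be ga F F' m n s s' H Ha Hb Hg Hm Hn HF HF' Hp Hk Hp' Hk'.
  pose proof (admissible_dual _ _ _ H) as H'.
  pose proof (pairing (fun x => x < 0) K G nu (4 - K) (cbar nu) be ga F F' m s H H' Hb Hg
    (CF_dual' K G nu H) HF' Hp Hk) as T1.
  pose proof (pairing (fun x => x <= 0) (4 - K) G (cbar nu) K nu al ga F' F n s' H' H Ha Hg
    (CF_undual' K G nu H) HF Hp' Hk') as T2. cbv beta in T1, T2.
  apply (residue_two_cusps G Gh (fun z => F z * F' z)%C); [apply H|exact hGh|apply H|apply Hb|apply Ha| |].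
  - intros g z Gg Hz. pose proof (subgrp_det _ _ (admissible_subgrp _ _ _ H) Gg) as Dg.
    rewrite (modular_aut G K nu F), (modular_aut G (4 - K) (cbar nu) F') by (eauto; try apply HF; apply HF').
    transitivity ((aut K nu g z * aut (4 - K) (cbar nu) g z) * (F z * F' z))%C; [ring|].
    rewrite aut_dual; [reflexivity|exact Dg|apply H, Gg|exact Hz].
  - intros l Hl. set (xi := lift l). assert (Hx : inH xi) by (unfold xi; auto).
    pose proof (coef_at_spec K G nu xi F HF Hx) as E1. pose proof (coef_at_spec _ G (cbar nu) xi F' HF' Hx) as E2.
    rewrite has_expansion_hexp in E1, E2. simpl fst in E1, E2.
    pose proof (admissible_conj _ _ _ _ H Hx) as A1. pose proof (admissible_conj _ _ _ _ H' Hx) as A2. simpl fst in A1, A2.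
    assert (Gd : sqrt_pair xi) by auto.
    destruct (sigma_dual (conjg G l) K (conj_mult K nu xi) (conj_mult (4 - K) (cbar nu) xi)) as [t Ht].
    { apply A1. } { apply A1. } { apply A2. }
    { intros g z Gg Hz. pose proof (subgrp_det _ _ (admissible_subgrp _ _ _ A1) Gg) as Dg.
      rewrite <- (proj2 (trel_0_inv _ _ _ _ _ (conj_dual K G nu xi (admissible_subgrp _ _ _ H) (admissible_ok _ _ _ H) Gd)) g z Gg Hz).
      apply aut_dual; [exact Dg|apply A1, Gg|exact Hz]. }
    assert (Hw : 0 < width (conjg G l)) by (apply width_pos, A1).
    destruct (product_primitive _ _ _ t _ _ _ _ (- m) n Hw E1 E2 Ht) as [Phi HPhi]; [lra| |].
    { intros x X1 X2. destruct (Rlt_dec x 0) as [Xl|Xl].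
      - rewrite T1 by assumption. destruct (Req_EM_T x (- m)); [contradiction|reflexivity].
      - rewrite Cmult_comm. rewrite <- (Ropp_involutive x) at 2. rewrite T2 by (auto; lra).
        destruct (Req_EM_T (- x) (- n)); [exfalso; lra|reflexivity]. }
    exists Phi. intros z Hz. destruct (HPhi z Hz) as [D1 D2]. split.
    + replace (F (moebius l z) * F' (moebius l z) * / (jfac l z * jfac l z))%C with
        (slash K F xi z * slash (4 - K) F' xi z)%C; [exact D1|].
      pose proof (Jx_dual K xi z Gd Hz) as J. simpl fst in J. rewrite <- J. unfold slash. simpl fst.
      fold (Jx K xi z). fold (Jx (4 - K) xi z). field. split; apply Jx_nz; assumption.
    + rewrite D2. f_equal. f_equal. f_equal.
      * rewrite T1 by (auto; lra). destruct (Req_EM_T (- m) (- m)); [reflexivity|contradiction].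
      * rewrite Cmult_comm. rewrite <- (Ropp_involutive n) at 2. rewrite T2 by (auto; lra).
        destruct (Req_EM_T (- n) (- n)); [reflexivity|contradiction].
Qed.

(** ** Nested conjugates *)

(** The group and the multiplier at [ga] reached through [al] agree with those
    reached directly. *)
Lemma frame_stage : forall K G nu al ga, admissible K G nu -> inH al -> inH ga ->
  trel K 0 (conjg G (fst ga)) (conj_mult K nu ga)
    (conjg (conjg G (fst al)) (fst (Gmul (Ginv al) ga))) (conj_mult K (conj_mult K nu al) (Gmul (Ginv al) ga)).
Proof.
  intros K G nu al ga H Ha Hg. eapply trel_0trans; [|apply conj_stages; eauto].
  apply conj_geq; eauto. apply geq_sym, geq_Kl; auto.
Qed.

Lemma frame_stage_dual : forall K G nu al ga, admissible K G nu -> inH al -> inH ga ->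
  trel (4 - K) 0 (conjg G (fst ga)) (conj_mult (4 - K) (cbar nu) ga)
    (conjg (conjg G (fst al)) (fst (Gmul (Ginv al) ga)))
    (conj_mult (4 - K) (cbar (conj_mult K nu al)) (Gmul (Ginv al) ga)).
Proof.
  intros K G nu al ga H Ha Hg. eapply trel_0trans; [apply (frame_stage (4 - K) G (cbar nu) al ga); auto|].
  apply conj_of_trel0; [| |apply conj_dual]; eauto.
Qed.

Lemma frame_dual_stage : forall K G nu al ga, admissible K G nu -> inH al -> inH ga ->
  trel (4 - K) 0 (conjg G (fst ga)) (conj_mult (4 - K) (cbar nu) ga)
    (conjg (conjg G (fst al)) (fst (Gmul (Ginv al) ga)))
    (cbar (conj_mult K (conj_mult K nu al) (Gmul (Ginv al) ga))).
Proof.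
  intros K G nu al ga H Ha Hg. eapply trel_0trans; [apply conj_dual; eauto|].
  pose proof (admissible_conj _ _ _ _ (admissible_conj _ _ _ _ H Ha) (inH_mul _ _ (inH_inv _ Ha) Hg)) as A.
  apply trel_dual; [eauto|exact (admissible_subgrp _ _ _ A)|eauto|exact (admissible_ok _ _ _ A)|].
  apply frame_stage; assumption.
Qed.

(** ** Coefficients of slashed forms *)

Lemma coef_back_one : forall K G nu al f, admissible K G nu -> inH al ->
  coef (conjg G (fst al)) K (conj_mult K nu al) f = coef_at G K nu al (slash K f (Ginv al)).
Proof.
  intros K G nu al f H Ha. rewrite <- (coef_one K (conjg G (fst al)) (conj_mult K nu al)) by auto.
  rewrite <- (back_coef) by auto. apply (geq_coef); auto. apply geq_one_r.
Qed.

Lemma coef_at_back : forall K G nu al ga f, admissible K G nu -> inH al -> inH ga ->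
  coef_at (conjg G (fst al)) K (conj_mult K nu al) (Gmul (Ginv al) ga) f = coef_at G K nu ga (slash K f (Ginv al)).
Proof.
  intros K G nu al ga f H Ha Hg. rewrite <- (back_coef) by auto.
  apply (geq_coef); auto. apply geq_Kl; auto.
Qed.

(** The expansion of the pulled back form at oo is that of [h] at [Ginv x]. *)
Lemma back_zero : forall (P : R -> Prop) K G nu x h n, admissible K G nu -> inH x ->
  formP P (conjg G (fst x)) K (conj_mult K nu x) h -> P n -> coef G K nu (slash K h (Ginv x)) n = RtoC 0.
Proof.
  intros P K G nu x h n H Hx Hf Pn. apply (formP_iff) in Hf; [|auto]. destruct Hf as [_ [_ Hc]].
  rewrite <- (coef_one K G nu _ H).
  rewrite <- (geq_coef K G nu (Gmul x (Ginv x)) Gone) by (auto; apply geq_inv_r; auto).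
  rewrite (back_coef) by auto. auto.
Qed.

(** A form is fixed by the projection when a combination of the basis elements
    vanishes; by independence its coefficients vanish. *)
Lemma projected_coef_zero : forall (V : (C -> C) -> Prop) K G nu y f B, admissible K G nu -> inH y ->
  reduced_echelon_basis V (conjg G (fst y)) K (conj_mult K nu y) B ->
  (forall z, upper z -> Cminus (f z)
    (lin_comb (idx B) (coef_at G K nu y f) (fun m => slash K (form B m) (Ginv y)) z) = f z) ->
  forall m, In m (idx B) -> coef_at G K nu y f m = RtoC 0.
Proof.
  intros V K G nu y f B H Hy [_ [_ [_ Hi]]] Hp. apply Hi. intros w Hw.
  assert (Gy : sqrt_pair y) by auto. pose proof (moebius_upper _ _ (proj1 Gy) Hw) as Hu.
  specialize (Hp _ Hu).
  assert (E0 : lin_comb (idx B) (coef_at G K nu y f) (fun m => slash K (form B m) (Ginv y)) (moebius (fst y) w) = RtoC 0).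
  { transitivity (f (moebius (fst y) w) - Cminus (f (moebius (fst y) w))
      (lin_comb (idx B) (coef_at G K nu y f) (fun m => slash K (form B m) (Ginv y)) (moebius (fst y) w)))%C; [ring|].
    rewrite Hp. ring. }
  assert (E1 : forall m, slash K (form B m) (Ginv y) (moebius (fst y) w) = (Jx K y w * form B m w)%C).
  { intros m. rewrite <- (slash_inv_at K (form B m) y w Gy Hw). unfold slash at 2. fold (Jx K y w). field.
    apply Jx_nz; assumption. }
  apply (Cmult_cancel_r _ _ (Jx K y w)); [apply Jx_nz; assumption|]. rewrite Cmult_0_l, <- E0.
  unfold lin_comb. generalize (idx B). intros l. clear - E1. induction l as [|m l IH]; [simpl; ring|].
  simpl. rewrite E1. fold (Csum (map (fun m => (coef_at G K nu y f m * form B m w)%C) l)).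
  fold (Csum (map (fun m => (coef_at G K nu y f m * slash K (form B m) (Ginv y) (moebius (fst y) w))%C) l)).
  rewrite <- IH. ring.
Qed.

Lemma coef_at_scal : forall K G nu x c f, admissible K G nu -> inH x -> qform G K nu f -> forall t,
  coef_at G K nu x (fun z => c * f z)%C t = (c * coef_at G K nu x f t)%C.
Proof.
  intros K G nu x c f H Hx Hf t. unfold coef_at at 1.
  rewrite (coef_unique _ _ _ _ (fun t => c * coef_at G K nu x f t)%C); [reflexivity|apply (admissible_conj _ _ _ _ H Hx)|].
  apply (has_expansion_ext _ _ _ (fun z => c * slash K f x z)%C); [intros; unfold slash; ring|].
  apply expansion_scal, (coef_at_spec); assumption.
Qed.

(** ** Bases attached to all groups and multipliers *)

Section Bases.

Variables (P : R -> Prop) (EB : (M2 -> Prop) -> Z -> (M2 -> C) -> echelon).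
Hypothesis hEB : forall K G nu, admissible K G nu -> reduced_echelon_basis (formP P G K nu) G K nu (EB G K nu).

Lemma EB_idx : forall K r G1 nu1 G2 nu2, admissible K G1 nu1 -> admissible K G2 nu2 -> trel K r G1 nu1 G2 nu2 -> Gh (Tmat r) ->
  forall m, In m (idx (EB G1 K nu1)) <-> In m (idx (EB G2 K nu2)).
Proof.
  intros K r G1 nu1 G2 nu2 H1 H2 T HT.
  exact (translate_idx_iff P K r G1 nu1 G2 nu2 _ _ H1 H2 T HT (hEB _ _ _ H1) (hEB _ _ _ H2)).
Qed.

Lemma Gh_T0 : Gh (Tmat 0).
Proof. apply (Gh_subgrp). Qed.

Lemma EB_form0 : forall K G1 nu1 G2 nu2 m z, admissible K G1 nu1 -> admissible K G2 nu2 -> trel K 0 G1 nu1 G2 nu2 ->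
  In m (idx (EB G1 K nu1)) -> upper z -> form (EB G2 K nu2) m z = form (EB G1 K nu1) m z.
Proof.
  intros K G1 nu1 G2 nu2 m z H1 H2 T Hm Hz.
  pose proof (translate_basis P K 0 G1 nu1 G2 nu2 _ _ H1 H2 T Gh_T0 (hEB _ _ _ H1) (hEB _ _ _ H2) m z Hm Hz) as E.
  rewrite Rmult_0_l, ee_0, Cmult_1_l in E. rewrite <- E. f_equal. ring.
Qed.

(** The index sets used by the two families at [ga] agree, hence a form
    normalised at [ga] kills the correction of the other. *)
Lemma correction_annihilated : forall K K' G nu nu' al be ga F' (X : R -> C) wr, admissible K G nu -> inH al -> inH be -> inH ga ->
  K' = (4 - K)%Z -> nu' = cbar nu ->
  (forall m, In m (idx (EB (conjg (conjg G (fst be)) (fst (Gmul (Ginv be) ga))) K'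
      (conj_mult K' (conj_mult K' nu' be) (Gmul (Ginv be) ga)))) ->
     coef_at G K' nu' ga F' m = RtoC 0) ->
  forall x, Cmult wr (Csum (map (fun j => Cmult (X j) (mono (- j) x))
    (idx (EB (conjg (conjg G (fst al)) (fst (Gmul (Ginv al) ga))) (4 - K)
      (conj_mult (4 - K) (cbar (conj_mult K nu al)) (Gmul (Ginv al) ga)))))) <> RtoC 0 ->
  coef_at G K' nu' ga F' (- x) = RtoC 0.
Proof.
  intros K K' G nu nu' al be ga F' X wr H Ha Hb Hg -> -> Hk x Hx. apply Hk.
  assert (T1 := frame_stage (4 - K) G (cbar nu) be ga (admissible_dual _ _ _ H) Hb Hg).
  assert (T2 := frame_stage_dual K G nu al ga H Ha Hg).
  apply (EB_idx (4 - K) 0 (conjg G (fst ga)) (conj_mult (4 - K) (cbar nu) ga)); auto using Gh_T0.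
  apply (EB_idx (4 - K) 0 _ _ _ _ (admissible_conj _ _ _ _ (admissible_dual _ _ _ H) Hg)
    (admissible_conj _ _ _ _ (admissible_dual _ _ _ (admissible_conj _ _ _ _ H Ha)) (inH_mul _ _ (inH_inv _ Ha) Hg)) T2 Gh_T0).
  match type of Hx with context [map _ ?l] => change (In (- x) l); set (L := l) in * end.
  apply NNPP. intros Hn. apply Hx.
  replace (Csum (map (fun j => Cmult (X j) (mono (- j) x)) L)) with (RtoC 0); [ring|].
  clear Hx. clearbody L. induction L as [|j L IH]; [reflexivity|]. simpl.
  fold (Csum (map (fun j => Cmult (X j) (mono (- j) x)) L)). rewrite <- IH by (intros Hi; apply Hn; simpl; auto).
  rewrite mono_0; [ring|]. intros E. apply Hn. left. lra.
Qed.

(** [Acoef] for the bases [Fb] and [Bcoef] for the bases [Gb]. *)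
Definition AB_coef (G : M2 -> Prop) (K : Z) (nu : M2 -> C) (g : Gelt) (j m : R) : C :=
  Cminus (coef G K nu (slash K (form (EB (conj_group G g) K (conj_mult K nu g)) j) (Ginv g)) m)
    (delta G K nu g j m).

(** The series at gamma in [calG] for the bases [Fb], in [calF] for [Gb]. *)
Definition correction (G : M2 -> Prop) (K : Z) (nu : M2 -> C) (x y : Gelt) (m t : R) : C :=
  Cmult (width_ratio G x y)
    (Csum (map (fun j => Cmult
       (AB_coef (conj_group G x) (4 - K) (conj_mult (4 - K) (cbar nu) x) (Gmul (Ginv x) y) j m) (mono (- j) t))
      (idx (EB (conj_group G y) (4 - K) (conj_mult (4 - K) (cbar nu) y))))).

(** The family [delta] contributes only if gamma and beta lead to one cusp and
    [m] is the index [- n]. Otherwise the correction at the exponent [n] is, up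
    to the ratio of the widths, the coefficient at [m] of the basis element
    with index [- n] at gamma, seen from beta. *)
Lemma correction_at : forall K G nu al be ga m n h, admissible K G nu -> inH al -> inH be -> inH ga ->
  let Gal := conjg G (fst al) in let nal := conj_mult K nu al in
  let x := Gmul (Ginv al) be in let y := Gmul (Ginv al) ga in
  let B := EB (conjg G (fst ga)) (4 - K) (conj_mult (4 - K) (cbar nu) ga) in
  In (- n) (idx B) -> (cusp_eq G (fst ga) (fst be) -> m <> - n) ->
  (forall z, upper z -> h z = form B (- n) z) ->
  correction Gal K nal x y m n =
  (RtoC (width (conjg G (fst be)) / width (conjg G (fst ga))) *
   coef_at G (4 - K) (cbar nu) be (slash (4 - K) h (Ginv ga)) m)%C.
Proof.
  intros K G nu al be ga m n h H Ha Hb Hg Gal nal x y B Hn Hno Hh.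
  pose proof (admissible_dual _ _ _ H) as H'. pose proof (admissible_conj _ _ _ _ H Ha) as HA. fold Gal nal in HA.
  assert (Hx : inH x) by (unfold x; auto). assert (Hy : inH y) by (unfold y; auto).
  set (w := Gmul (Ginv x) y). assert (Hw : inH w) by (unfold w; auto).
  set (Gx := conjg Gal (fst x)). set (nx := conj_mult (4 - K) (cbar nal) x).
  assert (HX : admissible (4 - K) Gx nx) by (unfold Gx, nx; auto).
  set (L := idx (EB (conjg Gal (fst y)) (4 - K) (conj_mult (4 - K) (cbar nal) y))).
  assert (HL : In (- n) L).
  { apply (EB_idx (4 - K) 0 (conjg G (fst ga)) (conj_mult (4 - K) (cbar nu) ga)); auto using Gh_T0.
    apply frame_stage_dual; assumption. }
  unfold correction. change (conj_group Gal x) with Gx. fold nx w.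
  change (idx (EB (conj_group Gal y) (4 - K) (conj_mult (4 - K) (cbar nal) y))) with L.
  rewrite (Csum_single _ L (- n)).
  2:{ apply (hEB (4 - K)). auto. }
  2:{ exact HL. }
  2:{ intros j _ Hj. rewrite mono_0; [ring|]. intros E. apply Hj. lra. }
  rewrite Ropp_involutive, mono_1, Cmult_1_r.
  assert (Ed : delta Gx (4 - K) nx w (- n) m = RtoC 0).
  { destruct (family_spec (4 - K) Gx nx w Gone (mono (- n)) m HX Hw inH_one) as [[r [c [HC E]]]|[_ E]]; [|exact E].
    unfold delta. rewrite E. rewrite mono_0; [ring|]. apply Hno.
    apply CF_cusp_eq in HC. unfold Gx in HC.
    apply (proj1 (cusp_eq_push Gal (fst x) _ _ (admissible_subgrp _ _ _ HA) (inH_det _ Hx))) in HC.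
    unfold Gal in HC. apply (proj1 (cusp_eq_push G (fst al) _ _ (admissible_subgrp _ _ _ H) (inH_det _ Ha))) in HC.
    pose proof (geq_Kl x y (inH_good _ Hx) (inH_good _ Hy)) as [K1 _].
    pose proof (geq_Kl al ga (inH_good _ Ha) (inH_good _ Hg)) as [K2 _]. pose proof (geq_Kl al be (inH_good _ Ha) (inH_good _ Hb)) as [K3 _].
    change (M2mul (fst x) (fst w)) with (fst (Gmul x (Gmul (Ginv x) y))) in HC. rewrite K1 in HC.
    change (M2mul (fst al) (fst y)) with (fst (Gmul al (Gmul (Ginv al) ga))) in HC. rewrite K2 in HC.
    simpl (fst Gone) in HC. rewrite M2mul_1r in HC.
    change (M2mul (fst al) (fst x)) with (fst (Gmul al (Gmul (Ginv al) be))) in HC. rewrite K3 in HC. exact HC. }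
  assert (Ew : width_ratio Gal x y = RtoC (width (conjg G (fst be)) / width (conjg G (fst ga)))).
  { assert (W1 : width (conj_group Gal x) = width (conjg G (fst be)))
      by exact (trel_width _ _ _ _ _ _ (frame_stage K G nu al be H Ha Hb)).
    assert (W2 : width (conj_group Gal y) = width (conjg G (fst ga)))
      by exact (trel_width _ _ _ _ _ _ (frame_stage K G nu al ga H Ha Hg)).
    unfold width_ratio. rewrite W1, W2. reflexivity. }
  rewrite Ew. f_equal. unfold AB_coef. rewrite Ed. unfold Cminus.
  transitivity (coef Gx (4 - K) nx (slash (4 - K) (form (EB (conj_group Gx w) (4 - K) (conj_mult (4 - K) nx w)) (- n)) (Ginv w)) m);
    [ring|].
  assert (T : trel (4 - K) 0 (conjg G (fst ga)) (conj_mult (4 - K) (cbar nu) ga)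
    (conjg Gx (fst w)) (conj_mult (4 - K) nx w)).
  { eapply trel_0trans; [apply (frame_stage_dual K G nu al ga H Ha Hg)|].
    apply (frame_stage (4 - K) Gal (cbar nal) x y); auto. }
  assert (Eh : forall z, upper z -> form (EB (conj_group Gx w) (4 - K) (conj_mult (4 - K) nx w)) (- n) z = h z).
  { intros z Hz. rewrite Hh by exact Hz. apply (EB_form0 (4 - K)); auto. apply (admissible_conj _ _ _ _ HX Hw). }
  rewrite (coef_ext _ _ _ _ (slash (4 - K) (slash (4 - K) h (Ginv y)) x)).
  2:{ intros z Hz. rewrite (slash_eq _ _ h) by (auto; apply inH_good; auto). apply slash_inv_div; auto. }
  change (coef_at Gal (4 - K) (cbar nal) x (slash (4 - K) h (Ginv y)) m =
    coef_at G (4 - K) (cbar nu) be (slash (4 - K) h (Ginv ga)) m).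
  rewrite (trel0_coef_at (4 - K) Gal (conj_mult (4 - K) (cbar nu) al)).
  2:{ unfold Gal. auto. } 2:{ auto. } 2:{ exact Hx. } 2:{ apply conj_dual; eauto. }
  unfold Gal, x. rewrite coef_at_back by auto.
  rewrite (coef_at_ext (4 - K) G (cbar nu) be _ (slash (4 - K) h (Ginv ga)) Hb); [reflexivity|]. intros z Hz.
  rewrite (slash_eq _ _ (slash (4 - K) (slash (4 - K) h (Ginv ga)) al)); [|apply inH_good; auto|exact Hz|].
  - apply slash_at_inv; auto.
  - intros t Ht. apply slash_inv_div; auto.
Qed.

(** The form [g] is a basis element at alpha. Since alpha and gamma lead to one
    cusp, it is a multiple of a basis element at gamma, by the comparison of
    translated bases. The coefficient of [f] at [n] comes from the correction
    at gamma alone, and is the coefficient of that same element at [m]. Here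
    [K'] and [nu'] allow for a second use with the two weights exchanged. *)
Lemma duality_echelon : forall (Q : R -> Prop) K K' G nu nu' al be ga f g m n, admissible K G nu -> inH al -> inH be -> inH ga ->
  K' = (4 - K)%Z -> nu' = cbar nu ->
  let Gal := conjg G (fst al) in let nal := conj_mult K nu al in
  let x := Gmul (Ginv al) be in let y := Gmul (Ginv al) ga in
  let Gbe := conjg G (fst be) in let nbe := conj_mult K' nu' be in
  let v := Gmul (Ginv be) al in
  let B := EB (conjg Gbe (fst v)) K' (conj_mult K' nbe v) in
  qform Gal K nal f ->
  (forall l, Gh l -> forall t, Q t -> coef_at Gal K nal (lift l) f t =
    Cminus (cusp_family Gal K nal x (mono (- m)) (lift l) t)
      (cusp_family Gal K nal y (correction Gal K nal x y m) (lift l) t)) ->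
  Q n -> same_cusp Gbe v (Gmul (Ginv be) ga) -> In (- n) (idx B) ->
  (same_cusp Gal x y -> ~ In m (idx (EB (conjg Gal (fst x)) (4 - K) (cbar (conj_mult K nal x))))) ->
  (forall z, upper z -> g z = slash K' (form B (- n)) (Ginv v) z) ->
  (RtoC (width Gal) * coef Gal K nal f n)%C = (- (RtoC (width Gbe) * coef Gbe K' nbe g m))%C.
Proof.
  intros Q K K' G nu nu' al be ga f g m n H Ha Hb Hg -> -> Gal nal x y Gbe nbe v B Hf Hp Qn Hsc Hn Hm Hgz.
  pose proof (admissible_dual _ _ _ H) as H'. pose proof (admissible_conj _ _ _ _ H Ha) as HA. fold Gal nal in HA.
  pose proof (admissible_conj _ _ _ _ H' Hb) as HB. fold Gbe nbe in HB. pose proof (admissible_subgrp _ _ _ H) as sG.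
  assert (Hx : inH x) by (unfold x; auto). assert (Hy : inH y) by (unfold y; auto).
  assert (Hv : inH v) by (unfold v; auto).
  pose proof (geq_Kl al ga (inH_good _ Ha) (inH_good _ Hg)) as [Kag _]. pose proof (geq_Kl al be (inH_good _ Ha) (inH_good _ Hb)) as [Kab _].
  pose proof (geq_Kl be al (inH_good _ Hb) (inH_good _ Ha)) as [Kba _]. pose proof (geq_Kl be ga (inH_good _ Hb) (inH_good _ Hg)) as [Kbg _].
  simpl in Kag, Kab, Kba, Kbg.
  assert (Hc : cusp_eq G (fst al) (fst ga)).
  { apply (same_cusp_iff (4 - K) Gbe nbe) in Hsc; [|auto|auto|auto].
    unfold Gbe in Hsc. apply (proj1 (cusp_eq_push G (fst be) _ _ sG (inH_det _ Hb))) in Hsc. unfold v in Hsc. simpl fst in Hsc.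
    rewrite Kba, Kbg in Hsc. apply cusp_eq_sym; auto. }
  set (B1 := EB (conjg G (fst al)) (4 - K) (conj_mult (4 - K) (cbar nu) al)).
  set (B0 := EB (conjg G (fst ga)) (4 - K) (conj_mult (4 - K) (cbar nu) ga)).
  assert (Tv : trel (4 - K) 0 (conjg G (fst al)) (conj_mult (4 - K) (cbar nu) al)
    (conjg Gbe (fst v)) (conj_mult (4 - K) nbe v)) by (apply frame_stage; auto).
  assert (HBv : admissible (4 - K) (conjg Gbe (fst v)) (conj_mult (4 - K) nbe v)) by auto.
  assert (Hn1 : In (- n) (idx B1)).
  { apply (EB_idx (4 - K) 0 (conjg G (fst al)) (conj_mult (4 - K) (cbar nu) al) _ _ (admissible_conj _ _ _ _ H' Ha) HBv Tv Gh_T0). exact Hn. }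
  destruct (CF_exists K G nu al ga H Ha Hg Hc) as [q [c0 HC0]].
  (* the two indices cannot meet at one cusp *)
  assert (Hno : cusp_eq G (fst al) (fst be) -> m <> - n).
  { intros E Em. apply Hm.
    - apply (same_cusp_iff K Gal nal); auto. unfold Gal. apply cusp_eq_push; [exact sG|auto|].
      unfold x, y. simpl fst. rewrite Kag, Kab. apply (cusp_eq_trans G _ (fst al)); [exact sG| |exact E].
      apply cusp_eq_sym; auto.
    - destruct (CF_exists (4 - K) G (cbar nu) al be H' Ha Hb E) as [r [c HC]].
      pose proof (frame_dual_stage K G nu al be H Ha Hb) as Td.
      assert (HAx : admissible (4 - K) (conjg Gal (fst x)) (cbar (conj_mult K nal x))) by auto.
      apply (EB_idx (4 - K) 0 _ _ _ _ (admissible_conj _ _ _ _ H' Hb) HAx Td Gh_T0).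
      apply (EB_idx (4 - K) (Rdefinitions.Q2R r) _ _ _ _ (admissible_conj _ _ _ _ H' Hb) (admissible_conj _ _ _ _ H' Ha)
        (CF_trel (4 - K) G (cbar nu) sG (admissible_ok _ _ _ H') al be _ c (inH_good _ Ha) (inH_good _ Hb) HC)).
      + eapply (CF_T (4 - K) G (cbar nu) al be); eassumption.
      + rewrite Em. exact Hn1. }
  destruct (principal_back Q K G nu al be ga f (mono (- m)) (correction Gal K nal x y m) H Ha Hb Hg Hf Hp al Ha n Qn)
    as [p [t [E1 [Fp Ft]]]].
  assert (Ep : p = RtoC 0).
  { destruct Fp as [[r [c [HC ->]]]|[_ ->]]; [|reflexivity].
    rewrite mono_0; [ring|]. intros En. apply (Hno (CF_cusp_eq K G nu _ _ _ _ HC)). lra. }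
  destruct Ft as [[r [c [HC Et]]]|[Hnc _]]; [|contradiction].
  pose proof (CF_trel K G nu sG (admissible_ok _ _ _ H) al ga r c (inH_good _ Ha) (inH_good _ Hg) HC) as Tga.
  destruct (CF_dual' K G nu H al ga r c (inH_good _ Ha) (inH_good _ Hg) HC) as [Nc HC'].
  pose proof (CF_trel (4 - K) G (cbar nu) sG (admissible_ok _ _ _ H') al ga r (/ c)%C (inH_good _ Ha) (inH_good _ Hg) HC') as Tga'.
  pose proof (CF_T K G nu al ga r c H Ha Hg HC) as HT.
  assert (Hn0 : In (- n) (idx B0)).
  { apply (EB_idx (4 - K) r _ _ _ _ (admissible_conj _ _ _ _ H' Hg) (admissible_conj _ _ _ _ H' Ha) Tga' HT). exact Hn1. }
  set (h0 := form B0 (- n)). set (h1 := form B1 (- n)).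
  set (U := slash (4 - K) h0 (Ginv ga)).
  assert (HU : qform G (4 - K) (cbar nu) U).
  { apply (back_qform (4 - K) G (cbar nu) ga h0 H' Hg).
    apply (formP_qform P (4 - K) (conjg G (fst ga)) (conj_mult (4 - K) (cbar nu) ga)); [auto|].
    apply (hEB (4 - K) (conjg G (fst ga)) (conj_mult (4 - K) (cbar nu) ga)); [auto|exact Hn0]. }
  (* [c ee(rn) U] is the form that [g] comes from *)
  assert (EU : forall z, upper z -> h1 z = slash (4 - K) (fun s => c * ee (r * n) * U s)%C al z).
  { intros z Hz. pose proof (upper_shift z r Hz) as Hz'.
    transitivity (c * ee (r * n) * slash (4 - K) U al z)%C; [|unfold slash; ring].
    rewrite (CF_slash (4 - K) G (cbar nu) sG (admissible_ok _ _ _ H') al ga r (/ c)%C U z (inH_good _ Ha) (inH_good _ Hg) HC' (proj1 HU) Hz).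
    unfold U. rewrite slash_inv_at by auto.
    pose proof (translate_basis P (4 - K) r _ _ _ _ B0 B1 (admissible_conj _ _ _ _ H' Hg) (admissible_conj _ _ _ _ H' Ha) Tga' HT
      (hEB _ _ _ (admissible_conj _ _ _ _ H' Hg)) (hEB _ _ _ (admissible_conj _ _ _ _ H' Ha)) (- n) z Hn0 Hz) as E.
    unfold h0. rewrite E. fold h1. replace (r * - n) with (- (r * n)) by ring. rewrite ee_opp. field.
    split; [apply ee_nz|exact Nc]. }
  assert (Eg : coef Gbe (4 - K) nbe g m = (c * ee (r * n) * coef_at G (4 - K) (cbar nu) be U m)%C).
  { rewrite <- (coef_at_scal (4 - K) G (cbar nu) be) by assumption.
    unfold coef_at. fold (conj_group G be). change (conj_group G be) with Gbe. fold nbe.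
    rewrite (coef_ext Gbe (4 - K) nbe g (slash (4 - K) (fun s => c * ee (r * n) * U s)%C be)); [reflexivity|].
    intros z Hz. rewrite Hgz by exact Hz.
    unfold v. rewrite slash_inv_div by auto. apply slash_eq; [auto|exact Hz|]. intros s Hs.
    rewrite (slash_eq (4 - K) _ (slash (4 - K) (fun s => c * ee (r * n) * U s)%C al)); [exact (slash_at_inv (4 - K) (fun s => c * ee (r * n) * U s)%C al s (inH_good _ Ha) Hs)|auto|exact Hs|].
    intros t' Ht'. rewrite <- EU by exact Ht'. unfold h1. apply (EB_form0 (4 - K)); auto. }
  assert (Ecorr := correction_at K G nu al be ga m n h0 H Ha Hb Hg Hn0). cbv zeta in Ecorr.
  fold Gal nal x y in Ecorr. rewrite Ecorr in Et.
  2:{ intros E. apply Hno. eapply cusp_eq_trans; eassumption. }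
  2:{ reflexivity. }
  unfold Gal, nal. rewrite coef_back_one by assumption. rewrite E1, Ep, Et, Eg.
  rewrite <- (trel_width _ _ _ _ _ _ Tga).
  assert (Nw : width (conjg G (fst al)) <> 0) by (apply Rgt_not_eq, width_pos, HA).
  unfold Gbe. rewrite RtoC_div by exact Nw. fold U. field. intros E. apply Nw, RtoC_inj, E.
Qed.

End Bases.

End Forms.

(** * Duality of the coefficients *)

Lemma echelon_bases_F : forall Gh E, maximal_commensurable Gh -> echelon_bases Gh E ->
  forall K G nu, admissible Gh K G nu -> reduced_echelon_basis (formP Gh (fun x => x < 0) G K nu) G K nu (Fb E G K nu).
Proof.
  intros Gh E hGh hE K G nu H. pose proof (admissible_subgrp _ _ _ _ H) as sG. destruct H as [c [s [o fin]]].
  apply (hE G K nu c s (mult_ok_consistent G K nu sG o) fin).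
Qed.

Lemma echelon_bases_G : forall Gh E, maximal_commensurable Gh -> echelon_bases Gh E ->
  forall K G nu, admissible Gh K G nu -> reduced_echelon_basis (formP Gh (fun x => x <= 0) G K nu) G K nu (Gb E G K nu).
Proof.
  intros Gh E hGh hE K G nu H. pose proof (admissible_subgrp _ _ _ _ H) as sG. destruct H as [c [s [o fin]]].
  apply (hE G K nu c s (mult_ok_consistent G K nu sG o) fin).
Qed.

Theorem theorem5p7
  (Gam Gh : M2 -> Prop) (K : Z) (nu : M2 -> C)
  (hGam : commensurable Gam)
  (hGh : maximal_commensurable Gh)
  (hsub : forall g, Gam g -> Gh g)
  (hnu : consistent_multiplier Gam K nu)
  (hfin : finite_multiplier Gam nu)
  (E : bases) (hE : echelon_bases Gh E)
  (alpha beta gamma : M2)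
  (halpha : Gh alpha) (hbeta : Gh beta) (hgamma : Gh gamma) :
  let al := lift alpha in
  let be := lift beta in
  let ga := lift gamma in
  let Gam_al := conj_group Gam al in
  let Gam_be := conj_group Gam be in
  let nu_al := conj_mult K nu al in
  let nubar_be := conj_mult (4 - K) (cbar nu) be in
  forall (m n : R)
    (hm : Iset3 E Gam_al K nu_al (Gmul (Ginv al) be) (Gmul (Ginv al) ga) m)
    (hn : Jset3 E Gam_be (4 - K) nubar_be (Gmul (Ginv be) al) (Gmul (Ginv be) ga) n)
    (f g : C -> C)
    (hf : is_f E Gh Gam_al K nu_al (Gmul (Ginv al) be) (Gmul (Ginv al) ga) m f)
    (hg : is_g E Gh Gam_be (4 - K) nubar_be
            (Gmul (Ginv be) al) (Gmul (Ginv be) ga) n g),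
  Cmult (RtoC (width Gam_al)) (coef Gam_al K nu_al f n) =
  Copp (Cmult (RtoC (width Gam_be)) (coef Gam_be (4 - K) nubar_be g m)).
Proof.
  intros al be ga Gam_al Gam_be nu_al nubar_be m n [hm1 hm2] [hn1 hn2] f g [hf1 hf2] [hg1 hg2].
  pose proof (comm_subgrp _ hGam) as sG.
  assert (H : admissible Gh K Gam nu).
  { split; [exact hGam|]. split; [exact hsub|]. split; [|exact hfin]. apply consistent_mult_ok; assumption. }
  pose proof (admissible_dual _ _ _ _ H) as H'.
  assert (Ha : inH Gh al) by (apply inH_lift; assumption).
  assert (Hb : inH Gh be) by (apply inH_lift; assumption).
  assert (Hg : inH Gh ga) by (apply inH_lift; assumption).
  assert (HA : admissible Gh K Gam_al nu_al) by (apply (admissible_conj Gh hGh K Gam nu al); assumption).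
  assert (HB : admissible Gh (4 - K) Gam_be nubar_be) by (apply (admissible_conj Gh hGh (4 - K) Gam (cbar nu) be); assumption).
  pose proof (inH_mul Gh hGh _ _ (inH_inv Gh hGh _ Ha) Hb) as Hx. pose proof (inH_mul Gh hGh _ _ (inH_inv Gh hGh _ Ha) Hg) as Hy.
  pose proof (inH_mul Gh hGh _ _ (inH_inv Gh hGh _ Hb) Ha) as Hv. pose proof (inH_mul Gh hGh _ _ (inH_inv Gh hGh _ Hb) Hg) as Hw.
  pose proof (echelon_bases_F Gh E hGh hE) as hF. pose proof (echelon_bases_G Gh E hGh hE) as hG.
  assert (E4 : K = (4 - (4 - K))%Z) by lia. assert (Ec : nu = cbar (cbar nu)) by (symmetry; apply cbar_cbar).
  destruct (Rlt_dec 0 m) as [Hm|Hm]; destruct (Rle_dec 0 n) as [Hn|Hn].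
  - (* two principal parts: the residue theorem *)
    destruct (hf1 Hm) as [f1 [f2 f3]]. destruct (hg1 Hn) as [g1 [g2 g3]].
    pose proof (whf_qform Gh hGh _ _ _ _ HA f1) as qf. pose proof (whf_qform Gh hGh _ _ _ _ HB g1) as qg.
    set (F := slash K f (Ginv al)). set (F' := slash (4 - K) g (Ginv be)).
    assert (R0 : (RtoC (width Gam_be) * coef_at Gam (4 - K) (cbar nu) be F' m +
      RtoC (width Gam_al) * coef_at Gam K nu al F n)%C = RtoC 0).
    { apply (residue_pairing Gh hGh K Gam nu al be ga F F' m n
        (correction (Gb E) Gam_al K nu_al (Gmul (Ginv al) be) (Gmul (Ginv al) ga) m)
        (correction (Fb E) Gam_be (4 - K) nubar_be (Gmul (Ginv be) al) (Gmul (Ginv be) ga) n) H Ha Hb Hg Hm Hn).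
      - apply (back_qform Gh hGh); assumption.
      - apply (back_qform Gh hGh); assumption.
      - exact (principal_back Gh hGh (fun x => x < 0) K Gam nu al be ga f (mono (- m)) _ H Ha Hb Hg qf f2).
      - apply (correction_annihilated Gh hGh (fun x => x <= 0) (Gb E) hG K (4 - K) Gam nu (cbar nu) al be ga F' _ _ H Ha Hb Hg eq_refl eq_refl).
        intros j Hj. unfold F'. rewrite <- (coef_at_back Gh hGh (4 - K) Gam (cbar nu) be ga g H' Hb Hg).
        exact (projected_coef_zero Gh _ (4 - K) Gam_be nubar_be _ g _ HB Hw (hG _ _ _ (admissible_conj Gh hGh _ _ _ _ HB Hw)) g3 j Hj).
      - exact (principal_back Gh hGh (fun x => x <= 0) (4 - K) Gam (cbar nu) be al ga g (mono (- n)) _ H' Hb Ha Hg qg g2).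
      - apply (correction_annihilated Gh hGh (fun x => x < 0) (Fb E) hF (4 - K) K Gam (cbar nu) nu be al ga F _ _ H' Hb Ha Hg E4 Ec).
        intros j Hj. unfold F. rewrite <- (coef_at_back Gh hGh K Gam nu al ga f H Ha Hg).
        exact (projected_coef_zero Gh _ K Gam_al nu_al _ f _ HA Hy (hF _ _ _ (admissible_conj Gh hGh _ _ _ _ HA Hy)) f3 j Hj). }
    unfold Gam_al, nu_al, Gam_be, nubar_be.
    change (coef (conj_group Gam al)) with (coef (conjg Gam (fst al))).
    change (coef (conj_group Gam be)) with (coef (conjg Gam (fst be))).
    rewrite (coef_back_one Gh hGh K Gam nu al f H Ha), (coef_back_one Gh hGh (4 - K) Gam (cbar nu) be g H' Hb).
    fold F F' Gam_al Gam_be.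
    set (u := (RtoC (width Gam_al) * coef_at Gam K nu al F n)%C) in *.
    set (t := (RtoC (width Gam_be) * coef_at Gam (4 - K) (cbar nu) be F' m)%C) in *.
    transitivity (t + u - t)%C; [ring|]. rewrite R0. ring.
  - (* [g] is a basis element of cusp forms *)
    apply Rnot_le_lt in Hn. destruct (hf1 Hm) as [f1 [f2 _]].
    assert (Hsc : same_cusp Gam_be (Gmul (Ginv be) al) (Gmul (Ginv be) ga)).
    { apply NNPP. intros Hsc. destruct (hn2 Hsc). lra. }
    apply (duality_echelon Gh hGh (fun x => x <= 0) (Gb E) hG (fun x => x < 0) K (4 - K) Gam nu (cbar nu) al be ga f g m n
      H Ha Hb Hg eq_refl eq_refl).
    + apply (whf_qform Gh hGh); assumption.
    + exact f2.
    + exact Hn.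
    + exact Hsc.
    + destruct (hn1 Hsc) as [[[_ Hn0]|Hi] _]; [lra|exact Hi].
    + intros Hs. apply (hm1 Hs).
    + exact (hg2 Hn).
  - (* [f] is a basis element of holomorphic forms *)
    apply Rnot_lt_le in Hm. destruct (hg1 Hn) as [g1 [g2 _]].
    assert (Hsc : same_cusp Gam_al (Gmul (Ginv al) be) (Gmul (Ginv al) ga)).
    { apply NNPP. intros Hsc. destruct (hm2 Hsc). lra. }
    assert (R0 : (RtoC (width Gam_be) * coef Gam_be (4 - K) nubar_be g m)%C =
      (- (RtoC (width Gam_al) * coef Gam_al K nu_al f n))%C).
    { apply (duality_echelon Gh hGh (fun x => x < 0) (Fb E) hF (fun x => x <= 0) (4 - K) K Gam (cbar nu) nu be al ga g f n m
        H' Hb Ha Hg E4 Ec).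
      + apply (whf_qform Gh hGh); assumption.
      + exact g2.
      + exact Hm.
      + exact Hsc.
      + destruct (hm1 Hsc) as [[[_ Hm0]|Hi] _]; [lra|exact Hi].
      + intros Hs. apply (hn1 Hs).
      + exact (hf2 Hm). }
    rewrite R0. ring.
  - (* both coefficients vanish: [f] is holomorphic and [g] is a cusp form *)
    apply Rnot_lt_le in Hm. apply Rnot_le_lt in Hn.
    assert (Hi : In (- m) (idx (Fb E (conj_group Gam_al (Gmul (Ginv al) be)) K (conj_mult K nu_al (Gmul (Ginv al) be))))).
    { destruct (classic (same_cusp Gam_al (Gmul (Ginv al) be) (Gmul (Ginv al) ga))) as [Hs|Hs].
      - destruct (hm1 Hs) as [[[_ Hm0]|Hi] _]; [lra|exact Hi].
      - destruct (hm2 Hs). lra. }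
    assert (Hj : In (- n) (idx (Gb E (conj_group Gam_be (Gmul (Ginv be) al)) (4 - K) (conj_mult (4 - K) nubar_be (Gmul (Ginv be) al))))).
    { destruct (classic (same_cusp Gam_be (Gmul (Ginv be) al) (Gmul (Ginv be) ga))) as [Hs|Hs].
      - destruct (hn1 Hs) as [[[_ Hn0]|Hj] _]; [lra|exact Hj].
      - destruct (hn2 Hs). lra. }
    pose proof (proj1 (proj1 (proj2 (hF _ _ _ (admissible_conj Gh hGh _ _ _ _ HA Hx))) _ Hi)) as Vf.
    pose proof (proj1 (proj1 (proj2 (hG _ _ _ (admissible_conj Gh hGh _ _ _ _ HB Hv))) _ Hj)) as Vg.
    assert (Cf : coef Gam_al K nu_al f n = RtoC 0).
    { rewrite (coef_ext _ _ _ f _ (hf2 Hm)). exact (back_zero Gh hGh (fun x => x < 0) K Gam_al nu_al _ _ n HA Hx Vf Hn). }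
    assert (Cg : coef Gam_be (4 - K) nubar_be g m = RtoC 0).
    { rewrite (coef_ext _ _ _ g _ (hg2 Hn)).
      exact (back_zero Gh hGh (fun x => x <= 0) (4 - K) Gam_be nubar_be _ _ m HB Hv Vg Hm). }
    rewrite Cf, Cg. ring.
Qed.
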